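(* Let $r\ge 2$ be an integer. For every $i$, $1\le i\le r$, let $q_i\ge 2$ be an integer, let $f_i(z)\in\overline{\mathbb Q}\{z\}$ be a regular singular $q_i$-Mahler function, and let $\alpha_i$ be an algebraic number with $0<|\alpha_i|<1$ such that $f_i$ is well-defined at $\alpha_i$. Then: (i) if $\alpha_1,\ldots,\alpha_r$ are multiplicatively independent, the numbers $f_1(\alpha_1),\ldots,f_r(\alpha_r)$ are algebraically independent over $\overline{\mathbb Q}$ if and only if they are all transcendental; (ii) if $q_1,\ldots,q_r$ are pairwise multiplicatively independent, the numbers $f_1(\alpha_1),\ldots,f_r(\alpha_r)$ are algebraically independent over $\overline{\mathbb Q}$ if and only if they are all transcendental.
   Context: $\overline{\mathbb Q}\{z\}$ denotes the ring of power series with algebraic coefficients converging in a neighbourhood of $0$. For an integer $q\ge2$, $f\in\overline{\mathbb Q}\{z\}$ is a $q$-Mahler function if there are polynomials $p_0,\ldots,p_n\in\overline{\mathbb Q}[z]$, not all zero, with $\sum_{k=0}^n p_k(z)f(z^{q^k})=0$; such a function extends meromorphically to the open unit disc, and ''well-defined at $\alpha$'' means $\alpha$ is not a pole. A $q$-Mahler system is a system $(f_1(z),\ldots,f_m(z))^{\top}=A(z)(f_1(z^q),\ldots,f_m(z^q))^{\top}$ with $A(z)\in\mathrm{GL}_m(\overline{\mathbb Q}(z))$; it is regular singular if there exist a matrix $\Phi(z)$, invertible, with entries in the field of convergent Puiseux series $\bigcup_{d\ge1}\mathrm{Frac}(\overline{\mathbb Q}\{z^{1/d}\})$, and a constant matrix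 $B\in\mathrm{GL}_m(\overline{\mathbb Q})$ such that $B=\Phi(z)A(z)\Phi(z^q)^{-1}$. A $q$-Mahler function is regular singular if it is a coordinate of a vector $(f_1,\ldots,f_m)\in\overline{\mathbb Q}\{z\}^m$ solving a regular singular $q$-Mahler system. Complex numbers $\alpha_1,\ldots,\alpha_r$ are multiplicatively independent if there is no nonzero integer tuple $(n_1,\ldots,n_r)$ with $\alpha_1^{n_1}\cdots\alpha_r^{n_r}=1$. *)

(* Defs.v *)
From HB Require Import structures.
From mathcomp Require Import all_boot all_order all_algebra.
From mathcomp Require Import complex.
From mathcomp Require Import all_classical all_reals all_analysis.
(* The notations of mpoly clash with those of MathComp-Analysis. *)
From mathcomp Require Import -(notations) mpoly.
Set Implicit Arguments.
Unset Strict Implicit.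
Unset Printing Implicit Defensive.
Import Order.TTheory GRing.Theory Num.Theory.
Import numFieldNormedType.Exports.
Local Open Scope classical_set_scope.
Local Open Scope ring_scope.

(* R[i], packed so that the topology of a numClosedFieldType is inferred. *)
Definition CC (R : realType) : numClosedFieldType := complex R.

Definition algebraic (R : realType) (x : CC R) : Prop := algebraicOver ratr x.

Definition transcendental (R : realType) (x : CC R) : Prop := ~ algebraic x.

Definition algebraicb (R : realType) : {pred CC R} :=
  fun x => `[< algebraic x >].

Lemma algebraicb_divring (R : realType) : divring_closed (@algebraicb R).
Proof.
split; first by apply/asboolP; exact: algebraic1.
- by move=> x y /asboolP hx /asboolP hy; apply/asboolP; exact: algebraic_sub.
- by move=> x y /asboolP hx /asboolP hy; apply/asboolP; exact: algebraic_div.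
Qed.

HB.instance Definition _ (R : realType) :=
  GRing.isDivringClosed.Build (CC R) (@algebraicb R) (@algebraicb_divring R).

Record Qbar (R : realType) := MkQbar {
  QbarC :> CC R;
  QbarP : QbarC \in @algebraicb R
}.

HB.instance Definition _ (R : realType) := [isSub for @QbarC R].
HB.instance Definition _ (R : realType) := [Choice of Qbar R by <:].
HB.instance Definition _ (R : realType) :=
  [SubChoice_isSubIntegralDomain of Qbar R by <:].
HB.instance Definition _ (R : realType) :=
  [SubIntegralDomain_isSubField of Qbar R by <:].

Definition algebraically_independent (R : realType) (r : nat)
    (x : 'I_r -> CC R) : Prop :=
  forall P : mpoly r (Qbar R), mmap (@QbarC R) x P = 0 -> P = 0.

Definition multiplicatively_independent (R : realType) (r : nat)
    (x : 'I_r -> CC R) : Prop :=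
  forall n : 'I_r -> int, \prod_(i < r) x i ^ n i = 1 -> forall i, n i = 0.

Record powser (K : Type) := PowSer { pcoef : nat -> K }.

HB.instance Definition _ (K : Type) := gen_eqMixin (powser K).
HB.instance Definition _ (K : Type) := gen_choiceMixin (powser K).

Section PowerSeriesRing.
Variable K : fieldType.
Implicit Types (f g h : powser K) (p q : {poly K}) (n : nat).

Lemma powserP f g : pcoef f =1 pcoef g -> f = g.
Proof. by case: f g => [f] [g] /= /funext ->. Qed.

Definition ps_add f g := PowSer (fun n => pcoef f n + pcoef g n).
Definition ps_opp f := PowSer (fun n => - pcoef f n).
Definition ps_of_poly p := PowSer (fun n => p`_n).
Definition ps_mul f g :=
  PowSer (fun n => \sum_(i < n.+1) pcoef f i * pcoef g (n - i)%N).

Fact ps_addA : associative ps_add.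
Proof. by move=> f g h; apply: powserP => n /=; rewrite addrA. Qed.
Fact ps_addC : commutative ps_add.
Proof. by move=> f g; apply: powserP => n /=; rewrite addrC. Qed.
Fact ps_add0 : left_id (ps_of_poly 0) ps_add.
Proof. by move=> f; apply: powserP => n /=; rewrite coef0 add0r. Qed.
Fact ps_addN : left_inverse (ps_of_poly 0) ps_opp ps_add.
Proof. by move=> f; apply: powserP => n /=; rewrite coef0 addNr. Qed.
HB.instance Definition _ :=
  GRing.isZmodule.Build (powser K) ps_addA ps_addC ps_add0 ps_addN.

Let agree n p f := forall i, (i <= n)%N -> p`_i = pcoef f i.

Let ps_mulE n p q f g :
  agree n p f -> agree n q g -> agree n (p * q) (ps_mul f g).
Proof.
move=> hp hq i hi /=; rewrite coefM; apply: eq_bigr => j _.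
by rewrite hp ?hq // (leq_trans _ hi) ?leq_subr // -ltnS.
Qed.

Let trunc n f := \poly_(i < n.+1) pcoef f i.

Let truncP n f : agree n (trunc n f) f.
Proof. by move=> i hi; rewrite coef_poly ltnS hi. Qed.

Fact ps_mulA : associative ps_mul.
Proof.
move=> f g h; apply: powserP => n.
rewrite -(ps_mulE (truncP f) (ps_mulE (truncP g) (truncP h)) (leqnn n)).
by rewrite mulrA (ps_mulE (ps_mulE (truncP f) (truncP g)) (truncP h)).
Qed.

Fact ps_mulC : commutative ps_mul.
Proof.
move=> f g; apply: powserP => n.
rewrite -(ps_mulE (truncP f) (truncP g) (leqnn n)) mulrC.
exact: (ps_mulE (truncP g) (truncP f)).
Qed.

Let polyP' n p : agree n p (ps_of_poly p). Proof. by []. Qed.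

Fact ps_mul1 : left_id (ps_of_poly 1) ps_mul.
Proof.
move=> f; apply: powserP => n.
rewrite -(ps_mulE (@polyP' n 1) (truncP f) (leqnn n)) mul1r.
exact: truncP.
Qed.

Fact ps_mulDl : left_distributive ps_mul ps_add.
Proof.
move=> f g h; apply: powserP => n /=; rewrite -big_split.
by apply: eq_bigr => i _; rewrite mulrDl.
Qed.

Fact ps_1neq0 : ps_of_poly 1 != 0.
Proof.
apply/eqP => /(congr1 (fun f => pcoef f 0)) /= /eqP.
by rewrite coef1 coef0 eqxx oner_eq0.
Qed.

HB.instance Definition _ := GRing.Zmodule_isComNzRing.Build (powser K)
  ps_mulA ps_mulC ps_mul1 ps_mulDl ps_1neq0.

Lemma pcoef0 n : pcoef (0 : powser K) n = 0. Proof. exact: coef0. Qed.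

Lemma pcoefD f g n : pcoef (f + g) n = pcoef f n + pcoef g n.
Proof. by []. Qed.

Lemma pcoefM f g n :
  pcoef (f * g) n = \sum_(i < n.+1) pcoef f i * pcoef g (n - i)%N.
Proof. by []. Qed.

Definition ps_unit : pred (powser K) := fun f => `[< exists g, g * f = 1 >].
Definition ps_inv f : powser K :=
  if pselect (exists g, g * f = 1) is left e then projT1 (cid e) else f.

Fact ps_mulV : {in ps_unit, left_inverse 1 ps_inv *%R}.
Proof.
move=> f /asboolP hf; rewrite /ps_inv.
by case: pselect => // e; case: cid.
Qed.
Fact ps_unitPl f g : g * f = 1 -> ps_unit f.
Proof. by move=> e; apply/asboolP; exists g. Qed.
Fact ps_inv_out : {in [predC ps_unit], ps_inv =1 id}.
Proof.
move=> f /negP hf; rewrite /ps_inv; case: pselect => // e.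
by case: hf; apply/asboolP.
Qed.

HB.instance Definition _ := GRing.ComNzRing_hasMulInverse.Build (powser K)
  ps_mulV ps_unitPl ps_inv_out.

Let ps_val f : f != 0 ->
  exists2 n, pcoef f n != 0 & forall i, (i < n)%N -> pcoef f i = 0.
Proof.
move=> hf; have e : exists n, pcoef f n != 0.
  apply: contrapT => h; case/eqP: hf; apply: powserP => n; rewrite pcoef0.
  by apply/eqP; case: eqP => // /eqP hn; case: h; exists n.
case: (ex_minnP e) => n hn hmin; exists n => // i hi.
by apply/eqP/negPn/negP => /hmin; rewrite leqNgt hi.
Qed.

Fact ps_idomain : GRing.integral_domain_axiom (powser K).
Proof.
move=> f g fg0; apply/norP => -[/ps_val [m fm hf] /ps_val [n gn hg]].
have := congr1 (fun h => pcoef h (m + n)%N) fg0; rewrite /= coef0.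
have hm : (m < (m + n).+1)%N by rewrite ltnS leq_addr.
rewrite (bigD1 (Ordinal hm)) //= addKn big1 ?addr0 => [/eqP|i].
  by rewrite mulf_eq0 (negPf fm) (negPf gn).
rewrite -val_eqE /= neq_ltn => /orP[/hf ->|hi]; first by rewrite mul0r.
rewrite hg ?mulr0 // -(ltn_add2r i) subnK; last by rewrite -ltnS.
by rewrite [ltnRHS]addnC ltn_add2r.
Qed.

HB.instance Definition _ :=
  GRing.ComUnitRing_isIntegral.Build (powser K) ps_idomain.

Fact ps_of_poly_zmod : zmod_morphism ps_of_poly.
Proof. by move=> p q; apply: powserP => n /=; rewrite coefB. Qed.
HB.instance Definition _ :=
  GRing.isZmodMorphism.Build {poly K} (powser K) ps_of_poly ps_of_poly_zmod.

Fact ps_of_poly_monoid : monoid_morphism ps_of_poly.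
Proof. by split=> // p q; apply: powserP => n /=; rewrite coefM. Qed.
HB.instance Definition _ :=
  GRing.isMonoidMorphism.Build {poly K} (powser K) ps_of_poly ps_of_poly_monoid.

Lemma ps_of_poly_eq0 p : ps_of_poly p = 0 -> p = 0.
Proof.
by move=> e; apply/polyP => n; have := congr1 (fun f => pcoef f n) e.
Qed.

(* f(z) |-> f(z^k); a ring morphism only for k > 0. *)
Definition ps_subst k f : powser K :=
  PowSer (fun n => if (k %| n)%N then pcoef f (n %/ k)%N else 0).

Let substP k n p f : (0 < k)%N ->
  agree n p f -> agree n (p \Po 'X^k) (ps_subst k f).
Proof.
move=> k0 hp i hi; rewrite coef_comp_poly_Xn //=; case: ifP => // _.
by rewrite hp // (leq_trans (leq_div _ _) hi).
Qed.

Lemma ps_substD k : {morph ps_subst k : f g / f + g}.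
Proof.
by move=> f g; apply: powserP => n /=; case: ifP; rewrite ?pcoefD // addr0.
Qed.

Lemma ps_substM k : (0 < k)%N -> {morph ps_subst k : f g / f * g}.
Proof.
move=> k0 f g; apply: powserP => n.
rewrite -(substP k0 (ps_mulE (truncP f) (truncP g)) (leqnn n)) comp_polyM.
exact: (ps_mulE (substP k0 (truncP f)) (substP k0 (truncP g))).
Qed.

Lemma ps_subst_eq0 k f : (0 < k)%N -> ps_subst k f = 0 -> f = 0.
Proof.
move=> k0 e; apply: powserP => n.
have := congr1 (fun f => pcoef f (n * k)%N) e.
by rewrite /= dvdn_mull // mulnK // !coef0.
Qed.

Lemma ps_subst_poly k p : (0 < k)%N ->
  ps_subst k (ps_of_poly p) = ps_of_poly (p \Po 'X^k).
Proof.
by move=> k0; apply: powserP => n; rewrite /= coef_comp_poly_Xn.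
Qed.

End PowerSeriesRing.

Notation "x %:F" := (FracField.tofrac x) : ring_scope.

(* \n_ and \d_ of fraction.v are shadowed by MathComp-Analysis. *)
Definition numer (A : idomainType) (x : {fraction A}) : A := (frac (repr x)).1.
Definition denom (A : idomainType) (x : {fraction A}) : A := (frac (repr x)).2.

(* The map induced on fields of fractions by an injective ring morphism; the
   value does not depend on the chosen representative, see [frac_mapE]. *)
Definition frac_map (A B : idomainType) (phi : A -> B) (x : {fraction A}) :
  {fraction B} := (phi (numer x))%:F / (phi (denom x))%:F.

Lemma frac_repr (A : idomainType) (x : {fraction A}) :
  x = (numer x)%:F / (denom x)%:F.
Proof.
rewrite /numer /denom -[x in LHS]reprK; case: (repr x) => -[n d] /= d0.
apply: (canRL (mulfK _)); first by rewrite tofrac_eq0.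
unlock FracField.tofrac; rewrite -[LHS]FracField.pi_mul /FracField.mulf /=.
apply/eqmodP; rewrite /= FracField.equivfE.
by rewrite !numden_Ratio ?mulf_neq0 ?oner_neq0 //= !mulr1 mulrC.
Qed.

Lemma frac_mapE (A B : idomainType) (phi : A -> B) (a b : A) :
    {morph phi : x y / x * y} -> phi 0 = 0 -> (forall x, phi x = 0 -> x = 0) ->
    b != 0 ->
  frac_map phi (a%:F / b%:F) = (phi a)%:F / (phi b)%:F.
Proof.
move=> phiM phi0 phi_inj b0.
have phi_neq0 x : x != 0 -> (phi x)%:F != 0 :> {fraction B}.
  by rewrite tofrac_eq0; apply: contra_neq; exact: phi_inj.
have F0 x : x != 0 -> x%:F != 0 :> {fraction A} by rewrite tofrac_eq0.
rewrite /frac_map; set y := a%:F / b%:F.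
have dy : denom y != 0 by exact: denom_ratioP.
have /eqP := frac_repr y; rewrite {1}/y eqr_div ?F0 //.
rewrite -[X in X == _]tofracM -[X in _ == X]tofracM tofrac_eq => /eqP e.
apply/eqP; rewrite eqr_div ?phi_neq0 // -!tofracM -!phiM.
by rewrite e.
Qed.

Section Analytic.
Variable R : realType.
Implicit Types (f : powser (Qbar R)) (F : CC R -> CC R) (z : CC R).

Definition ps_sum f z (l : CC R) : Prop :=
  series (fun n => QbarC (pcoef f n) * z ^+ n) @ \oo --> l.

Definition convergent f : Prop :=
  \forall z \near (0 : CC R), exists l, ps_sum f z l.

Definition holomorphic_at F z : Prop := \forall w \near z, derivable F w 1.

(* F is constrained only near z with z excluded: at a pole (or at a removable
   singularity) the value of F is irrelevant. *)
Definition meromorphic_at F z : Prop :=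
  exists (k : nat) (G : CC R -> CC R), holomorphic_at G z /\
    \forall w \near z^', (w - z) ^+ k * F w = G w.

Definition meromorphic_extension f F : Prop :=
  (forall z, `|z| < 1 -> meromorphic_at F z) /\
  (\forall z \near (0 : CC R), ps_sum f z (F z)).

End Analytic.

Section Mahler.
Variable R : realType.

Local Notation Q := (Qbar R).
Local Notation ps := (powser Q).

Definition mahler_function (q : nat) (f : ps) : Prop :=
  exists (n : nat) (p : 'I_n.+1 -> {poly Q}),
    (exists k, p k != 0) /\
    \sum_(k < n.+1) ps_of_poly (p k) * ps_subst (q ^ k) f = 0.

(* Membership in Frac(Q{z}), seen as a subfield of Frac(Q[[z]]). *)
Definition convergent_frac (x : {fraction ps}) : Prop :=
  exists g h : ps,
    [/\ convergent g, convergent h, h != 0 & x = g%:F / h%:F].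

Definition mahler_solution (q m : nat) (A : 'M[{fraction {poly Q}}]_m)
    (g : 'cV[ps]_m) : Prop :=
  map_mx (@FracField.tofrac ps) g =
  map_mx (frac_map (@ps_of_poly Q)) A *m
  map_mx (fun h => (ps_subst q h)%:F) g.

(* The finitely many entries of Phi lie in a common Frac(Q{z^(1/d)}).  Its
   elements are written as fractions of power series in t = z^(1/d); then z
   is t^d, so that A(z) becomes A(t^d), and z |-> z^q becomes t |-> t^q. *)
Definition regular_singular_system (q m : nat)
    (A : 'M[{fraction {poly Q}}]_m) : Prop :=
  exists (d : nat) (Phi : 'M[{fraction ps}]_m) (B : 'M[Q]_m),
    [/\ (0 < d)%N,
        forall i j, convergent_frac (Phi i j),
        Phi \in unitmx,
        B \in unitmx &
        map_mx (fun b => (ps_of_poly b%:P)%:F) B =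
        Phi *m map_mx (frac_map (fun p => ps_subst d (ps_of_poly p))) A
            *m invmx (map_mx (frac_map (ps_subst q)) Phi)].

Definition regular_singular (q : nat) (f : ps) : Prop :=
  mahler_function q f /\
  exists (m : nat) (A : 'M[{fraction {poly Q}}]_m) (g : 'cV[ps]_m) (i : 'I_m),
    [/\ A \in unitmx,
        regular_singular_system q A,
        forall j, convergent (g j 0),
        mahler_solution q A g &
        g i 0 = f].

End Mahler.

(* Main.v *)
(* Write x_i = F_i(alpha_i).  Each f_i is a coordinate of a vector g_i of power series with
   e g_i = A g_i(z^q); iterating this relation, x_i is algebraic over the values of g_i and
   of its derivatives at a regular point beta_i = alpha_i^(q_i^l).  The derivatives satisfy
   Mahler systems too, so they may be included in g_i.  Sample every system along
   z_(i,n) = beta_i^(q_i^k), with k chosen so that q_i^k is of size 2^n.  Either hypothesis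
   of independence implies that no nonzero polynomial vanishes at (z_(1,n), .., z_(r,n)) for
   all large n: a relation yields, by Kummer theory, a multiplicative relation between two
   monomials.  Hence in a suitable ultrapower of C the point z = [z_n] is generic over C.

   Let W_i be a transcendence basis of g_i over K(z), K a number field containing all
   coefficients, and let y be a transcendence basis, over K(z), of the entries of the
   matrices relating g_i(z_i) to the vector of constants v_i = g_i(beta_i).  Mahler's method
   (linear algebra for an auxiliary polynomial P, smallness of P(z_n, y_n) from the power
   series, Liouville's inequality) shows that z, y and all the W_i(z_i) are together
   algebraically independent over K.  All of them are algebraic over z, y and the v_i, so the
   v_i have transcendence degree at least the sum of the |W_i|.  Since v_i has transcendence
   degree at most |W_i|, exchanging one element of a basis of v_i for the transcendental
   number x_i shows that a relation between the x_i would make this degree too small. *)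
Require Import Defs.
From HB Require Import structures.
From mathcomp Require Import all_boot all_order all_algebra.
From mathcomp Require Import complex.
From mathcomp Require Import all_classical all_reals all_analysis.
From mathcomp Require Import -(notations) mpoly.
From mathcomp Require Import perm separable cyclotomic cyclic.
From mathcomp Require Import ring lra zify.
Set Implicit Arguments.
Unset Strict Implicit.
Unset Printing Implicit Defensive.
Import Order.TTheory GRing.Theory Num.Theory.
Import numFieldNormedType.Exports.
Local Open Scope classical_set_scope.
Local Open Scope ring_scope.

(** * Algebraic independence *)

Section GeneratedSubfield.
Variable L : fieldType.
Implicit Types (A B : set L) (x y : L).

(** The exponents q_i differ, so no common substitution merges the systems into one; the sampling
    exponents q_i^k are only known to lie between 2^n and 2^(n+L). The matrices that relate values
    at two times are products of a growing number of factors, and no rational function of z_n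
    independent of n gives their entries. These entries therefore have to be treated as additional
    coordinates y of the sampled point. Their heights are under control, but they are not small.
    This shapes the auxiliary polynomial: its degree in y is fixed before its degree and order in z
    are chosen. Liouville's inequality also needs a nonzero value, so (z, y) must be known to be
    generic beforehand. In an ultrapower, statements about arbitrarily large n become statements
    about elements of one field, where exchange and transcendence degree apply. The final comparison
    of degrees succeeds because z and y occur on both sides and cancel. *)

Inductive fgen A : L -> Prop :=
| fgen_in x : A x -> fgen A x
| fgen_1 : fgen A 1
| fgen_sub x y : fgen A x -> fgen A y -> fgen A (x - y)
| fgen_div x y : fgen A x -> fgen A y -> fgen A (x / y).

Definition fgenb A : {pred L} := fun x => `[< fgen A x >].

Lemma fgenb_divring A : divring_closed (fgenb A).
Proof.
split; first by apply/asboolP; exact: fgen_1.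
- by move=> x y /asboolP hx /asboolP hy; apply/asboolP; exact: fgen_sub.
- by move=> x y /asboolP hx /asboolP hy; apply/asboolP; exact: fgen_div.
Qed.

HB.instance Definition _ A :=
  GRing.isDivringClosed.Build L (fgenb A) (fgenb_divring A).

Lemma fgenbP A x : reflect (fgen A x) (x \in fgenb A).
Proof. exact: asboolP. Qed.

Record FG A := MkFG { fgval :> L; fgP : fgval \in fgenb A }.

HB.instance Definition _ A := [isSub for @fgval A].
HB.instance Definition _ A := [Choice of FG A by <:].
HB.instance Definition _ A := [SubChoice_isSubIntegralDomain of FG A by <:].
HB.instance Definition _ A := [SubIntegralDomain_isSubField of FG A by <:].

HB.instance Definition _ A :=
  GRing.isZmodMorphism.Build (FG A) L (@fgval A) (rmorphB (val : FG A -> L)).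
HB.instance Definition _ A := GRing.isMonoidMorphism.Build (FG A) L (@fgval A)
  (conj (rmorph1 (val : FG A -> L)) (rmorphM (val : FG A -> L))).

Definition fgin A x (h : fgen A x) : FG A := MkFG (introT (fgenbP A x) h).

Lemma fgenP A (x : FG A) : fgen A x. Proof. exact/fgenbP/fgP. Qed.

Lemma fgen_le A B : (forall x, A x -> fgen B x) -> fgen A `<=` fgen B.
Proof.
move=> h x; elim=> [y /h//||y z _ hy _ hz|y z _ hy _ hz].
- exact: fgen_1.
- exact: fgen_sub.
- exact: fgen_div.
Qed.

Lemma fgen_mono A B : A `<=` B -> fgen A `<=` fgen B.
Proof. by move=> h; apply: fgen_le => x /h; exact: fgen_in. Qed.

Lemma fgen0 A : fgen A 0. Proof. by apply/fgenbP/rpred0. Qed.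
Lemma fgenN A x : fgen A x -> fgen A (- x).
Proof. by move/fgenbP=> h; apply/fgenbP; rewrite rpredN. Qed.
Lemma fgenD A x y : fgen A x -> fgen A y -> fgen A (x + y).
Proof. by move=> /fgenbP h /fgenbP k; apply/fgenbP; rewrite rpredD. Qed.
Lemma fgenM A x y : fgen A x -> fgen A y -> fgen A (x * y).
Proof. by move=> /fgenbP h /fgenbP k; apply/fgenbP; rewrite rpredM. Qed.
Lemma fgenV A x : fgen A x -> fgen A x^-1.
Proof. by move=> /fgenbP h; apply/fgenbP; rewrite rpredV. Qed.
Lemma fgenX A x n : fgen A x -> fgen A (x ^+ n).
Proof. by move=> /fgenbP h; apply/fgenbP; rewrite rpredX. Qed.
Lemma fgen_sum A (I : Type) (r : seq I) (P : pred I) F :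
  (forall i, P i -> fgen A (F i)) -> fgen A (\sum_(i <- r | P i) F i).
Proof. by move=> h; apply/fgenbP/rpred_sum => i /h /fgenbP. Qed.
Lemma fgen_prod A (I : Type) (r : seq I) (P : pred I) F :
  (forall i, P i -> fgen A (F i)) -> fgen A (\prod_(i <- r | P i) F i).
Proof. by move=> h; apply/fgenbP/rpred_prod => i /h /fgenbP. Qed.

(** The relative algebraic closure in [L] of the subfield generated by [A]. Subfields are carried as
    generating sets, so that towers of extensions are unions; [FG] turns the generated subfield into
    a type, which polynomial coefficients require. *)
Definition acl A x : Prop := algebraicOver (val : FG A -> L) x.

Lemma acl_fgen A x : fgen A x -> acl A x.
Proof. by move=> h; have := algebraic_id (val : FG A -> L) (fgin h). Qed.

Lemma acl_in A x : A x -> acl A x.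
Proof. by move=> h; apply/acl_fgen/fgen_in. Qed.

Lemma acl1 A : acl A 1. Proof. exact: algebraic1. Qed.
Lemma acl0 A : acl A 0. Proof. exact: algebraic0. Qed.
Lemma aclB A x y : acl A x -> acl A y -> acl A (x - y).
Proof. exact: algebraic_sub. Qed.
Lemma aclD A x y : acl A x -> acl A y -> acl A (x + y).
Proof. exact: algebraic_add. Qed.
Lemma aclM A x y : acl A x -> acl A y -> acl A (x * y).
Proof. exact: algebraic_mul. Qed.
Lemma acl_div A x y : acl A x -> acl A y -> acl A (x / y).
Proof. exact: algebraic_div. Qed.
Lemma aclV A x : acl A x -> acl A x^-1.
Proof. exact: algebraic_inv. Qed.
Lemma aclX A x n : acl A x -> acl A (x ^+ n).
Proof.
by move=> h; elim: n => [|n IH]; [exact: acl1|rewrite exprS; exact: aclM].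
Qed.
Lemma acl_sum A (I : Type) (r : seq I) (P : pred I) F :
  (forall i, P i -> acl A (F i)) -> acl A (\sum_(i <- r | P i) F i).
Proof.
by move=> h; elim/big_ind: _ => //; [exact: acl0|exact: aclD].
Qed.
Lemma acl_prod A (I : Type) (r : seq I) (P : pred I) F :
  (forall i, P i -> acl A (F i)) -> acl A (\prod_(i <- r | P i) F i).
Proof.
by move=> h; elim/big_ind: _ => //; [exact: acl1|exact: aclM].
Qed.

Lemma acl_gen A B : A `<=` acl B -> fgen A `<=` acl B.
Proof.
move=> h x; elim=> [y /h//||y z _ hy _ hz|y z _ hy _ hz].
- exact: acl1.
- exact: aclB.
- exact: acl_div.
Qed.

(** Over a field algebraic and integral coincide, so coefficients that are merely algebraic over [B]
    are acceptable. Transitivity, [acl_le], follows. *)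
Lemma acl_root B (p : {poly L}) x :
  p != 0 -> (forall i, acl B p`_i) -> root p x -> acl B x.
Proof.
move=> p0 hp px; apply/integral_algebraic.
apply: (integral_root p0 px) => c /(nthP 0) [i _ <-].
exact/integral_algebraic/hp.
Qed.

Lemma acl_le A B : A `<=` acl B -> acl A `<=` acl B.
Proof.
move=> h x [p p0 px].
apply: (acl_root _ _ px) => [|i]; first by rewrite map_poly_eq0.
by rewrite coef_map; apply: (acl_gen h); exact: fgenP.
Qed.

Lemma acl_mono A B : A `<=` B -> acl A `<=` acl B.
Proof. by move=> h; apply: acl_le => x /h; exact: acl_in. Qed.

Lemma fgen_frac A y x : fgen (A `|` [set y]) x ->
  exists p q : {poly FG A}, [/\ (map_poly val q).[y] != 0 &
    x = (map_poly val p).[y] / (map_poly val q).[y]].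
Proof.
elim=> {x} [x [Ax|->]||x z _ [p [q [q0 ->]]] _ [p' [q' [q'0 ->]]]
           |x z _ [p [q [q0 ->]]] _ [p' [q' [q'0 ->]]]].
- exists (fgin (fgen_in Ax))%:P, 1.
  by rewrite rmorph1 map_polyC !hornerE ?divr1 oner_eq0.
- by exists 'X, 1; rewrite map_polyX rmorph1 !hornerE ?divr1 oner_eq0.
- by exists 1, 1; rewrite rmorph1 hornerC divr1; split=> //; exact: oner_neq0.
- exists (p * q' - p' * q), (q * q').
  rewrite !rmorphB !rmorphM /= !hornerE mulf_neq0 //; split=> //.
  by rewrite -mulNr addf_div // mulNr.
- have [->|p'0] := eqVneq (map_poly val p').[y] 0.
    exists 0, 1; rewrite rmorph0 rmorph1 horner0 hornerC oner_eq0 /=.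
    by split=> //; rewrite !mul0r invr0 mulr0.
  exists (p * q'), (q * p'); rewrite !rmorphM /= !hornerE mulf_neq0 //.
  by split=> //; rewrite invf_div mulf_div.
Qed.

Lemma acl_polyXY A y x : acl (A `|` [set y]) x ->
  exists P : {poly {poly FG A}},
    map_poly (horner_eval y \o map_poly val) P != 0 /\
    root (map_poly (horner_eval y \o map_poly val) P) x.
Proof.
move=> [p p0 px].
have /boolp.choice [f fP] : forall i : nat, exists pq : {poly FG A} * {poly FG A},
    (map_poly val pq.2).[y] != 0 /\
    val p`_i = (map_poly val pq.1).[y] / (map_poly val pq.2).[y].
  by move=> i; have [a [b [? ?]]] := fgen_frac (fgenP p`_i); exists (a, b).
pose ev := horner_eval y \o map_poly val : {poly FG A} -> L.
pose d : {poly FG A} := \prod_(i < size p) (f i).2.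
pose P : {poly {poly FG A}} := \poly_(i < size p)
  ((f i).1 * \prod_(j < size p | j != i :> nat) (f j).2).
have evd : ev d != 0.
  by rewrite /ev rmorph_prod; apply/prodf_neq0 => i _; exact: (fP i).1.
have evM (u v : {poly FG A}) : ev (u * v) = ev u * ev v by rewrite /ev rmorphM.
have PE : map_poly ev P = ev d *: map_poly val p.
  apply/polyP => i; rewrite coef_map coefZ coef_map coef_poly.
  case: ltnP => hi; last by rewrite (nth_default _ hi) !raddf0 mulr0.
  change (ev ((f i).1 * \prod_(j < size p | j != i :> nat) (f j).2) =
          ev d * val p`_i).
  have -> : d = (f i).2 * \prod_(j < size p | j != i :> nat) (f j).2.
    by rewrite /d (bigD1 (Ordinal hi)).
  rewrite (fP i).2 !evM.
  have e u : (map_poly val u).[y] = ev u by [].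
  rewrite !e; have q0 : ev (f i).2 != 0 := (fP i).1.
  by field.
exists P; rewrite PE; split; last by rewrite rootZ.
by rewrite scaler_eq0 negb_or evd map_poly_eq0.
Qed.

(** A relation P(y, x) = 0 over [fgen A] is read as an equation for y. It is not trivial: if all its
    coefficients, which are polynomials in x, vanished, a nonzero one among them would make x
    algebraic over [A]. *)
Lemma acl_exchange A x y :
  acl (A `|` [set y]) x -> ~ acl A x -> acl (A `|` [set x]) y.
Proof.
move=> /acl_polyXY [P [P0 Px]] nx.
have emb : A `<=` A `|` [set x] by move=> z; left.
pose ev z := horner_eval z \o map_poly (val : FG A -> L).
have evE z : map_poly (ev z) P =
    map_poly (horner_eval z) (map_poly (map_poly val) P).
  by rewrite -map_poly_comp.
have evE' z : map_poly (ev z) (swapXY P) =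
    map_poly (horner_eval z) (swapXY (map_poly (map_poly val) P)).
  by rewrite swapXY_map -map_poly_comp.
apply: (@acl_root _ (map_poly (ev x) (swapXY P))).
- apply: contraNneq P0 => S0; suff -> : P = 0 by rewrite rmorph0.
  apply/eqP; rewrite -swapXY_eq0; apply/eqP/polyP => j; rewrite coef0.
  apply/eqP/negPn/negP => c0; apply: nx; exists (swapXY P)`_j => //.
  by have := congr1 (fun p : {poly L} => p`_j) S0; rewrite coef_map coef0 => /eqP.
- move=> i; rewrite coef_map.
  change (acl (A `|` [set x]) (map_poly (val : FG A -> L) (swapXY P)`_i).[x]).
  rewrite horner_coef.
  apply: acl_sum => j _; apply: aclM.
    by apply: acl_fgen; rewrite coef_map; apply: (fgen_mono emb); exact: fgenP.
  by apply: aclX; apply: acl_in; right.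
- move: Px; rewrite /root evE' -horner_polyC evE -horner_swapXY.
  by rewrite horner2_swapXY.
Qed.
End GeneratedSubfield.

Section Independence.
Variable L : fieldType.
Implicit Types (A B : set L) (x y : L) (s t : seq L).

(** Independence is stated one element at a time, each over [A] and its predecessors, which suits
    exchange arguments; [aindep_mmap] and [mmap_aindep] connect it with polynomial relations. *)
Fixpoint aindep A s : Prop :=
  if s is x :: s' then ~ acl A x /\ aindep (A `|` [set x]) s' else True.

Lemma setU_cons A x s :
  A `|` [set` x :: s] = (A `|` [set x]) `|` [set` s].
Proof.
apply/seteqP; split=> z /=.
- by case=> [?|]; [left; left|rewrite inE => /orP[/eqP ->|?]; [left; right|right]].
- by case=> [[?|->]|h]; [left|right; rewrite inE eqxx|right; rewrite inE h orbT].
Qed.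

Lemma setU_nil A : A `|` [set` ([::] : seq L)] = A.
Proof. by apply/seteqP; split=> z /=; [case|left]. Qed.

Lemma setU_cat A s t : A `|` [set` s ++ t] = (A `|` [set` s]) `|` [set` t].
Proof.
apply/seteqP; split=> z /=; rewrite mem_cat.
- by case=> [?|/orP[]?]; [left; left|left; right|right].
- by case=> [[?|h]|h]; [left|right; rewrite h|right; rewrite h orbT].
Qed.

Lemma setU_rcons A x s :
  A `|` [set` rcons s x] = (A `|` [set` s]) `|` [set x].
Proof.
rewrite -cats1 setU_cat; congr (_ `|` _); apply/seteqP.
by split=> z /=; rewrite inE => /eqP.
Qed.

Lemma aindep_eq A B s : A `<=` acl B -> B `<=` acl A -> aindep A s -> aindep B s.
Proof.
elim: s A B => //= x s IH A B hAB hBA [nx h]; split.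
  by move=> h'; apply: nx; exact: (acl_le hBA).
apply: IH h => z [hz|->]; try by apply: acl_in; right.
- by apply: (acl_mono (A := B)) => [w|]; [left|exact: hAB].
- by apply: (acl_mono (A := A)) => [w|]; [left|exact: hBA].
Qed.

Lemma aindep_cat A s t :
  aindep A (s ++ t) <-> aindep A s /\ aindep (A `|` [set` s]) t.
Proof.
elim: s A => [|x s IH] A /=; first by rewrite setU_nil; split=> [|[]].
rewrite setU_cons IH; tauto.
Qed.

Lemma aindep_nth A s : (forall i, (i < size s)%N ->
  ~ acl (A `|` [set` take i s]) (nth 0 s i)) -> aindep A s.
Proof.
elim: s A => //= x s IH A h; split; first by have := h 0%N; rewrite setU_nil; exact.
by apply: IH => i hi; have := h i.+1 hi; rewrite /= setU_cons.
Qed.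

(** The element dropped is the last one of the shortest initial segment of [t] over which x is
    algebraic. As x is not algebraic over [A] alone, that segment is not empty. *)
Lemma acl_exchange_seq A t x : acl (A `|` [set` t]) x -> ~ acl A x ->
  exists t', [/\ (size t').+1 = size t, {subset t' <= t} &
    [set` t] `<=` acl ((A `|` [set x]) `|` [set` t'])].
Proof.
elim/last_ind: t => [|t y IH]; first by rewrite setU_nil.
rewrite setU_rcons => hx nx.
have [/IH /(_ nx) [t' [st sub ht]]|nxt] := pselect (acl (A `|` [set` t]) x).
  exists (rcons t' y); rewrite !size_rcons st; split=> // z /=.
    by rewrite !mem_rcons !inE => /orP[->//|/sub ->]; rewrite orbT.
  rewrite mem_rcons inE => /orP[/eqP ->|hz].
    by apply: acl_in; right; rewrite /= mem_rcons inE eqxx.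
  apply: (acl_mono (A := (A `|` [set x]) `|` [set` t'])); last exact: ht.
  by move=> w [?|hw]; [left|right; rewrite /= mem_rcons inE hw orbT].
exists t; rewrite size_rcons; split=> // z /=.
  by rewrite mem_rcons inE => ->; rewrite orbT.
rewrite mem_rcons inE => /orP[/eqP ->|hz]; last by apply: acl_in; right.
apply: (acl_mono _ (acl_exchange hx nxt)).
by move=> w [[?|?]|?]; [left; left|right|left; right].
Qed.

Theorem steinitz A s t :
  aindep A s -> [set` s] `<=` acl (A `|` [set` t]) -> (size s <= size t)%N.
Proof.
elim: s A t => //= x s IH A t [nx hs] hst.
have hx : acl (A `|` [set` t]) x by apply: hst; rewrite /= inE eqxx.
have [t' [<- _ ht]] := acl_exchange_seq hx nx.
rewrite ltnS; apply: (IH _ _ hs) => z hz.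
have : acl (A `|` [set` t]) z by apply: hst; rewrite /= inE hz orbT.
apply: acl_le => w [hw|/ht //]; by apply: acl_in; left; left.
Qed.

(** The basis is returned as a list of indices, because the same indices are used later for other
    families, such as the values of the chosen series. *)
Lemma abasis (I : eqType) (e : I -> L) A (s : seq I) :
  exists t : seq I, [/\ {subset t <= s}, aindep A (map e t) &
    forall i, i \in s -> acl (A `|` [set` map e t]) (e i)].
Proof.
elim: s A => [|i s IH] A; first by exists [::].
have [hi|hi] := pselect (acl A (e i)).
  have [t [h1 h2 h3]] := IH A; exists t; split=> //.
    by move=> j /h1 hj; rewrite inE hj orbT.
  move=> j; rewrite inE => /orP[/eqP ->|/h3 //].
  by apply: (acl_mono _ hi) => w; left.
have [t [h1 h2 h3]] := IH (A `|` [set e i]); exists (i :: t); split=> //=.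
  by move=> j; rewrite !inE => /orP[->//|/h1 ->]; rewrite orbT.
move=> j; rewrite setU_cons inE => /orP[/eqP ->|/h3 //].
by apply: acl_in; left; right.
Qed.

End Independence.

Local Notation "p '@_' m" := (mcoeff m p) (at level 3, m at level 2).

(** * Polynomials in several variables as polynomials in the last one *)

Section MPolyUnivariate.
Variables (n : nat) (R : nzRingType).
Implicit Type p : mpoly n.+1 R.

Let widen := widen_ord (leqnSn n).

Definition mnm_init (m : multinom n.+1) : multinom n :=
  Multinom [tuple m (widen i) | i < n].

Lemma mnm_init_inj m m' :
  mnm_init m = mnm_init m' -> m ord_max = m' ord_max -> m = m'.
Proof.
move=> h1 h2; apply/mnmP => i.
have [->//|hi] := eqVneq i ord_max.
have hin : (i < n)%N.
  by rewrite ltn_neqAle -ltnS ltn_ord andbT; apply: contraNneq hi => hi; apply/eqP/val_inj.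
have -> : i = widen (Ordinal hin) by apply: val_inj.
by have := congr1 (fun m : (multinom n) => m (Ordinal hin)) h1; rewrite !mnmE.
Qed.

Lemma muni_coef p m : (muni p)`_(m ord_max) @_ (mnm_init m) = p @_ m.
Proof.
rewrite muniE coef_sum raddf_sum /= (bigID (pred1 m)) /=.
rewrite [X in _ + X]big1 ?addr0 => [|m' /= hm].
  have [hm|hm] := boolP (m \in msupp p).
    rewrite -big_filter filter_pred1_uniq ?msupp_uniq // big_seq1.
    by rewrite coefZ coefXn eqxx mulr1 mcoeffZ mcoeffX eqxx mulr1.
  rewrite big1_seq ?memN_msupp_eq0 // => m' /andP[/eqP -> h].
  by rewrite h in hm.
rewrite coefZ coefXn; case: eqP => [e|_]; last by rewrite mulr0 mcoeff0.
rewrite mulr1 mcoeffZ mcoeffX; case: eqP => [e'|_]; last by rewrite mulr0.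
by case/eqP: hm; apply: mnm_init_inj.
Qed.

Lemma muni_eq0 p : muni p = 0 -> p = 0.
Proof.
move=> h; apply/mpolyP => m.
by rewrite -muni_coef h coef0 !mcoeff0.
Qed.

End MPolyUnivariate.

Lemma mmap_muni n (K L : fieldType) (iota : {rmorphism K -> L})
    (x : 'I_n.+1 -> L) (p : mpoly n.+1 K) :
  mmap iota x p =
  (map_poly (mmap iota (x \o widen_ord (leqnSn n))) (muni p)).[x ord_max].
Proof.
rewrite muniE rmorph_sum /= horner_sum; apply: eq_bigr => m _.
rewrite map_polyZ /= map_polyXn hornerZ hornerXn mmapZ mmapX -mulrA.
congr (_ * _); rewrite /mmap1 big_ord_recr /=; congr (_ * _).
by apply: eq_bigr => i _; rewrite mnmE.
Qed.

Section MuniMwiden.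
Variables (n : nat) (R : nzRingType).
Let widen := widen_ord (leqnSn n).

Lemma muniX (m : multinom n.+1) :
  muni (@mpolyX n.+1 R m) = @mpolyX n R (mnm_init m) *: 'X^(m ord_max).
Proof. by rewrite muniE msuppX big_seq1 mcoeffX eqxx scale1r. Qed.

Lemma mnm_init_widen (m : multinom n) : mnm_init (mnmwiden m) = m.
Proof. by apply/mnmP => i; rewrite mnmE mnmwiden_widen. Qed.

Lemma muni_mwiden (p : mpoly n R) : muni (mwiden p) = p%:P.
Proof.
rewrite [in LHS](mpolyE p) [in RHS](mpolyE p) (raddf_sum (@mwiden n R)).
rewrite (raddf_sum (@muni n R)) rmorph_sum /=; apply: eq_bigr => m _.
rewrite mwidenZ mwidenX muniZ muniX mnm_init_widen mnmwiden_ordmax expr0.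
by rewrite scalerA -mul_polyC mulr1 mul_mpolyC.
Qed.

Lemma muni_Xmax (i : nat) : muni ((@mpolyX n.+1 R (mnm1 ord_max)) ^+ i) = 'X^i.
Proof.
rewrite rmorphXn /= muniX mnm1E eqxx expr1.
suff -> : mnm_init (mnm1 (@ord_max n)) = mnm0 by rewrite mpolyX0 scale1r.
by apply/mnmP => j; rewrite mnmE mnm1E mnm0E eqE /= gtn_eqF.
Qed.

Lemma muni_mmulti (p : {poly mpoly n R}) : muni (mmulti p) = p.
Proof.
rewrite /mmulti (raddf_sum (@muni n R)).
by rewrite -[RHS]coefK poly_def; apply: eq_bigr => i _; rewrite [LHS]muniM muni_mwiden muni_Xmax mul_polyC.
Qed.
End MuniMwiden.

Section AlgebraicIndependence.
Variables (K L : fieldType) (iota : {rmorphism K -> L}).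

Lemma codom_ordSr n (x : 'I_n.+1 -> L) :
  codom x = rcons (codom (x \o widen_ord (leqnSn n))) (x ord_max).
Proof. by rewrite !codomE enum_ordSr map_rcons -map_comp. Qed.

Lemma acl_mmap n (x : 'I_n -> L) (P : mpoly n K) :
  acl (range iota `|` [set` codom x]) (mmap iota x P).
Proof.
apply: acl_sum => m _; apply: aclM; first by apply: acl_in; left; exists (P @_ m).
apply: acl_prod => i _; apply: aclX; apply: acl_in; right; exact: codom_f.
Qed.

Lemma aindep_mmap n (x : 'I_n -> L) : aindep (range iota) (codom x) ->
  forall P : mpoly n K, mmap iota x P = 0 -> P = 0.
Proof.
elim: n x => [|n IH] x hx P hP.
  move: hP; rewrite (nvar0_mpolyC P) mmapC => /eqP.
  by rewrite fmorph_eq0 => /eqP ->; rewrite mpolyC0.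
move: hx; rewrite codom_ordSr -cats1 => /aindep_cat [hx /= [nx _]].
apply/muni_eq0/eqP/negPn/negP => P0; apply: nx.
move: hP; rewrite mmap_muni => /eqP hP.
apply: (acl_root _ _ hP) => [|i]; last by rewrite coef_map /=; exact: acl_mmap.
apply: contraNneq P0 => h; apply/eqP/polyP => i; rewrite coef0.
apply: (IH _ hx); have := congr1 (fun q : {poly L} => q`_i) h.
by rewrite coef_map coef0.
Qed.

Lemma fgen_mmap n (x : 'I_n -> L) y :
  fgen (range iota `|` [set` codom x]) y ->
  exists P Q : mpoly n K, mmap iota x Q != 0 /\ y = mmap iota x P / mmap iota x Q.
Proof.
have one : mmap iota x 1 = 1 by rewrite rmorph1.
elim=> {y} [y [[c _ <-]|/codomP [i ->]]||y z _ [p [q [q0 ->]]] _ [p' [q' [q'0 ->]]]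
           |y z _ [p [q [q0 ->]]] _ [p' [q' [q'0 ->]]]].
- by exists (mpolyC n c), 1; rewrite one mmapC divr1 oner_neq0.
- by exists (mpolyX K (mnm1 i)), 1; rewrite one mmapX mmap1U divr1 oner_neq0.
- by exists 1, 1; rewrite one divr1 oner_neq0.
- exists (p * q' - p' * q), (q * q').
  by rewrite rmorphB !rmorphM /= mulf_neq0 //; split=> //; field; apply/andP.
- have [->|p'0] := eqVneq (mmap iota x p') 0.
    exists 0, 1; rewrite one oner_neq0 rmorph0; split=> //.
    by rewrite !mul0r invr0 mulr0.
  exists (p * q'), (q * p'); rewrite !rmorphM /= mulf_neq0 //.
  by split=> //; field; apply/and3P.
Qed.

Lemma mmap_mwiden n (x : 'I_n.+1 -> L) (p : mpoly n K) :
  mmap iota x (mwiden p) = mmap iota (x \o widen_ord (leqnSn n)) p.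
Proof. by rewrite mmap_muni muni_mwiden map_polyC hornerC. Qed.

(** If the last element were algebraic over the others, clearing denominators in its equation would
    give a polynomial whose coefficients are polynomials in the other variables; [mmulti] makes it a
    relation in all variables. *)
Lemma mmap_aindep n (x : 'I_n -> L) :
  (forall P : mpoly n K, mmap iota x P = 0 -> P = 0) ->
  aindep (range iota) (codom x).
Proof.
elim: n x => [|n IH] x hx.
  by rewrite (_ : codom x = [::]) //; apply: size0nil; rewrite size_codom card_ord.
rewrite codom_ordSr -cats1; apply/aindep_cat; split.
  apply: IH => P; rewrite -mmap_mwiden => /hx h; apply: inj_mwiden.
  by rewrite h mwiden0.
split=> //; set w := x \o _ => -[p p0 px].
have /boolp.choice [f fP] : forall i : nat, exists pq : mpoly n K * mpoly n K,
    mmap iota w pq.2 != 0 /\ val p`_i = mmap iota w pq.1 / mmap iota w pq.2.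
  by move=> i; have [a [b [? ?]]] := fgen_mmap (fgenP p`_i); exists (a, b).
pose d : mpoly n K := \prod_(i < size p) (f i).2.
pose P : {poly mpoly n K} := \poly_(i < size p)
  ((f i).1 * \prod_(j < size p | j != i :> nat) (f j).2).
have d0 : mmap iota w d != 0.
  by rewrite rmorph_prod; apply/prodf_neq0 => i _; exact: (fP i).1.
have PE : map_poly (mmap iota w) P = mmap iota w d *: map_poly val p.
  apply/polyP => i; rewrite coef_map coefZ coef_map coef_poly.
  case: ltnP => hi; last by rewrite (nth_default _ hi) !raddf0 mulr0.
  change (mmap iota w ((f i).1 * \prod_(j < size p | j != i :> nat) (f j).2) =
          mmap iota w d * val p`_i).
  have -> : d = (f i).2 * \prod_(j < size p | j != i :> nat) (f j).2.
    by rewrite /d (bigD1 (Ordinal hi)).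
  have q0 := (fP i).1; rewrite (fP i).2 !rmorphM /=.
  by field.
have : mmap iota x (mmulti P) = 0.
  by rewrite mmap_muni muni_mmulti PE hornerZ (rootP px) mulr0.
move/hx => h; have P0 : P = 0 by rewrite -[P]muni_mmulti h muni0.
move/eqP: PE; rewrite P0 rmorph0 eq_sym scaler_eq0 (negPf d0) orFb.
by rewrite map_poly_eq0 (negPf p0).
Qed.

End AlgebraicIndependence.

(** * Ultraproducts *)

Section UltraProduct.
Variables (C : fieldType) (U : set_system nat) (UU : UltraFilter U).

Let UP : ProperFilter U := @ultra_proper _ _ UU.

(** The ultrafilter proof is an argument of the predicate so that the ideal structure, which needs
    properness of [U], can be attached to it. *)
Definition uideal of UltraFilter U : {pred nat -> C} :=
  fun f => `[< U [set n | f n = 0] >].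

Lemma uideal_closed : idealr_closed (uideal UU).
Proof.
split.
- by apply/asboolP; apply: (@filterS _ _ _ setT) => //; exact: filterT.
- apply/negP => /asboolP h; have : U set0.
    by apply: filterS h => n /= /eqP; rewrite oner_eq0.
  exact: filter_not_empty.
- move=> a u v /asboolP hu /asboolP hv; apply/asboolP.
  by apply: filterS2 hu hv => n /= hu hv; rewrite !fctE hu hv mulr0 addr0.
Qed.

HB.instance Definition _ :=
  isIdealr.Build (nat -> C) (uideal UU) uideal_closed.

Definition ultraprod : Type := {ideal_quot (uideal UU)}.

HB.instance Definition _ := GRing.ComNzRing.on ultraprod.

Definition upi (f : nat -> C) : ultraprod := \pi_({ideal_quot (uideal UU)})%qT f.

Lemma upi_zmod : zmod_morphism upi.
Proof. exact: (rmorphB (\pi_({ideal_quot (uideal UU)})%qT)). Qed.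
Lemma upi_monoid : monoid_morphism upi.
Proof.
split; first exact: (rmorph1 (\pi_({ideal_quot (uideal UU)})%qT)).
exact: (rmorphM (\pi_({ideal_quot (uideal UU)})%qT)).
Qed.
HB.instance Definition _ :=
  GRing.isZmodMorphism.Build (nat -> C) ultraprod upi upi_zmod.
HB.instance Definition _ :=
  GRing.isMonoidMorphism.Build (nat -> C) ultraprod upi upi_monoid.

Lemma upi_eq f g : upi f = upi g <-> U [set n | f n = g n].
Proof.
rewrite /upi; split=> [/eqP|h].
  rewrite -Quotient.idealrBE => /asboolP; apply: filterS => n /= /eqP.
  by rewrite !fctE subr_eq0 => /eqP.
apply/eqP; rewrite -Quotient.idealrBE; apply/asboolP; apply: filterS h => n /= h.
by rewrite !fctE h subrr.
Qed.

Lemma upi_eq0 f : upi f = 0 <-> U [set n | f n = 0].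
Proof. by rewrite -(rmorph0 upi) upi_eq. Qed.

Lemma upi_surj (x : ultraprod) : exists f, x = upi f.
Proof. by exists (repr x); rewrite /upi reprK. Qed.

Definition uinv (x : ultraprod) : ultraprod :=
  let f := projT1 (cid (upi_surj x)) in upi (fun n => (f n)^-1).

Lemma uinv_pi f : uinv (upi f) = upi (fun n => (f n)^-1).
Proof.
rewrite /uinv; case: cid => g /= /upi_eq h.
by apply/upi_eq; apply: filterS h => n /= ->.
Qed.

(** By maximality of the ultrafilter a nonzero class is nonzero at every index of some set of [U],
    and there the pointwise inverse works. *)
Lemma umulVf x : x != 0 -> uinv x * x = 1.
Proof.
have [f ->] := upi_surj x; rewrite uinv_pi => /eqP nf.
rewrite -rmorphM -(rmorph1 upi); apply/upi_eq.
have [h|h] := in_ultra_setVsetC [set n | f n = 0] UU.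
  by case: nf; apply/upi_eq0.
by apply: filterS h => n /= /eqP h; rewrite !fctE mulVf.
Qed.

Lemma uinv0 : uinv 0 = 0.
Proof.
by rewrite -(rmorph0 upi) uinv_pi; apply/upi_eq/filterE => n /=; rewrite invr0.
Qed.

HB.instance Definition _ :=
  GRing.ComNzRing_isField.Build ultraprod umulVf uinv0.

Definition udiag (c : C) : ultraprod := upi (fun _ => c).

Lemma udiag_zmod : zmod_morphism udiag.
Proof. by move=> x y; rewrite /udiag -rmorphB. Qed.
Lemma udiag_monoid : monoid_morphism udiag.
Proof. by split=> [|x y]; rewrite /udiag ?rmorph1 // -rmorphM. Qed.
HB.instance Definition _ :=
  GRing.isZmodMorphism.Build C ultraprod udiag udiag_zmod.
HB.instance Definition _ :=
  GRing.isMonoidMorphism.Build C ultraprod udiag udiag_monoid.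

Lemma upi_prod (I : Type) (r : seq I) (P : pred I) (F : I -> nat -> C) :
  upi (fun n => \prod_(i <- r | P i) F i n) = \prod_(i <- r | P i) upi (F i).
Proof. by rewrite -rmorph_prod; congr upi; apply/funext => n; rewrite fct_prodE. Qed.

Lemma upi_sum (I : Type) (r : seq I) (P : pred I) (F : I -> nat -> C) :
  upi (fun n => \sum_(i <- r | P i) F i n) = \sum_(i <- r | P i) upi (F i).
Proof. by rewrite -rmorph_sum; congr upi; apply/funext => n; rewrite fct_sumE. Qed.

Lemma upiM f g : upi (fun n => f n * g n) = upi f * upi g.
Proof. by rewrite -rmorphM. Qed.

Lemma upiX f k : upi (fun n => f n ^+ k) = upi f ^+ k.
Proof. by rewrite -rmorphXn; congr upi; apply/funext => n; elim: k => [|k IH]; rewrite ?expr0 // !exprS IH. Qed.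

Lemma upi_mmap (K : fieldType) (iota : {rmorphism K -> C}) n
    (P : mpoly n K) (x : 'I_n -> nat -> C) :
  mmap (udiag \o iota) (fun i => upi (x i)) P =
  upi (fun k => mmap iota (x^~ k) P).
Proof.
rewrite upi_sum; apply: eq_bigr => m _; rewrite upiM; congr (_ * _).
by rewrite upi_prod; apply: eq_bigr => i _; rewrite upiX.
Qed.

End UltraProduct.

(** * Linear dimension and Kummer theory *)

Section LinearDimension.
Variable L : fieldType.
Implicit Types (A B : set L) (x y z : L).

Definition inspan A (I : finType) (b : I -> L) x :=
  exists c : I -> L, (forall i, fgen A (c i)) /\ x = \sum_i c i * b i.

Definition lfree A (I : finType) (b : I -> L) :=
  forall c : I -> L, (forall i, fgen A (c i)) -> \sum_i c i * b i = 0 ->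
  forall i, c i = 0.

(** An upper bound for a degree: the spanning family may be dependent. Lower bounds come from
    [lfree], and the two meet in [lfree_span_card]. *)
Definition fdim A B n := exists (I : finType) (b : I -> L),
  (#|I| <= n)%N /\ forall x, fgen B x -> inspan A b x.

Lemma lfree_span_card A (I J : finType) (e : I -> L) (b : J -> L) :
  lfree A e -> (forall i, inspan A b (e i)) -> (#|I| <= #|J|)%N.
Proof.
rewrite /inspan => fe /boolp.choice [c hc]; rewrite leqNgt; apply/negP => hlt.
have fc i j : fgen A (c i j) by have [h _] := hc i.
have ec i : e i = \sum_j c i j * b j by have [_ h] := hc i.
pose N : 'M[FG A]_(#|I|, #|J|) :=
  \matrix_(i, j) fgin (fc (enum_val i) (enum_val j)).
have /rowV0Pn [v /sub_kermxP hv v0] : kermx N != 0.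
  by rewrite -mxrank_eq0 mxrank_ker -lt0n subn_gt0 (leq_ltn_trans (rank_leq_col N)).
case/eqP: v0; apply/rowP => i0; rewrite mxE; apply: val_inj => /=.
pose d (i : I) : L := val (v 0 (enum_rank i)).
have := fe d _ _ (enum_val i0); rewrite /d enum_valK; apply.
  by move=> i; exact: fgenP.
under eq_bigr do rewrite ec mulr_sumr.
rewrite exchange_big big1 //= => j _.
have := congr1 (fun M : 'M[FG A]_(1, #|J|) => val (M 0 (enum_rank j))) hv.
rewrite !mxE rmorph_sum /= => h; rewrite -[RHS](mul0r (b j)) -[X in _ = X * _]h.
rewrite mulr_suml (reindex (@enum_val I I)) /=; last first.
  by apply: onW_bij; exact: enum_val_bij.
by apply: eq_bigr => i _; rewrite enum_valK !mxE enum_rankK mulrA.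
Qed.

Lemma fdim_trans A B D n m : fdim A B n -> fdim B D m -> fdim A D (m * n).
Proof.
move=> [I [b [hn hb]]] [J [d [hm hd]]].
exists (J * I)%type, (fun k => d k.1 * b k.2).
split=> [|x /hd [c [hc ->]]]; first by rewrite card_prod leq_mul.
have /boolp.choice [e he] : forall i, inspan A b (c i) by move=> i; exact/hb/hc.
exists (fun k => e k.1 k.2); split=> [k|]; first by have [] := he k.1.
rewrite -(pair_bigA_idem _ (fun i j => e i j * (d i * b j))) //=; last exact: addr0.
apply: eq_bigr => i _; have [_ ->] := he i; rewrite mulr_suml.
by apply: eq_bigr => j _; rewrite mulrAC mulrA.
Qed.

Lemma inspan_poly A y d (p : {poly FG A}) : (size p <= d)%N ->
  inspan A (fun i : 'I_d => y ^+ i) (map_poly val p).[y].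
Proof.
move=> hd; exists (fun i : 'I_d => val p`_i); split=> [i|]; first exact: fgenP.
rewrite (@horner_coef_wide _ d) ?size_map_poly //.
by apply: eq_bigr => i _; rewrite coef_map.
Qed.

Lemma horner_modp A y (p q : {poly FG A}) : root (map_poly val q) y ->
  (map_poly val (p %% q)).[y] = (map_poly val p).[y].
Proof.
move=> /rootP qy; rewrite [in RHS](divp_eq p q) rmorphD rmorphM hornerD hornerM.
by rewrite qy mulr0 add0r.
Qed.

Lemma minimal_root A y (p : {poly FG A}) : p != 0 -> root (map_poly val p) y ->
  exists q : {poly FG A}, [/\ q != 0, root (map_poly val q) y,
    (size q <= size p)%N & forall g : {poly FG A},
      g != 0 -> root (map_poly val g) y -> (size q <= size g)%N].
Proof.
move=> p0 py; pose P n := `[< exists q : {poly FG A},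
  [/\ q != 0, root (map_poly val q) y & size q = n] >].
have exP : exists n, P n by exists (size p); apply/asboolP; exists p.
case: (ex_minnP exP) => n /asboolP [q [q0 qy qn]] hmin.
exists q; split=> //.
  by rewrite qn; apply: hmin; apply/asboolP; exists p.
by move=> g g0 gy; rewrite qn; apply: hmin; apply/asboolP; exists g.
Qed.

(** Denominators are removed by a Bezout identity: the polynomial of least degree with root y is
    coprime to every g with g(y) != 0, for a common factor would leave a shorter polynomial with
    root y. *)
Lemma simple_ext_poly A y (p : {poly FG A}) d x :
  p != 0 -> root (map_poly val p) y -> (size p <= d.+1)%N ->
  fgen (A `|` [set y]) x ->
  exists2 f : {poly FG A}, (size f <= d)%N & x = (map_poly val f).[y].
Proof.
move=> p0 py hd /fgen_frac [f [g [g0 ->]]].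
have [q [q0 qy qp qmin]] := minimal_root p0 py.
have cop : coprimep q g.
  have gcd0 : (map_poly val (gcdp q g)).[y] != 0.
    apply: contra g0 => h; have := dvdp_gcdr q g.
    by move/dvdpP => [u ->]; rewrite rmorphM hornerM (eqP h) mulr0.
  have /dvdpP [u hu] := dvdp_gcdl q g.
  have u0 : u != 0 by apply: contraNneq q0 => u0; rewrite hu u0 mul0r.
  have gn0 : gcdp q g != 0 by rewrite gcdp_eq0 negb_and q0.
  have uy : root (map_poly val u) y.
    by move: qy; rewrite {1}hu rmorphM rootM /= => /orP[//|]; rewrite /root (negPf gcd0).
  have hs : size q = (size u + size (gcdp q g)).-1 by rewrite {1}hu size_mul.
  have := qmin _ u0 uy; have : (0 < size (gcdp q g))%N by rewrite size_poly_gt0.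
  have : (0 < size u)%N by rewrite size_poly_gt0.
  rewrite /coprimep hs; move: (size u) (size (gcdp q g)) => [//|a] [//|[//|b]] _ _.
  by rewrite addnS /= -[X in (_ <= X)%N]addn0 leq_add2l.
have /Bezout_eq1_coprimepP [[u v] /= huv] := cop.
have -> : (map_poly val f).[y] / (map_poly val g).[y] =
          (map_poly val ((f * v) %% q)).[y].
  have hv : (map_poly val v).[y] * (map_poly val g).[y] = 1.
    have := congr1 (fun p => (map_poly (val : FG A -> L) p).[y]) huv.
    by rewrite rmorphD !rmorphM rmorph1 !hornerE (rootP qy) mulr0 add0r.
  rewrite horner_modp // rmorphM hornerM.
  by apply: (canLR (mulfK g0)); rewrite -mulrA hv mulr1.
exists ((f * v) %% q) => //; rewrite -ltnS.
by apply: leq_trans (ltn_modpN0 _ q0) (leq_trans qp hd).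
Qed.

Lemma simple_ext A y (p : {poly FG A}) d : p != 0 -> root (map_poly val p) y ->
  (size p <= d.+1)%N -> fdim A (A `|` [set y]) d.
Proof.
move=> p0 py hd; exists 'I_d, (fun i : 'I_d => y ^+ i); rewrite card_ord.
split=> // x /(simple_ext_poly p0 py hd) [f hf ->]; exact: inspan_poly.
Qed.

End LinearDimension.

Section Kummer.
Variables (L : fieldType) (l : nat) (zeta : L).
Hypotheses (l0 : (0 < l)%N) (prim : l.-primitive_root zeta).
Implicit Types (B : set L) (y z : L).

Lemma Xn_sub_prod y : y != 0 ->
  'X^l - (y ^+ l)%:P = \prod_(z <- [seq zeta ^+ i * y | i <- iota 0 l]) ('X - z%:P).
Proof.
move=> y0; set rs := map _ _.
have rsu : uniq rs.
  rewrite map_inj_in_uniq ?iota_uniq // => i j.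
  rewrite !mem_iota !add0n /= => hi hj /(mulIf y0) /eqP.
  by rewrite (eq_prim_root_expr prim) !modn_small // => /eqP.
have sz : size ('X^l - (y ^+ l)%:P) = (size rs).+1.
  by rewrite size_XnsubC // size_map size_iota.
rewrite [LHS](all_roots_prod_XsubC sz) ?uniq_rootsE //.
  by rewrite lead_coefXnsubC // scale1r.
apply/allP => z /mapP [i _ ->].
by rewrite /root !hornerE exprMn -exprM (mulnC i) exprM (prim_expr_order prim) expr1n mul1r subrr.
Qed.

Variable B : set L.
Hypothesis Bzeta : fgen B zeta.

(** The order of y modulo the nonzero elements of [fgen B]. By [kmin_free] no polynomial over
    [fgen B] of smaller degree has root y, the l-th roots of unity being in [fgen B]. *)
Definition kmin y d := [/\ (0 < d)%N, fgen B (y ^+ d) &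
  forall k, (0 < k)%N -> fgen B (y ^+ k) -> (d <= k)%N].

Lemma kmin_ex y : fgen B (y ^+ l) -> exists d, kmin y d.
Proof.
move=> yl; pose P k := (0 < k)%N && `[< fgen B (y ^+ k) >].
have exP : exists k, P k by exists l; rewrite /P l0; apply/asboolP.
case: (ex_minnP exP) => d /andP[d0 /asboolP hd] hmin; exists d; split=> // k k0 hk.
by apply: hmin; rewrite /P k0; apply/asboolP.
Qed.

Lemma kmin_dvd y d : y != 0 -> kmin y d -> fgen B (y ^+ l) -> (d %| l)%N.
Proof.
move=> y0 [d0 hd hmin] hl; rewrite /dvdn -leqn0 leqNgt; apply/negP => hr.
have := hmin _ hr; rewrite leqNgt ltn_mod d0; move/(_ _)/negP; case=> //.
have -> : y ^+ (l %% d) = y ^+ l / (y ^+ d) ^+ (l %/ d).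
  apply: (canRL (mulfK _)); first by rewrite !expf_neq0.
  by rewrite -exprM -exprD mulnC addnC -divn_eq.
by apply: fgen_div => //; exact: fgenX.
Qed.

(** The minimal polynomial of y divides X^l - y^l, so its roots are multiples of y by roots of
    unity, and its constant term is y^k times an element of [fgen B], where k is its degree. Hence
    y^k is in [fgen B] and d <= k. *)
Lemma kmin_free y d (p : {poly FG B}) : y != 0 -> fgen B (y ^+ l) -> kmin y d ->
  (size p <= d)%N -> root (map_poly val p) y -> p = 0.
Proof.
move=> y0 yl [d0 hd hmin] szp py; apply/eqP/negPn/negP => p0.
have [q [q0 qy qp qmin]] := minimal_root p0 py.
pose Y : {poly FG B} := 'X^l - (fgin yl)%:P.
have YE : map_poly val Y = 'X^l - (y ^+ l)%:P.
  by rewrite rmorphB /= map_polyXn map_polyC.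
have : q %| Y.
  apply/modp_eq0P/eqP/negPn/negP => r0.
  have : root (map_poly val (Y %% q)) y.
    by rewrite /root horner_modp // YE !hornerE subrr.
  by move/(qmin _ r0); rewrite leqNgt ltn_modpN0.
rewrite -(dvdp_map (val : FG B -> L)) YE Xn_sub_prod // => /dvdp_prod_XsubC [m].
set rs := mask _ _ => hq.
have szq : size q = (size rs).+1.
  by rewrite -(size_map_poly (val : FG B -> L) q) (eqp_size hq) size_prod_XsubC.
have rs0 : (0 < size rs)%N.
  rewrite -ltnS -szq ltnNge; apply: contraL qy => /size1_polyC qc.
  rewrite qc map_polyC rootC; apply: contra q0 => h; rewrite qc polyC_eq0.
  exact: h.
have [c c0 hc] : exists2 c, c != 0 & map_poly val q = c *: \prod_(z <- rs) ('X - z%:P).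
  move: hq => /eqpP [[a b] /= /andP[a0 b0] hab]; exists (b / a).
    by rewrite mulf_neq0 // invr_eq0.
  by rewrite mulrC -scalerA -hab scalerA mulVf // scale1r.
have cB : fgen B c.
  have -> : c = lead_coef (map_poly val q).
    by rewrite hc lead_coefZ (monicP (monic_prod_XsubC _ _ _)) mulr1.
  by rewrite lead_coef_map; exact: fgenP.
have [c' [c'0 c'B hk]] : exists c', [/\ c' != 0, fgen B c' &
    \prod_(z <- rs) (0 - z) = c' * y ^+ size rs].
  have : {subset rs <= [seq zeta ^+ i * y | i <- iota 0 l]}.
    by move=> z; exact: mem_mask.
  elim: (rs) => [|z s IH] hs.
    by exists 1; rewrite big_nil expr0 mulr1 oner_neq0; split=> //; exact: fgen_1.
  have [c' [c'0 c'B hk]] := IH (fun w hw => hs w (mem_behead (s := z :: s) hw)).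
  have /mapP [i _ zi] : z \in [seq zeta ^+ i * y | i <- iota 0 l].
    by apply: hs; rewrite inE eqxx.
  exists (- zeta ^+ i * c'); split.
  - by rewrite mulf_neq0 // oppr_eq0 expf_neq0 // (prim_root_eq0 prim) -lt0n.
  - by apply: fgenM => //; apply: fgenN; exact: fgenX.
  - by rewrite big_cons hk zi /= exprS sub0r; ring.
have : fgen B (y ^+ size rs).
  have q0E : val q`_0 = c * (c' * y ^+ size rs).
    have -> : val q`_0 = (map_poly val q)`_0 by rewrite coef_map.
    rewrite -horner_coef0 hc hornerZ horner_prod -hk; congr (_ * _).
    by apply: eq_bigr => z _; rewrite !hornerE.
  have -> : y ^+ size rs = val q`_0 / c / c' by rewrite q0E; field; apply/andP.
  by apply: fgen_div => //; apply: fgen_div => //; exact: fgenP.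
move/(hmin _ rs0); apply/negP; rewrite -ltnNge.
by rewrite -szq; apply: leq_trans szp; exact: qmin.
Qed.

Lemma kmin_freeE y d (c : nat -> L) : y != 0 -> fgen B (y ^+ l) -> kmin y d ->
  (forall i, fgen B (c i)) -> \sum_(i < d) c i * y ^+ i = 0 ->
  forall i, (i < d)%N -> c i = 0.
Proof.
move=> y0 yl hd hc h i hi.
pose p : {poly FG B} := \poly_(i < d) fgin (hc i).
have : p = 0.
  apply: (kmin_free y0 yl hd); first exact: size_poly.
  rewrite /root (@horner_coef_wide _ d) ?size_map_poly ?size_poly //.
  apply/eqP; rewrite -[RHS]h; apply: eq_bigr => j _.
  by rewrite coef_map coef_poly ltn_ord.
move/(congr1 (fun p : {poly FG B} => val p`_i)).
by rewrite coef_poly hi coef0.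
Qed.

(* The conjugates of [y] over [fgen B] are its multiples by roots of unity, so a
   radical [z] in [fgen B (y)] must be homogeneous in [y]. *)
Lemma radical_homog y d z : y != 0 -> fgen B (y ^+ l) -> kmin y d ->
  fgen (B `|` [set y]) z -> fgen B (z ^+ l) ->
  exists c j, [/\ fgen B c, (j < d)%N & z = c * y ^+ j].
Proof.
move=> y0 yl hd hz zl; have [d0 yd dmin] := hd.
pose Y : {poly FG B} := 'X^d - (fgin yd)%:P.
have Y0 : Y != 0 by rewrite -size_poly_gt0 size_XnsubC.
have YE t : (map_poly val Y).[t] = t ^+ d - y ^+ d.
  by rewrite rmorphB /= map_polyXn map_polyC !hornerE.
have szY : (size Y <= d.+1)%N by rewrite size_XnsubC.
have Yy : root (map_poly val Y) y by rewrite /root YE subrr.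
have red (g : {poly FG B}) : root (map_poly val g) y -> Y %| g.
  move=> gy; apply/modp_eq0P/(kmin_free y0 yl hd).
    by rewrite -ltnS; apply: leq_trans (ltn_modpN0 _ Y0) szY.
  by rewrite /root horner_modp.
have [f szf zE] := simple_ext_poly Y0 Yy szY hz.
pose c j := val f`_j; have cB j : fgen B (c j) by exact: fgenP.
have fE t : (map_poly val f).[t] = \sum_(j < d) c j * t ^+ j.
  rewrite (@horner_coef_wide _ d) ?size_map_poly //.
  by apply: eq_bigr => j _; rewrite coef_map.
have [z0|z0] := eqVneq z 0.
  by exists 0, 0%N; rewrite mul0r; split=> //; exact: fgen0.
have /dvdnP [e le] := kmin_dvd y0 hd yl.
pose eta := zeta ^+ (l %/ d).
have peta : d.-primitive_root eta.
  apply: (dvdn_prim_root prim); first by rewrite le dvdn_mull.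
have eB : fgen B eta by exact: fgenX.
have eta0 : eta != 0 by rewrite expf_neq0 // (prim_root_eq0 prim) -lt0n.
(* z' is the conjugate of z under y -> eta y. Its l-th power is that of z, so z' = zeta^i z.
   Comparing the coefficients of f(eta y) and zeta^i f(y) leaves a single monomial, since the eta^j
   with j < d are distinct. *)
pose z' := (map_poly val f).[eta * y].
have z'l : z' ^+ l = z ^+ l.
  have ev t : (map_poly val (f ^+ l - (fgin zl)%:P)).[t] =
              (map_poly val f).[t] ^+ l - z ^+ l.
    by rewrite rmorphB /= rmorphXn /= map_polyC hornerD hornerN hornerC horner_exp.
  have /dvdpP [h hh] : Y %| f ^+ l - (fgin zl)%:P.
    by apply: red; rewrite /root ev -zE subrr.
  have := ev (eta * y); rewrite hh rmorphM hornerM YE exprMn.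
  rewrite (prim_expr_order peta) mul1r subrr mulr0.
  by move/esym/eqP; rewrite subr_eq0 => /eqP.
have zz : (z' / z) ^+ l = 1 by rewrite expr_div_n z'l divff // expf_neq0.
have [i hi] := prim_rootP prim zz.
have hc : forall j, (j < d)%N -> c j * (eta ^+ j - zeta ^+ i) = 0.
  apply: (kmin_freeE y0 yl hd (c := fun j => c j * (eta ^+ j - zeta ^+ i))).
    by move=> j; apply: fgenM => //; apply: fgen_sub; exact: fgenX.
  have : z' - zeta ^+ i * z = 0 by rewrite -hi divfK // subrr.
  rewrite /z' fE {1}zE fE mulr_sumr -sumrB => {2}<-.
  by apply: eq_bigr => j _; rewrite exprMn; ring.
have [j hj cj] : exists2 j, (j < d)%N & c j != 0.
  apply: contrapT => h; case/eqP: z0; rewrite zE fE big1 // => j _.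
  apply/eqP; rewrite mulf_eq0; apply/orP; left; apply/negPn/negP => cj.
  by apply: h; exists j.
have ej : eta ^+ j = zeta ^+ i.
  by move/eqP: (hc j hj); rewrite mulf_eq0 (negPf cj) subr_eq0 => /eqP.
exists (c j), j; split=> //; rewrite zE fE (bigD1 (Ordinal hj)) //= big1 ?addr0 //.
move=> k hk; have /eqP := hc k (ltn_ord k); rewrite mulf_eq0 subr_eq0 -ej.
rewrite (eq_prim_root_expr peta) !modn_small // => /orP[/eqP ->|/eqP kj].
  by rewrite mul0r.
by case/eqP: hk; apply: val_inj.
Qed.

End Kummer.

(* Induction on the number of terms: over [fgen (B + y)] with [y = x2 / x1] the
   first two terms merge; the class sum obtained there is then split according to
   powers of [y]. *)
Lemma kummer (L : fieldType) l (zeta : L) B (s : seq (L * L)) :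
  (0 < l)%N -> l.-primitive_root zeta -> fgen B zeta ->
  (forall p, p \in s -> [/\ fgen B p.1, p.2 != 0 & fgen B (p.2 ^+ l)]) ->
  \sum_(p <- s) p.1 * p.2 = 0 -> forall u,
  \sum_(p <- s | `[< fgen B (p.2 / u) >]) p.1 * p.2 = 0.
Proof.
move=> l0 prim; move: {-1}(size s) (leqnn (size s)) => n.
elim: n B s => [|n IH] B [|p [|q s]] //= szs Bz hs sum0 u; rewrite ?big_nil //.
- rewrite big_mkcond /=; move: sum0; rewrite !big_cons !big_nil.
  by case: ifP => // _; rewrite !addr0.
have hp := hs p (mem_head _ _).
have hq : [/\ fgen B q.1, q.2 != 0 & fgen B (q.2 ^+ l)].
  by apply: hs; rewrite !inE eqxx orbT.
have {}hs r : r \in p :: q :: s -> [/\ fgen B r.1, r.2 != 0 & fgen B (r.2 ^+ l)].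
  exact: hs.
pose y := q.2 / p.2.
have [p1 p0 pl] := hp; have [q1 q0 ql] := hq.
have y0 : y != 0 by rewrite mulf_neq0 // invr_eq0.
have yl : fgen B (y ^+ l) by rewrite expr_div_n; exact: fgen_div.
pose B' := B `|` [set y].
have sub : fgen B `<=` fgen B' by apply: fgen_mono => z; left.
have yB' : fgen B' y by apply: fgen_in; right.
have sum' v : \sum_(r <- p :: q :: s | `[< fgen B' (r.2 / v) >]) r.1 * r.2 = 0.
  have := IH B' ((p.1 + q.1 * y, p.2) :: s) szs (sub _ Bz) _ _ v.
  have qE : q.2 = y * p.2 by rewrite divfK.
  have pq : `[< fgen B' (q.2 / v) >] = `[< fgen B' (p.2 / v) >].
    apply: asbool_equiv_eq; rewrite qE -mulrA; split=> [h|h]; last exact: fgenM.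
    by rewrite -[p.2 / v](mulKf y0) mulrC; apply: fgen_div.
  rewrite !big_cons /= pq => h; rewrite -{}[RHS]h.
  - by case: `[< fgen B' (p.2 / v) >] => //; rewrite qE; ring.
  - move=> r; rewrite inE => /orP[/eqP -> /=|hr]; last first.
      have [|? ? ?] := hs r; first by rewrite !inE hr !orbT.
      by split=> //; exact: sub.
    split=> //; last exact: sub.
    by apply: fgenD; [|apply: fgenM => //]; exact: sub.
  - by rewrite -[RHS]sum0 !big_cons /= qE; ring.
have [[r0 hr0 r0u]|none] := pselect (exists2 r, r \in p :: q :: s & fgen B (r.2 / u)); last first.
  rewrite big1_seq // => r /andP[/asboolP h hr]; by case: none; exists r.
(* For u = 0 all quotients are 0, so the class is the whole list. *)
have [u0|u0] := eqVneq u 0.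
  rewrite -[RHS](sum' 0); apply: eq_bigl => r; rewrite u0 invr0 mulr0.
  by apply: asbool_equiv_eq; split=> _; exact: fgen0.
have [r01 r00 r0l] := hs _ hr0.
have ul : fgen B (u ^+ l).
  have -> : u = r0.2 / (r0.2 / u) by rewrite invf_div mulrCA divff // mulr1.
  by rewrite expr_div_n; apply: fgen_div => //; exact: fgenX.
have [d hd] := kmin_ex l0 yl; have [d0 yd dmin] := hd.
have /boolp.choice [f hf] : forall r : L * L, exists cj : L * nat,
    r \in p :: q :: s -> fgen B' (r.2 / u) ->
    [/\ fgen B cj.1, (cj.2 < d)%N & r.2 / u = cj.1 * y ^+ cj.2].
  move=> r; have [hr|/negP hr] := boolP (r \in p :: q :: s); last by exists (0, 0%N).
  have [_ _ rl] := hs _ hr.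
  have [hru|hru] := pselect (fgen B' (r.2 / u)); last by exists (0, 0%N).
  have rul : fgen B ((r.2 / u) ^+ l) by rewrite expr_div_n; exact: fgen_div.
  by have [c [j hcj]] := radical_homog l0 prim Bz y0 yl hd hru rul; exists (c, j).
(* In the class of u over [B'] every r.2 / u is c y^j with j < d, and [C k] collects the terms with
   j = k. The powers of y below d are free over [B], so each [C k] is 0; the value k = 0 singles out
   the class of u over [B]. *)
pose C k := \sum_(r <- p :: q :: s | `[< fgen B' (r.2 / u) >] && ((f r).2 == k))
  r.1 * (f r).1.
have C0 : C 0%N = 0.
  apply: (kmin_freeE l0 prim Bz y0 yl hd (c := C)) d0 => [k|].
    rewrite /C big_seq_cond; apply: fgen_sum => r /andP[hr /andP[/asboolP hru _]].
    by have [? _ _] := hs _ hr; have [? _ _] := hf _ hr hru; exact: fgenM.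
  have := sum' u; move/(congr1 ( *%R^~ u^-1)); rewrite mul0r mulr_suml => sum'u.
  rewrite -[RHS]sum'u [RHS]big_seq_cond.
  have -> : \sum_(i < d) C i * y ^+ i = \sum_(i < d) \sum_(r <- p :: q :: s |
     (r \in p :: q :: s) && `[< fgen B' (r.2 / u) >] && ((f r).2 == i)) r.1 * (r.2 / u).
    apply: eq_bigr => i _; rewrite /C mulr_suml big_seq_cond.
    rewrite [RHS](eq_bigl (fun r => (r \in p :: q :: s) && (`[< fgen B' (r.2 / u) >] && ((f r).2 == i)))); last by move=> r; rewrite andbA.
    apply: eq_bigr => r /andP[hr /andP[/asboolP hru /eqP hi]].
    by have [_ _ ->] := hf _ hr hru; rewrite hi; ring.
  rewrite (exchange_big_dep (fun r => (r \in p :: q :: s) && `[< fgen B' (r.2 / u) >])) /=; last first.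
    by move=> i r _ /andP[].
  apply: eq_bigr => r /andP[hr hru].
  have [_ hj _] := hf _ hr (asboolP _ hru).
  rewrite (bigD1 (Ordinal hj)) /=; last by rewrite hr hru eqxx.
  rewrite big1 ?addr0 ?mulrA // => i /andP[/andP[_ /eqP hi] /eqP ni].
  by case: ni; apply: val_inj; rewrite /= -hi.
have j0 r : r \in p :: q :: s -> fgen B (r.2 / u) -> (f r).2 = 0%N.
  move=> hr h; have [cB jd rE] := hf _ hr (sub _ h); have [_ r0' _] := hs _ hr.
  have ru0 : r.2 / u != 0 by rewrite mulf_neq0 // invr_eq0.
  have c0 : (f r).1 != 0 by apply: contraNneq ru0 => c0; rewrite rE c0 mul0r.
  apply/eqP; rewrite -leqn0 leqNgt; apply/negP => j0.
  have yj : fgen B (y ^+ (f r).2).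
    have -> : y ^+ (f r).2 = (r.2 / u) / (f r).1 by rewrite rE mulrAC divff // mul1r.
    exact: fgen_div.
  by have := dmin _ j0 yj; rewrite leqNgt jd.
have -> : \sum_(r <- p :: q :: s | `[< fgen B (r.2 / u) >]) r.1 * r.2 = u * C 0%N.
  rewrite /C mulr_sumr big_seq_cond [RHS]big_seq_cond; apply: eq_big => [r|r].
    apply: andb_id2l => hr; apply/asboolP/andP => [h|[/asboolP h /eqP jr]].
      by split; [apply/asboolP; exact: sub|rewrite j0].
    by have [? _ ->] := hf _ hr h; rewrite jr expr0 mulr1.
  move=> /andP[hr /asboolP h]; have [_ _ rE] := hf _ hr (sub _ h).
  move: rE; rewrite (j0 _ hr h) expr0 mulr1 => <-; field.
  exact: u0.
by rewrite C0 mulr0.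
Qed.

(** * Generic points *)

Local Notation "''X_[' m ]" := (@mpolyX _ _ m) (at level 8, format "''X_[' m ]").

(** An element and a positive power of it are algebraic over each other. *)
Lemma aindep_pow (L : fieldType) (A : set L) (I : Type) (x : I -> L) (Q : I -> nat) (s : seq I) :
  (forall i, (0 < Q i)%N) -> aindep A (map x s) ->
  aindep A (map (fun i => x i ^+ Q i) s).
Proof.
move=> Q0; elim: s A => //= i s IH A [nx hs].
have root B : acl B (x i ^+ Q i) -> acl B (x i).
  move=> h; have p0 : 'X^(Q i) - (x i ^+ Q i)%:P != 0 :> {poly L}.
    by rewrite -size_poly_gt0 size_XnsubC.
  apply: (acl_root p0) => [j|]; last by rewrite /root !hornerE subrr.
  rewrite coefB coefXn coefC; apply: aclB; first by case: eqP => _; [exact: acl1|exact: acl0].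
  by case: eqP => _ //; exact: acl0.
split; first by move/root.
apply: IH; apply: aindep_eq hs => w [hw|->]; try by apply: acl_in; left.
- by apply: root; apply: acl_in; right.
- by apply: aclX; apply: acl_in; right.
Qed.

Section MonomialsFree.
Variables (K L : fieldType) (iota : {rmorphism K -> L}) (c : nat).
Variables (x : 'I_c -> L) (Q : 'I_c -> nat) (a : nat).
Hypothesis xi : forall P : mpoly c K, mmap iota x P = 0 -> P = 0.
Hypothesis aQ : forall i, (a <= Q i)%N.

Let sub (P : mpoly c K) : mpoly c K :=
  mmap (@mpolyC c K) (fun i => 'X_[mnm1 i] ^+ Q i) P.

Let mnmQ (m : multinom c) : multinom c := Multinom [tuple (Q i * m i)%N | i < c].
Let mnmE' (e : {ffun 'I_c -> 'I_a}) : multinom c := Multinom [tuple (e i : nat) | i < c].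

Let subE P : sub P = \sum_(m <- msupp P) P@_m *: 'X_[mnmQ m].
Proof.
apply: eq_bigr => m _; rewrite mul_mpolyC; congr (_ *: _).
rewrite [RHS]mpolyXE_id; apply: eq_bigr => i _.
by rewrite mnmE -exprM.
Qed.

Let sub_eval P : mmap iota x (sub P) = mmap iota (fun i => x i ^+ Q i) P.
Proof.
rewrite subE rmorph_sum; apply: eq_bigr => m _ /=.
rewrite mmapZ mmapX; congr (_ * _); apply: eq_bigr => i _.
by rewrite mnmE exprM.
Qed.

(** Division with remainder of exponents is unique, so a monomial with exponents below a <= Q_i
    times a monomial in the x_i^(Q_i) determines both factors. After clearing denominators, a linear
    relation becomes a polynomial relation between the x_i. This bounds the degree of K(x) over
    K(x^Q) from below by a^c. *)
Lemma monomials_free :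
  lfree (range iota `|` [set` codom (fun i => x i ^+ Q i)])
        (fun e : {ffun 'I_c -> 'I_a} => \prod_i x i ^+ e i).
Proof.
move=> cc hcc hsum e0.
have /boolp.choice [f fP] : forall e : {ffun 'I_c -> 'I_a}, exists pq : mpoly c K * mpoly c K,
    mmap iota (fun i => x i ^+ Q i) pq.2 != 0 /\
    cc e = mmap iota (fun i => x i ^+ Q i) pq.1 / mmap iota (fun i => x i ^+ Q i) pq.2.
  by move=> e; have [p [q [? ?]]] := fgen_mmap (hcc e); exists (p, q).
set y := fun i => x i ^+ Q i in fP *.
pose d := \prod_e (f e).2.
have d0 : mmap iota y d != 0.
  by rewrite rmorph_prod; apply/prodf_neq0 => e _; exact: (fP e).1.
pose g e := (f e).1 * \prod_(e' | e' != e) (f e').2.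
have gE e : mmap iota y (g e) = cc e * mmap iota y d.
  rewrite /d (bigD1 e) //= /g !rmorphM /= (fP e).2.
  by have := (fP e).1 => ?; field.
pose G := \sum_e sub (g e) * 'X_[mnmE' e].
have G0 : G = 0.
  apply: xi; transitivity ((\sum_e cc e * \prod_i x i ^+ e i) * mmap iota y d).
    rewrite rmorph_sum /= mulr_suml; apply: eq_bigr => e _.
    rewrite rmorphM /= sub_eval gE mmapX mulrAC; congr (_ * _ * _).
    by apply: eq_bigr => i _; rewrite mnmE.
  by rewrite hsum mul0r.
suff : g e0 = 0.
  move/(congr1 (mmap iota y)); rewrite gE rmorph0 => /eqP.
  by rewrite mulf_eq0 (negPf d0) orbF => /eqP.
apply/mpolyP => m0; rewrite mcoeff0.
have := congr1 (mcoeff (mnm_add (mnmQ m0) (mnmE' e0))) G0.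
rewrite mcoeff0 raddf_sum /= => h; apply: etrans h.
have key m e : (mnm_add (mnmQ m) (mnmE' e) == mnm_add (mnmQ m0) (mnmE' e0)) =
    (m == m0) && (e == e0).
  apply/eqP/andP => [/mnmP hm|[/eqP -> /eqP ->//]].
  have hh i : m i = m0 i /\ e i = e0 i :> nat.
    have := hm i; rewrite !mnmDE !mnmE => hi.
    have l1 := leq_trans (ltn_ord (e i)) (aQ i).
    have l2 := leq_trans (ltn_ord (e0 i)) (aQ i).
    have Q0 : (0 < Q i)%N by exact: leq_ltn_trans l1.
    have := congr1 (divn^~ (Q i)) hi; have := congr1 (modn^~ (Q i)) hi.
    by rewrite ![(Q i * _)%N]mulnC !modnMDl !divnMDl // !modn_small // !divn_small // !addn0.
  split; apply/eqP; first by apply/mnmP => i; have [] := hh i.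
  by apply/ffunP => i; apply: val_inj; have [] := hh i.
have coef e : (sub (g e) * 'X_[mnmE' e])@_(mnm_add (mnmQ m0) (mnmE' e0)) =
    \sum_(m <- msupp (g e)) (g e)@_m * ((m == m0) && (e == e0))%:R.
  rewrite subE mulr_suml raddf_sum /=; apply: eq_bigr => m _.
  by rewrite -scalerAl -mpolyXD mcoeffZ mcoeffX key.
rewrite (bigD1 e0) //= coef [X in _ + X]big1 ?addr0 => [|e ne]; last first.
  by rewrite coef big1 // => m _; rewrite (negPf ne) andbF mulr0.
have [hm|hm] := boolP (m0 \in msupp (g e0)); last first.
  rewrite (memN_msupp_eq0 hm) big1_seq // => m /andP[_ h'].
  by rewrite (_ : m == m0 = false) ?mulr0 //; apply: contraNF hm => /eqP <-.
rewrite (bigD1_seq m0) ?msupp_uniq //= !eqxx mulr1 big1 ?addr0 // => m nm.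
by rewrite (negPf nm) mulr0.
Qed.

End MonomialsFree.

Lemma fdim_id (L : fieldType) (A : set L) : fdim A A 1.
Proof.
exists 'I_1, (fun _ => 1); rewrite card_ord; split=> // x hx.
by exists (fun _ => x); split=> //; rewrite big_ord1 mulr1.
Qed.

Lemma fgen_subset (L : fieldType) (A B : set L) : A `<=` fgen B -> fgen A `<=` fgen B.
Proof. by move=> h; apply: fgen_le => x /h. Qed.

Lemma fdim_leq (L : fieldType) (A B : set L) m n : (m <= n)%N -> fdim A B m -> fdim A B n.
Proof.
by move=> mn [I [b [hI hb]]]; exists I, b; split=> //; exact: leq_trans hI mn.
Qed.

Lemma fdim_seq (L : fieldType) (A : set L) (I : eqType) (y : I -> L) (d : I -> nat) (s : seq I) :
  (forall i (B : set L), i \in s -> A `<=` B -> fdim B (B `|` [set y i]) (d i)) ->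
  fdim A (A `|` [set` map y s]) (\prod_(i <- s) d i).
Proof.
move=> hs; suff h B : A `<=` B -> fdim B (B `|` [set` map y s]) (\prod_(i <- s) d i) by exact: h.
elim: s B hs => [|x s IH] B hs AB; first by rewrite setU_nil big_nil; exact: fdim_id.
rewrite [map _ _]/= setU_cons big_cons (mulnC (d x)); apply: (@fdim_trans _ _ (B `|` [set y x])).
  by apply: hs => //; rewrite inE eqxx.
apply: IH => [i C hi|]; first by apply: hs; rewrite inE hi orbT.
by move=> w /AB; left.
Qed.

(** The bound d is uniform over all larger base fields; it is used over bases that vary with s. *)
Lemma acl_fdim (L : fieldType) (A : set L) x : acl A x ->
  exists d, (0 < d)%N /\ forall B, fgen A `<=` fgen B -> fdim B (B `|` [set x]) d.
Proof.
move=> [p p0 px]; exists (size p); rewrite size_poly_gt0; split=> // B AB.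
have hB i : fgen B (val p`_i) by apply: AB; exact: fgenP.
pose q : {poly FG B} := \poly_(i < size p) fgin (hB i).
have qE : map_poly val q = map_poly val p.
  apply/polyP => i; rewrite !coef_map coef_poly; case: ltnP => // hi.
  by rewrite (nth_default _ hi) !raddf0.
apply: (@simple_ext _ _ _ q) => //.
- by rewrite -(map_poly_eq0 (val : FG B -> L)) qE map_poly_eq0.
- by rewrite qE.
- by apply: leq_trans (size_poly _ _) _.
Qed.

Lemma pow_fdim (L : fieldType) (B : set L) x Q : (0 < Q)%N -> fgen B (x ^+ Q) ->
  fdim B (B `|` [set x]) Q.
Proof.
move=> Q0 h; apply: (@simple_ext _ _ _ ('X^Q - (fgin h)%:P)).
- by rewrite -size_poly_gt0 size_XnsubC.
- by rewrite rmorphB /= map_polyXn map_polyC /root !hornerE subrr.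
- by rewrite size_XnsubC.
Qed.

(** * Vanishing polynomials yield multiplicative relations *)

Section Nonvanishing.
Variables (K : fieldType) (C : closedFieldType) (iota : {rmorphism K -> C}).
Hypothesis Kroots : forall l, (0 < l)%N -> exists zeta : K, l.-primitive_root zeta.
Variables (z : nat -> nat -> C) (kappa : nat).
Hypothesis z0 : forall i n, z i n != 0.
Hypothesis zshift : forall i n s, exists Q,
  [/\ z i (n + s)%N = z i n ^+ Q, (2 ^ s <= kappa * Q)%N & (Q <= kappa * 2 ^ s)%N].

Definition zvec c n : 'I_c -> C := fun i => z i n.
Arguments zvec : clear implicits.

Section Ultra.
Variables (U : set_system nat) (UU : UltraFilter U).
Hypothesis Uoo : forall N, U [set n | (N <= n)%N].

Let UP : ProperFilter U := @ultra_proper _ _ UU.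
Let Om := ultraprod C UU.
Let io : {rmorphism K -> Om} := (udiag UU \o iota).

Lemma ultra_pick (f : nat -> nat) (b : nat) : U [set n | (f n <= b)%N] ->
  exists k, U [set n | f n = k].
Proof.
elim: b => [|b IH] hb.
  by exists 0%N; apply: filterS hb => n /=; rewrite leqn0 => /eqP.
have [h|h] := in_ultra_setVsetC [set n | f n = b.+1] UU; first by exists b.+1.
apply: IH; apply: filterS2 hb h => n /= h1 h2.
by move: h1; rewrite leq_eqVlt => /orP[/eqP//|]; rewrite ltnS.
Qed.

Definition ux t i : Om := upi UU (fun n => z i (n + t)%N).
Definition uvec c t : 'I_c -> Om := fun i => ux t i.
Arguments uvec : clear implicits.

Lemma kappa_gt0 : (0 < kappa)%N.
Proof.
have [Q [_ h _]] := zshift 0 0 0; rewrite lt0n; apply: contraTneq h => ->.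
by rewrite mul0n.
Qed.

(** The exponent Q may depend on n, but for fixed s it is bounded and hence constant on a set of
    [U]. *)
Lemma ux_shift t s i : exists Q, [/\ ux (t + s) i = ux t i ^+ Q, (0 < Q)%N,
  (2 ^ s <= kappa * Q)%N & (Q <= kappa * 2 ^ s)%N].
Proof.
have /boolp.choice [q hq] := fun n => zshift i (n + t)%N s.
have [|Q hQ] := @ultra_pick q (kappa * 2 ^ s)%N.
  by apply: filterE => n /=; have [] := hq n.
exists Q; have [n] := filter_ex hQ => /= qn; have [_ h1 h2] := hq n.
rewrite -qn; split=> //; last first.
  by rewrite lt0n; apply: contraTneq h1 => ->; rewrite muln0 -ltnNge expn_gt0.
rewrite /ux -upiX; apply/upi_eq; apply: filterS hQ => m /= hm.
by have [e _ _] := hq m; rewrite addnA e hm -qn.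
Qed.

Lemma ux_neq0 t i : ux t i != 0.
Proof.
apply/eqP => /upi_eq0 h; have [n /= /eqP] := filter_ex h.
by rewrite (negPf (z0 _ _)).
Qed.

Variable c : nat.
Hypothesis indep : forall P : mpoly c K, mmap io (uvec c 0) P = 0 -> P = 0.

Lemma uvec_aindep t : aindep (range io) (codom (uvec c t)).
Proof.
have /boolp.choice [q hq] := ux_shift 0 t.
have -> : codom (uvec c t) = codom (fun i => uvec c 0 i ^+ q i).
  by rewrite !codomE; apply: eq_map => i /=; have [] := hq i.
rewrite codomE; apply: aindep_pow => [i|]; first by have [] := hq i.
by rewrite -codomE; exact: mmap_aindep.
Qed.

Lemma uvec_indep t (P : mpoly c K) : mmap io (uvec c t) P = 0 -> P = 0.
Proof. exact: aindep_mmap (uvec_aindep t) P. Qed.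

Variables (P0 : mpoly c.+1 K) (n0 : nat).
Hypothesis P0neq0 : P0 != 0.
Hypothesis P0z : forall n, (n0 <= n)%N -> mmap iota (zvec c.+1 n) P0 = 0.

Lemma P0u t : mmap io (uvec c.+1 t) P0 = 0.
Proof.
rewrite (upi_mmap UU iota P0 (fun i n => z i (n + t)%N)); apply/upi_eq0.
apply: filterS (Uoo n0) => n /= hn.
by apply: P0z; exact: leq_trans hn (leq_addr _ _).
Qed.

Let Bs t (Q : nat -> nat) (m : nat) : set Om :=
  range io `|` [set` codom (fun i : 'I_m => ux t i ^+ Q i)].

(** [P0] vanishes at every shift t + s, so the same polynomial bounds the degree of the last
    coordinate over the others for all s. The coordinates at shift t + s are the Q-th powers of
    those at t. *)
Lemma last_fdim t : exists D, (0 < D)%N /\ forall s Q,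
  (forall i, ux (t + s) i = ux t i ^+ Q i) ->
  fdim (Bs t Q c) (Bs t Q c.+1) D.
Proof.
exists (size (muni P0)); split.
  by rewrite size_poly_gt0; apply: contraNneq P0neq0 => /muni_eq0 ->.
move=> s Q hQ.
have e m : (fun i : 'I_m => ux t i ^+ Q i) = uvec m (t + s).
  by apply/funext => i; rewrite -hQ.
rewrite /Bs !e (codom_ordSr (uvec c.+1 (t + s))) setU_rcons.
have -> : uvec c.+1 (t + s) \o widen_ord (leqnSn c) = uvec c (t + s) by [].
set B := _ `|` _; pose p := map_poly (mmap io (uvec c (t + s))) (muni P0).
have hB i : fgen B p`_i.
  rewrite coef_map; apply: fgen_sum => m _; apply: fgenM.
    by apply: fgen_in; left; exists ((muni P0)`_i@_m).
  by apply: fgen_prod => j _; apply: fgenX; apply: fgen_in; right; exact: codom_f.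
pose q : {poly FG B} := \poly_(i < size (muni P0)) fgin (hB i).
have qE : map_poly val q = p.
  apply/polyP => i; rewrite coef_map coef_poly; case: ltnP => // hi.
  by rewrite /p coef_map (nth_default _ hi) !raddf0.
apply: (@simple_ext _ _ _ q) => //.
- rewrite -(map_poly_eq0 (val : FG B -> Om)) qE; apply: contraNneq P0neq0 => h.
  apply/eqP/muni_eq0/polyP => i; rewrite coef0; apply: (@uvec_indep (t + s)).
  by have := congr1 (fun r : {poly Om} => r`_i) h; rewrite coef_map coef0.
- by rewrite qE /p /root; have := P0u (t + s); rewrite mmap_muni => ->.
- by apply: leq_trans (size_poly _ _) _.
Qed.

(** If w were transcendental over K, it could replace one of the c coordinates x_i: all x_i would be
    algebraic over w and the c - 1 remaining ones, t'. The field of Q-th powers, with the last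
    coordinate adjoined, contains w. Over the field of the first c powers the x_i thus have degree
    at most D b^(c-1) D2 with b of size 2^s, as only the elements of t' contribute a factor growing
    with s. But by [monomials_free] the degree is at least a^c with a of size 2^s. *)
Lemma monomial_bounded t (w : Om) :
  (forall S, exists2 s, (S <= s)%N & exists Q,
     (forall i, [/\ ux (t + s) i = ux t i ^+ Q i, (0 < Q i)%N,
       (2 ^ s <= kappa * Q i)%N & (Q i <= kappa * 2 ^ s)%N]) /\
     fgen (Bs t Q c.+1) w) ->
  acl (range io `|` [set` codom (uvec c t)]) w ->
  acl (range io) w.
Proof.
move=> hs wacl; apply: contrapT => nw.
have [t' [szt' subt' ht']] := acl_exchange_seq wacl nw.
rewrite size_codom card_ord in szt'.
have [D [D0 hD]] := last_fdim t.
have /boolp.choice [d hd] : forall i : 'I_c, exists d, (0 < d)%N /\ forall B,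
    fgen (range io `|` [set w] `|` [set` t']) `<=` fgen B ->
    fdim B (B `|` [set uvec c t i]) d.
  by move=> i; apply: acl_fdim; apply: ht' => /=; exact: codom_f.
pose D2 := (\prod_i d i)%N.
have c0 : (0 < c)%N by rewrite -szt'.
pose D1 := (D * (kappa ^ c.-1 * D2))%N.
(* The summand [kappa] makes [a] positive; the other one contradicts the final inequality 2^s <= (2
   kappa)^c D1. *)
have [s hsE [Q [hQ wB]]] := hs ((2 * kappa) ^ c * D1 + kappa)%N.
pose b := (kappa * 2 ^ s)%N; pose a := ((2 ^ s) %/ kappa)%N.
have k0 := kappa_gt0.
pose A1 := Bs t Q c; pose A2 := Bs t Q c.+1.
pose A3 := A2 `|` [set` map id t']; pose A4 := A3 `|` [set` map (uvec c t) (enum 'I_c)].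
have d12 : fdim A1 A2 D by apply: (hD s) => i; have [] := hQ i.
have d23 : fdim A2 A3 (\prod_(x <- t') b)%N.
  apply: fdim_seq => x B /subt' /codomP[i ->] AB; apply: (@fdim_leq _ _ _ (Q i)).
    by have [] := hQ i.
  apply: pow_fdim; first by have [] := hQ i.
  apply: fgen_in; apply: AB; right.
  by apply/codomP; exists (widen_ord (leqnSn c) i).
have d34 : fdim A3 A4 (\prod_(i <- enum 'I_c) d i)%N.
  apply: fdim_seq => i B _ AB; apply: (hd i).2.
  apply: fgen_subset => y [[hy|->]|hy].
  - by apply: fgen_in; apply: AB; left; left.
  - by apply: fgen_mono wB => v hv; apply: AB; left.
  - by apply: fgen_in; apply: AB; right => /=; rewrite map_id.
have := fdim_trans (fdim_trans d12 d23) d34.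
rewrite big_enum /= big_const_seq count_predT iter_muln_1.
have -> : size t' = c.-1 by rewrite -szt'.
move=> dall.
have free : lfree A1 (fun e : {ffun 'I_c -> 'I_a} => \prod_i uvec c t i ^+ e i).
  apply: (@monomials_free K Om io c (uvec c t) (fun i => Q i) a).
    exact: uvec_indep.
  move=> i; have [_ _ h _] := hQ i.
  by rewrite -(leq_pmul2l k0); apply: leq_trans h; rewrite mulnC leq_trunc_div.
have [I [e [hI he]]] := dall.
have hc : (a ^ c <= D2 * (b ^ c.-1 * D))%N.
  apply: leq_trans hI; have := @lfree_span_card _ _ _ _ _ e free.
  rewrite card_ffun !card_ord; apply=> m; apply: he; apply: fgen_prod => i _.
  by apply: fgenX; apply: fgen_in; right; apply: map_f; rewrite mem_enum.
have D20 : (0 < D2)%N by apply: prodn_gt0 => i; have [] := hd i.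
have s2 : (s < 2 ^ s)%N by exact: ltn_expl.
have a0 : (0 < a)%N.
  by rewrite divn_gt0 //; apply: leq_trans (ltnW s2); apply: leq_trans hsE; exact: leq_addl.
have X1 : (2 ^ s <= 2 * kappa * a)%N.
  apply: leq_trans (ltnW (ltn_ceil (2 ^ s) k0)) _.
  by rewrite -/a mulnAC leq_mul2r mul2n -addnn -addn1 leq_add2l a0 orbT.
have X2 : ((2 ^ s) ^ c <= (2 * kappa) ^ c * D1 * (2 ^ s) ^ c.-1)%N.
  apply: (@leq_trans ((2 * kappa * a) ^ c)%N); first by rewrite leq_exp2r.
  rewrite expnMn -mulnA leq_mul2l; apply/orP; right; apply: leq_trans hc _.
  by rewrite /D1 /b expnMn; rewrite [leqRHS](_ : _ = D2 * (kappa ^ c.-1 * (2 ^ s) ^ c.-1 * D))%N //; ring.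
have : (2 ^ s <= (2 * kappa) ^ c * D1)%N.
  rewrite -(@leq_pmul2r ((2 ^ s) ^ c.-1)) ?expn_gt0 //.
  by rewrite -expnS prednK.
rewrite leqNgt => /negP; apply; apply: leq_ltn_trans s2; apply: leq_trans hsE.
exact: leq_addr.
Qed.

Definition umon t (m : multinom c.+1) : Om := \prod_i uvec c.+1 t i ^+ m i.

Lemma last_acl t : acl (range io `|` [set` codom (uvec c t)]) (ux t c).
Proof.
apply: contrapT => h; move/eqP: P0neq0; apply; apply: (@aindep_mmap _ _ io _ (uvec c.+1 t)); last exact: P0u.
rewrite codom_ordSr -cats1; apply/aindep_cat; split; first exact: uvec_aindep.
by split.
Qed.

Lemma umon_neq0 t m : umon t m != 0.
Proof. by apply/prodf_neq0 => i _; rewrite expf_neq0 // ux_neq0. Qed.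

(** [C] is algebraically closed, so a polynomial with constant coefficients already has all its
    roots among the constants. *)
Lemma acl_diag (w : Om) : acl (range io) w -> exists e, w = udiag UU e.
Proof.
move=> [p p0 pw].
have h x : fgen (range io) x -> exists e, x = udiag UU e.
  elim=> [y [k _ <-]||y z' _ [a ->] _ [b ->]|y z' _ [a ->] _ [b ->]].
  - by exists (iota k).
  - by exists 1; rewrite rmorph1.
  - by exists (a - b); rewrite rmorphB.
  - by exists (a / b); rewrite fmorph_div.
have /boolp.choice [f hf] : forall i, exists e, val p`_i = udiag UU e.
  by move=> i; apply: h; exact: fgenP.
pose q := \poly_(i < size p) f i.
have qE : map_poly (udiag UU) q = map_poly val p.
  apply/polyP => i; rewrite !coef_map coef_poly; case: ltnP => hi; first exact: (esym (hf i)).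
  by rewrite (nth_default _ hi) !raddf0.
have q0 : q != 0 by rewrite -(map_poly_eq0 (udiag UU)) qE map_poly_eq0.
have [rs hrs] := closed_field_poly_normal q.
move: pw; rewrite -qE hrs map_polyZ rootZ; last by rewrite fmorph_eq0 lead_coef_eq0.
rewrite (_ : map_poly _ _ = \prod_(r <- map (udiag UU) rs) ('X - r%:P)).
  by rewrite root_prod_XsubC => /mapP[r _ ->]; exists r.
rewrite rmorph_prod big_map; apply: eq_bigr => r _.
by rewrite rmorphB /= map_polyX map_polyC.
Qed.

(** At shift t, [P0] gives a vanishing sum of radicals over the field generated by the coordinates
    at shift t + s. By [kummer] the class of the term m0 must contain another term m. Some m occurs
    for arbitrarily large s; by [monomial_bounded] the ratio of its monomial to that of m0 is then
    algebraic over K, hence a constant e. *)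
Lemma umon_relation t : exists m m' e, [/\ m \in msupp P0, m' \in msupp P0, m != m' &
  U [set n | \prod_(i < c.+1) z i (n + t)%N ^+ m i =
             e * \prod_(i < c.+1) z i (n + t)%N ^+ m' i]].
Proof.
have [m0 m0P] : exists m0, m0 \in msupp P0.
  by exists (mlead P0); exact: mlead_supp.
have step s : exists m Q, [/\ m \in msupp P0, m != m0,
    (forall i, [/\ ux (t + s) i = ux t i ^+ Q i, (0 < Q i)%N,
       (2 ^ s <= kappa * Q i)%N & (Q i <= kappa * 2 ^ s)%N]) &
    fgen (Bs t Q c.+1) (umon t m / umon t m0)].
  have /boolp.choice [Q hQ] := fun i => ux_shift t s i.
  (* A multiple of all Q_i, so that l-th powers of monomials lie in [B]. *)
  pose l := (\prod_(i < c.+1) Q i)%N.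
  have l0 : (0 < l)%N by apply: prodn_gt0 => i; have [] := hQ i.
  have [zeta hz] := Kroots l0.
  have hz' : l.-primitive_root (io zeta) by rewrite fmorph_primitive_root.
  pose B := Bs t Q c.+1.
  have Bz : fgen B (io zeta) by apply: fgen_in; left; exists zeta.
  pose ps := [seq (io P0@_m, umon t m) | m <- msupp P0].
  have h1 p : p \in ps -> [/\ fgen B p.1, p.2 != 0 & fgen B (p.2 ^+ l)].
    case/mapP => m _ -> /=; split.
    - by apply: fgen_in; left; exists (P0@_m).
    - exact: umon_neq0.
    - rewrite /umon -prodrXl; apply: fgen_prod => i _; rewrite exprAC /l (bigD1 i) //= exprM.
      apply: fgenX; apply: fgenX; apply: fgen_in; right.
      by apply/codomP; exists i.
  have h2 : \sum_(p <- ps) p.1 * p.2 = 0.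
    by rewrite big_map; apply: etrans (P0u t); apply: eq_bigr.
  have := kummer l0 hz' Bz h1 h2 (umon t m0); rewrite big_map /= => h3.
  apply: contrapT => nex.
  suff : io P0@_m0 * umon t m0 = 0.
    move/eqP; rewrite mulf_eq0 (negPf (umon_neq0 _ _)) orbF fmorph_eq0.
    by rewrite mcoeff_eq0 m0P.
  apply: etrans h3; rewrite big_mkcond (bigD1_seq m0) ?msupp_uniq //=.
  have -> : `[< fgen B (umon t m0 / umon t m0) >].
    by rewrite divff ?umon_neq0 //; apply/asboolP; exact: fgen_1.
  rewrite big1_seq ?addr0 // => m /andP[nm mP].
  by case: asboolP => // h4; case: nex; exists m, Q.
have [m [mP nm hm]] : exists m, [/\ m \in msupp P0, m != m0 &
   forall S, exists2 s, (S <= s)%N & exists Q,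
    (forall i, [/\ ux (t + s) i = ux t i ^+ Q i, (0 < Q i)%N,
       (2 ^ s <= kappa * Q i)%N & (Q i <= kappa * 2 ^ s)%N]) /\
    fgen (Bs t Q c.+1) (umon t m / umon t m0)].
  apply: contrapT => nex.
  have /boolp.choice [S hS] : forall m, exists S, m \in msupp P0 -> m != m0 -> forall s Q, (S <= s)%N ->
    (forall i, [/\ ux (t + s) i = ux t i ^+ Q i, (0 < Q i)%N,
       (2 ^ s <= kappa * Q i)%N & (Q i <= kappa * 2 ^ s)%N]) ->
    fgen (Bs t Q c.+1) (umon t m / umon t m0) -> False.
    move=> m; apply: contrapT => nS; case: nex; exists m.
    have mP : m \in msupp P0.
      by apply: contrapT => h; case: nS; exists 0%N.
    have mP' : m != m0.
      by apply: contrapT => h; case: nS; exists 0%N.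
    split=> // S; apply: contrapT => nS'; case: nS; exists S => _ _ s Q hs hQ hf.
    by case: nS'; exists s => //; exists Q.
  have [m [Q [mP nm hQ hf]]] := step (\max_(m <- msupp P0) S m)%N.
  apply: (hS m mP nm _ Q _ hQ hf).
  by rewrite (big_rem m) //= leq_maxl.
have wacl : acl (range io `|` [set` codom (uvec c t)]) (umon t m / umon t m0).
  have h i : acl (range io `|` [set` codom (uvec c t)]) (uvec c.+1 t i).
    case: (unliftP ord_max i) => [j ->|->]; last exact: last_acl.
    apply: acl_in; right; apply/codomP; exists j; rewrite /uvec; congr ux.
    by rewrite lift_max.
  by apply: acl_div; apply: acl_prod => i _; apply: aclX.
have [e he] := acl_diag (monomial_bounded hm wacl).
exists m, m0, e; split=> //.
have : umon t m = udiag UU e * umon t m0 by rewrite -he divfK ?umon_neq0.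
have umonE m' : umon t m' = upi UU (fun n => \prod_(i < c.+1) z i (n + t)%N ^+ m' i).
  by rewrite upi_prod; apply: eq_bigr => i _; rewrite upiX.
by rewrite !umonE -upiM => /upi_eq.
Qed.

End Ultra.
Arguments uvec : clear implicits.

Lemma indep_mono (U : set_system nat) (UU : UltraFilter U) c :
  (forall P : mpoly c K, mmap (udiag UU \o iota) (uvec U UU c 0) P = 0 -> P = 0) ->
  forall m m' : multinom c, forall e : K,
  U [set n | \prod_(i < c) z i n ^+ m i = iota e * \prod_(i < c) z i n ^+ m' i] -> m = m'.
Proof.
move=> ind m m' e he.
have UP : ProperFilter U := @ultra_proper _ _ UU.
have : 'X_[m] - e *: 'X_[m'] = 0 :> mpoly c K.
  apply: ind; rewrite (upi_mmap UU iota _ (fun i n => z i (n + 0)%N)); apply/upi_eq0.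
  apply: filterS he => n /= he; rewrite rmorphB /= mmapZ !mmapX /mmap1 /=.
  by rewrite [X in _ - X]/= addn0 he subrr.
move/(congr1 (mcoeff m)); rewrite mcoeffB mcoeffZ !mcoeffX eqxx mcoeff0.
case: (m' =P m) => [->//|_]; rewrite mulr0 subr0 => /eqP.
by rewrite oner_eq0.
Qed.

(** An ultrafilter containing these sets makes the point generic. They are closed under intersection
    because nonzero polynomials can be multiplied. *)
Definition Ubase c (A : set nat) := exists N (P : mpoly c K), P != 0 /\
  forall n, (N <= n)%N -> mmap iota (zvec c n) P != 0 -> A n.

Lemma exists_ultra c :
  (forall P : mpoly c K, P != 0 -> forall N, exists2 n, (N <= n)%N & mmap iota (zvec c n) P != 0) ->
  exists U (UU : UltraFilter U), (forall N, U [set n | (N <= n)%N]) /\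
  forall P : mpoly c K, mmap (udiag UU \o iota) (uvec U UU c 0) P = 0 -> P = 0.
Proof.
move=> nv.
have FF : ProperFilter (@Ubase c).
  apply: Build_ProperFilter; last split.
  - by move=> [N [P [P0 h]]]; have [n hn Pn] := nv P P0 N; apply: (h n).
  - by exists 0%N, 1; split; first exact: oner_neq0.
  - move=> A B [N [P [P0 h]]] [M [Q [Q0 k]]]; exists (maxn N M), (P * Q).
    split=> [|n]; first exact: mulf_neq0.
    rewrite geq_max rmorphM mulf_eq0 negb_or => /andP[? ?] /andP[? ?].
    by split; [exact: h|exact: k].
  - by move=> A B AB [N [P [P0 h]]]; exists N, P; split=> // n hn hP; apply/AB/h.
have [U [UU FU]] := ultraFilterLemma FF; exists U, UU.
have UP : ProperFilter U := @ultra_proper _ _ UU.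
split=> [N|P hP].
  by apply: FU; exists N, 1; split; first exact: oner_neq0.
apply: contrapT => /eqP P0; move: hP.
rewrite (upi_mmap UU iota _ (fun i n => z i (n + 0)%N)) => /upi_eq0 hU.
have hU' : U [set n | mmap iota (zvec c n) P != 0].
  by apply: FU; exists 0%N, P; split.
have [n [/= h1]] := filter_ex (filterI hU hU').
by rewrite -[n in zvec c n]addn0 /zvec h1 eqxx.
Qed.

Variable r : nat.
Hypothesis iota_surj : forall e, exists k, e = iota k.
Hypothesis norel : forall U (UU : UltraFilter U) c, (c < r)%N ->
  (forall N, U [set n | (N <= n)%N]) ->
  (forall (m m' : multinom c) e,
    U [set n | \prod_(i < c) z i n ^+ m i = e * \prod_(i < c) z i n ^+ m' i] -> m = m') ->
  forall S : seq (multinom c.+1), ~ (forall t, exists m m' e, [/\ m \in S, m' \in S, m != m' &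
    U [set n | \prod_(i < c.+1) z i (n + t)%N ^+ m i =
               e * \prod_(i < c.+1) z i (n + t)%N ^+ m' i]]).

(** Induction on the number of coordinates. If the first c are generic for some ultrafilter while a
    polynomial in c + 1 of them vanishes for all n >= N, [umon_relation] produces relations between
    two monomials at every shift, with exponents from one finite set; [norel] excludes this. *)
Theorem nonvanishing c : (c <= r)%N -> forall P : mpoly c K, P != 0 ->
  forall N, exists2 n, (N <= n)%N & mmap iota (zvec c n) P != 0.
Proof.
elim: c => [_|c IH cr] P P0 N.
  exists N => //; move: P0; apply: contraNneq.
  by rewrite (nvar0_mpolyC P) mmapC => /eqP; rewrite fmorph_eq0 => /eqP ->; rewrite mpolyC0.
apply: contrapT => nex.
have [U [UU [Uoo ind]]] := exists_ultra (IH (ltnW cr)).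
apply: (norel UU cr Uoo) => [m m' e he|].
  by have [k ek] := iota_surj e; apply: (indep_mono ind (e := k)); rewrite -ek.
apply: (@umon_relation _ UU Uoo _ ind _ N P0) => n hn.
by apply: contrapT => /eqP h; case: nex; exists n.
Qed.

End Nonvanishing.

(** * Multiplicative relations between the sampled powers *)

Section PowerSequences.
Variables (C : closedFieldType) (q : nat -> nat) (L : nat) (beta : nat -> C).
Hypothesis q2 : forall i, (2 <= q i)%N.
Hypothesis qL : forall i, (q i <= 2 ^ L)%N.
Hypothesis beta0 : forall i, beta i != 0.
Hypothesis beta_inj : forall i a b, beta i ^+ a = beta i ^+ b -> a = b.

(** The largest exponent whose power of q_i is at most 2^(n + L). As q_i <= 2^L, that power is at
    least 2^n, so all coordinates shrink at comparable speed. *)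
Definition expo i n := trunc_log (q i) (2 ^ (n + L)).
Definition bigexp i n := (q i ^ expo i n)%N.
Definition zseq i n := beta i ^+ bigexp i n.

Lemma bigexp_leq i n : (bigexp i n <= 2 ^ (n + L))%N.
Proof. by apply: trunc_logP => //; rewrite expn_gt0. Qed.

Lemma bigexp_gt i n : (2 ^ (n + L) < q i * bigexp i n)%N.
Proof. by rewrite -expnS; exact: trunc_log_ltn. Qed.

Lemma bigexp_geq i n : (2 ^ n <= bigexp i n)%N.
Proof.
rewrite -(@leq_pmul2l (2 ^ L)) ?expn_gt0 // -expnD addnC.
by apply: leq_trans (ltnW (bigexp_gt i n)) _; rewrite leq_mul2r qL orbT.
Qed.

Lemma expo_mono i n s : (expo i n <= expo i (n + s))%N.
Proof. by apply: leq_trunc_log; rewrite leq_exp2l // leq_add2r leq_addr. Qed.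

Lemma bigexp_shift i n s : bigexp i (n + s) =
  (bigexp i n * q i ^ (expo i (n + s) - expo i n))%N.
Proof. by rewrite /bigexp -expnD subnKC // expo_mono. Qed.

Lemma bigexp_lt i n m : (n + L < m)%N -> (bigexp i n < bigexp i m)%N.
Proof.
move=> h; apply: leq_ltn_trans (bigexp_leq i n) _.
by apply: leq_trans (bigexp_geq i m); rewrite ltn_exp2l.
Qed.

Lemma zseq_neq0 i n : zseq i n != 0. Proof. by rewrite expf_neq0. Qed.

Lemma shift_bounds i n s : let Q := (q i ^ (expo i (n + s) - expo i n))%N in
  (2 ^ s <= 2 ^ L * Q)%N /\ (Q <= 2 ^ L * 2 ^ s)%N.
Proof.
move=> Q; have e := bigexp_shift i n s; rewrite -/Q in e.
have b0 : (0 < bigexp i n)%N by rewrite expn_gt0 (ltnW (q2 i)).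
split.
  rewrite -(@leq_pmul2l (2 ^ (n + L))) ?expn_gt0 // -expnD addnAC.
  apply: leq_trans (ltnW (bigexp_gt i _)) _; rewrite e mulnCA.
  by apply: leq_mul; [exact: bigexp_leq|rewrite leq_mul2r qL orbT].
rewrite -(@leq_pmul2l (bigexp i n)) // -e; apply: leq_trans (bigexp_leq _ _) _.
rewrite addnAC expnD mulnA leq_mul2r; apply/orP; right.
by apply: leq_trans (ltnW (bigexp_gt i n)) _; rewrite mulnC leq_mul2l qL orbT.
Qed.

Lemma zseq_shift i n s : exists Q, [/\ zseq i (n + s) = zseq i n ^+ Q,
  (2 ^ s <= 2 ^ L * Q)%N & (Q <= 2 ^ L * 2 ^ s)%N].
Proof.
exists (q i ^ (expo i (n + s) - expo i n))%N; have [? ?] := shift_bounds i n s.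
by split=> //; rewrite /zseq bigexp_shift exprM.
Qed.

Variables (r : nat) (U : set_system nat) (UU : UltraFilter U) (c : nat).
Hypothesis cr : (c < r)%N.
Hypothesis Uoo : forall N, U [set n | (N <= n)%N].

Let UP : ProperFilter U := @ultra_proper _ _ UU.
Let UI (A B : set nat) : U A -> U B -> U (A `&` B).
Proof. by move=> hA hB; apply: filterI. Qed.

Section OneRelation.
Variables (m m' : multinom c.+1) (e : C).
Hypothesis neq : m != m'.
Variable t : nat.
Hypothesis rel : U [set n | \prod_(i < c.+1) zseq i (n + t)%N ^+ m i =
                            e * \prod_(i < c.+1) zseq i (n + t)%N ^+ m' i].

(** Two times n and n' give relations with the same constant e, with exponents A_i and B_i > A_i of
    beta_i. Cross-multiplying removes e and leaves a relation between the beta_i with exponents (B_i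
    - A_i)(m_i - m'_i), written with nonnegative exponents on both sides. *)
Lemma no_relation_base :
  ~ (forall a b : nat -> nat, \prod_(i < r) beta i ^+ a i = \prod_(i < r) beta i ^+ b i ->
    forall i, (i < r)%N -> a i = b i).
Proof.
move=> ind; have [n /= hn] := filter_ex rel.
have [n' [/= hn' lt]] := filter_ex (filterI rel (Uoo (n + t + L).+1)).
pose A i := bigexp i (n + t); pose B i := bigexp i (n' + t).
have AB i : (A i < B i)%N by apply: bigexp_lt; apply: leq_trans lt (leq_addr _ _).
pose ext (f : 'I_c.+1 -> nat) i := if (i < c.+1)%N then f (inord i) else 0%N.
have extE f : \prod_(i < r) beta i ^+ ext f i = \prod_(i < c.+1) beta i ^+ f i.
  rewrite -(big_mkord xpredT (fun i => beta i ^+ ext f i)) (big_cat_nat (n := c.+1)) //=.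
  rewrite [X in _ * X]big_nat_cond [X in _ * X]big1 ?mulr1 => [|i]; last first.
    by rewrite andbT /ext => /andP[h _]; rewrite ltnNge h.
  rewrite big_mkord; apply: eq_bigr => i _.
  by rewrite /ext ltn_ord inord_val.
move/eqP: neq; apply; apply/mnmP => i.
have := ind (ext (fun i => A i * m i + B i * m' i)%N) (ext (fun i => B i * m i + A i * m' i)%N).
rewrite !extE => /(_ _ i); rewrite /ext ltn_ord inord_val (leq_trans (ltn_ord i) cr).
have E f g : \prod_(i < c.+1) beta i ^+ (f i * m i + g i * m' i) =
   (\prod_(i < c.+1) (beta i ^+ f i) ^+ m i) * \prod_(i < c.+1) (beta i ^+ g i) ^+ m' i.
  by rewrite -big_split; apply: eq_bigr => j _; rewrite exprD !exprM.
rewrite !E => h; have {}h : (A i * m i + B i * m' i)%N = (B i * m i + A i * m' i)%N.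
  apply: h => //; rewrite [X in X * _]hn [X in _ = X * _]hn'.
  by rewrite mulrAC.
by have := AB i; nia.
Qed.

(** The first c coordinates cancel; then e is removed by comparing two times, and injectivity of the
    powers of beta_c gives (B - A)(m - m') = 0 for the last exponent. *)
Lemma no_relation_single : (forall i : 'I_c, m (widen_ord (leqnSn c) i) = m' (widen_ord (leqnSn c) i)) -> False.
Proof.
move=> he; have [n /= hn] := filter_ex rel.
have [n' [/= hn' lt]] := filter_ex (filterI rel (Uoo (n + t + L).+1)).
have AB := @bigexp_lt c (n + t) (n' + t) (leq_trans lt (leq_addr _ _)).
have red k : \prod_(i < c.+1) zseq i (k + t)%N ^+ m i =
      e * \prod_(i < c.+1) zseq i (k + t)%N ^+ m' i ->
   zseq c (k + t) ^+ m ord_max = e * zseq c (k + t) ^+ m' ord_max.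
  rewrite !big_ord_recr /=; set x := \prod_(i < c) _; set y := \prod_(i < c) _.
  have -> : x = y by apply: eq_bigr => i _; rewrite he.
  rewrite mulrCA; apply: mulfI; apply/prodf_neq0 => i _.
  by rewrite expf_neq0 // zseq_neq0.
have {}hn := red _ hn; have {}hn' := red _ hn'.
have h : zseq c (n + t) ^+ m ord_max * zseq c (n' + t) ^+ m' ord_max =
         zseq c (n' + t) ^+ m ord_max * zseq c (n + t) ^+ m' ord_max.
  by rewrite hn hn' mulrAC.
move: h; rewrite /zseq -!exprM -!exprD => /beta_inj h.
move/eqP: neq; apply; apply/mnmP => i.
case: (unliftP ord_max i) => [j ->|->].
  have -> : lift ord_max j = widen_ord (leqnSn c) j by apply: val_inj; exact: lift_max.
  exact: he.
by move: AB h; nia.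
Qed.

End OneRelation.

Hypothesis rigid : forall (m m' : multinom c) e,
  U [set n | \prod_(i < c) zseq i n ^+ m i = e * \prod_(i < c) zseq i n ^+ m' i] -> m = m'.

(** For fixed t the increment of the exponent is bounded, hence constant on a set of [U]. There each
    coordinate at shift t is a fixed power of the one at shift 0. *)
Lemma expo_stable t : exists J : nat -> nat, forall i,
  U [set n | expo i (n + t) = (expo i n + J i)%N].
Proof.
suff h i : exists J, U [set n | expo i (n + t) = (expo i n + J)%N].
  by have /boolp.choice [J hJ] := h; exists J.
have [|J hJ] := @ultra_pick _ UU (fun n => expo i (n + t) - expo i n)%N (2 ^ L * 2 ^ t)%N.
  apply: filterE => n /=; have [_ h] := shift_bounds i n t.
  by apply: leq_trans h; apply: ltnW; apply: ltn_expl.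
by exists J; apply: filterS hJ => n /= <-; rewrite subnKC // expo_mono.
Qed.

(** Pigeonhole gives shifts t1 < t2 with the same two monomials. The relations have exponents
    q_i^(J1 i) and q_i^(J2 i); raised to the powers B = q_c^(J2 c) and A = q_c^(J1 c), they contain
    the last coordinate with the same exponents. Dividing leaves the first c coordinates with
    exponents (B q_i^(J1 i) - A q_i^(J2 i))(m_i - m'_i), which [rigid] forces to be 0. The first
    factor cannot vanish, for then q_c and q_i would have a common nontrivial power. *)
Lemma no_relations_exponents (S : seq (multinom c.+1)) :
  (forall i j a b, (i < r)%N -> (j < r)%N -> i != j -> (q i ^ a)%N = (q j ^ b)%N -> a = 0%N) ->
  ~ (forall t, exists m m' e, [/\ m \in S, m' \in S, m != m' &
    U [set n | \prod_(i < c.+1) zseq i (n + t)%N ^+ m i =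
               e * \prod_(i < c.+1) zseq i (n + t)%N ^+ m' i]]).
Proof.
move=> qind /boolp.choice [m /boolp.choice [m' /boolp.choice [e h]]].
have [t1 [t2 [lt hm hm']]] : exists t1 t2, [/\ (t1 + L < t2)%N, m t1 = m t2 & m' t1 = m' t2].
  have pick (f : nat -> (multinom c.+1)) : (forall t, f t \in S) -> exists k, U [set t | index (f t) S = k].
    move=> hf; apply: (@ultra_pick _ UU (fun t => index (f t) S) (size S)).
    by apply: filterE => t /=; exact: index_size.
  have S1 t : m t \in S by have [] := h t.
  have S2 t : m' t \in S by have [] := h t.
  have [k1 hk1] := pick _ S1; have [k2 hk2] := pick _ S2.
  have hk : U (_ `&` _) := UI hk1 hk2; have [t1 [/= i1 i1']] := filter_ex hk.
  have [t2 [/= [i2 i2'] lt]] := filter_ex (filterI hk (Uoo (t1 + L).+1)).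
  exists t1, t2; split=> //.
    by rewrite -(nth_index mnm0 (S1 t1)) i1 -i2 nth_index.
  by rewrite -(nth_index mnm0 (S2 t1)) i1' -i2' nth_index.
have [_ _ neq rel1] := h t1; have [_ _ _ rel2] := h t2.
rewrite -hm -hm' in rel2; set m1 := m t1 in neq rel1 rel2; set m1' := m' t1 in neq rel1 rel2.
apply: (no_relation_single neq rel1) => i0.
have [J1 hJ1] := expo_stable t1; have [J2 hJ2] := expo_stable t2.
have J12 i : (J1 i < J2 i)%N.
  have [n [/= h1 h2]] := filter_ex (filterI (hJ1 i) (hJ2 i)).
  have := @bigexp_lt i (n + t1) (n + t2); rewrite /bigexp ltn_exp2l // h1 h2 ltn_add2l; apply.
  by rewrite -addnA ltn_add2l.
pose Q1 i := (q i ^ J1 i)%N; pose Q2 i := (q i ^ J2 i)%N.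
have shift J t : (forall i, U [set n | expo i (n + t) = (expo i n + J i)%N]) ->
    forall f : (multinom c.+1), U [set n | \prod_(i < c.+1) zseq i (n + t)%N ^+ f i =
     (\prod_(i < c) (zseq i n ^+ (q i ^ J i)) ^+ f (widen_ord (leqnSn c) i)) *
       (zseq c n ^+ (q c ^ J c)) ^+ f ord_max].
  move=> hJ f; have : U [set n | forall i : 'I_c.+1, expo i (n + t) = (expo i n + J i)%N].
    have := @filter_forall _ _ (fun (i : 'I_c.+1) n => expo i (n + t) = (expo i n + J i)%N) U _.
    by apply=> i; exact: hJ.
  apply: filterS => n /= hn; rewrite big_ord_recr /=.
  have zE (i : 'I_c.+1) : zseq i (n + t) = zseq i n ^+ (q i ^ J i).
    by rewrite /zseq -exprM /bigexp hn expnD.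
  rewrite (zE ord_max); congr (_ * _); apply: eq_bigr => i _.
  by rewrite (zE (widen_ord (leqnSn c) i)).
pose w := widen_ord (leqnSn c); set A := Q1 c; set B := Q2 c.
(* [mu] and [mu'] are the two sides of the divided relation, with negative exponents moved
   across. *)
pose mu : multinom c := Multinom [tuple (B * Q1 i * m1 (w i) + A * Q2 i * m1' (w i))%N | i < c].
pose mu' : multinom c := Multinom [tuple (B * Q1 i * m1' (w i) + A * Q2 i * m1 (w i))%N | i < c].
have muE : mu = mu'.
  apply: (@rigid _ _ (e t1 ^+ B / e t2 ^+ A)).
  have h1 : U (_ `&` _) := UI (UI (shift _ _ hJ1 m1) (shift _ _ hJ1 m1')) rel1.
  have h2 : U (_ `&` _) := UI (UI (shift _ _ hJ2 m1) (shift _ _ hJ2 m1')) rel2.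
  apply: filterS2 h1 h2 => n /= [[-> ->] r1] [[-> ->] r2].
  have pE (f g : multinom c.+1) : \prod_(i < c) zseq i n ^+ (B * Q1 i * f (w i) + A * Q2 i * g (w i))%N =
    (\prod_(i < c) (zseq i n ^+ Q1 i) ^+ f (w i)) ^+ B * (\prod_(i < c) (zseq i n ^+ Q2 i) ^+ g (w i)) ^+ A.
    rewrite -!prodrXl -big_split; apply: eq_bigr => i _ /=.
    by rewrite exprD -!exprM; congr (_ ^+ _ * _ ^+ _); ring.
  under eq_bigr => i _ do rewrite mnmE.
  under [in RHS]eq_bigr => i _ do rewrite mnmE.
  rewrite !pE.
  move: r1 r2; rewrite -/(Q1 c) -/(Q2 c) -/A -/B; set x := _ ord_max; set x' := _ ord_max.
  set p1 := \prod_(i < c) _; set p2 := \prod_(i < c) _.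
  set p3 := \prod_(i < c) _; set p4 := \prod_(i < c) _ => r1 r2.
  have z0 := zseq_neq0 c n; move: (zseq c n) z0 r1 r2 => zz z0 r1 r2.
  have e2 : e t2 != 0.
    have nz : p4 * zz ^+ B ^+ x != 0.
      rewrite mulf_neq0 ?expf_neq0 //.
      by apply/prodf_neq0 => i _; rewrite !expf_neq0 // zseq_neq0.
    by apply: contraNneq nz => e0; rewrite r2 e0 mul0r.
  have e2A : e t2 ^+ A != 0 by rewrite expf_neq0.
  apply: (mulIf e2A); rewrite [RHS]mulrAC divfK //.
  apply: (mulIf (expf_neq0 (A * B * (x + x'))%N z0)).
  have {}r1 := congr1 (fun y => y ^+ B) r1; have {}r2 := congr1 (fun y => y ^+ A) r2.
  move: r1 r2; rewrite !exprMn -!exprM => r1 r2.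
  have -> : (A * B * (x + x') = A * x * B + B * x' * A)%N by ring.
  rewrite exprD; set u := zz ^+ (A * x * B) in r1 *; set v := zz ^+ (B * x' * A) in r2 *.
  have ux : u = zz ^+ (B * x * A) by congr (_ ^+ _); ring.
  have vx : v = zz ^+ (A * x' * B) by congr (_ ^+ _); ring.
  rewrite -ux in r2; rewrite -vx in r1.
  transitivity ((p1 ^+ B * u) * (e t2 ^+ A * (p2 ^+ A * v))); first by ring.
  by rewrite r1 -r2; ring.
move/mnmP: muE => /(_ i0); rewrite !mnmE => muE.
have QQ : (B * Q1 i0 <> A * Q2 i0)%N.
  rewrite /A /B /Q1 /Q2 -(subnKC (ltnW (J12 c))) -(subnKC (ltnW (J12 i0))) !expnD => E.
  have : (q c ^ (J2 c - J1 c) = q i0 ^ (J2 i0 - J1 i0))%N.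
    have p0 : (0 < q c ^ J1 c * q i0 ^ J1 i0)%N by rewrite muln_gt0 !expn_gt0 !(ltnW (q2 _)).
    by apply/eqP; rewrite -(eqn_pmul2l p0); apply/eqP; rewrite mulnAC E; ring.
  move/qind; rewrite cr (ltn_trans (ltn_ord i0) cr) => /(_ isT isT); rewrite neq_ltn ltn_ord orbT => /(_ isT) /eqP.
  by rewrite subn_eq0 leqNgt J12.
move: QQ muE; rewrite -/w; set X := (B * _)%N; set Y := (A * _)%N.
set a := m1 _; set b := m1' _ => XY E.
have : ((X%:Z - Y%:Z) * (a%:Z - b%:Z) = 0)%R by move: E; lia.
move/eqP; rewrite mulf_eq0 !subr_eq0 => /orP[/eqP[]//|/eqP[]//].
Qed.

End PowerSequences.

(** * Heights *)

Section IntegralBasis.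
Variable C : numClosedFieldType.

Lemma fgen_rat (x : C) : fgen set0 x ->
  exists (D : nat) (a : int), (0 < D)%N /\ x * D%:R = a%:~R.
Proof.
elim=> [y []||y z _ [D [a [D0 hy]]] _ [E [b [E0 hz]]]|y z _ [D [a [D0 hy]]] _ [E [b [E0 hz]]]].
- by exists 1%N, 1; rewrite mulr1.
- exists (D * E)%N, (a * E - b * D); split; first by rewrite muln_gt0 D0.
  by rewrite natrM mulrBl mulrA hy mulrCA hz rmorphB /= !rmorphM /= !pmulrn mulrC (mulrC b%:~R).
- have [->|z0] := eqVneq z 0; first by exists 1%N, 0; rewrite invr0 mulr0 mul0r.
  have D1 : D%:R != 0 :> C by rewrite pnatr_eq0 -lt0n.
  have E1 : E%:R != 0 :> C by rewrite pnatr_eq0 -lt0n.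
  have b0 : b%:~R != 0 :> C by rewrite -hz mulf_neq0.
  have zE : z = b%:~R / E%:R by rewrite -hz mulfK.
  have yE : y = a%:~R / D%:R by rewrite -hy mulfK.
  have [s hs] : exists s : int, `|b|%N = s * b :> int.
    by case: (b) => k; [exists 1|exists (-1)]; rewrite ?mul1r // mulN1r NegzE opprK.
  exists (D * `|b|)%N, (a * E * s); split.
    by rewrite muln_gt0 D0 absz_gt0; apply: contraNneq b0 => ->.
  have hb : `|b|%N%:R = s%:~R * b%:~R :> C by rewrite -rmorphM /= -hs -pmulrn.
  rewrite yE zE natrM hb !rmorphM /= -pmulrn; field.
  by rewrite b0 D1 E1.
Qed.

Lemma fgen_int (a : int) A : fgen A (a%:~R : C).
Proof.
have h n : fgen A (n%:R : C).
  by elim: n => [|n IH]; [exact: fgen0|rewrite -addn1 natrD; apply: fgenD => //; exact: fgen_1].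
by case: a => n; rewrite ?NegzE ?rmorphN; [exact: h|apply: fgenN; exact: h].
Qed.

Variables (B : set C) (n : nat).
Hypothesis Bfin : fdim set0 B n.

Lemma rat_basis : exists d (e : 'I_d -> C),
  [/\ forall i, fgen B (e i), lfree set0 e & forall x, fgen B x -> inspan set0 e x].
Proof.
pose P d := `[< exists e : 'I_d -> C, (forall i, fgen B (e i)) /\ lfree set0 e >].
have P0 : P 0%N.
  by apply/asboolP; exists (fun _ => 0); split=> [[]//|c _ _ []//].
have Pn d : P d -> (d <= n)%N.
  move=> /asboolP[e [eB ef]]; have [I [b [hI hb]]] := Bfin.
  by apply: leq_trans hI; rewrite -[d]card_ord; apply: lfree_span_card ef _ => i; apply: hb.
have [d /asboolP[e [eB ef]] dmax] := ex_maxnP (ex_intro (fun d => is_true (P d)) 0%N P0) Pn.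
exists d, e; split=> // x Bx.
apply: contrapT => nx; suff /dmax : P d.+1 by rewrite ltnn.
apply/asboolP; exists (fun i => oapp e x (unlift ord_max i)); split=> [i|c cf].
  by case: unliftP => [j _|_] //=.
rewrite big_ord_recr /= unlift_none /=.
under eq_bigr => j _.
  rewrite (_ : widen_ord _ j = lift ord_max j); last by apply: val_inj; rewrite [RHS]lift_max.
  rewrite liftK /=; over.
move=> h.
have cmax : c ord_max = 0.
  apply: contrapT => /eqP c0; apply: nx; exists (fun j => - c (lift ord_max j) / c ord_max); split.
    by move=> j; apply: fgenM; [apply: fgenN|apply: fgenV].
  apply: (mulfI c0); rewrite mulr_sumr.
  move/eqP: h; rewrite addrC addr_eq0 => /eqP ->; rewrite -sumrN; apply: eq_bigr => j _.
  by field.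
move: h; rewrite cmax mul0r addr0 => h i.
case: (unliftP ord_max i) => [j ->|->//].
by apply: (ef (fun j => c (lift ord_max j))).
Qed.

Lemma common_denom (I : finType) (f : I -> C) : (forall i, fgen set0 (f i)) ->
  exists (D : nat) (a : I -> int), (0 < D)%N /\ forall i, f i * D%:R = (a i)%:~R.
Proof.
move=> /(_ _)/fgen_rat-/boolp.choice [D /boolp.choice [a h]].
exists (\prod_i D i)%N, (fun i => a i * (\prod_(j | j != i) D j)%N); split.
  by apply: prodn_gt0 => i; have [] := h i.
move=> i; have [_ hi] := h i.
by rewrite (bigD1 i) //= natrM mulrA hi rmorphM /= -pmulrn.
Qed.

(** A rational basis of the number field is multiplied by a common denominator N of its structure
    constants: the constants of the basis N e_i are N times the old ones, hence integers. *)
Lemma integral_basis : exists d (e : 'I_d -> C) (c : 'I_d -> 'I_d -> 'I_d -> int),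
  [/\ forall a : 'I_d -> int, \sum_i (a i)%:~R * e i = 0 -> forall i, a i = 0,
      forall i j, e i * e j = \sum_k (c i j k)%:~R * e k &
      forall x, fgen B x -> exists (D : nat) (a : 'I_d -> int),
        (0 < D)%N /\ x * D%:R = \sum_k (a k)%:~R * e k].
Proof.
have [d [e [eB ef sp]]] := rat_basis.
have /boolp.choice [g hg] : forall ij : 'I_d * 'I_d, exists g : 'I_d -> C,
    (forall k, fgen set0 (g k)) /\ e ij.1 * e ij.2 = \sum_k g k * e k.
  by move=> ij; apply: sp; apply: fgenM; apply: eB.
have [|N [c [N0 hc]]] := @common_denom ('I_d * 'I_d * 'I_d)%type (fun ijk => g ijk.1 ijk.2).
  by move=> ijk; exact: (hg ijk.1).1.
have N1 : N%:R != 0 :> C by rewrite pnatr_eq0 -lt0n.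
exists d, (fun i => N%:R * e i), (fun i j k => c ((i, j), k)); split.
- move=> a h i.
  have := ef (fun i => (a i)%:~R * N%:R) _ _ i => /(_ _ _)/eqP.
  rewrite mulf_eq0 (negPf N1) orbF intr_eq0 => H; apply/eqP; apply: H => [k|].
    by apply: fgenM; first exact: fgen_int; rewrite pmulrn; exact: fgen_int.
  by rewrite -[RHS]h; apply: eq_bigr => k _; rewrite mulrA.
- move=> i j; transitivity (N%:R * N%:R * (e i * e j)); first by ring.
  rewrite (hg (i, j)).2 mulr_sumr; apply: eq_bigr => k _.
  by rewrite -(hc ((i, j), k)) /=; ring.
- move=> x /sp [h [h0 ->]]; have [D [a [D0 ha]]] := common_denom h0.
  exists (D * N)%N, a; split; first by rewrite muln_gt0 D0.
  by rewrite mulr_suml; apply: eq_bigr => k _; rewrite -ha natrM; ring.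
Qed.

End IntegralBasis.

Section Order.
Variables (C : numClosedFieldType) (d : nat) (e : 'I_d -> C) (c : 'I_d -> 'I_d -> 'I_d -> int).
Hypothesis efree : forall a : 'I_d -> int, \sum_i (a i)%:~R * e i = 0 -> forall i, a i = 0.
Hypothesis emul : forall i j, e i * e j = \sum_k (c i j k)%:~R * e k.

(** [D] is an exact denominator and not a bound: sums are formed over a common [D], and products
    multiply the denominators. *)
Definition hgt (D H : nat) (x : C) := exists a : 'I_d -> int,
  (forall k, (`|a k| <= H)%N) /\ x * D%:R = \sum_k (a k)%:~R * e k.

Definition cbound := (\max_i \max_j \max_k `|c i j k|)%N.
(** The loss in [hgtM]: a coordinate of a product is a sum of d^2 terms, each at most [cbound] times
    the two heights. The successor makes it positive. *)
Definition kap := (d * d * cbound).+1.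

Lemma c_le i j k : (`|c i j k| <= cbound)%N.
Proof.
apply: leq_trans (leq_bigmax i); apply: leq_trans (leq_bigmax j).
exact: (leq_bigmax k).
Qed.

Lemma hgt_mono D H H' x : (H <= H')%N -> hgt D H x -> hgt D H' x.
Proof. by move=> h [a [ha hx]]; exists a; split=> // k; exact: leq_trans (ha k) h. Qed.

Lemma hgt0 D H : hgt D H 0.
Proof. by exists (fun _ => 0); split=> // ; rewrite mul0r big1 // => i _; rewrite mul0r. Qed.

Lemma hgtD D H H' x y : hgt D H x -> hgt D H' y -> hgt D (H + H') (x + y).
Proof.
move=> [a [ha hx]] [b [hb hy]]; exists (fun k => a k + b k); split=> [k|].
  by have := ha k; have := hb k; lia.
by rewrite mulrDl hx hy -big_split; apply: eq_bigr => k _; rewrite rmorphD mulrDl.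
Qed.

Lemma hgt_sum (I : Type) (s : seq I) (P : pred I) (F : I -> C) D H :
  (forall i, P i -> hgt D H (F i)) -> hgt D (size s * H) (\sum_(i <- s | P i) F i).
Proof.
move=> h; elim: s => [|i s IH]; first by rewrite big_nil; exact: hgt0.
rewrite big_cons mulSn; case: ifP => [Pi|_]; first by apply: hgtD => //; exact: h.
by apply: hgt_mono IH; exact: leq_addl.
Qed.

Lemma absz_sum (I : finType) (F : I -> int) b : (forall i, (`|F i| <= b)%N) ->
  (`|(\sum_i F i)%R| <= #|I| * b)%N.
Proof.
move=> h; rewrite -sum_nat_const; elim/big_rec2: _ => // i y z _.
by have := h i; lia.
Qed.

Lemma hgtM D D' H H' x y : hgt D H x -> hgt D' H' y ->
  hgt (D * D') (kap * (H * H')) (x * y).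
Proof.
move=> [a [ha hx]] [b [hb hy]].
exists (fun k => \sum_(ij : 'I_d * 'I_d) a ij.1 * b ij.2 * c ij.1 ij.2 k); split=> [k|].
  apply: leq_trans (absz_sum (b := H * H' * cbound) _) _ => [ij|].
    by rewrite !abszM; apply: leq_mul; [apply: leq_mul|exact: c_le].
  by rewrite card_prod card_ord /kap; nia.
rewrite natrM mulrACA hx hy big_distrlr /= pair_bigA /=.
under [RHS]eq_bigr => k _ do rewrite rmorph_sum mulr_suml.
rewrite exchange_big; apply: eq_bigr => -[i j] _ /=.
rewrite mulrACA emul mulr_sumr; apply: eq_bigr => k _.
by rewrite !rmorphM /= !mulrA.
Qed.

Lemma hgt_scale D H E x : hgt D H x -> hgt (D * E) (H * E) x.
Proof.
move=> [a [ha hx]]; exists (fun k => a k * E); split=> [k|].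
  by rewrite abszM leq_mul.
by rewrite natrM mulrA hx mulr_suml; apply: eq_bigr => k _; rewrite rmorphM /= -pmulrn mulrAC.
Qed.

Lemma hgtXM D H D' H' x y n : hgt D H x -> hgt D' H' y ->
  hgt (D ^ n * D') ((kap * H) ^ n * H') (x ^+ n * y).
Proof.
move=> hx hy; elim: n => [|n IH]; first by rewrite !expn0 expr0 mul1r !mul1n.
rewrite exprS -mulrA !expnS -!mulnA.
exact: hgtM.
Qed.

Lemma hgt_monom n (x : 'I_n -> C) D H D' H' y (m : multinom n) :
  (forall i, hgt D H (x i)) -> hgt D' H' y ->
  hgt (D ^ mdeg m * D') ((kap * H) ^ mdeg m * H') (\prod_i x i ^+ m i * y).
Proof.
move=> hx hy; rewrite mdegE.
elim: (index_enum _) => [|i s IH]; first by rewrite !big_nil !expn0 mul1r !mul1n.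
rewrite !big_cons !expnD -!mulnA -mulrA.
by apply: hgtXM.
Qed.

Lemma hgt_norm D H x : (0 < D)%N -> hgt D H x -> `|x| <= H%:R * \sum_i `|e i|.
Proof.
move=> D0 [a [ha hx]]; have D1 : (1 : C) <= D%:R by rewrite ler1n.
apply: (@le_trans _ _ `|x * D%:R|); first by rewrite normrM normr_nat ler_peMr.
rewrite hx mulr_sumr; apply: le_trans (ler_norm_sum _ _ _) _.
apply: ler_sum => i _; rewrite normrM; apply: ler_wpM2r => //.
by rewrite -intr_norm; have := ha i; rewrite -(ler_nat C) natr_absz.
Qed.

Lemma det_bound n (M : 'M[int]_n) b : (forall i j, (`|M i j| <= b)%N) ->
  (`|\det M| <= n`! * b ^ n)%N.
Proof.
move=> h; rewrite (_ : n`! = #|{perm 'I_n}|) /determinant; last first.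
  rewrite -[in LHS](card_ord n) -cardsT -card_perm; apply: eq_card => s.
  by rewrite [RHS]inE; apply/fintype.subsetP => i _; rewrite inE.
apply: absz_sum => s; rewrite abszM.
have -> : `|(-1) ^+ s : int|%N = 1%N by case: (odd_perm s).
rewrite mul1n -[X in (b ^ X)%N]card_ord -prod_nat_const.
elim: (index_enum _) => [|i t IH]; first by rewrite !big_nil.
by rewrite !big_cons abszM leq_mul.
Qed.

Lemma adj_bound n (M : 'M[int]_n) b : (0 < b)%N -> (forall i j, (`|M i j| <= b)%N) ->
  forall i j, (`|(\adj M) i j| <= n`! * b ^ n)%N.
Proof.
case: n M => [M b0 h []//|n M b0 h i j]; rewrite mxE /cofactor abszM.
have -> : `|(-1) ^+ (j + i) : int|%N = 1%N by rewrite abszX exp1n.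
rewrite mul1n; apply: leq_trans (det_bound (b := b) _) _ => [k l|]; first by rewrite !mxE.
by rewrite factS expnS mulnACA leq_pmull // muln_gt0.
Qed.

(** Multiplication by y = x D has an integer matrix M in the basis e. Its determinant is nonzero,
    hence at least 1 in absolute value. Applying the adjugate to M e = y e gives det M e_k0 = y (adj
    M e)_k0, and the entries of adj M are bounded by [adj_bound]. *)
Lemma liouville_order : exists A : C, 0 < A /\ forall D H x, (0 < D)%N -> (0 < H)%N ->
  hgt D H x -> x != 0 -> 1 <= A * (D * H ^ d)%:R * `|x|.
Proof.
have [d0|d0] := posnP d.
  exists 1; split=> [|D H x D0 H0 [a [_ hx]] x0]; first exact: ltr01.
  move: hx; rewrite big1 => [/eqP|i]; last by have := ltn_ord i; rewrite [X in (_ < X)%N]d0.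
  by rewrite mulf_eq0 (negPf x0) pnatr_eq0 => /eqP D1; rewrite D1 in D0.
pose k0 := Ordinal d0.
have ek0 : e k0 != 0.
  apply/eqP => h; have /(_ _ k0) := @efree (fun i => (i == k0)%:Z).
  rewrite eqxx => H; suff : (1 : int) = 0 by [].
  by apply: H; rewrite (bigD1 k0) //= h mulr0 add0r big1 // => i /negPf ->; rewrite mul0r.
pose S := \sum_j `|e j|.
have S0 : 0 < S.
  rewrite /S (bigD1 k0) //=; apply: ltr_wpDr; last by rewrite normr_gt0.
  by apply: sumr_ge0.
pose A := (d`! * kap ^ d)%:R * S / `|e k0|.
have A0 : 0 < A.
  by rewrite divr_gt0 ?normr_gt0 // mulr_gt0 // ltr0n muln_gt0 fact_gt0 expn_gt0.
exists A; split=> // D H x D0 H0 [a [ha hx]] x0.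
set y := x * D%:R in hx; have y0 : y != 0 by rewrite mulf_neq0 // pnatr_eq0 -lt0n.
pose M := \matrix_(j, k) \sum_i a i * c i j k : 'M[int]_d.
have ME j : y * e j = \sum_k (M j k)%:~R * e k.
  rewrite hx mulr_suml; under [RHS]eq_bigr => k _ do rewrite mxE rmorph_sum mulr_suml.
  rewrite exchange_big; apply: eq_bigr => i _.
  rewrite -mulrA emul mulr_sumr; apply: eq_bigr => k _.
  by rewrite rmorphM /= mulrA.
have Mb i j : (`|M i j| <= kap * H)%N.
  rewrite mxE; apply: leq_trans (absz_sum (b := H * cbound) _) _ => [k|].
    by rewrite abszM leq_mul // c_le.
  by rewrite card_ord /kap; have := d0; clear; nia.
have det0 : \det M != 0.
  apply/negP => /det0P [v v0 vM]; move/negP: v0; apply; apply/eqP/rowP => j; rewrite mxE.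
  apply: (efree (a := fun j => v ord0 j)); apply: (mulfI y0); rewrite mulr0 mulr_sumr.
  under eq_bigr => i _ do rewrite mulrCA ME mulr_sumr.
  rewrite exchange_big big1 // => k _.
  under eq_bigr => i _ do rewrite mulrA.
  rewrite -mulr_suml; have := congr1 (fun m : 'rV_d => (m ord0 k)%:~R : C) vM.
  rewrite mxE mxE rmorph_sum /=; under eq_bigr => i _ do rewrite rmorphM /=.
  by move=> ->; rewrite mul0r.
have key : (\det M)%:~R * e k0 = y * \sum_j ((\adj M) k0 j)%:~R * e j.
  rewrite mulr_sumr; under [RHS]eq_bigr => j _ do rewrite mulrCA ME mulr_sumr.
  rewrite exchange_big /=; under [RHS]eq_bigr => k _.
    under eq_bigr => j _ do rewrite mulrA -rmorphM /=.
    rewrite -mulr_suml -rmorph_sum /=.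
    rewrite (_ : \sum_j _ = (\adj M *m M) k0 k); last by rewrite mxE.
    rewrite mul_adj_mx mxE; over.
  rewrite (bigD1 k0) // [X in _ = _ + X]big1 => [|k /negPf nk].
    by rewrite addr0 eqxx.
  by rewrite eq_sym nk mulr0n mul0r.
have n1 : `|e k0| <= `|y| * (d`! * (kap * H) ^ d)%:R * S.
  apply: (@le_trans _ _ `|(\det M)%:~R * e k0|).
    rewrite normrM ler_peMl // -intr_norm ler1z; move: det0; lia.
  rewrite key normrM -mulrA; apply: ler_wpM2l => //; rewrite mulr_sumr.
  apply: le_trans (ler_norm_sum _ _ _) _; apply: ler_sum => i _.
  rewrite normrM; apply: ler_wpM2r => //; rewrite -intr_norm -natr_absz ler_nat.
  by apply: adj_bound Mb _ _; rewrite muln_gt0.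
rewrite /A -[X in X <= _](divff (x := `|e k0|)) ?normr_eq0 //.
rewrite [leRHS](_ : _ = (`|y| * (d`! * (kap * H) ^ d)%:R * S) / `|e k0|).
  by rewrite ler_pM2r // invr_gt0 normr_gt0.
by rewrite /y normrM normr_nat expnMn !natrM; ring.
Qed.

Variable B : set C.
Hypothesis span : forall x, fgen B x -> exists (D : nat) (a : 'I_d -> int),
  (0 < D)%N /\ x * D%:R = \sum_k (a k)%:~R * e k.

Lemma hgt_ex x : fgen B x -> exists D H, [/\ (0 < D)%N, (0 < H)%N & hgt D H x].
Proof.
move=> /span [D [a [D0 hx]]]; exists D, (\max_k `|a k|).+1%N; split=> //.
by exists a; split=> // k; apply: leqW; exact: leq_bigmax.
Qed.

Lemma hgt_ex_seq (s : seq C) : (forall x, x \in s -> fgen B x) ->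
  exists D H, [/\ (0 < D)%N, (0 < H)%N & forall x, x \in s -> hgt D H x].
Proof.
elim: s => [|x s IH] hs; first by exists 1%N, 1%N.
have [|D [H [D0 H0 h]]] := IH; first by move=> y hy; apply: hs; rewrite inE hy orbT.
have [|E [I [E0 I0 hx]]] := @hgt_ex x; first by apply: hs; rewrite inE eqxx.
exists (D * E)%N, (H * E + I * D)%N; split=> [||y].
- by rewrite muln_gt0 D0.
- by rewrite addn_gt0 muln_gt0 H0 E0.
rewrite inE => /orP[/eqP ->|/h hy].
  by rewrite mulnC; apply: hgt_mono (hgt_scale D hx); exact: leq_addl.
by apply: hgt_mono (hgt_scale E hy); exact: leq_addr.
Qed.

(** The scale 2^k is that of the exponents of the sampled powers, which makes heights comparable
    with the smallness theta^(2^k). *)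
Definition growth n (X : nat -> 'I_n -> C) := exists C0, (0 < C0)%N /\
  forall k i, exists D, [/\ (0 < D)%N, (D <= C0 ^ (2 ^ k))%N & hgt D (C0 ^ (2 ^ k)) (X k i)].

Lemma growth_common n (X : nat -> 'I_n -> C) : growth X -> exists C1, (0 < C1)%N /\
  forall k, exists D, [/\ (0 < D)%N, (D <= C1 ^ (2 ^ k))%N & forall i, hgt D (C1 ^ (2 ^ k)) (X k i)].
Proof.
move=> [C0 [C00 h]]; exists (C0 ^ n.+1)%N; split=> [|k]; first by rewrite expn_gt0 C00.
have /boolp.choice [D hD] := h k; exists (\prod_i D i)%N.
have hb (P : pred 'I_n) : (\prod_(i | P i) D i <= (C0 ^ 2 ^ k) ^ n)%N.
  rewrite -[X in (_ ^ X)%N]card_ord -prod_nat_const big_mkcond /=.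
  apply: leq_prod => i _; case: (P i); first by have [] := hD i.
  by rewrite expn_gt0 C00.
rewrite -expnM mulnC expnM expnS; split.
- by apply: prodn_gt0 => i; have [] := hD i.
- by apply: leq_trans (hb _) _; rewrite leq_pmull // expn_gt0 C00.
move=> i; have [_ _ hi] := hD i; rewrite (bigD1 i) //=.
by apply: hgt_mono (hgt_scale _ hi); rewrite leq_mul.
Qed.

Lemma growth_norm n (X : nat -> 'I_n -> C) : growth X -> exists c C0 : C,
  [/\ 1 <= c, 1 <= C0 & forall k i, `|X k i| <= c * C0 ^+ (2 ^ k)].
Proof.
move=> [C0 [C00 h]]; exists (1 + \sum_i `|e i|), C0%:R; split=> [||k i].
- by rewrite lerDl sumr_ge0.
- by rewrite ler1n.
have [D [D0 _ hX]] := h k i; apply: le_trans (hgt_norm D0 hX) _.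
by rewrite mulrC natrX; apply: ler_wpM2r; rewrite ?exprn_ge0 // ler_wpDl.
Qed.

(** The order of the quantifiers matters: [C2] depends on the points alone, while [P] enters through
    the degree bound delta and through c. The degree can thus be chosen in terms of [C2], and c is
    overcome by letting k grow. *)
Lemma liouville_mpoly n (X : nat -> 'I_n -> C) : growth X ->
  exists C2 : nat, (0 < C2)%N /\ forall (P : mpoly n (FG B)) delta,
    (forall m, m \in msupp P -> (mdeg m <= delta)%N) ->
    exists c : C, 0 < c /\ forall k, mmap val (X k) P != 0 ->
      1 <= c * C2%:R ^+ (delta * 2 ^ k) * `|mmap val (X k) P|.
Proof.
move=> /growth_common [C1 [C10 h]]; have [A [A0 liou]] := liouville_order.
exists (C1 * (kap * C1 * C1) ^ d)%N; split; first by rewrite muln_gt0 C10 expn_gt0 !muln_gt0 C10.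
move=> P delta hP.
have [|DP [HP [DP0 HP0 hc]]] := @hgt_ex_seq [seq val P@_m | m <- msupp P].
  by move=> x /mapP[m _ ->]; exact: fgenP.
pose sz := (size (msupp P)).+1.
exists (A * (DP * (sz * HP) ^ d)%:R); split.
  by rewrite mulr_gt0 // ltr0n muln_gt0 DP0 expn_gt0 muln_gt0 HP0.
move=> k nz; have [D [D0 Db hX]] := h k; set G := (C1 ^ 2 ^ k)%N in Db hX.
have G0 : (0 < G)%N by rewrite expn_gt0 C10.
have hPX : hgt (D ^ delta * DP) (sz * ((kap * G * G) ^ delta * HP)) (mmap val (X k) P).
  apply: (hgt_mono (H := size (msupp P) * ((kap * G * G) ^ delta * HP))).
    by rewrite leq_mul2r leqnSn orbT.
  rewrite /mmap big_seq; apply: hgt_sum => m mP.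
  have hm := hP m mP; have := hgt_monom m hX (hc _ (map_f (fun m => val P@_m) mP)).
  move=> /(hgt_scale (D ^ (delta - mdeg m))).
  rewrite mulnAC -expnD subnKC // mulrC; apply: hgt_mono.
  rewrite mulnAC leq_mul2r; apply/orP; right.
  have kG : (0 < kap * G)%N by rewrite muln_gt0.
  rewrite [leqRHS]expnMn leq_mul // ?leq_pexp2l //.
  apply: (@leq_trans (G ^ (delta - mdeg m))%N); last by rewrite leq_pexp2l // leq_subr.
  by have [->//|/lt0n_neq0 ?] := posnP (delta - mdeg m)%N; rewrite leq_exp2r // lt0n.
have := liou _ _ _ _ _ hPX nz => /(_ _ _)/le_trans; apply.
- by rewrite muln_gt0 expn_gt0 D0.
- by rewrite !muln_gt0 HP0 expn_gt0 !muln_gt0 G0.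
apply: ler_wpM2r => //; rewrite -!mulrA; apply: ler_wpM2l; first exact: ltW.
rewrite -natrX -natrM ler_nat.
have exp_le a b n' : (a <= b)%N -> (a ^ n' <= b ^ n')%N.
  by case: n' => // n' ab; rewrite leq_exp2r.
rewrite [leqLHS](_ : _ = DP * (sz * HP) ^ d * (D ^ delta * ((kap * G * G) ^ delta) ^ d))%N; last first.
  by rewrite mulnCA expnMn (expnMn sz); ring.
rewrite leq_mul2l; apply/orP; right; rewrite [leqRHS]expnMn; apply: leq_mul.
  by apply: leq_trans (exp_le _ _ delta Db) _; rewrite /G -expnM mulnC.
have kGG : (kap * G * G <= (kap * C1 * C1) ^ 2 ^ k)%N.
  rewrite !expnMn -/G !leq_mul2r; apply/orP; right; apply/orP; right.
  by rewrite -[leqLHS]expn1 leq_pexp2l // expn_gt0.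
rewrite -expnM; apply: leq_trans (exp_le _ _ (delta * d)%N kGG) _.
by rewrite -!expnM (_ : 2 ^ k * (delta * d) = d * (delta * 2 ^ k))%N //; ring.
Qed.

End Order.

(** * Mahler's method *)

(** Mere existence is enough: the auxiliary polynomial is fixed before k tends to infinity, so no
    Siegel-type bound on its coefficients enters. *)
Lemma linear_system (K : fieldType) (I J : finType) (c : I -> J -> K) : (#|J| < #|I|)%N ->
  exists x : I -> K, (exists i, x i != 0) /\ forall j, \sum_i x i * c i j = 0.
Proof.
move=> hlt; pose N : 'M[K]_(#|I|, #|J|) := \matrix_(i, j) c (enum_val i) (enum_val j).
have /rowV0Pn [v /sub_kermxP hv v0] : kermx N != 0.
  by rewrite -mxrank_eq0 mxrank_ker -lt0n subn_gt0 (leq_ltn_trans (rank_leq_col N)).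
exists (fun i => v 0 (enum_rank i)); split.
  move/rV0Pn: v0 => [i vi]; exists (enum_val i); by rewrite enum_valK.
move=> j; have := congr1 (fun M : 'M[K]_(1, #|J|) => M 0 (enum_rank j)) hv.
rewrite !mxE => h; apply: etrans h; rewrite (reindex (@enum_val I I)) /=; last first.
  by apply: onW_bij; exact: enum_val_bij.
by apply: eq_bigr => i _; rewrite enum_valK !mxE enum_rankK.
Qed.

Section Boxes.
Variables (K : fieldType) (rho : nat).
Implicit Types (b : 'I_rho -> nat) (m : multinom rho).

Definition boxType b := {dffun forall i : 'I_rho, 'I_(b i)}.
Definition boxmnm b (f : boxType b) : multinom rho := Multinom [tuple (f i : nat) | i < rho].

Lemma card_box b : #|{: boxType b}| = (\prod_i b i)%N.
Proof.
rewrite card_dep_ffun foldrE big_map big_enum.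
by apply: eq_bigr => i _; rewrite card_ord.
Qed.

Lemma boxmnm_inj b : injective (@boxmnm b).
Proof.
by move=> f g /mnmP h; apply/ffunP => i; apply: val_inj; have := h i; rewrite !mnmE.
Qed.

Lemma boxmnm_lt b (f : boxType b) i : (boxmnm f i < b i)%N.
Proof. by rewrite mnmE. Qed.

Lemma boxmnm_ex b m : (forall i, (m i < b i)%N) -> exists f : boxType b, boxmnm f = m.
Proof.
move=> h; exists [ffun i => Ordinal (h i)]; apply/mnmP => i.
by rewrite mnmE ffunE.
Qed.

Definition boxpoly b (x : boxType b -> K) : mpoly rho K := \sum_f x f *: 'X_[boxmnm f].

Lemma boxpoly_coef b x (f : boxType b) : (boxpoly x)@_(boxmnm f) = x f.
Proof.
rewrite raddf_sum (bigD1 f) //= mcoeffZ mcoeffX eqxx mulr1 big1 ?addr0 // => g ng.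
by rewrite mcoeffZ mcoeffX (inj_eq (@boxmnm_inj b)) (negPf ng) mulr0.
Qed.

Lemma boxpoly_supp b (x : boxType b -> K) m : m \in msupp (boxpoly x) -> forall i, (m i < b i)%N.
Proof.
rewrite mcoeff_msupp raddf_sum /= => h.
have [f hf] : exists f : boxType b, boxmnm f = m.
  apply: contrapT => nf; case/eqP: h; rewrite big1 // => f _.
  rewrite mcoeffZ mcoeffX; case: eqP => [e|_]; last by rewrite mulr0.
  by case: nf; exists f.
by move=> i; rewrite -hf boxmnm_lt.
Qed.

(** The monomial order is compatible with multiplication, so the product of the two least monomials
    arises from one pair of terms only. *)
Lemma mlastM_coef (p q : mpoly rho K) :
  (p * q)@_(mnm_add (mlast p) (mlast q)) = p@_(mlast p) * q@_(mlast q).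
Proof.
have low (u : mpoly rho K) m : m \in msupp u -> m != mlast u -> (mlast u < m)%O.
  by move=> hm ne; rewrite lt_neqAle eq_sym ne mlast_lemc.
have [->|p0] := eqVneq p 0; first by rewrite mul0r !mcoeff0 mul0r.
have [->|q0] := eqVneq q 0; first by rewrite mulr0 !mcoeff0 mulr0.
have coefE m : (p * q)@_m = \sum_(m1 <- msupp p) \sum_(m2 <- msupp q)
    p@_m1 * q@_m2 * (mnm_add m1 m2 == m)%:R.
  rewrite {1}(mpolyE p) mulr_suml raddf_sum /=; apply: eq_bigr => m1 _.
  rewrite {1}(mpolyE q) mulr_sumr raddf_sum /=; apply: eq_bigr => m2 _.
  by rewrite -scalerAr -scalerAl scalerA mcoeffZ -mpolyXD mcoeffX (mulrC q@_m2).
rewrite coefE (bigD1_seq (mlast p)) ?msupp_uniq ?mlast_supp //=.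
rewrite (bigD1_seq (mlast q)) ?msupp_uniq ?mlast_supp //= eqxx mulr1.
rewrite !big1_seq ?addr0 // => [m1 /andP[n1 s1]|m2 /andP[n2 s2]].
  rewrite big1_seq // => m2 /andP[_ s2]; case: eqP => [e|_]; last by rewrite mulr0.
  have := ltmc_le_add (low _ _ s1 n1) (mlast_lemc s2); by rewrite e ltxx.
case: eqP => [e|_]; last by rewrite mulr0.
have := low _ _ s2 n2; by rewrite -(ltmc_add2r (mlast p)) e ltxx.
Qed.

(** The unknowns are the coefficients of P in the box d and of G in the box b - A; the equations are
    the coefficients of P - G H in the box b. If P were 0, all monomials of G H would lie outside
    the box b. But the least one is the product of the least ones of G and H, and the latter has
    degree at most A. The term of H of low degree is what lets G fill almost the whole box b. *)
Lemma auxiliary_polynomial (H : mpoly rho K) A d b a :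
  a \in msupp H -> (mdeg a <= A)%N -> (\prod_i b i < \prod_i d i + \prod_i (b i - A))%N ->
  exists P G : mpoly rho K,
  [/\ P != 0, forall m, m \in msupp P -> forall i, (m i < d i)%N,
      forall m, m \in msupp G -> forall i, (m i + A < b i)%N &
      forall m, (forall i, (m i < b i)%N) -> (P - G * H)@_m = 0].
Proof.
move=> aH aA count; pose b' i := (b i - A)%N.
pose I := (boxType d + boxType b')%type.
pose c (u : I) (j : boxType b) : K := match u with
  | inl f => 'X_[boxmnm f]@_(boxmnm j)
  | inr g => - ('X_[boxmnm g] * H)@_(boxmnm j) end.
have [|x [[u xu] hx]] := @linear_system K I (boxType b) c; first by rewrite card_sum !card_box.
pose P := boxpoly (fun f => x (inl f)); pose G := boxpoly (fun g => x (inr g)).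
have PG m : (forall i, (m i < b i)%N) -> (P - G * H)@_m = 0.
  move=> /boxmnm_ex [j <-]; have := hx j; rewrite big_sumType /= => h; apply: etrans h.
  rewrite mcoeffB /P /G /boxpoly mulr_suml !(raddf_sum (mcoeff _)) /=; congr (_ + _).
    by apply: eq_bigr => f _; rewrite mcoeffZ.
  by rewrite -sumrN; apply: eq_bigr => g _; rewrite mulrN -scalerAl mcoeffZ.
have GB m : m \in msupp G -> forall i, (m i + A < b i)%N.
  by move=> /boxpoly_supp h i; have := h i; rewrite /b'; lia.
exists P, G; split=> // [|m /boxpoly_supp//].
apply/eqP => P0; have G0 : G != 0.
  case: u xu => u; first by rewrite -(boxpoly_coef (fun f => x (inl f)) u) -/P P0 mcoeff0 eqxx.
  by rewrite -(boxpoly_coef (fun g => x (inr g)) u) -/G; apply: contraNneq => ->; rewrite mcoeff0.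
have H0 : H != 0 by apply: contraTneq aH => ->; rewrite msupp0.
have := PG (mnm_add (mlast G) (mlast H)); rewrite P0 sub0r mcoeffN mlastM_coef => /(_ _)/eqP.
rewrite oppr_eq0 mulf_eq0 !mcoeff_eq0 !mlast_supp //= => h.
suff : false by []; apply: h => i; rewrite mnmDE.
have := GB _ (mlast_supp G0) i; apply: leq_ltn_trans; rewrite leq_add2l.
apply: leq_trans aA; apply: leq_trans (lemc_mdeg (mlast_lemc aH)).
by rewrite mdegE (bigD1 i) //= leq_addr.
Qed.

(** Bernoulli's inequality prod (1 - A / b_i) >= 1 - n A / D, multiplied out so as to stay within
    the natural numbers. *)
Lemma bernoulli_prod (s : seq 'I_rho) b A D : (A <= D)%N -> (forall i, (D <= b i)%N) ->
  (D * \prod_(i <- s) b i <= D * \prod_(i <- s) (b i - A) + size s * A * \prod_(i <- s) b i)%N.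
Proof.
move=> AD hb; elim: s => [|i s IH]; first by rewrite !big_nil /= addn0.
rewrite !big_cons /=; have := hb i; move: IH.
set p := (\prod_(i <- s) b i)%N; set p' := (\prod_(i <- s) (b i - A))%N.
set n := size s => IH hi.
have le : (p' <= p)%N by apply: leq_prod => j _; exact: leq_subr.
have e : (b i = (b i - A) + A)%N by rewrite subnK // (leq_trans AD).
move: e hi; set u := (b i - A)%N; move: (b i) => B -> hi.
have h1 := leq_mul (leqnn u) IH; have h2 := leq_mul (leqnn (A * p)%N) hi.
by move: h1 h2; clear; nia.
Qed.

End Boxes.

Section Formal.
Variables (K : fieldType) (rho T : nat) (blk : 'I_T -> 'I_rho) (F : 'I_T -> powser K).
Local Notation n := (rho + T)%N.

Definition psc : {rmorphism K -> powser K} := (@ps_of_poly K \o polyC).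

Lemma pcoef_psc c f k : pcoef (psc c * f) k = c * pcoef f k.
Proof.
rewrite /= big_ord_recl /= subn0 coefC eqxx big1 ?addr0 // => i _.
by rewrite coefC mul0r.
Qed.

(** The variables are z_1, ..., z_rho followed by one for each series; [bl] names the z on which a
    variable depends. *)
Definition bl (v : 'I_n) : 'I_rho := match fintype.split v with inl i => i | inr j => blk j end.
Definition bser (v : 'I_n) : powser K :=
  match fintype.split v with inl i => ps_of_poly 'X | inr j => F j end.

Lemma blL i : bl (lshift T i) = i. Proof. by rewrite /bl (unsplitK (inl i)). Qed.
Lemma blR j : bl (rshift rho j) = blk j. Proof. by rewrite /bl (unsplitK (inr j)). Qed.

Hypothesis blockfree : forall i (Q : mpoly n K),
  (forall m, m \in msupp Q -> forall v, bl v != i -> m v = 0%N) ->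
  mmap psc bser Q = 0 -> Q = 0.

Definition monS (m : multinom n) i := \prod_(v | bl v == i) bser v ^+ m v.

(** Different blocks involve different z_i, so freeness within each block should make FF nonzero at
    the series in separate variables. Blocks are treated one at a time: the exponents in later
    blocks are fixed as in m0, and a nonvanishing coefficient of the current z_i is selected. Only
    coefficients occur, never a power series in several variables. *)
Lemma separate (FF : mpoly n K) i : FF != 0 -> (i <= rho)%N ->
  exists (a : 'I_rho -> nat) (m0 : multinom n),
  \sum_(m <- msupp FF | [forall v, (i <= bl v)%N ==> (m v == m0 v)])
     FF@_m * \prod_(l < rho | (l < i)%N) pcoef (monS m l) (a l) != 0.
Proof.
move=> FF0; elim: i => [_|i IH hi].
  exists (fun _ => 0%N), (mlead FF).
  rewrite (eq_bigl (fun m => m == mlead FF)) => [|m]; last first.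
    apply/forallP/eqP => [h|-> v]; last by rewrite eqxx implybT.
    by apply/mnmP => v; apply/eqP; exact: h.
  rewrite -big_filter filter_pred1_uniq ?msupp_uniq ?mlead_supp // big_seq1 big_pred0 // mulr1.
  by rewrite mleadc_eq0.
have [a [m0 h0]] := IH (ltnW hi); pose io := Ordinal hi.
pose res (m : multinom n) : multinom n := Multinom [tuple if bl v == io then m v else 0%N | v < n].
pose c m := FF@_m * \prod_(l < rho | (l < i)%N) pcoef (monS m l) (a l).
pose ag k m := [forall v : 'I_n, (k <= bl v)%N ==> (m v == m0 v)].
(* The terms of FF that agree with [m0] beyond block i, contracted by the coefficients already
   selected, as a polynomial in the variables of block i. Its coefficient at [res m0] is the sum
   [h0] known to be nonzero. *)
pose Q : mpoly n K := \sum_(m <- msupp FF | ag i.+1 m) c m *: 'X_[res m].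
have Q0 : Q != 0.
  apply: contra_neq h0 => /(congr1 (mcoeff (res m0))); rewrite mcoeff0 raddf_sum /=.
  under eq_bigr => m _ do rewrite mcoeffZ mcoeffX.
  move=> h; apply: etrans h; rewrite big_mkcond [RHS]big_mkcond; apply: eq_bigr => m _.
  have -> : [forall v, (i <= bl v)%N ==> (m v == m0 v)] = ag i.+1 m && (res m == res m0).
    apply/forallP/andP => [h|[/forallP h1 /eqP/mnmP h2] v].
      split; first by apply/forallP => v; apply/implyP => /ltnW hv; apply: (implyP (h v)).
      apply/eqP/mnmP => v; rewrite !mnmE; case: eqP => // e; apply/eqP/(implyP (h v)).
      by rewrite e.
    apply/implyP; rewrite leq_eqVlt => /orP[/eqP e|hv]; last exact: (implyP (h1 v)).
    have := h2 v; rewrite !mnmE (_ : bl v == io) => [->//|].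
    by apply/eqP/val_inj.
  by case: (ag _ _) => //=; case: (_ == _); rewrite ?mulr1 ?mulr0.
have Qsupp m : m \in msupp Q -> forall v, bl v != io -> m v = 0%N.
  rewrite mcoeff_msupp raddf_sum /= => hm v nv; apply: contrapT => mv.
  case/eqP: hm; rewrite big1 // => m' _; rewrite mcoeffZ mcoeffX.
  case: eqP => [e|_]; last by rewrite mulr0.
  by case: mv; rewrite -e mnmE (negPf nv).
have [k hk] : exists k, pcoef (mmap psc bser Q) k != 0.
  apply: contrapT => nk; case/eqP: Q0; apply: (blockfree Qsupp); apply: powserP => k.
  by apply: contrapT => /eqP hk; case: nk; exists k; rewrite -[X in _ != X](coef0 K k).
exists (fun l => if l == io then k else a l), m0.
apply: contra_neq hk => h; apply: etrans h.
have pcsum (J : Type) (s : seq J) (P : pred J) (f : J -> powser K) :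
    pcoef (\sum_(j <- s | P j) f j) k = \sum_(j <- s | P j) pcoef (f j) k.
  by elim/big_rec2: _ => [|j y1 y2 _ <-] //=; rewrite ?coef0.
rewrite rmorph_sum pcsum; apply: eq_bigr => m _ /=.
rewrite mmapZ pcoef_psc mmapX -mulrA; congr (_ * _).
rewrite [RHS](bigD1 io) //= eqxx mulrC; congr (_ * _).
  congr (pcoef _ k); rewrite /mmap1 /monS [RHS]big_mkcond; apply: eq_bigr => v _.
  by rewrite mnmE; case: ifP.
apply: eq_big => [l|l hl]; last first.
  by rewrite (_ : (l == io) = false) //; apply/eqP => e; move: hl; rewrite e ltnn.
by rewrite ltnS ltn_neqAle andbC -val_eqE.
Qed.

Definition upoly (l : 'I_rho) : {rmorphism {poly K} -> mpoly rho K} :=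
  (horner_eval ('X_[mnm1 l] : mpoly rho K) \o map_poly (@mpolyC rho K)).

Lemma mcoeff_prod_upoly (p : 'I_rho -> {poly K}) (a : multinom rho) :
  (\prod_l upoly l (p l))@_a = \prod_l (p l)`_(a l).
Proof.
pose M := (\max_l size (p l) + mdeg a).+1.
have aM l : (a l < M)%N by rewrite ltnS (leq_trans _ (leq_addl _ _)) // mdegE (bigD1 l) //= leq_addr.
have upE l : upoly l (p l) = \sum_(k < M) (p l)`_k *: ('X_[mnm1 l] : mpoly rho K) ^+ k.
  rewrite /= /horner_eval (@horner_coef_wide _ M).
    by apply: eq_bigr => k _; rewrite coef_map mul_mpolyC.
  apply: leq_trans (size_poly _ _) _; apply: leqW.
  by apply: leq_trans (leq_bigmax l) (leq_addr _ _).
under eq_bigr => l _ do rewrite upE.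
rewrite bigA_distr_bigA raddf_sum /= (bigD1 [ffun l => Ordinal (aM l)]) //=.
have monE (f : {ffun 'I_rho -> 'I_M}) : \prod_l ((p l)`_(f l) *: ('X_[mnm1 l] : mpoly rho K) ^+ f l) =
    (\prod_l (p l)`_(f l)) *: 'X_[Multinom [tuple (f l : nat) | l < rho]].
  rewrite scaler_prod mpolyXE_id; congr (_ *: _); apply: eq_bigr => l _.
  by rewrite mnmE.
rewrite [X in _ + X]big1 ?addr0 => [|f nf].
  rewrite monE mcoeffZ mcoeffX (_ : _ == a) ?mulr1.
    by apply: eq_bigr => l _; rewrite ffunE.
  by apply/eqP/mnmP => l; rewrite mnmE ffunE.
rewrite monE mcoeffZ mcoeffX; case: eqP => [e|_]; last by rewrite mulr0.
case/eqP: nf; apply/ffunP => l; apply: val_inj; rewrite ffunE /= -e.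
by rewrite mnmE.
Qed.

Definition tser N (v : 'I_n) : {poly K} :=
  match fintype.split v with inl i => 'X | inr j => \poly_(k < N) pcoef (F j) k end.

(** FF with every series cut at degree N, as a polynomial in z_1, ..., z_rho. It is the H of the
    auxiliary construction. *)
Definition truncated (FF : mpoly n K) N : mpoly rho K :=
  mmap (@mpolyC rho K) (fun v => upoly (bl v) (tser N v)) FF.

Let agr N (p : {poly K}) (f : powser K) := forall k, (k < N)%N -> p`_k = pcoef f k.

Lemma agr_prod N (J : finType) (P : pred J) (p : J -> {poly K}) f (e : J -> nat) :
  (forall j, agr N (p j) (f j)) -> agr N (\prod_(j | P j) p j ^+ e j) (\prod_(j | P j) f j ^+ e j).
Proof.
have agM p1 p2 f1 f2 : agr N p1 f1 -> agr N p2 f2 -> agr N (p1 * p2) (f1 * f2).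
  move=> h1 h2 k hk; rewrite coefM /=; apply: eq_bigr => i _.
  rewrite h1 ?h2 // ?(leq_ltn_trans (leq_subr _ _)) //.
  by apply: leq_trans hk; exact: ltn_ord.
have ag1 : agr N 1 1 by [].
move=> h; elim/big_rec2: _ => // j f1 p1 _ h1; apply: (agM) => //.
by elim: (e j) => [|d IH]; rewrite ?expr0 // !exprS; exact: agM.
Qed.

Lemma truncated_coef (FF : mpoly n K) N a :
  (truncated FF N)@_a =
  \sum_(m <- msupp FF) FF@_m * \prod_l (\prod_(v | bl v == l) tser N v ^+ m v)`_(a l).
Proof.
rewrite /truncated /mmap raddf_sum /=; apply: eq_bigr => m _.
rewrite mul_mpolyC mcoeffZ; congr (_ * _).
rewrite /mmap1 (partition_big bl xpredT) //=.
rewrite (eq_bigr (fun l => upoly l (\prod_(v | bl v == l) tser N v ^+ m v))); last first.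
  by move=> l _; rewrite rmorph_prod; apply: eq_bigr => v /eqP <-; rewrite rmorphXn.
by rewrite mcoeff_prod_upoly.
Qed.

(** The coefficient found by [separate] is unaffected by truncation once N exceeds its exponents;
    hence a bound A that does not depend on N. *)
Lemma truncated_low (FF : mpoly n K) : FF != 0 -> exists A, forall N, (A <= N)%N ->
  exists2 a, a \in msupp (truncated FF N) & (mdeg a <= A)%N.
Proof.
move=> FF0; have [a [m0 h]] := separate FF0 (leqnn rho).
pose am : multinom rho := Multinom [tuple a l | l < rho].
exists (mdeg am).+1 => N hN; exists am; last exact: leqnSn.
rewrite mcoeff_msupp; apply: contra_neq h => h; rewrite -[RHS]h truncated_coef.
apply: eq_big => [m|m _]; first by apply/forallP => v; rewrite leqNgt ltn_ord.
congr (_ * _); apply: eq_big => [l|l _]; first exact: ltn_ord.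
rewrite mnmE; apply/esym; apply: (@agr_prod N _ _ _ _ (fun v => m v)) => [v k hk|].
  rewrite /tser /bser; case: (fintype.split v) => [i|j]; first by [].
  by rewrite coef_poly hk.
apply: leq_trans hN; rewrite ltnS mdegE (bigD1 l) //= mnmE.
exact: leq_addr.
Qed.

(** Variables that carry no series, in the application the y, keep a degree bounded independently of
    N. *)
Lemma truncated_deg (FF : mpoly n K) N i : (forall j, blk j != i) ->
  forall m, m \in msupp (truncated FF N) -> (m i <= msize FF)%N.
Proof.
move=> hi m; rewrite mcoeff_msupp truncated_coef; apply: contraR; rewrite -ltnNge => h.
rewrite big1_seq // => m' /andP[_ hm']; rewrite (bigD1 i) //=.
suff -> : (\prod_(v | bl v == i) tser N v ^+ m' v)`_(m i) = 0 by rewrite mul0r mulr0.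
rewrite (big_pred1 (lshift T i)) => [|v]; last first.
  case: (split_ordP v) => [k ->|k ->]; rewrite ?blL ?blR /= ?eq_lshift //.
  by rewrite eq_rlshift (negPf (hi k)).
rewrite /tser (unsplitK (inl i)) coefXn; case: eqP => // e.
have := msize_mdeg_lt hm'; rewrite mdegE (bigD1 (lshift T i)) //= -e.
move=> /(leq_ltn_trans (leq_addr _ _))/ltnW/(leq_trans h); by rewrite ltnn.
Qed.

End Formal.

Section Estimates.
Variables (K : fieldType) (C : numClosedFieldType) (iota : {rmorphism K -> C}) (n : nat).
Implicit Types (P : mpoly n K) (x y : 'I_n -> C) (m : multinom n).

Definition mnorm P : C := \sum_(m <- msupp P) `|iota P@_m|.

Lemma mnorm_ge0 P : 0 <= mnorm P.
Proof. by apply: sumr_ge0. Qed.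

Lemma mmap_norm P x (b : C) :
  (forall m, m \in msupp P -> `|\prod_i x i ^+ m i| <= b) ->
  `|mmap iota x P| <= mnorm P * b.
Proof.
move=> h; apply: le_trans (ler_norm_sum _ _ _) _.
rewrite /mnorm mulr_suml big_seq [leRHS]big_seq; apply: ler_sum => m mP.
by rewrite normrM; apply: ler_wpM2l => //; exact: h.
Qed.

(** One small variable occurs to order at least N, the other small ones contribute at most 1, and
    those outside [Z] have degree at most d'. *)
Lemma monom_box_norm (Z : pred 'I_n) x (M tau : C) m N d' i0 :
  1 <= M -> (forall i, `|x i| <= M) -> 0 <= tau <= 1 -> (forall i, Z i -> `|x i| <= tau) ->
  (forall i, ~~ Z i -> (m i <= d')%N) -> Z i0 -> (N <= m i0)%N ->
  `|\prod_i x i ^+ m i| <= tau ^+ N * M ^+ (n * d').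
Proof.
move=> M1 hx /andP[t0 t1] hZ hm Zi0 hN; have M0 := le_trans ler01 M1.
rewrite normr_prod (bigD1 i0) //=.
apply: ler_pM => //.
- by apply: prodr_ge0.
- rewrite normrX; apply: (@le_trans _ _ (tau ^+ m i0)); last exact: ler_wiXn2l.
  by rewrite lerXn2r ?nnegrE // hZ.
apply: (@le_trans _ _ (\prod_(i < n) M ^+ d')); last first.
  by rewrite prodr_const card_ord -exprM mulnC.
rewrite big_mkcond /=; apply: ler_prod => i _; case: ifP => _; last first.
  by rewrite ler01 exprn_ege1.
rewrite normr_ge0 /= normrX; have [Zi|Zi] := boolP (Z i).
  apply: (@le_trans _ _ 1); last exact: exprn_ege1.
  by rewrite exprn_ile1 // (le_trans (hZ _ Zi)).
apply: (@le_trans _ _ (M ^+ m i)); first by rewrite lerXn2r ?nnegrE.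
by apply: ler_weXn2l => //; exact: hm.
Qed.

Lemma monom_diff x y (M e : C) m : 1 <= M -> 0 <= e -> (forall i, `|x i| <= M) ->
  (forall i, `|y i| <= M) -> (forall i, `|x i - y i| <= e) ->
  `|\prod_i x i ^+ m i - \prod_i y i ^+ m i| <= (mdeg m)%:R * M ^+ mdeg m * e.
Proof.
move=> M1 e0 hx hy hd; have M0 := le_trans ler01 M1.
have key (a a' b b' : C) k l : `|a| <= M ^+ k -> `|a'| <= M ^+ k -> `|b| <= M ^+ l -> `|b'| <= M ^+ l ->
   `|a - a'| <= k%:R * M ^+ k * e -> `|b - b'| <= l%:R * M ^+ l * e ->
   `|a * b - a' * b'| <= (k + l)%:R * M ^+ (k + l) * e.
  move=> ha ha' hb hb' da db.
  rewrite (_ : a * b - a' * b' = (a - a') * b + a' * (b - b')); last by ring.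
  apply: le_trans (ler_normD _ _) _; rewrite !normrM natrD exprD.
  rewrite (_ : (k%:R + l%:R) * (M ^+ k * M ^+ l) * e =
    (k%:R * M ^+ k * e) * M ^+ l + M ^+ k * (l%:R * M ^+ l * e)); last by ring.
  by apply: lerD; apply: ler_pM.
have pow i k : [/\ `|x i ^+ k| <= M ^+ k, `|y i ^+ k| <= M ^+ k &
    `|x i ^+ k - y i ^+ k| <= k%:R * M ^+ k * e].
  elim: k => [|k [h1 h2 h3]]; first by rewrite !expr0 normr1 subrr normr0 !mul0r; split.
  split; try by rewrite normrX lerXn2r ?nnegrE.
  rewrite (exprS (x i)) (exprS (y i)) -(add1n k); apply: (key) => //; rewrite ?expr1 ?mul1r //.
  by apply: le_trans (hd i) _; rewrite ler_peMl.
rewrite mdegE.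
suff : [/\ `|\prod_i x i ^+ m i| <= M ^+ (\sum_i m i), `|\prod_i y i ^+ m i| <= M ^+ (\sum_i m i) &
  `|\prod_i x i ^+ m i - \prod_i y i ^+ m i| <= (\sum_i m i)%:R * M ^+ (\sum_i m i) * e] by case.
elim: (index_enum _) => [|i s [h1 h2 h3]].
  by rewrite !big_nil normr1 subrr normr0 expr0 !mul0r.
rewrite !big_cons; have [k1 k2 k3] := pow i (m i); split.
- by rewrite normrM exprD ler_pM.
- by rewrite normrM exprD ler_pM.
- exact: key.
Qed.

Lemma mmap_diff P x y (M e : C) : 1 <= M -> 0 <= e -> (forall i, `|x i| <= M) ->
  (forall i, `|y i| <= M) -> (forall i, `|x i - y i| <= e) ->
  `|mmap iota x P - mmap iota y P| <= mnorm P * ((msize P)%:R * M ^+ msize P * e).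
Proof.
move=> M1 e0 hx hy hd; rewrite /mmap -sumrB.
apply: le_trans (ler_norm_sum _ _ _) _.
rewrite /mnorm mulr_suml big_seq [leRHS]big_seq; apply: ler_sum => m mP.
rewrite -mulrBr normrM; apply: ler_wpM2l => //.
apply: le_trans (monom_diff m M1 e0 hx hy hd) _; apply: ler_wpM2r => //.
have hm := ltnW (msize_mdeg_lt mP).
by apply: ler_pM; rewrite ?ler_nat ?exprn_ge0 ?ler_weXn2l // (le_trans ler01).
Qed.

End Estimates.

(** Bernoulli: t^k (1 + k (1 - t)) <= 1. The Archimedean property is a hypothesis because the field
    is an arbitrary [numClosedFieldType]. *)
Lemma pow_small (C : numClosedFieldType) (arch : forall x : C, exists k : nat, `|x| <= k%:R)
  (t e : C) : 0 <= t -> t < 1 -> 0 < e -> exists k, t ^+ k <= e.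
Proof.
move=> t0 t1 e0; pose s := 1 - t; have s0 : 0 < s by rewrite subr_gt0.
have key k : t ^+ k * (1 + k%:R * s) <= 1.
  elim: k => [|k IH]; first by rewrite expr0 mul0r addr0 mul1r.
  apply: le_trans IH; rewrite exprSr -mulrA; apply: ler_wpM2l; first exact: exprn_ge0.
  rewrite -subr_ge0 (_ : _ - _ = k.+1%:R * s ^+ 2).
    by rewrite mulr_ge0 // exprn_ge0 // ltW.
  by rewrite /s -natr1; ring.
have [k hk] := arch (e * s)^-1; exists k.
have es : 0 < e * s by rewrite mulr_gt0.
have h : 1 <= k%:R * s * e.
  rewrite -mulrA (mulrC s) -ler_pdivrMr // div1r.
  by apply: le_trans hk; rewrite ger0_norm // invr_ge0 ltW.
apply: (@le_trans _ _ (t ^+ k * (k%:R * s * e))); first by rewrite ler_peMr // exprn_ge0.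
rewrite !mulrA -[leRHS]mul1r ler_pM2r //; apply: le_trans (key k).
by rewrite -mulrA; apply: ler_wpM2l; [exact: exprn_ge0|apply: ler_wpDl].
Qed.

Section Main.
Variables (C : numClosedFieldType) (B : set C) (rho T : nat).
Local Notation K := (FG B).
Local Notation n := (rho + T)%N.
Variables (blk : 'I_T -> 'I_rho) (F : 'I_T -> powser K) (Z : pred 'I_rho) (z0 : 'I_rho).
Variables (X : nat -> 'I_rho -> C) (w : nat -> 'I_T -> C) (theta : C).
Hypothesis arch : forall x : C, exists k : nat, `|x| <= k%:R.
Hypothesis liou : exists C2 : nat, (0 < C2)%N /\ forall (P : mpoly rho K) delta,
    (forall m, m \in msupp P -> (mdeg m <= delta)%N) ->
    exists c : C, 0 < c /\ forall k, mmap val (X k) P != 0 ->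
      1 <= c * C2%:R ^+ (delta * 2 ^ k) * `|mmap val (X k) P|.
Hypothesis Xn : exists c C0 : C,
    [/\ 1 <= c, 1 <= C0 & forall k i, `|X k i| <= c * C0 ^+ (2 ^ k)].
Hypothesis theta01 : 0 < theta < 1.
Hypothesis Zz0 : Z z0.
Hypothesis XZ : forall k i, Z i -> `|X k i| <= theta ^+ (2 ^ k).
Hypothesis blkZ : forall j, Z (blk j).
Hypothesis wN : forall N, exists2 c : C, 0 <= c & forall k j,
  `|w k j - (map_poly val (\poly_(l < N) pcoef (F j) l)).[X k (blk j)]| <=
    c * theta ^+ (N * 2 ^ k).
Hypothesis blockfree : forall i (Q : mpoly n K),
  (forall m, m \in msupp Q -> forall v, bl blk v != i -> m v = 0%N) ->
  mmap (@psc K) (bser F) Q = 0 -> Q = 0.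
Variables (U : set_system nat) (UU : UltraFilter U).
Hypothesis Uoo : forall N, U [set k | (N <= k)%N].
Hypothesis Unv : forall P : mpoly rho K, P != 0 -> U [set k | mmap val (X k) P != 0].

Definition point k (v : 'I_n) : C := match fintype.split v with inl i => X k i | inr j => w k j end.

Lemma truncated_eval N k (FF : mpoly n K) : mmap val (X k) (truncated blk F FF N) =
  mmap val (fun v => (map_poly val (tser F N v)).[X k (bl blk v)]) FF.
Proof.
rewrite /truncated [X in mmap val _ X]/mmap rmorph_sum [RHS]/mmap; apply: eq_bigr => m _ /=.
rewrite rmorphM /= mmapC; congr (_ * _); rewrite rmorph_prod; apply: eq_bigr => v _.
rewrite rmorphXn; congr (_ ^+ _) => /=.
rewrite /horner_eval; set p := tser F N v; rewrite (@horner_coef_wide _ (size p)); last exact: size_poly.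
rewrite rmorph_sum (@horner_coef_wide _ (size p)); last exact: size_poly.
apply: eq_bigr => l _; rewrite !coef_map rmorphM /= mmapC rmorphXn /= mmapX; congr (_ * _ ^+ _).
rewrite /mmap1 (bigD1 (bl blk v)) //= mnm1E eqxx expr1 big1 ?mulr1 // => i ni.
by rewrite mnm1E eq_sym (negPf ni) expr0.
Qed.

(** Suppose FF vanishes at the points for U-almost all k, and write P = G H + R as in
    [auxiliary_polynomial]. R is small by its order in the variables of [Z], and H because it
    differs from FF at the point by tails of the series. Up to constants |P(X_k)| is at most
    theta^(N 2^k) C0^(E 2^k), against the lower bound C2^(-delta 2^k) with delta = rho (d2 + d'). *)
Theorem algebraic_independence_lift (FF : mpoly n K) : FF != 0 ->
  U [set k | mmap val (point k) FF != 0].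
Proof.
move=> FF0; have UP : ProperFilter U := @ultra_proper _ _ UU.
have [//|hU] := in_ultra_setVsetC [set k | mmap val (point k) FF != 0] UU.
have [A0 hA0] := truncated_low blockfree FF0; pose A := maxn A0 (msize FF).
have [C2 [C20 liou2]] := liou; have [c [C0 [c1 C01 hX]]] := Xn.
have [t0 t1] := andP theta01; pose D := msize FF.
have C21 : 1 <= C2%:R :> C by rewrite ler1n.
have half0 : 0 < 2%:R^-1 :> C by rewrite invr_gt0 ltr0n.
have half1 : 2%:R^-1 < 1 :> C by rewrite invf_lt1 ?ltr0n // ltr1n.
(* [Lam] is the ratio of the order N to the degree d2. It makes the gain theta^(Lam d2) beat the
   Liouville loss C2^(rho d2) by a factor 2^d2. *)
have [Lam' hLam'] : exists k, theta ^+ k <= (2%:R * C2%:R ^+ rho)^-1.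
  apply: pow_small => //; try exact: ltW.
  by rewrite invr_gt0 mulr_gt0 ?ltr0n // exprn_gt0 // ltr0n.
pose Lam := Lam'.+1.
have hLam : theta ^+ Lam * C2%:R ^+ rho <= 2%:R^-1.
  have e0 : 0 < C2%:R ^+ rho :> C by rewrite exprn_gt0 // ltr0n.
  rewrite -ler_pdivlMr // -invfM; apply: le_trans hLam'.
  by rewrite exprS ler_piMl ?exprn_ge0 // ltW.
(* The degree in the variables outside [Z]. The proportion rho A / d' of unknowns lost for G, by
   [bernoulli_prod], must stay below the proportion of unknowns gained for P, which is at least
   Lam^(-rho). This choice does not involve d2. *)
pose d' := (rho * A * Lam ^ rho + A + 1)%N.
pose E := (rho * d' + D)%N.
pose b0 : C := C2%:R ^+ (rho * d') * C0 ^+ E.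
have b01 : 1 <= b0 by rewrite mulr_ege1 // exprn_ege1.
(* Since d' is fixed, b0 is a constant, and a large d2 makes 2^(-d2) b0 at most 1/2. *)
have [d2' hd2'] : exists k, 2%:R^-1 ^+ k <= (2%:R * b0)^-1 :> C.
  apply: pow_small => //; try exact: ltW.
  by rewrite invr_gt0 mulr_gt0 ?ltr0n // (lt_le_trans ltr01).
pose d2 := (d2' + d')%N; pose N := (Lam * d2)%N.
have hd2 : (2%:R^-1 ^+ d2 : C) * b0 <= 2%:R^-1.
  have e0 : 0 < b0 by rewrite (lt_le_trans ltr01).
  rewrite -ler_pdivlMr // -invfM; apply: le_trans hd2'.
  by apply: ler_wiXn2l; [exact: ltW|exact: ltW|exact: leq_addr].
have d'0 : (0 < d')%N by rewrite /d' addn1.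
have Nd : (d' <= N)%N by rewrite /N mulSn -addnA; apply: leq_trans (leq_addl _ _); apply: leq_addr.
have AD : (A <= d')%N by rewrite /d' addn1 leqW // leq_addl.
have NA : (A0 <= N)%N by apply: leq_trans (leq_trans AD Nd); exact: leq_maxl.
have [a aH aA] := hA0 N NA.
pose d i := if Z i then d2 else d'; pose b i := if Z i then N else d'.
have count : (\prod_i b i < \prod_i d i + \prod_i (b i - A))%N.
  rewrite ltnNge; apply/negP => h.
  have hb i : (d' <= b i)%N by rewrite /b; case: (Z i).
  have := bernoulli_prod (enum 'I_rho) AD hb; rewrite size_enum_ord !big_enum /= => bern.
  have bd : (\prod_i b i <= Lam ^ rho * \prod_i d i)%N.
    rewrite -[X in (Lam ^ X)%N]card_ord -prod_nat_const -big_split; apply: leq_prod => i _.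
    by rewrite /b /d; case: (Z i) => //; rewrite /= leq_pmull.
  have d0 : (0 < \prod_i d i)%N.
    by apply: prodn_gt0 => i; rewrite /d; case: (Z i) => //; rewrite addn_gt0 d'0 orbT.
  have := leq_mul (leqnn d') h.
  have := leq_mul (leqnn (rho * A)%N) bd.
  move: bern bd d0; set p1 := (\prod_i b i)%N; set p2 := (\prod_i d i)%N; set p3 := (\prod_i _)%N.
  rewrite /d'; set L := (Lam ^ rho)%N; clear; nia.
have [P [G [P0 Pd Gd PG]]] := auxiliary_polynomial aH (leq_trans aA (leq_maxl _ _ : A0 <= A)%N) count.
set H := truncated blk F FF N in aH PG.
have Hy i m : m \in msupp H -> ~~ Z i -> (m i <= A)%N.
  move=> hm nZ; apply: leq_trans (leq_maxr _ _); apply: truncated_deg hm => j.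
  by apply: contraNneq nZ => <-.
have Hyd i m : m \in msupp P \/ m \in msupp (G * H) -> ~~ Z i -> (m i < d')%N.
  case=> [/Pd/(_ i)|/msuppM_le/allpairsP [[g h] [/= hg hh ->]] nZ].
    by rewrite /d; case: (Z i).
  have := Gd _ hg i; rewrite /b (negPf nZ) mnmDE; apply: leq_ltn_trans.
  by rewrite leq_add2l; apply: Hy.
pose R := P - G * H.
(* A monomial of R lies outside the box b but respects its bounds for the variables outside [Z]; the
   excess is therefore in a variable of [Z], where the bound is N. *)
have Rsupp m : m \in msupp R -> (exists2 i, Z i & (N <= m i)%N) /\ forall i, ~~ Z i -> (m i <= d')%N.
  move=> mR; have mPG : m \in msupp P \/ m \in msupp (G * H).
    have := msuppB_le mR; rewrite mem_cat => /orP[]; [by left|by right].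
  split=> [|i nZ]; last exact/ltnW/Hyd.
  apply: contrapT => nex; move: mR; rewrite mcoeff_msupp PG ?eqxx // => i.
  rewrite /b; case: ifP => Zi; last by apply: Hyd => //; rewrite Zi.
  by rewrite ltnNge; apply/negP => hi; case: nex; exists i.
have [cN cN0 hcN] := wN N; have [cw cw0 hcw] := wN 0.
pose c' := c + cw + cN.
have c'1 : 1 <= c' by rewrite /c' -addrA ler_wpDr // addr_ge0.
have Pdeg m : m \in msupp P -> (mdeg m <= rho * (d2 + d'))%N.
  move=> /Pd hm; rewrite mdegE -[X in (X * _)%N]card_ord -sum_nat_const; apply: leq_sum => i _.
  by apply: leq_trans (ltnW (hm i)) _; rewrite /d; case: (Z i); rewrite ?leq_addr ?leq_addl.
have [cP [cP0 hP]] := liou2 P _ Pdeg.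
pose M k := c' * C0 ^+ (2 ^ k); pose tau k := theta ^+ (2 ^ k).
have M1 k : 1 <= M k by rewrite mulr_ege1 // exprn_ege1.
have M0 k : 0 <= M k by exact: le_trans ler01 (M1 k).
have tau01 k : 0 <= tau k <= 1 by rewrite exprn_ge0 ?exprn_ile1 // ltW.
have XM k i : `|X k i| <= M k.
  apply: le_trans (hX k i) _; apply: ler_wpM2r; first by rewrite exprn_ge0 // (le_trans ler01).
  by rewrite /c' -addrA lerDl addr_ge0.
pose ptN k v := (map_poly val (tser F N v)).[X k (bl blk v)].
have e0 k : 0 <= cN * tau k ^+ N by rewrite mulr_ge0 // exprn_ge0 //; case/andP: (tau01 k).
have diff k v : [/\ `|point k v| <= M k, `|ptN k v| <= M k & `|ptN k v - point k v| <= cN * tau k ^+ N].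
  have MM k' : c' <= M k' by rewrite ler_peMr ?exprn_ege1 // (le_trans ler01).
  have tN1 : tau k ^+ N <= 1 by case/andP: (tau01 k) => ? ?; rewrite exprn_ile1.
  rewrite /point /ptN /tser /bl; case: (fintype.split v) => [i|j].
    by rewrite map_polyX hornerX subrr normr0.
  have h0 := hcw k j; rewrite poly_def big_ord0 rmorph0 horner0 subr0 mul0n expr0 mulr1 in h0.
  have h1 := hcN k j; rewrite mulnC exprM -/(tau k) in h1.
  split; last by rewrite distrC.
    by apply: le_trans h0 _; apply: le_trans (MM k); rewrite /c' addrAC lerDr addr_ge0 // (le_trans ler01).
  apply: le_trans (MM k); set p := _.[_] in h1 *.
  rewrite (_ : p = w k j - (w k j - p)); last by ring.
  apply: le_trans (ler_normB _ _) _; rewrite /c'.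
  have -> : c + cw + cN = c + (cw + cN) by ring.
  apply: ler_wpDl; first exact: le_trans ler01 c1.
  by apply: lerD => //; apply: le_trans h1 _; rewrite ler_piMr.
pose c2 := mnorm val R + mnorm val G * (mnorm val FF * (D%:R * cN)).
have c20 : 0 <= c2.
  by rewrite addr_ge0 ?mulr_ge0 ?mnorm_ge0.
have upper k : mmap val (point k) FF = 0 ->
    `|mmap val (X k) P| <= c2 * (tau k ^+ N * M k ^+ E).
  move=> FFk; have tN0 : 0 <= tau k ^+ N by case/andP: (tau01 k) => ? _; exact: exprn_ge0.
  have XZ' i : Z i -> `|X k i| <= tau k by exact: XZ.
  have hR : `|mmap val (X k) R| <= mnorm val R * (tau k ^+ N * M k ^+ (rho * d')).
    apply: mmap_norm => m /Rsupp [[i Zi hi] hy].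
    exact: monom_box_norm (M1 k) (XM k) (tau01 k) XZ' hy Zi hi.
  have hG : `|mmap val (X k) G| <= mnorm val G * M k ^+ (rho * d').
    apply: mmap_norm => m mG; rewrite -[leRHS]mul1r -(expr0 (tau k)).
    apply: (monom_box_norm (M1 k) (XM k) (tau01 k) XZ' _ Zz0 (leq0n _)) => i nZ.
    have := Gd _ mG i; rewrite /b (negPf nZ) => h; apply: ltnW; apply: leq_ltn_trans h; exact: leq_addr.
  (* As FF is 0 at the point, the value of H is the difference of FF at the truncated series and at
     the full ones. *)
  have hH : `|mmap val (X k) H| <= mnorm val FF * (D%:R * M k ^+ D * (cN * tau k ^+ N)).
    rewrite truncated_eval -[X in `|X|]subr0 -FFk.
    apply: (mmap_diff _ _ (M1 k) (e0 k)) => v; by have [] := diff k v.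
  have -> : P = R + G * H by rewrite /R subrK.
  rewrite rmorphD rmorphM /=; apply: le_trans (ler_normD _ _) _; rewrite normrM.
  apply: (@le_trans _ _ (mnorm val R * (tau k ^+ N * M k ^+ E) + (mnorm val G * M k ^+ (rho * d')) *
     (mnorm val FF * (D%:R * M k ^+ D * (cN * tau k ^+ N))))).
    apply: lerD; last exact: ler_pM.
    apply: le_trans hR _; apply: ler_wpM2l; first exact: mnorm_ge0.
    by apply: ler_wpM2l => //; apply: ler_weXn2l => //; exact: leq_addr.
  rewrite le_eqVlt; apply/orP; left; apply/eqP; rewrite /c2 /E exprD.
  move: (mnorm val R) (mnorm val G) (mnorm val FF) (D%:R : C) (M k ^+ (rho * d')) (M k ^+ D) (tau k ^+ N).
  by clear=> r g f x y u t; ring.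
have conv k : cP * C2%:R ^+ (rho * (d2 + d') * 2 ^ k) * (c2 * (tau k ^+ N * M k ^+ E)) <=
    cP * c2 * c' ^+ E * 2%:R^-1 ^+ k.
  pose eta : C := C2%:R ^+ (rho * (d2 + d')) * theta ^+ N * C0 ^+ E.
  have eta0 : 0 <= eta by rewrite !mulr_ge0 ?exprn_ge0 ?ltW // (lt_le_trans ltr01).
  have etah : eta <= 2%:R^-1.
    apply: le_trans hd2.
    rewrite (_ : eta = (theta ^+ Lam * C2%:R ^+ rho) ^+ d2 * b0).
      apply: ler_wpM2r; first exact: le_trans ler01 b01.
      apply: lerXn2r => //; rewrite nnegrE ?(ltW half0) // mulr_ge0 //.
      by rewrite exprn_ge0 // ltW.
    rewrite /eta /b0 /N exprMn -!exprM mulnDr exprD.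
    move: (C2%:R ^+ (rho * d2)) (C2%:R ^+ (rho * d')) (theta ^+ _) (C0 ^+ _).
    by clear=> r g f x; ring.
  rewrite (_ : _ * _ = cP * c2 * c' ^+ E * eta ^+ (2 ^ k)).
    apply: ler_wpM2l; first by rewrite !mulr_ge0 ?exprn_ge0 ?(ltW cP0) // (le_trans ler01).
    apply: (@le_trans _ _ (2%:R^-1 ^+ (2 ^ k))); first by apply: lerXn2r => //; rewrite nnegrE // ltW.
    by apply: ler_wiXn2l; [exact: ltW|exact: ltW|apply: ltnW; exact: ltn_expl].
  rewrite /eta /M /tau !exprMn -!exprM (mulnC (2 ^ k)%N N) (mulnC (2 ^ k)%N E).
  move: (C2%:R ^+ _) (theta ^+ _) (C0 ^+ _) (c' ^+ _).
  by clear=> r g f x; ring.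
pose c3 := cP * c2 * c' ^+ E.
have c30 : 0 <= c3 by rewrite !mulr_ge0 ?exprn_ge0 ?(ltW cP0) // (le_trans ler01).
have [k1 hk1] : exists k, 2%:R^-1 ^+ k <= (c3 + 1)^-1.
  by apply: pow_small => //; try exact: ltW; rewrite invr_gt0 ltr_wpDl.
have UI (A1 A2 : set nat) : U A1 -> U A2 -> U (A1 `&` A2) by move=> h1 h2; apply: filterI.
have [k [[/= hk /negP/negPn/eqP FFk] Pk]] := filter_ex (UI _ _ (UI _ _ (Uoo k1) hU) (Unv P0)).
have := hP k Pk => h; suff : (1 : C) < 1 by rewrite ltxx.
apply: (le_lt_trans h).
apply: (@le_lt_trans _ _ (c3 * 2%:R^-1 ^+ k)).
  apply: le_trans (conv k); apply: ler_wpM2l; last exact: upper.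
  by rewrite mulr_ge0 ?exprn_ge0 ?(ltW cP0).
apply: (@le_lt_trans _ _ (c3 * (c3 + 1)^-1)).
  apply: ler_wpM2l => //; apply: le_trans hk1; apply: ler_wiXn2l => //; exact: ltW.
by rewrite ltr_pdivrMr ?mul1r ?ltrDl // ltr_wpDl.
Qed.

End Main.

(** * Complex differentiability *)

Section ComplexDifferentiability.
Variable C : numClosedFieldType.
Implicit Types (f g : C -> C) (z w : C).

(** Differentiability by a linear approximation without division. Norms and bounds are elements of
    [C] itself. *)
Definition cdiff f z := exists D, forall e, 0 < e -> exists2 d, 0 < d &
  forall w, `|w - z| < d -> `|f w - f z - D * (w - z)| <= e * `|w - z|.

Lemma cdiff_cst c z : cdiff (fun _ => c) z.
Proof.
exists 0 => e e0; exists 1 => // w _.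
by rewrite subrr mul0r subr0 normr0 mulr_ge0 // ltW.
Qed.

Lemma cdiff_id z : cdiff id z.
Proof.
exists 1 => e e0; exists 1 => // w _.
by rewrite mul1r subrr normr0 mulr_ge0 // ltW.
Qed.

(** The order of [C] is partial, but positive elements are real and hence comparable. *)
Lemma cmin (x y : C) : 0 < x -> 0 < y -> exists2 d, 0 < d & d <= x /\ d <= y.
Proof.
move=> x0 y0; have [h|h] := boolP (x <= y); first by exists x.
exists y => //; split=> //; move: h; rewrite real_leNgt ?gtr0_real // negbK.
exact: ltW.
Qed.

Lemma cdiff_lip f z : cdiff f z -> exists M d, [/\ 0 < M, 0 < d &
  forall w, `|w - z| < d -> `|f w - f z| <= M * `|w - z|].
Proof.
move=> [D /(_ 1 ltr01) [d d0 h]]; exists (1 + `|D|), d; split=> // w hw.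
rewrite (_ : f w - f z = (f w - f z - D * (w - z)) + D * (w - z)); last by ring.
apply: le_trans (ler_normD _ _) _; rewrite normrM mulrDl; apply: lerD => //.
exact: h.
Qed.

Lemma cdiff_ext f g z : cdiff f z -> (exists2 d, 0 < d & forall w, `|w - z| < d -> g w = f w) ->
  cdiff g z.
Proof.
move=> [D h] [d1 d10 fg]; exists D => e e0; have [d2 d20 h2] := h e e0.
have [d d0 [dd1 dd2]] := cmin d10 d20; exists d => // w hw.
rewrite !fg ?subrr ?normr0 //; last exact: lt_le_trans hw dd1.
by apply: h2; exact: lt_le_trans hw dd2.
Qed.

Lemma cdiffD f g z : cdiff f z -> cdiff g z -> cdiff (fun w => f w + g w) z.
Proof.
move=> [D hf] [E hg]; exists (D + E) => e e0; have e2 : 0 < e / 2%:R by rewrite divr_gt0 ?ltr0n.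
have [d1 d10 h1] := hf _ e2; have [d2 d20 h2] := hg _ e2.
have [d d0 [dd1 dd2]] := cmin d10 d20; exists d => // w hw.
rewrite (_ : _ - _ = (f w - f z - D * (w - z)) + (g w - g z - E * (w - z))); last by ring.
apply: le_trans (ler_normD _ _) _; rewrite [e](splitr e) mulrDl; apply: lerD.
  by apply: h1; exact: lt_le_trans hw dd1.
by apply: h2; exact: lt_le_trans hw dd2.
Qed.

Lemma cdiffM f g z : cdiff f z -> cdiff g z -> cdiff (fun w => f w * g w) z.
Proof.
move=> cf cg; have [M [d3 [M0 d30 hM]]] := cdiff_lip cf.
have [N [d4 [N0 d40 hN]]] := cdiff_lip cg.
case: cf cg => [D hf] [E hg]; exists (D * g z + f z * E) => e e0.
pose k := (3%:R * (1 + `|f z| + `|g z|)).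
have k0 : 0 < k by rewrite mulr_gt0 ?ltr0n // !ltr_wpDr.
have ek : 0 < e / k by rewrite divr_gt0.
have [d1 d10 h1] := hf _ ek; have [d2 d20 h2] := hg _ ek.
have ek2 : 0 < e / (3%:R * (M * N)) by rewrite divr_gt0 // mulr_gt0 ?ltr0n // mulr_gt0.
have [d5 d50 [dd1 dd2]] := cmin d10 d20; have [d6 d60 [dd3 dd4]] := cmin d30 d40.
have [d7 d70 [dd5 dd6]] := cmin d50 d60; have [d d0 [dd7 dd8]] := cmin d70 ek2.
exists d => // w hw; have hw7 := lt_le_trans hw dd7.
have {}h1 := h1 w (lt_le_trans (lt_le_trans hw7 dd5) dd1).
have {}h2 := h2 w (lt_le_trans (lt_le_trans hw7 dd5) dd2).
have {}hM := hM w (lt_le_trans (lt_le_trans hw7 dd6) dd3).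
have {}hN := hN w (lt_le_trans (lt_le_trans hw7 dd6) dd4).
rewrite (_ : _ - _ = (f w - f z - D * (w - z)) * g z + f z * (g w - g z - E * (w - z)) +
   (f w - f z) * (g w - g z)); last by ring.
apply: le_trans (ler_normD _ _) _; rewrite (_ : e * `|w - z| = (e / 3%:R) * `|w - z| +
  (e / 3%:R) * `|w - z| + e / 3%:R * `|w - z|); last by field.
apply: lerD.
  have hk (x : C) : `|x| <= 1 + `|f z| + `|g z| -> e / k * `|w - z| * `|x| <= e / 3%:R * `|w - z|.
    move=> hx; rewrite mulrAC; apply: ler_wpM2r => //.
    rewrite (_ : e / k * `|x| = e / 3%:R * (`|x| / (1 + `|f z| + `|g z|))); last first.
      by rewrite /k invfM !mulrA mulrAC.
    rewrite -[leRHS]mulr1; apply: ler_wpM2l; first by rewrite divr_ge0 ?ler0n // ltW.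
    by rewrite ler_pdivrMr ?mul1r // !ltr_wpDr.
  apply: le_trans (ler_normD _ _) _; rewrite !normrM (mulrC `|f z|); apply: lerD.
    apply: le_trans (hk (g z) _); first by apply: ler_wpM2r.
    by rewrite lerDr addr_ge0.
  apply: le_trans (hk (f z) _); first by apply: ler_wpM2r.
  by rewrite addrAC lerDr addr_ge0.
rewrite normrM; apply: (@le_trans _ _ ((M * `|w - z|) * (N * `|w - z|))); first exact: ler_pM.
rewrite mulrACA mulrA; apply: ler_wpM2r => //.
have := ltW (lt_le_trans hw dd8); rewrite ler_pdivlMr ?mulr_gt0 ?ltr0n // => h.
by rewrite ler_pdivlMr ?ltr0n // (le_trans _ h) // le_eqVlt (_ : _ == _) //; apply/eqP; ring.
Qed.

Lemma cdiffV f z : f z != 0 -> cdiff f z -> cdiff (fun w => (f w)^-1) z.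
Proof.
move=> fz0 cf; have [M [d3 [M0 d30 hM]]] := cdiff_lip cf; have nf : 0 < `|f z| by rewrite normr_gt0.
case: cf => [D hf]; exists (- D / f z ^+ 2) => e e0; set a := f z in fz0 nf hM hf *.
have [|d1 d10 h1] := hf (e * `|a| ^+ 2 / 4%:R).
  by rewrite divr_gt0 ?ltr0n // mulr_gt0 // exprn_gt0.
have D0 : 0 < `|D| + 1 by rewrite ltr_wpDl.
have k1 : 0 < `|a| / (2%:R * M) by rewrite divr_gt0 // mulr_gt0 ?ltr0n.
have k2 : 0 < e * `|a| ^+ 3 / (4%:R * (`|D| + 1) * M).
  by rewrite divr_gt0 ?mulr_gt0 ?ltr0n // exprn_gt0.
have [d4 d40 [dd1 dd2]] := cmin d10 d30; have [d5 d50 [dd3 dd4]] := cmin k1 k2.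
have [d d0 [dd5 dd6]] := cmin d40 d50; exists d => // w hw.
have {}h1 := h1 w (lt_le_trans (lt_le_trans hw dd5) dd1).
have {}hM := hM w (lt_le_trans (lt_le_trans hw dd5) dd2).
have hw1 := ltW (lt_le_trans (lt_le_trans hw dd6) dd3).
have hw2 := ltW (lt_le_trans (lt_le_trans hw dd6) dd4).
set h := w - z in h1 hM hw1 hw2 *; set b := f w in h1 hM *.
have hb : `|a| / 2%:R <= `|b|.
  have : `|a| <= `|b| + `|b - a|.
    by rewrite [X in `|X| <= _](_ : a = b - (b - a)); [exact: ler_normB|ring].
  have : `|b - a| <= `|a| / 2%:R.
    apply: le_trans hM _; rewrite mulrC -ler_pdivlMr //; apply: le_trans hw1 _.
    by rewrite invfM mulrA.
  move=> u1 u2; rewrite -(lerD2r `|b - a|); apply: le_trans u2; rewrite [leRHS](splitr `|a|) lerD2l.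
  exact: u1.
have b0 : b != 0.
  by rewrite -normr_gt0; apply: lt_le_trans hb; rewrite divr_gt0 ?ltr0n.
have -> : b^-1 - a^-1 - - D / a ^+ 2 * h = (- a * (b - a - D * h) + D * h * (b - a)) / (a ^+ 2 * b).
  by field; rewrite fz0 b0.
rewrite normrM normfV ler_pdivrMr ?normr_gt0 ?mulf_neq0 ?expf_neq0 //.
apply: (@le_trans _ _ (e * `|h| * (`|a| ^+ 2 * (`|a| / 2%:R)))); last first.
  rewrite normrM normrX; apply: ler_wpM2l; first by rewrite mulr_ge0 // ltW.
  by apply: ler_wpM2l => //; rewrite exprn_ge0.
apply: le_trans (ler_normD _ _) _; rewrite normrM normrN !normrM.
have -> : e * `|h| * (`|a| ^+ 2 * (`|a| / 2%:R)) =
    `|a| * (e * `|a| ^+ 2 / 4%:R * `|h|) + (e * `|a| ^+ 3 / 4%:R) * `|h| by field.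
apply: lerD; first exact: ler_wpM2l.
apply: (@le_trans _ _ ((`|D| + 1) * `|h| * (M * `|h|))).
  by apply: ler_pM => //; apply: ler_wpM2r => //; rewrite lerDl.
rewrite mulrA; apply: ler_wpM2r => //.
move: hw2; rewrite ler_pdivlMr ?mulr_gt0 ?ltr0n // => hw2.
rewrite ler_pdivlMr ?ltr0n //; apply: le_trans hw2.
by rewrite le_eqVlt; apply/orP; left; apply/eqP; ring.
Qed.

Lemma cdiff_subV a z : z != a -> cdiff (fun w => (w - a)^-1) z.
Proof.
move=> za; apply: (@cdiffV (fun w => w - a)); first by rewrite subr_eq0.
exact: cdiffD (cdiff_id z) (cdiff_cst (- a) z).
Qed.

Lemma cdiff_sum (I : Type) (s : seq I) (F : I -> C -> C) z :
  (forall i, cdiff (F i) z) -> cdiff (fun w => \sum_(i <- s) F i w) z.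
Proof.
move=> h; elim: s => [|i s IH].
  by apply: cdiff_ext (cdiff_cst 0 z) _; exists 1 => // w _; rewrite big_nil.
by apply: cdiff_ext (cdiffD (h i) IH) _; exists 1 => // w _; rewrite big_cons.
Qed.

Lemma cdiffX f z k : cdiff f z -> cdiff (fun w => f w ^+ k) z.
Proof.
move=> h; elim: k => [|k IH].
  by apply: cdiff_ext (cdiff_cst 1 z) _; exists 1.
by apply: cdiff_ext (cdiffM h IH) _; exists 1 => // w _; rewrite exprS.
Qed.

Lemma cdiff_horner (p : {poly C}) z : cdiff (horner p) z.
Proof.
apply: (@cdiff_ext (fun w => \sum_(i < size p) p`_i * w ^+ i)).
  by apply: cdiff_sum => i; apply: cdiffM (cdiff_cst _ _) (cdiffX _ (cdiff_id _)).
by exists 1 => // w _; rewrite horner_coef.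
Qed.

End ComplexDifferentiability.

(** * Contour sums over squares, Cauchy's estimate and the identity principle *)

Section DiscreteIntegral.
Variable C : numClosedFieldType.
Implicit Types (f g : C -> C) (z w d s : C) (m : nat).

(* Trapezoidal sum over the segment from z to z + d, in 3 ^ m equal steps. *)
Definition edge f m z d :=
  \sum_(k < 3 ^ m) (f (z + k%:R * (d / (3 ^ m)%:R)) + f (z + k.+1%:R * (d / (3 ^ m)%:R))) / 2%:R *
     (d / (3 ^ m)%:R).

(** The boundary of a square, counterclockwise. No integral is formed: all statements concern these
    sums, at any level m or at all large ones. *)
Definition loop f m z s :=
  edge f m z s + edge f m (z + s) ('i * s) - edge f m (z + 'i * s) s - edge f m z ('i * s).

Lemma pow3_neq0 m : (3 ^ m)%:R != 0 :> C.
Proof. by rewrite pnatr_eq0 expn_eq0. Qed.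

Lemma edge_split f m z d : edge f m.+1 z d = \sum_(a < 3) edge f m (z + a%:R * (d / 3%:R)) (d / 3%:R).
Proof.
have h3 := pow3_neq0 m; have t3 : 3%:R != 0 :> C by rewrite pnatr_eq0.
rewrite /edge; set h := d / (3 ^ m.+1)%:R.
have hE : d / 3%:R / (3 ^ m)%:R = h by rewrite /h expnS natrM invfM mulrA.
rewrite hE -(big_mkord xpredT (fun k => (f (z + k%:R * h) + f (z + k.+1%:R * h)) / 2%:R * h)) expnS.
rewrite big_nat_mul big_mkord; apply: eq_bigr => a _.
rewrite -{1}[(a * 3 ^ m)%N]add0n big_addn mulSn addnK big_mkord; apply: eq_bigr => k _.
have E j : z + (j + a * 3 ^ m)%:R * h = z + a%:R * (d / 3%:R) + j%:R * h.
  by rewrite natrD natrM -hE; field; rewrite ?h3.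
by rewrite -addSn !E.
Qed.

Lemma edgeD f g m z d : edge (fun x => f x + g x) m z d = edge f m z d + edge g m z d.
Proof. by rewrite /edge -big_split; apply: eq_bigr => k _ /=; ring. Qed.

Lemma edgeZ c f m z d : edge (fun x => c * f x) m z d = c * edge f m z d.
Proof. by rewrite /edge mulr_sumr; apply: eq_bigr => k _ /=; ring. Qed.

Lemma loopD f g m z s : loop (fun x => f x + g x) m z s = loop f m z s + loop g m z s.
Proof. by rewrite /loop !edgeD; ring. Qed.

Lemma loopZ c f m z s : loop (fun x => c * f x) m z s = c * loop f m z s.
Proof. by rewrite /loop !edgeZ; ring. Qed.

(** The inner sides cancel exactly, at the cost of one level of subdivision. Division into three
    parts, not two, keeps the centre of the square inside the middle part, as [cauchy_estimate]
    requires. *)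
Lemma loop_split f m z s : loop f m.+1 z s =
  \sum_(a < 3) \sum_(b < 3) loop f m (z + (a%:R + 'i * b%:R) * (s / 3%:R)) (s / 3%:R).
Proof.
pose t := s / 3%:R; have t3 : 3%:R != 0 :> C by rewrite pnatr_eq0.
have sE : s = 3%:R * t by rewrite /t; field.
pose H a b := edge f m (z + (a%:R + 'i * b%:R) * t) t.
pose V a b := edge f m (z + (a%:R + 'i * b%:R) * t) ('i * t).
have -> : \sum_(a < 3) \sum_(b < 3) loop f m (z + (a%:R + 'i * b%:R) * (s / 3%:R)) (s / 3%:R) =
    \sum_(a < 3) \sum_(b < 3) (H a b - H a b.+1) + \sum_(b < 3) \sum_(a < 3) (V a.+1 b - V a b).
  rewrite [X in _ = _ + X]exchange_big -big_split; apply: eq_bigr => a _ /=.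
  rewrite -big_split; apply: eq_bigr => b _ /=; rewrite /loop -/t /H /V.
  rewrite (_ : z + (a%:R + 'i * b%:R) * t + t = z + (a.+1%:R + 'i * b%:R) * t); last by rewrite -natr1; ring.
  rewrite (_ : z + (a%:R + 'i * b%:R) * t + 'i * t = z + (a%:R + 'i * b.+1%:R) * t).
    ring.
  by rewrite -[b.+1%:R]natr1; ring.
have eE p d d' : d / 3%:R = d' -> edge f m.+1 p d = \sum_(a < 3) edge f m (p + a%:R * d') d'.
  by move=> <-; exact: edge_split.
have id3 : 'i * s / 3%:R = 'i * t by rewrite /t mulrA.
rewrite /loop (eE z s t) // (eE (z + s) _ _ id3) (eE (z + 'i * s) s t) // (eE z _ _ id3).
have telH a : \sum_(b < 3) (H a b - H a b.+1) = H a 0%N - H a 3%N.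
  by rewrite !big_ord_recl big_ord0 /=; ring.
have telV b : \sum_(a < 3) (V a.+1 b - V a b) = V 3%N b - V 0%N b.
  by rewrite !big_ord_recl big_ord0 /=; ring.
under [X in _ = X + _]eq_bigr => a _ do rewrite telH.
under [X in _ = _ + X]eq_bigr => b _ do rewrite telV.
rewrite !sumrB.
have hH a : H a 0%N = edge f m (z + a%:R * t) t by rewrite /H mulr0 addr0.
have hH3 a : H a 3%N = edge f m (z + 'i * s + a%:R * t) t by rewrite /H sE; congr edge; ring.
have hV b : V 0%N b = edge f m (z + b%:R * ('i * t)) ('i * t) by rewrite /V add0r; congr edge; ring.
have hV3 b : V 3%N b = edge f m (z + s + b%:R * ('i * t)) ('i * t) by rewrite /V sE; congr edge; ring.
under [X in _ = X - _ + _]eq_bigr => a _ do rewrite hH.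
under [X in _ = _ - X + _]eq_bigr => a _ do rewrite hH3.
under [X in _ = _ + (X - _)]eq_bigr => a _ do rewrite hV3.
under [X in _ = _ + (_ - X)]eq_bigr => a _ do rewrite hV.
ring.
Qed.

(** The trapezoidal rule is exact on affine functions. Hence the linear approximation drops out of a
    loop at every level. *)
Lemma edge_affine a b m z d : edge (fun x => a + b * x) m z d =
  (a * (z + d) + b * (z + d) ^+ 2 / 2%:R) - (a * z + b * z ^+ 2 / 2%:R).
Proof.
have h3 := pow3_neq0 m; set h := d / (3 ^ m)%:R; pose G x := a * x + b * x ^+ 2 / 2%:R.
have -> : a * (z + d) + b * (z + d) ^+ 2 / 2%:R = G (z + (3 ^ m)%:R * h).
  by rewrite /h (mulrC (3 ^ m)%:R) divfK.
have -> : a * z + b * z ^+ 2 / 2%:R = G (z + 0%:R * h) by rewrite mul0r addr0.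
rewrite -(telescope_sumr (fun k => G (z + k%:R * h)) (leq0n _)) big_mkord.
apply: eq_bigr => k _; rewrite -/h /G -natr1; by field.
Qed.

Lemma loop_affine a b m z s : loop (fun x => a + b * x) m z s = 0.
Proof. by rewrite /loop !edge_affine; field. Qed.

Lemma edge_bound f m z d (e : C) :
  (forall t, 0 <= t <= 1 -> `|f (z + t * d)| <= e) -> `|edge f m z d| <= e * `|d|.
Proof.
move=> h; have h3 := pow3_neq0 m; have n0 : 0 < (3 ^ m)%:R :> C by rewrite ltr0n expn_gt0.
have hk k : (k <= 3 ^ m)%N -> `|f (z + k%:R * (d / (3 ^ m)%:R))| <= e.
  move=> hk; rewrite mulrCA mulrC; apply: h; rewrite divr_ge0 ?ler0n //=.
  by rewrite ler_pdivrMr // mul1r ler_nat.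
apply: le_trans (ler_norm_sum _ _ _) _.
apply: (@le_trans _ _ (\sum_(k < 3 ^ m) e * (`|d| / (3 ^ m)%:R))).
  apply: ler_sum => k _; rewrite !normrM normfV normr_nat normfV normr_nat.
  apply: ler_wpM2r; first by rewrite divr_ge0 ?ler0n.
  rewrite ler_pdivrMr ?ltr0n //; apply: le_trans (ler_normD _ _) _.
  by rewrite mulr_natr mulr2n; apply: lerD; apply: hk => //; exact: ltnW.
by rewrite sumr_const card_ord -[X in X <= _]mulr_natr -mulrA divfK.
Qed.

Definition insq z s w := 0 <= 'Re (w - z) <= s /\ 0 <= 'Im (w - z) <= s.

Lemma insqP z s (u v : C) : 0 <= s -> 0 <= u <= 1 -> 0 <= v <= 1 -> insq z s (z + (u + 'i * v) * s).
Proof.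
move=> s0 /andP[u0 u1] /andP[v0 v1].
have us : u * s \is Num.real by rewrite ger0_real // mulr_ge0.
have vs : v * s \is Num.real by rewrite ger0_real // mulr_ge0.
rewrite /insq; have -> : z + (u + 'i * v) * s - z = u * s + 'i * (v * s) by ring.
rewrite Re_rect // Im_rect //; by split; rewrite mulr_ge0 //= ler_piMl.
Qed.

Lemma insq_dist z s w w' : insq z s w -> insq z s w' -> `|w - w'| <= 2%:R * s.
Proof.
have key (x y t : C) : 0 <= x <= t -> 0 <= y <= t -> `|x - y| <= t.
  move=> /andP[x0 xt] /andP[y0 yt]; have xr := ger0_real x0; have yr := ger0_real y0.
  rewrite real_ler_norml ?realB // lerBrDl lerBlDr.
  apply/andP; split; first by apply: le_trans yt _; rewrite lerDr.
  by apply: le_trans xt; rewrite gerBl.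
move=> [h1 h2] [h3 h4]; have -> : w - w' = ('Re (w - z) - 'Re (w' - z)) + 'i * ('Im (w - z) - 'Im (w' - z)).
  rewrite (_ : w - w' = (w - z) - (w' - z)); last by ring.
  by rewrite {1}(Crect (w - z)) {1}(Crect (w' - z)); ring.
apply: le_trans (ler_normD _ _) _; rewrite normrM normCi mul1r mulr_natl mulr2n.
by apply: lerD; exact: key.
Qed.

Lemma loop_bound f m z s (e : C) : 0 <= s -> (forall w, insq z s w -> `|f w| <= e) ->
  `|loop f m z s| <= 4%:R * s * e.
Proof.
move=> s0 h; have i1 : `|'i * s| = s by rewrite normrM normCi mul1r ger0_norm.
have s1 : `|s| = s by rewrite ger0_norm.
have c0 : 0 <= (0 : C) <= 1 by apply/andP; split=> //; exact: ler01.
have c1 : 0 <= (1 : C) <= 1 by apply/andP; split=> //; exact: ler01.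
have E1 : `|edge f m z s| <= e * s.
  by rewrite -[X in _ <= e * X]s1; apply: edge_bound => t ht; apply: h; rewrite -(addr0 t) -[X in t + X](mulr0 'i); exact: insqP.
have E2 : `|edge f m (z + s) ('i * s)| <= e * s.
  rewrite -[X in _ <= e * X]i1; apply: edge_bound => t ht; apply: h.
  by rewrite (_ : z + s + t * ('i * s) = z + (1 + 'i * t) * s); [exact: insqP|ring].
have E3 : `|edge f m (z + 'i * s) s| <= e * s.
  rewrite -[X in _ <= e * X]s1; apply: edge_bound => t ht; apply: h.
  by rewrite (_ : z + 'i * s + t * s = z + (t + 'i * 1) * s); [exact: insqP|ring].
have E4 : `|edge f m z ('i * s)| <= e * s.
  rewrite -[X in _ <= e * X]i1; apply: edge_bound => t ht; apply: h.
  by rewrite (_ : z + t * ('i * s) = z + (0 + 'i * t) * s); [exact: insqP|ring].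
rewrite /loop; apply: le_trans (ler_normB _ _) _.
rewrite (_ : 4%:R * s * e = e * s + e * s + e * s + e * s); last by ring.
apply: lerD => //; apply: le_trans (ler_normB _ _) _; apply: lerD => //.
by apply: le_trans (ler_normD _ _) _; exact: lerD.
Qed.

End DiscreteIntegral.

Section Goursat.
Variable C : numClosedFieldType.
Hypothesis arch : forall x : C, exists k : nat, `|x| <= k%:R.
Hypothesis complete : forall (u : nat -> C) (b t : C), 0 <= t -> t < 1 ->
  (forall m n, (m <= n)%N -> `|u n - u m| <= b * t ^+ m) ->
  exists l, forall m, `|l - u m| <= b * t ^+ m.
Implicit Types (f g : C -> C) (z w s : C) (m : nat).

Let third0 : (0 : C) < 3%:R^-1. Proof. by rewrite invr_gt0 ltr0n. Qed.
Let third1 : 3%:R^-1 < 1 :> C. Proof. by rewrite invf_lt1 ?ltr0n // ltr1n. Qed.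

Lemma third_small (b e : C) : 0 < e -> 0 <= b -> exists k, b * 3%:R^-1 ^+ k <= e.
Proof.
move=> e0 b0; have b1 : 0 < b + 1 by rewrite ltr_wpDl.
have [|k hk] := pow_small arch (ltW third0) third1 (_ : 0 < e / (b + 1)); first by rewrite divr_gt0.
exists k; apply: (@le_trans _ _ ((b + 1) * (e / (b + 1)))); last by rewrite mulrC divfK // lt0r_neq0.
by apply: ler_pM => //; rewrite lerDl.
Qed.

(** Otherwise one of the nine parts is bad at each stage, and the nested bad squares shrink to a
    point of the given square, near which the local hypothesis applies. This replaces
    compactness. *)
Lemma cousin (P : C -> C -> Prop) z s : 0 < s ->
  (forall p t, 0 < t -> (forall a b : nat, (a < 3)%N -> (b < 3)%N ->
      P (p + (a%:R + 'i * b%:R) * (t / 3%:R)) (t / 3%:R)) -> P p t) ->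
  (forall c, insq z s c -> exists2 d, 0 < d & forall p t, 0 < t -> t < d -> insq p t c ->
     (forall w, insq p t w -> insq z s w) -> P p t) ->
  P z s.
Proof.
move=> s0 sub loc; apply: contrapT => nP.
pose st k := s * 3%:R^-1 ^+ k.
have st0 k : 0 < st k by rewrite mulr_gt0 // exprn_gt0.
have stS k : st k / 3%:R = st k.+1 by rewrite /st exprSr mulrA.
have step p k : exists q : C, ~ P p (st k) -> ~ P q (st k.+1) /\
    exists a b : nat, [/\ (a < 3)%N, (b < 3)%N & q = p + (a%:R + 'i * b%:R) * st k.+1].
  have [h|h] := pselect (P p (st k)); first by exists p.
  have [[a [b [ha hb hn]]]|h'] := pselect (exists a b : nat, [/\ (a < 3)%N, (b < 3)%N &
     ~ P (p + (a%:R + 'i * b%:R) * st k.+1) (st k.+1)]).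
    by exists (p + (a%:R + 'i * b%:R) * st k.+1) => _; split=> //; exists a, b.
  case: h; apply: sub => // a b ha hb; rewrite stS; apply: contrapT => hn.
  by case: h'; exists a, b.
have /boolp.choice [nx hnx] : forall pk : C * nat, exists q : C, ~ P pk.1 (st pk.2) -> ~ P q (st pk.2.+1) /\
    exists a b : nat, [/\ (a < 3)%N, (b < 3)%N & q = pk.1 + (a%:R + 'i * b%:R) * st pk.2.+1].
  by move=> [p k]; exact: step.
pose fix c k := if k is k'.+1 then nx (c k', k') else z.
have cP k : ~ P (c k) (st k).
  by elim: k => [|k IH]; [rewrite /st mulr1|have [] := hnx (c k, k) IH].
have cS k : exists a b : nat, [/\ (a < 3)%N, (b < 3)%N & c k.+1 = c k + (a%:R + 'i * b%:R) * st k.+1].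
  by have [_] := hnx (c k, k) (cP k).
have c0E : c 0%N = z by [].
clearbody c.
have nest k w : insq (c k.+1) (st k.+1) w -> insq (c k) (st k) w.
  have [a [b [ha hb e]]] := cS k.
  have t0 := st0 k.+1; have ar : a%:R * st k.+1 \is Num.real by rewrite ger0_real // mulr_ge0 // ltW.
  have br : b%:R * st k.+1 \is Num.real by rewrite ger0_real // mulr_ge0 // ltW.
  rewrite /insq e; have -> : w - (c k + (a%:R + 'i * b%:R) * st k.+1) =
     (w - c k) - (a%:R * st k.+1 + 'i * (b%:R * st k.+1)) by ring.
  move: (w - c k) => y; rewrite !raddfB /= Re_rect // Im_rect //.
  have st3 : st k = 3%:R * st k.+1 by rewrite -stS mulrC divfK // pnatr_eq0.
  have b3 (x : C) (j : nat) : (j < 3)%N -> 0 <= x - j%:R * st k.+1 <= st k.+1 -> 0 <= x <= st k.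
    move=> hj /andP[x0 x1]; have hj0 : 0 <= j%:R * st k.+1 by rewrite mulr_ge0 // ltW.
    apply/andP; split; first by apply: le_trans hj0 _; rewrite -subr_ge0.
    move: x1; rewrite lerBlDr => /le_trans; apply.
    by rewrite st3 -[X in X + _]mul1r -mulrDl; apply: ler_wpM2r; [exact: ltW|rewrite nat1r ler_nat].
  by move=> [h1 h2]; split; [exact: (b3 _ a)|exact: (b3 _ b)].
have nest' j k w : insq (c (k + j)%N) (st (k + j)%N) w -> insq (c k) (st k) w.
  by elim: j => [|j IH]; [rewrite addn0|rewrite addnS => h; apply: IH; apply: (nest _ _ h)].
have cin k : insq (c k) (st k) (c k) by rewrite /insq subrr !raddf0 lexx ltW.
have cauchy m n : (m <= n)%N -> `|c n - c m| <= (2%:R * s) * 3%:R^-1 ^+ m.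
  move=> /subnKC <-; rewrite -mulrA; apply: (@insq_dist _ (c m) (st m)); last exact: cin.
  by apply: (nest' (n - m)%N); exact: cin.
have [l hl] := complete (ltW third0) third1 cauchy.
have lin k : insq (c k) (st k) l.
  have gap (x : C) : x \is Num.real -> (forall e, 0 < e -> - e <= x) -> 0 <= x.
    move=> xr h; rewrite real_leNgt ?real0 //; apply/negP => x0.
    have := h (- x / 2%:R); rewrite divr_gt0 ?ltr0n ?oppr_gt0 // => /(_ isT).
    rewrite mulNr opprK ler_pdivrMr ?ltr0n // mulr_natr mulr2n lerDl.
    by move=> /(lt_le_trans x0); rewrite ltxx.
  have near e : 0 < e -> exists2 w, insq (c k) (st k) w & `|l - w| <= e.
    move=> e0; have s20 : 0 <= 2%:R * s by rewrite mulr_ge0 // ltW.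
    have [j hj] := third_small e0 s20.
    exists (c (k + j)%N); first by apply: (nest' j); exact: cin.
    apply: le_trans (hl _) _; apply: le_trans hj; apply: ler_wpM2l => //.
    by apply: ler_wiXn2l; [exact: ltW|exact: ltW|exact: leq_addl].
  have Rb (x : C) : `|'Re x| <= `|x| by exact: (leif_normC_Re_Creal x).1.
  have Ib (x : C) : `|'Im x| <= `|x|.
    by have := Rb ('i * x); rewrite ReMil normrN normrM normCi mul1r.
  have box (x y : C) t : x \is Num.real -> 0 <= t -> (forall e, 0 < e -> exists2 y, 0 <= y <= t & `|x - y| <= e) -> 0 <= x <= t.
    move=> xr t0 h; apply/andP; split.
      apply: gap => // e /h [y' /andP[y0 yt] hxy].
      have yr : x - y' \is Num.real by rewrite realB // ger0_real.
      move: hxy; rewrite real_ler_norml // => /andP[h1 _]; apply: le_trans h1 _.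
      by rewrite gerBl.
    rewrite -subr_ge0; apply: gap => [|e /h [y' /andP[y0 yt] hxy]]; first by rewrite realB // ger0_real.
    have yr : x - y' \is Num.real by rewrite realB // ger0_real.
    move: hxy; rewrite real_ler_norml // => /andP[_ h1]; rewrite lerNl opprB.
    by apply: le_trans h1; rewrite lerD2l lerN2.
  split; apply: (box _ 0); rewrite ?Creal_Re ?Creal_Im ?(ltW (st0 k)) //.
    move=> e /near [w [h1 h2] h3]; exists ('Re (w - c k)) => //.
    by rewrite -raddfB /= (_ : l - c k - (w - c k) = l - w); [apply: le_trans h3; exact: Rb|ring].
  move=> e /near [w [h1 h2] h3]; exists ('Im (w - c k)) => //.
  by rewrite -raddfB /= (_ : l - c k - (w - c k) = l - w); [apply: le_trans h3; exact: Ib|ring].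
have zin w k : insq (c k) (st k) w -> insq z s w.
  by have := @nest' k 0%N w; rewrite add0n c0E {2}/st expr0 mulr1.
have [d d0 hd] := loc l (zin _ _ (lin 0%N)).
have d20 : 0 < d / 2%:R by rewrite divr_gt0 ?ltr0n.
have [k hk] := third_small d20 (ltW s0).
apply: (cP k); apply: hd => //; last by move=> w; exact: zin.
apply: le_lt_trans hk _; rewrite ltr_pdivrMr ?ltr0n // -[X in X < _]mulr1 ltr_pM2l //.
by rewrite ltr1n.
Qed.

Lemma eventually_all (n : nat) (P : nat -> nat -> Prop) :
  (forall a, (a < n)%N -> exists m0, forall m, (m0 <= m)%N -> P a m) ->
  exists m0, forall m, (m0 <= m)%N -> forall a, (a < n)%N -> P a m.
Proof.
elim: n => [|n IH] h; first by exists 0%N.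
have [|m1 h1] := IH; first by move=> a ha; apply: h; exact: ltnW.
have [m2 h2] := h n (ltnSn n); exists (maxn m1 m2) => m; rewrite geq_max => /andP[k1 k2] a.
by rewrite ltnS leq_eqVlt => /orP[/eqP ->|/h1]; [exact: h2|exact].
Qed.

(** Near c the function is affine up to e/8 |w - c|, and the affine part contributes 0 at every
    level. The bound e s^2 is additive over the nine parts, so [cousin] applies. *)
Lemma goursat f z s (e : C) : 0 < s -> 0 < e -> (forall w, insq z s w -> cdiff f w) ->
  exists m0, forall m, (m0 <= m)%N -> `|loop f m z s| <= e * s ^+ 2.
Proof.
move=> s0 e0 hf.
apply: (@cousin (fun p t => exists m0, forall m, (m0 <= m)%N -> `|loop f m p t| <= e * t ^+ 2)) => //.
  move=> p t t0 h.
  have [|m0 hm0] := @eventually_all 3 (fun a m => forall b, (b < 3)%N ->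
      `|loop f m (p + (a%:R + 'i * b%:R) * (t / 3%:R)) (t / 3%:R)| <= e * (t / 3%:R) ^+ 2).
    move=> a ha; apply: (@eventually_all 3 (fun b m =>
      `|loop f m (p + (a%:R + 'i * b%:R) * (t / 3%:R)) (t / 3%:R)| <= e * (t / 3%:R) ^+ 2)).
    by move=> b hb; exact: h.
  exists m0.+1 => -[//|m] hm; rewrite loop_split.
  apply: (@le_trans _ _ (\sum_(a < 3) \sum_(b < 3) e * (t / 3%:R) ^+ 2)).
    apply: le_trans (ler_norm_sum _ _ _) _; apply: ler_sum => a _.
    apply: le_trans (ler_norm_sum _ _ _) _; apply: ler_sum => b _; exact: hm0.
  rewrite !sumr_const !card_ord -mulrnA -[X in X <= _]mulr_natr le_eqVlt; apply/orP; left.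
  by apply/eqP; field.
move=> c cin; have [D hD] := hf c cin.
have [|d d0 hd] := hD (e / 8%:R); first by rewrite divr_gt0 ?ltr0n.
exists (d / 2%:R); first by rewrite divr_gt0 ?ltr0n.
move=> p t t0 td pc sub; exists 0%N => m _.
pose r w := f w - ((f c - D * c) + D * w).
have -> : loop f m p t = loop r m p t.
  have : loop f m p t = loop (fun w => r w + ((f c - D * c) + D * w)) m p t.
    by congr loop; apply/funext => w; rewrite /r subrK.
  by move=> ->; rewrite loopD loop_affine addr0.
apply: (@le_trans _ _ (4%:R * t * (e / 8%:R * (2%:R * t)))).
  apply: loop_bound => [|w hw]; first exact: ltW.
  have hwc := insq_dist hw pc.
  rewrite /r (_ : _ - _ = f w - f c - D * (w - c)); last by ring.
  apply: le_trans (hd w _) _.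
    apply: le_lt_trans hwc _; move: td; rewrite ltr_pdivlMr ?ltr0n //; by rewrite mulrC.
  by apply: ler_wpM2l => //; rewrite divr_ge0 ?ler0n // ltW.
by rewrite le_eqVlt; apply/orP; left; apply/eqP; field.
Qed.

Lemma third_split (x t : C) : 0 <= x <= t -> exists a : 'I_3, 0 <= x - a%:R * (t / 3%:R) <= t / 3%:R.
Proof.
move=> /andP[x0 xt]; have t0 := le_trans x0 xt; have xr := ger0_real x0.
have t3 : 0 <= t / 3%:R by rewrite divr_ge0 ?ler0n.
have tE : t = 3%:R * (t / 3%:R) by rewrite mulrC divfK // pnatr_eq0.
have r1 : t / 3%:R \is Num.real by rewrite ger0_real.
have r2 : 2%:R * (t / 3%:R) \is Num.real by rewrite ger0_real // mulr_ge0.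
case: (real_leP xr r1) => h1.
  by exists (Ordinal (isT : (0 < 3)%N)); rewrite /= mul0r subr0 x0.
case: (real_leP xr r2) => h2.
  exists (Ordinal (isT : (1 < 3)%N)); rewrite /= mul1r subr_ge0 (ltW h1) /= lerBlDr.
  by apply: le_trans h2 _; rewrite mulr_natl mulr2n.
exists (Ordinal (isT : (2 < 3)%N)); rewrite /= subr_ge0 (ltW h2) /= lerBlDr; apply: le_trans xt _.
by rewrite {1}tE -[X in _ <= X + _]mul1r -mulrDl nat1r.
Qed.

Lemma sq_bounded f z s : 0 < s -> (forall w, insq z s w -> cdiff f w) ->
  exists2 M, 0 <= M & forall w, insq z s w -> `|f w| <= M.
Proof.
move=> s0 hf.
apply: (@cousin (fun p t => exists2 M, 0 <= M & forall w, insq p t w -> `|f w| <= M)) => //.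
  move=> p t t0 h.
  have {h}/boolp.choice [M hM] : forall ab : 'I_3 * 'I_3, exists M, 0 <= M /\ forall w,
      insq (p + (ab.1%:R + 'i * ab.2%:R) * (t / 3%:R)) (t / 3%:R) w -> `|f w| <= M.
    by move=> [a b]; have [M M0 hM] := h a b (ltn_ord a) (ltn_ord b); exists M.
  exists (\sum_ab M ab) => [|w [hre him]]; first by apply: sumr_ge0 => ab _; have [] := hM ab.
  have [a ha] := third_split hre; have [b hb] := third_split him.
  rewrite (bigD1 (a, b)) //=; apply: ler_wpDr.
    by apply: sumr_ge0 => ab _; have [] := hM ab.
  have t3 : 0 < t / 3%:R by rewrite divr_gt0 ?ltr0n.
  apply: (hM (a, b)).2; rewrite /insq /=.
  have -> : w - (p + (a%:R + 'i * b%:R) * (t / 3%:R)) =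
     (w - p) - (a%:R * (t / 3%:R) + 'i * (b%:R * (t / 3%:R))) by ring.
  have ar (k : nat) : k%:R * (t / 3%:R) \is Num.real by rewrite ger0_real // mulr_ge0 // ltW.
  by move: (w - p) ha hb => y ha hb; rewrite !raddfB /= Re_rect // Im_rect.
move=> c cin; have [M [d [M0 d0 hd]]] := cdiff_lip (hf c cin).
exists (d / 2%:R); first by rewrite divr_gt0 ?ltr0n.
move=> p t t0 td pc sub; exists (`|f c| + M * d) => [|w hw].
  by rewrite addr_ge0 // mulr_ge0 // ltW.
have hwc := insq_dist hw pc.
have hwd : `|w - c| < d.
  by apply: le_lt_trans hwc _; move: td; rewrite ltr_pdivlMr ?ltr0n // mulrC.
rewrite (_ : f w = f c + (f w - f c)); last by ring.
apply: le_trans (ler_normD _ _) _; rewrite lerD2l; apply: le_trans (hd w hwd) _.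
by apply: ler_wpM2l; exact: ltW.
Qed.

(** With t in [-1, 1] as parameter on a side, k dz / (z - w) is (k t + i) dt / (t^2 + 1), with
    imaginary part at least dt / 2, over an interval of length 2. The direction is [o] = 1 or i, and
    [k] = 1 or -1 distinguishes opposite sides. *)
Lemma edge_kernel w s (o k : C) m : 0 < s -> o != 0 -> k \is Num.real -> k ^+ 2 = 1 ->
  1 <= 'Im (k * edge (fun z => (z - w)^-1) m (w + o * (s / 2%:R) * (- 1 - k * 'i)) (o * s)).
Proof.
move=> s0 o0 kr k2; have h3 := pow3_neq0 C m.
have n0 : 0 < (3 ^ m)%:R^-1 :> C by rewrite invr_gt0 ltr0n expn_gt0.
pose t j : C := -1 + 2%:R * j%:R / (3 ^ m)%:R.
pose J (x : C) : C := (k * x + 'i) / (x ^+ 2 + 1).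
have tr j : t j \is Num.real by rewrite realD ?realN ?real1 // realM // ?realV ?realM // realn.
have den (x : C) : x \is Num.real -> 0 < x ^+ 2 + 1.
  by move=> xr; rewrite ltr_wpDl // real_exprn_even_ge0.
have tb j : (j <= 3 ^ m)%N -> t j ^+ 2 <= 1.
  move=> hj; rewrite -real_normK // exprn_ile1 // real_ler_norml // /t.
  rewrite lerDl divr_ge0 ?ler0n ?mulr_ge0 ?ler0n //= addrC lerBlDr.
  rewrite ler_pdivrMr ?ltr0n ?expn_gt0 // (_ : 1 + 1 = 2%:R :> C) // ler_pM2l ?ltr0n //.
  by rewrite ler_nat.
have ImJ j : (j <= 3 ^ m)%N -> 2%:R^-1 <= 'Im (J (t j)).
  move=> hj; have dn := den _ (tr j).
  have -> : J (t j) = k * t j / (t j ^+ 2 + 1) + 'i * (t j ^+ 2 + 1)^-1.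
    by rewrite /J mulrDl.
  rewrite Im_rect ?realM ?realV ?(gtr0_real dn) //; try by rewrite ?realV; exact: gtr0_real.
  by rewrite lef_pV2 ?posrE ?ltr0n // mulr2n lerD2r tb.
have kk : k * k = 1 by rewrite -expr2.
have si : s != 0 by rewrite lt0r_neq0.
have termE j : k * (w + o * (s / 2%:R) * (-1 - k * 'i) + j%:R * (o * s / (3 ^ m)%:R) - w)^-1 * (o * s / (3 ^ m)%:R) =
   2%:R / (3 ^ m)%:R * J (t j).
  rewrite (_ : w + _ + _ - w = (o * (s / 2%:R)) * (t j - k * 'i)); last by rewrite /t; field.
  have dn := lt0r_neq0 (den _ (tr j)).
  have e1 : (t j - k * 'i) * (t j + k * 'i) = t j ^+ 2 + 1.
    rewrite (_ : _ * _ = t j ^+ 2 - (k * k) * 'i ^+ 2); last by ring.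
    by rewrite kk sqrCi mul1r opprK.
  have n1 : t j - k * 'i != 0.
    by apply: contra_neq dn => z0; rewrite -e1 z0 mul0r.
  rewrite /J (_ : k * t j + 'i = k * (t j + k * 'i)); last by rewrite [RHS]mulrDr mulrA kk mul1r.
  by rewrite -e1; field; rewrite n1 si o0 h3 (_ : t j + k * 'i != 0) // ; apply: contra_neq dn => z0; rewrite -e1 z0 mulr0.
rewrite /edge mulr_sumr raddf_sum /=.
apply: (@le_trans _ _ (\sum_(j < 3 ^ m) (3 ^ m)%:R^-1)).
  by rewrite sumr_const card_ord -[X in _ <= X]mulr_natr mulVf.
apply: ler_sum => j _.
have -> : k * (((w + o * (s / 2%:R) * (-1 - k * 'i) + j%:R * (o * s / (3 ^ m)%:R) - w)^-1 +
    (w + o * (s / 2%:R) * (-1 - k * 'i) + j.+1%:R * (o * s / (3 ^ m)%:R) - w)^-1) / 2%:R * (o * s / (3 ^ m)%:R)) =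
   (3 ^ m)%:R^-1 * (J (t j) + J (t j.+1)).
  transitivity (2%:R^-1 * (2%:R / (3 ^ m)%:R * J (t j) + 2%:R / (3 ^ m)%:R * J (t j.+1))).
    by rewrite -!termE; ring.
  by field.
rewrite ImMl ?gtr0_real // -[leLHS]mulr1; apply: ler_wpM2l; first exact: ltW.
rewrite raddfD /= [leLHS](splitr 1) !div1r; apply: lerD; apply: ImJ => //; exact: ltnW.
Qed.

(** A lower bound takes the place of the value 2 pi i: each of the four sides contributes at least 1
    to the imaginary part. *)
Lemma kernel_bound w s m : 0 < s ->
  4%:R <= `|loop (fun z => (z - w)^-1) m (w - (1 + 'i) * (s / 2%:R)) s|.
Proof.
move=> s0; set K := loop _ _ _ _; have r1 : (1 : C) \is Num.real by exact: real1.
have rN1 : (-1 : C) \is Num.real by rewrite realN.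
have sq1 : (-1 : C) ^+ 2 = 1 by rewrite sqrrN expr1n.
have K1 := @edge_kernel w s 1 1 m s0 (oner_neq0 _) r1 (expr1n _ _).
have K2 := @edge_kernel w s 'i 1 m s0 (neq0Ci _) r1 (expr1n _ _).
have K3 := @edge_kernel w s 1 (-1) m s0 (oner_neq0 _) rN1 sq1.
have K4 := @edge_kernel w s 'i (-1) m s0 (neq0Ci _) rN1 sq1.
have ii : 'i * 'i = -1 :> C by rewrite -expr2 sqrCi.
have KE : K = 1 * edge (fun z => (z - w)^-1) m (w + 1 * (s / 2%:R) * (- 1 - 1 * 'i)) (1 * s) +
   1 * edge (fun z => (z - w)^-1) m (w + 'i * (s / 2%:R) * (- 1 - 1 * 'i)) ('i * s) +
   (-1) * edge (fun z => (z - w)^-1) m (w + 1 * (s / 2%:R) * (- 1 - (-1) * 'i)) (1 * s) +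
   (-1) * edge (fun z => (z - w)^-1) m (w + 'i * (s / 2%:R) * (- 1 - (-1) * 'i)) ('i * s).
  rewrite /K /loop !mul1r !mulN1r; congr (_ + _ - _ - _); congr edge.
  - by ring.
  - rewrite (_ : 'i * (s / 2%:R) * (-1 - 'i) = - 'i * (s / 2%:R) - ('i * 'i) * (s / 2%:R)); last by ring.
    by rewrite ii; field.
  - by field.
  - rewrite (_ : 'i * (s / 2%:R) * (-1 - - 'i) = - 'i * (s / 2%:R) + ('i * 'i) * (s / 2%:R)); last by ring.
    by rewrite ii; ring.
have : 4%:R <= 'Im K.
  rewrite KE !raddfD /= (_ : 4%:R = 1 + 1 + 1 + 1 :> C); last by ring.
  by rewrite !lerD.
move=> h; apply: le_trans h _; apply: le_trans (_ : `|'Im K| <= _).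
  by apply: real_ler_norm; exact: Creal_Im.
by have := (leif_normC_Re_Creal ('i * K)).1; rewrite ReMil normrN normrM normCi mul1r.
Qed.

Lemma insq_sub p t (a b : nat) z : 0 < t -> (a < 3)%N -> (b < 3)%N ->
  insq (p + (a%:R + 'i * b%:R) * (t / 3%:R)) (t / 3%:R) z ->
  insq p t z /\ (0 <= 'Re (z - p) - a%:R * (t / 3%:R) <= t / 3%:R /\
                 0 <= 'Im (z - p) - b%:R * (t / 3%:R) <= t / 3%:R).
Proof.
move=> t0 ha hb; set u := t / 3%:R; have u0 : 0 < u by rewrite divr_gt0 ?ltr0n.
have ar (k : nat) : k%:R * u \is Num.real by rewrite ger0_real // mulr_ge0 // ltW.
rewrite /insq; have -> : z - (p + (a%:R + 'i * b%:R) * u) = (z - p) - (a%:R * u + 'i * (b%:R * u)) by ring.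
move: (z - p) => y; rewrite !raddfB /= Re_rect // Im_rect // => -[h1 h2]; split=> //.
have tE : t = 3%:R * u by rewrite /u mulrC divfK // pnatr_eq0.
have b3 (x : C) (j : nat) : (j < 3)%N -> 0 <= x - j%:R * u <= u -> 0 <= x <= t.
  move=> hj /andP[x0 x1]; have hj0 : 0 <= j%:R * u by rewrite mulr_ge0 // ltW.
  apply/andP; split; first by apply: le_trans hj0 _; rewrite -subr_ge0.
  move: x1; rewrite lerBlDr => /le_trans; apply.
  by rewrite tE -[X in X + _]mul1r -mulrDl; apply: ler_wpM2r; [exact: ltW|rewrite nat1r ler_nat].
by split; [exact: (b3 _ a)|exact: (b3 _ b)].
Qed.

Definition corner w s := w - (1 + 'i) * (s / 2%:R).

(** For phi(z) = f(z) / (z - w) the loop around w may be shrunk repeatedly to the middle ninth,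
    because by [goursat] the other eight parts contribute arbitrarily little. On a small square phi
    is f(w) / (z - w) plus a bounded function, so by [kernel_bound] 4 |f(w)| is at most the outer
    loop, 4 s B, up to small terms. *)
Lemma cauchy_estimate f w s (B : C) : 0 < s -> 0 <= B -> (forall z, insq (corner w s) s z -> cdiff f z) ->
  (forall z, insq (corner w s) s z -> s / 2%:R <= `|z - w| -> `|f z / (z - w)| <= B) ->
  `|f w| <= s * B.
Proof.
move=> s0 B0 hf hB; pose phi z := f z / (z - w); pose sj j := s * 3%:R^-1 ^+ j.
have sj0 j : 0 < sj j by rewrite mulr_gt0 // exprn_gt0.
have sjS j : sj j / 3%:R = sj j.+1 by rewrite /sj exprSr mulrA.
have corS j : corner w (sj j) + (1%:R + 'i * 1%:R) * (sj j / 3%:R) = corner w (sj j.+1).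
  by rewrite /corner -sjS; field.
have sjle j : sj j <= s.
  by rewrite ler_piMr ?(ltW s0) //; apply: exprn_ile1; exact: ltW.
have shalf j : sj j / 2%:R \is Num.real by rewrite ger0_real // divr_ge0 ?ler0n // ltW.
have coord j (z : C) : insq (corner w (sj j)) (sj j) z <->
   0 <= 'Re (z - w) + sj j / 2%:R <= sj j /\ 0 <= 'Im (z - w) + sj j / 2%:R <= sj j.
  rewrite /insq /corner (_ : z - (w - (1 + 'i) * (sj j / 2%:R)) = (z - w) + (sj j / 2%:R + 'i * (sj j / 2%:R))); last by ring.
  have eR (u v : C) : 'Re (u + v) = 'Re u + 'Re v by rewrite raddfD.
  have eI (u v : C) : 'Im (u + v) = 'Im u + 'Im v by rewrite raddfD.
  by rewrite (eR (z - w)) (eI (z - w)) Re_rect // Im_rect.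
have win j : insq (corner w (sj j)) (sj j) w.
  apply/coord; rewrite subrr !raddf0 add0r divr_ge0 ?ler0n ?(ltW (sj0 j)) //=.
  by rewrite ler_pdivrMr ?ltr0n // ler_peMr ?ler1n // ltW.
have sub0 j z : insq (corner w (sj j)) (sj j) z -> insq (corner w s) s z.
  have mono (x t : C) : 0 <= t -> t <= s -> 0 <= x + t / 2%:R <= t -> 0 <= x + s / 2%:R <= s.
    move=> t0 ts /andP[x0 x1]; apply/andP; split.
      by apply: le_trans x0 _; rewrite lerD2l ler_pM2r // invr_gt0 ltr0n.
    move: x1; rewrite -lerBrDr => x1; rewrite -lerBrDr; apply: le_trans x1 _.
    have half (y : C) : y - y / 2%:R = y / 2%:R by field.
    by rewrite !half ler_pM2r // invr_gt0 ltr0n.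
  have c0 := coord 0%N; rewrite /sj expr0 mulr1 in c0.
  move=> /coord [h1 h2]; apply/c0; split; apply: mono (sjle j) _ => //; exact: ltW.
have phid j (a b : nat) z : (a < 3)%N -> (b < 3)%N -> (a == 1%N) && (b == 1%N) = false ->
    insq (corner w (sj j) + (a%:R + 'i * b%:R) * (sj j / 3%:R)) (sj j / 3%:R) z -> cdiff phi z.
  move=> ha hb nab /(insq_sub (sj0 j) ha hb) [h1 [h2 h3]].
  have zw : z - w != 0.
    apply/eqP => zw0; move: nab h2 h3; have -> : z - corner w (sj j) = sj j / 2%:R + 'i * (sj j / 2%:R).
      by rewrite /corner opprB addrCA zw0; ring.
    rewrite Re_rect // Im_rect //.
    have mid (k : nat) : (k < 3)%N -> 0 <= sj j / 2%:R - k%:R * (sj j / 3%:R) <= sj j / 3%:R -> k == 1%N.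
      case: k => [|[|[|//]]] // _ /andP[].
        rewrite mul0r subr0 => _; rewrite ler_pM2l // lef_pV2 ?posrE ?ltr0n // ler_nat; by [].
      rewrite (_ : _ - _ = - (sj j / 6%:R)); last by field.
      by rewrite oppr_ge0 => /(lt_le_trans (_ : 0 < sj j / 6%:R)); rewrite ltxx divr_gt0 ?ltr0n // => /(_ isT).
    by move=> nab /(mid _ ha) ea /(mid _ hb) eb; rewrite ea eb in nab.
  by apply: (@cdiffM C f (fun y => (y - w)^-1)); [exact/hf/(sub0 j)|apply: cdiff_subV; rewrite -subr_eq0].
have stepA j (e : C) : 0 < e -> exists m0, forall m, (m0 <= m)%N ->
    `|loop phi m.+1 (corner w (sj j)) (sj j) - loop phi m (corner w (sj j.+1)) (sj j.+1)| <= e.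
  move=> e0; pose X m (a b : nat) := loop phi m (corner w (sj j) + (a%:R + 'i * b%:R) * (sj j / 3%:R)) (sj j / 3%:R).
  pose Y m (a b : nat) := if (a == 1%N) && (b == 1%N) then 0 else X m a b.
  have u0 : 0 < sj j / 3%:R by rewrite divr_gt0 ?ltr0n.
  have e9 : 0 < e / 9%:R by rewrite divr_gt0 ?ltr0n.
  have [|m0 hm0] := @eventually_all 3 (fun a m => forall b, (b < 3)%N -> `|Y m a b| <= e / 9%:R).
    move=> a ha; apply: (@eventually_all 3 (fun b m => `|Y m a b| <= e / 9%:R)) => b hb.
    rewrite /Y; have [ab|ab] := boolP ((a == 1%N) && (b == 1%N)).
      by exists 0%N => m _; rewrite normr0 ltW.
    have e' : 0 < e / 9%:R / (sj j / 3%:R) ^+ 2 by rewrite divr_gt0 // exprn_gt0.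
    have [|m0 hm0] := goursat u0 e' (f := phi) (z := corner w (sj j) + (a%:R + 'i * b%:R) * (sj j / 3%:R)).
      by move=> z; apply: phid => //; exact: negbTE.
    exists m0 => m hm; apply: le_trans (hm0 m hm) _.
    by rewrite divfK // expf_neq0 // lt0r_neq0.
  exists m0 => m hm; rewrite loop_split -corS -sjS.
  have -> : \sum_(a < 3) \sum_(b < 3) loop phi m (corner w (sj j) + (a%:R + 'i * b%:R) * (sj j / 3%:R)) (sj j / 3%:R) -
     loop phi m (corner w (sj j) + (1%:R + 'i * 1%:R) * (sj j / 3%:R)) (sj j / 3%:R) =
     \sum_(a < 3) \sum_(b < 3) Y m a b.
    rewrite -/(X m 1%N 1%N) (eq_bigr (fun a : 'I_3 => \sum_(b < 3) X m a b)) //.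
    by rewrite !big_ord_recl !big_ord0 /Y /=; ring.
  apply: (@le_trans _ _ (\sum_(a < 3) \sum_(b < 3) e / 9%:R)).
    apply: le_trans (ler_norm_sum _ _ _) _; apply: ler_sum => a _.
    by apply: le_trans (ler_norm_sum _ _ _) _; apply: ler_sum => b _; exact: hm0.
  rewrite !sumr_const !card_ord -mulrnA -[X in X <= _]mulr_natr le_eqVlt; apply/orP; left.
  by apply/eqP; field.
have iter j (e : C) : 0 < e -> exists m0, forall m, (m0 <= m)%N ->
    `|loop phi (m + j) (corner w s) s - loop phi m (corner w (sj j)) (sj j)| <= e.
  elim: j e => [|j IH] e e0.
    by exists 0%N => m _; rewrite addn0 /sj expr0 mulr1 subrr normr0 ltW.
  have e2 : 0 < e / 2%:R by rewrite divr_gt0 ?ltr0n.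
  have [m1 h1] := IH _ e2; have [m2 h2] := stepA j _ e2.
  exists (maxn m1 m2) => m; rewrite geq_max => /andP[k1 k2].
  rewrite [e]splitr addnS -addSn (_ : loop phi (m.+1 + j) (corner w s) s - _ = (loop phi (m.+1 + j) (corner w s) s -
     loop phi m.+1 (corner w (sj j)) (sj j)) + (loop phi m.+1 (corner w (sj j)) (sj j) -
     loop phi m (corner w (sj j.+1)) (sj j.+1))); last by ring.
  by apply: le_trans (ler_normD _ _) _; apply: lerD; [apply: h1; exact: leqW|exact: h2].
have [M [d [M0 d0 hM]]] := cdiff_lip (hf w (sub0 0%N _ (win 0%N))).
have outer m : `|loop phi m (corner w s) s| <= 4%:R * s * B.
  have c0 : 0 <= (0 : C) <= 1 by apply/andP; split=> //; exact: ler01.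
  have c1 : 0 <= (1 : C) <= 1 by apply/andP; split=> //; exact: ler01.
  have i1 : `|'i * s| = s by rewrite normrM normCi mul1r gtr0_norm.
  have s1 : `|s| = s by rewrite gtr0_norm.
  have hs2 : s / 2%:R \is Num.real by rewrite gtr0_real // divr_gt0 ?ltr0n.
  have Rb (x : C) : `|'Re x| <= `|x| by exact: (leif_normC_Re_Creal x).1.
  have Ib (x : C) : `|'Im x| <= `|x|.
    by have := Rb ('i * x); rewrite ReMil normrN normrM normCi mul1r.
  have onb (u v : C) : 0 <= u <= 1 -> 0 <= v <= 1 -> (u == 0) || (u == 1) || (v == 0) || (v == 1) ->
     `|phi (corner w s + (u + 'i * v) * s)| <= B.
    move=> hu hv huv; apply: hB; first by apply: insqP => //; exact: ltW.
    have ur : u * s - s / 2%:R \is Num.real by rewrite realB // ger0_real // mulr_ge0 ?(ltW s0) //; case/andP: hu.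
    have vr : v * s - s / 2%:R \is Num.real by rewrite realB // ger0_real // mulr_ge0 ?(ltW s0) //; case/andP: hv.
    have hn : `|s / 2%:R| = s / 2%:R by rewrite ger0_norm // divr_ge0 ?ler0n // ltW.
    rewrite /corner (_ : _ - w = (u * s - s / 2%:R) + 'i * (v * s - s / 2%:R)); last by ring.
    move: huv; rewrite -!orbA => /or4P[]/eqP e.
    - by apply: le_trans (Rb _); rewrite Re_rect // e mul0r sub0r normrN hn.
    - by apply: le_trans (Rb _); rewrite Re_rect // e mul1r (_ : s - s / 2%:R = s / 2%:R) ?hn //; field.
    - by apply: le_trans (Ib _); rewrite Im_rect // e mul0r sub0r normrN hn.
    - by apply: le_trans (Ib _); rewrite Im_rect // e mul1r (_ : s - s / 2%:R = s / 2%:R) ?hn //; field.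
  have E1 : `|edge phi m (corner w s) s| <= B * s.
    rewrite -[X in _ <= B * X]s1; apply: edge_bound => t ht.
    by rewrite (_ : _ + t * s = corner w s + (t + 'i * 0) * s); [apply: onb; rewrite ?eqxx ?orbT|ring].
  have E2 : `|edge phi m (corner w s + s) ('i * s)| <= B * s.
    rewrite -[X in _ <= B * X]i1; apply: edge_bound => t ht.
    by rewrite (_ : _ + t * _ = corner w s + (1 + 'i * t) * s); [apply: onb; rewrite ?eqxx ?orbT|ring].
  have E3 : `|edge phi m (corner w s + 'i * s) s| <= B * s.
    rewrite -[X in _ <= B * X]s1; apply: edge_bound => t ht.
    by rewrite (_ : _ + t * s = corner w s + (t + 'i * 1) * s); [apply: onb; rewrite ?eqxx ?orbT|ring].
  have E4 : `|edge phi m (corner w s) ('i * s)| <= B * s.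
    rewrite -[X in _ <= B * X]i1; apply: edge_bound => t ht.
    by rewrite (_ : _ + t * _ = corner w s + (0 + 'i * t) * s); [apply: onb; rewrite ?eqxx ?orbT|ring].
  rewrite /loop; apply: le_trans (ler_normB _ _) _.
  rewrite (_ : 4%:R * s * B = B * s + B * s + B * s + B * s); last by ring.
  apply: lerD => //; apply: le_trans (ler_normB _ _) _; apply: lerD => //.
  by apply: le_trans (ler_normD _ _) _; exact: lerD.
have final (e : C) : 0 < e -> `|f w| <= s * B + e.
  move=> e0; have d3 : 0 < d / 3%:R by rewrite divr_gt0 ?ltr0n.
  have eM : 0 < e / (2%:R * M) by rewrite divr_gt0 // mulr_gt0 ?ltr0n.
  have [d1 d10 [dd1 dd2]] := cmin d3 eM; have [j hj] := third_small d10 (ltW s0).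
  rewrite -/(sj j) in hj; have e2 : 0 < 2%:R * e by rewrite mulr_gt0 ?ltr0n.
  have [m0 hm0] := iter j _ e2; have {}hm0 := hm0 m0 (leqnn _).
  pose psi z := (f z - f w) / (z - w).
  have phiE : phi = fun z => f w * (z - w)^-1 + psi z.
    by apply/funext => z; rewrite /phi /psi -mulrDl (addrC (f w)) subrK.
  have psib z : insq (corner w (sj j)) (sj j) z -> `|psi z| <= M.
    move=> hz; rewrite /psi; have [->|zw] := eqVneq z w.
      by rewrite subrr mul0r normr0 ltW.
    rewrite normrM normfV ler_pdivrMr ?normr_gt0 ?subr_eq0 //; apply: hM.
    apply: le_lt_trans (insq_dist hz (win j)) _.
    apply: (@le_lt_trans _ _ (2%:R * (d / 3%:R))).
      by apply: ler_wpM2l => //; apply: le_trans hj dd1.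
    by rewrite mulrA ltr_pdivrMr ?ltr0n // mulrC ltr_pM2l // ltr_nat.
  have hpsi := loop_bound m0 (ltW (sj0 j)) psib.
  have hM2 : sj j * M <= e / 2%:R.
    move: (le_trans hj dd2); rewrite ler_pdivlMr ?mulr_gt0 ?ltr0n // => h.
    by rewrite ler_pdivlMr ?ltr0n // -mulrA (mulrC M).
  have hK := kernel_bound w m0 (sj0 j); rewrite -/(corner w (sj j)) in hK.
  have split4 : `|f w| * 4%:R <= (4%:R * s * B + 2%:R * e) + 4%:R * sj j * M.
    apply: (@le_trans _ _ (`|f w| * `|loop (fun z => (z - w)^-1) m0 (corner w (sj j)) (sj j)|)).
      exact: ler_wpM2l.
    rewrite -normrM -loopZ.
    have -> : loop (fun z => f w * (z - w)^-1) m0 (corner w (sj j)) (sj j) =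
       loop phi m0 (corner w (sj j)) (sj j) - loop psi m0 (corner w (sj j)) (sj j).
      by rewrite phiE loopD addrK.
    apply: le_trans (ler_normB _ _) _; apply: lerD => //.
    rewrite (_ : loop phi m0 _ _ = loop phi (m0 + j) (corner w s) s -
      (loop phi (m0 + j) (corner w s) s - loop phi m0 (corner w (sj j)) (sj j))); last by ring.
    by apply: le_trans (ler_normB _ _) _; apply: lerD.
  rewrite -(@ler_pM2r _ 4%:R) ?ltr0n //; apply: le_trans split4 _.
  rewrite (_ : (s * B + e) * 4%:R = 4%:R * s * B + 2%:R * e + 4%:R * (e / 2%:R)); last by field.
  by rewrite lerD2l -mulrA; apply: ler_wpM2l.
have sBr : s * B \is Num.real by rewrite ger0_real // mulr_ge0 // ltW.
rewrite real_leNgt ?normr_real //; apply/negP => h.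
have := final ((`|f w| - s * B) / 2%:R); rewrite divr_gt0 ?ltr0n ?subr_gt0 // => /(_ isT).
rewrite -lerBlDl ler_pdivlMr ?ltr0n // mulr_natr mulr2n gerDl => h2.
by move: h; rewrite -subr_gt0 => /lt_le_trans/(_ h2); rewrite ltxx.
Qed.

(** Cauchy's estimate is applied to H(z) / (z - a)^n, which is differentiable at a because H
    vanishes around it. Points with |z - w| >= s/2 are at least twice as far from a as w is, so
    |H(w)| <= 2 M 2^(-n) for every n. *)
Lemma vanishing_spreads (H : C -> C) w a s r : 0 < s -> 0 < r ->
  (forall z, insq (corner w s) s z -> cdiff H z) ->
  (forall z, `|z - a| < r -> H z = 0) -> `|w - a| <= s / 6%:R -> H w = 0.
Proof.
move=> s0 r0 hH Ha was; have [->|wa] := eqVneq w a; first by apply: Ha; rewrite subrr normr0.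
set rho := `|w - a| in was; have rho0 : 0 < rho by rewrite normr_gt0 subr_eq0.
have [M M0 hM] := sq_bounded s0 hH.
have bound n : `|H w| <= 2%:R * M * 2%:R^-1 ^+ n.
  pose f z := H z * (z - a)^-1 ^+ n.
  have hf z : insq (corner w s) s z -> cdiff f z.
    move=> hz; have [za|za] := eqVneq z a.
      apply: cdiff_ext (cdiff_cst 0 z) _; exists r => // y; rewrite za => hy.
      by rewrite /f Ha // mul0r.
    apply: (@cdiffM C H (fun y => (y - a)^-1 ^+ n)); first exact: hH.
    by apply: (@cdiffX C (fun y => (y - a)^-1)); exact: cdiff_subV.
  pose B := M * (2%:R * rho)^-1 ^+ n * (2%:R / s).
  have rr : 0 < 2%:R * rho by rewrite mulr_gt0 ?ltr0n.
  have B0 : 0 <= B.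
    apply: mulr_ge0; last by rewrite divr_ge0 ?ler0n // (ltW s0).
    by apply: mulr_ge0 => //; apply: exprn_ge0; rewrite invr_ge0; exact: ltW.
  have hB z : insq (corner w s) s z -> s / 2%:R <= `|z - w| -> `|f z / (z - w)| <= B.
    move=> hz hzw; have za : 2%:R * rho <= `|z - a|.
      rewrite -(lerD2r rho); apply: (@le_trans _ _ `|z - w|); last first.
        by rewrite /rho (_ : z - w = (z - a) - (w - a)); [exact: ler_normB|ring].
      apply: le_trans hzw; rewrite (_ : 2%:R * rho + rho = 3%:R * rho); last by ring.
      apply: (@le_trans _ _ (3%:R * (s / 6%:R))); first by apply: ler_wpM2l.
      by rewrite le_eqVlt; apply/orP; left; apply/eqP; field.
    rewrite !normrM normrX !normfV /B; apply: ler_pM; rewrite ?mulr_ge0 ?exprn_ge0 ?invr_ge0 //.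
      apply: ler_pM; rewrite ?exprn_ge0 ?invr_ge0 //; first exact: hM.
      apply: lerXn2r; rewrite ?nnegrE ?invr_ge0 ?(ltW rr) //.
      by rewrite lef_pV2 // posrE // (lt_le_trans rr).
    rewrite -[2%:R / s]invf_div lef_pV2 // posrE ?divr_gt0 ?ltr0n //.
    by apply: lt_le_trans hzw; rewrite divr_gt0 ?ltr0n.
  have := cauchy_estimate s0 B0 hf hB.
  rewrite /f normrM normrX normfV -/rho /B.
  have rn : 0 < rho ^+ n by rewrite exprn_gt0.
  rewrite (exprVn rho) ler_pdivrMr // => /le_trans; apply.
  rewrite le_eqVlt; apply/orP; left; apply/eqP; rewrite (exprVn (2%:R * rho)) exprMn (exprVn 2%:R).
  have n2 : 2%:R ^+ n != 0 :> C by rewrite expf_neq0 // pnatr_eq0.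
  by field; rewrite n2 ?(lt0r_neq0 s0) ?(lt0r_neq0 rn).
apply/eqP; rewrite -normr_eq0 eq_le normr_ge0 andbT real_leNgt ?normr_real ?real0 //.
apply/negP => Hw0; have h2 : (2%:R^-1 : C) < 1 by rewrite invf_lt1 ?ltr0n // ltr1n.
have hp : 0 < `|H w| / (2%:R * (2%:R * M + 1)).
  by rewrite divr_gt0 // mulr_gt0 ?ltr0n // ltr_wpDl // mulr_ge0.
have [|n hn] := pow_small arch (_ : 0 <= 2%:R^-1) h2 hp; first by rewrite invr_ge0.
have := bound n; apply/negP; rewrite -real_ltNge ?normr_real //; last first.
  by rewrite ger0_real // !mulr_ge0 // exprn_ge0 // invr_ge0.
apply: (@le_lt_trans _ _ (2%:R * M * (`|H w| / (2%:R * (2%:R * M + 1))))).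
  by apply: ler_wpM2l => //; rewrite mulr_ge0.
have M1 : 0 < 2%:R * M + 1 by rewrite ltr_wpDl // mulr_ge0.
rewrite mulrA ltr_pdivrMr ?mulr_gt0 ?ltr0n // mulrC ltr_pM2l //.
apply: (@lt_le_trans _ _ (2%:R * M + 1)); first by rewrite ltrDl.
by rewrite ler_peMl ?ler1n // ltW.
Qed.

End Goursat.

(** * Convergent power series *)

Section PowerSums.
Variable C : numClosedFieldType.
Hypothesis arch : forall x : C, exists k : nat, `|x| <= k%:R.
Hypothesis complete : forall (u : nat -> C) (b t : C), 0 <= t -> t < 1 ->
  (forall m n, (m <= n)%N -> `|u n - u m| <= b * t ^+ m) ->
  exists l, forall m, `|l - u m| <= b * t ^+ m.
Implicit Types (a b : nat -> C) (s z w l : C) (N : nat).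

Definition psum a z N := \sum_(k < N) a k * z ^+ k.

(** Absolute convergence at radius s, expressed by a bound for all partial sums, so that no limit is
    involved. *)
Definition bsum s a (B : C) := forall N, \sum_(k < N) `|a k| * s ^+ k <= B.

Lemma bsum_ge0 s a B : bsum s a B -> 0 <= B.
Proof. by move=> /(_ 0%N); rewrite big_ord0. Qed.

Lemma bsum_mono s s' a B : 0 <= s' -> s' <= s -> bsum s a B -> bsum s' a B.
Proof.
move=> s0 ss h N; apply: le_trans (h N); apply: ler_sum => k _.
by apply: ler_wpM2l => //; apply: lerXn2r; rewrite ?nnegrE // (le_trans s0).
Qed.

Lemma tail_bound s a B z m n : 0 < s -> bsum s a B -> `|z| <= s -> (m <= n)%N ->
  `|psum a z n - psum a z m| <= B * (`|z| / s) ^+ m.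
Proof.
move=> s0 hB zs mn; have zs1 : `|z| / s <= 1 by rewrite ler_pdivrMr ?mul1r.
have zs0 : 0 <= `|z| / s by rewrite divr_ge0 // ltW.
have -> : psum a z n = psum a z m + \sum_(m <= k < n) a k * z ^+ k.
  by rewrite /psum -!(big_mkord xpredT (fun k => a k * z ^+ k)) (big_cat_nat (n := m)).
rewrite addrAC subrr add0r.
apply: le_trans (ler_norm_sum _ _ _) _.
apply: (@le_trans _ _ (\sum_(m <= k < n) `|a k| * s ^+ k * (`|z| / s) ^+ m)).
  rewrite big_nat_cond [leRHS]big_nat_cond; apply: ler_sum => k /andP[/andP[mk _] _].
  rewrite normrM normrX -mulrA; apply: ler_wpM2l => //.
  rewrite (_ : `|z| ^+ k = s ^+ k * (`|z| / s) ^+ k).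
    by apply: ler_wpM2l; [rewrite exprn_ge0 // ltW|exact: ler_wiXn2l].
  by rewrite -exprMn mulrC divfK // lt0r_neq0.
rewrite -mulr_suml; apply: ler_wpM2r; first exact: exprn_ge0.
apply: le_trans (hB n); rewrite -(big_mkord xpredT (fun k => `|a k| * s ^+ k)) [leRHS](big_cat_nat (n := m)) //=.
by rewrite lerDr sumr_ge0 // => k _; rewrite mulr_ge0 // exprn_ge0 // ltW.
Qed.

Lemma psum_limit s a B z : 0 < s -> bsum s a B -> `|z| < s ->
  exists l, forall N, `|l - psum a z N| <= B * (`|z| / s) ^+ N.
Proof.
move=> s0 hB zs; apply: complete => [||m n mn].
- by rewrite divr_ge0 // ltW.
- by rewrite ltr_pdivrMr ?mul1r.
- by apply: tail_bound => //; exact: ltW.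
Qed.

(** Passage to the limit in inequalities: all convergence below is geometric with an explicit
    ratio. *)
Lemma geom_le (x y B t : C) : 0 <= t -> t < 1 -> x \is Num.real -> y \is Num.real -> 0 <= B ->
  (forall N, x <= y + B * t ^+ N) -> x <= y.
Proof.
move=> t0 t1 xr yr B0 h; rewrite real_leNgt //; apply/negP => yx.
have e0 : 0 < (x - y) / (2%:R * (B + 1)).
  by rewrite divr_gt0 ?subr_gt0 // mulr_gt0 ?ltr0n // ltr_wpDl.
have [N hN] := pow_small arch t0 t1 e0; have := h N; rewrite -lerBlDl => h1.
have B1 : 0 < B + 1 by rewrite ltr_wpDl.
have : B * t ^+ N <= (x - y) / 2%:R.
  apply: (@le_trans _ _ ((B + 1) * ((x - y) / (2%:R * (B + 1))))).
    by apply: ler_pM; rewrite ?exprn_ge0 // lerDl.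
  by rewrite le_eqVlt; apply/orP; left; apply/eqP; field; rewrite lt0r_neq0.
move=> /(le_trans h1); rewrite ler_pdivlMr ?ltr0n // mulr_natr mulr2n gerDl => h2.
by move: yx; rewrite -subr_gt0 => /lt_le_trans/(_ h2); rewrite ltxx.
Qed.

Lemma limit_unique l l' (B B' t : C) (u : nat -> C) : 0 <= t -> t < 1 ->
  (forall N, `|l - u N| <= B * t ^+ N) -> (forall N, `|l' - u N| <= B' * t ^+ N) -> l = l'.
Proof.
move=> t0 t1 h h'; apply/eqP; rewrite -subr_eq0 -normr_eq0 eq_le normr_ge0 andbT.
have B0 : 0 <= B by have := h 0%N; rewrite expr0 mulr1; apply: le_trans.
have B0' : 0 <= B' by have := h' 0%N; rewrite expr0 mulr1; apply: le_trans.
apply: (@geom_le _ _ (B + B') t); rewrite ?normr_real ?real0 ?addr_ge0 // => N.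
rewrite add0r mulrDl (_ : l - l' = (l - u N) - (l' - u N)); last by ring.
by apply: le_trans (ler_normB _ _) _; apply: lerD.
Qed.

Section Evaluation.
Variables (K : fieldType) (iota : {rmorphism K -> C}) (s z : C).
Hypothesis s0 : 0 < s.
Hypothesis zs : `|z| < s.
Local Notation t := (`|z| / s).
Local Notation cf f := (fun k => iota (pcoef f k)).

Let t0 : 0 <= t. Proof. by rewrite divr_ge0 // ltW. Qed.
Let t1 : t < 1. Proof. by rewrite ltr_pdivrMr ?mul1r. Qed.

(** A value with its rate of convergence. The ratio |z| / s depends on the radius, which is
    therefore a parameter; [evals_radius] makes it smaller. *)
Definition evals (f : powser K) l :=
  (exists B, bsum s (cf f) B) /\ (exists B, forall N, `|l - psum (cf f) z N| <= B * t ^+ N).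

Lemma evals_unique f l l' : evals f l -> evals f l' -> l = l'.
Proof. by move=> [_ [B h]] [_ [B' h']]; exact: (limit_unique t0 t1 h h'). Qed.

Lemma evals_poly (p : {poly K}) : evals (ps_of_poly p) (map_poly iota p).[z].
Proof.
have key (g : nat -> C) N : (forall k, (size p <= k)%N -> g k = 0) -> (size p <= N)%N ->
    \sum_(k < N) g k = \sum_(k < size p) g k.
  move=> hg hN; rewrite -!(big_mkord xpredT g) (big_cat_nat (n := size p)) //= addrC.
  by rewrite big_nat_cond big1 ?add0r // => k /andP[/andP[h _] _]; exact: hg.
have val0 k : (size p <= k)%N -> iota p`_k = 0.
  by move=> h; rewrite nth_default // rmorph0.
pose B := \sum_(k < size p) `|iota p`_k| * s ^+ k; split.
  exists B => N; have [h|h] := leqP (size p) N.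
    by rewrite /= (key (fun k => `|iota p`_k| * s ^+ k)) // => k /val0 ->; rewrite normr0 mul0r.
  rewrite /B -!(big_mkord xpredT (fun k => `|iota p`_k| * s ^+ k)) [leRHS](big_cat_nat (n := N)) ?(ltnW h) //=.
  by rewrite lerDl sumr_ge0 // => k _; rewrite mulr_ge0 // exprn_ge0 // ltW.
have E : (map_poly iota p).[z] = \sum_(k < size p) iota p`_k * z ^+ k.
  rewrite (@horner_coef_wide _ (size p)) ?size_map_poly //.
  by apply: eq_bigr => k _; rewrite coef_map.
have hB : bsum s (fun k => iota p`_k) B.
  move=> N; have [h|h] := leqP (size p) N.
    by rewrite /= (key (fun k => `|iota p`_k| * s ^+ k)) // => k /val0 ->; rewrite normr0 mul0r.
  rewrite /B -!(big_mkord xpredT (fun k => `|iota p`_k| * s ^+ k)) [leRHS](big_cat_nat (n := N)) ?(ltnW h) //=.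
  by rewrite lerDl sumr_ge0 // => k _; rewrite mulr_ge0 // exprn_ge0 // ltW.
exists B => N; rewrite E /=.
have [h|h] := leqP (size p) N.
  have -> : psum (fun k => iota p`_k) z N = \sum_(k < size p) iota p`_k * z ^+ k.
    by apply: (key (fun k => iota p`_k * z ^+ k)) => // k /val0 ->; rewrite mul0r.
  by rewrite subrr normr0 mulr_ge0 ?exprn_ge0 // (bsum_ge0 hB).
exact: (tail_bound s0 hB (ltW zs) (ltnW h)).
Qed.

Lemma psumD f g N : psum (cf (f + g)) z N = psum (cf f) z N + psum (cf g) z N.
Proof. by rewrite /psum -big_split; apply: eq_bigr => k _ /=; rewrite rmorphD mulrDl. Qed.

Lemma evalsD f g l l' : evals f l -> evals g l' -> evals (f + g) (l + l').
Proof.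
move=> [[B hB] [M hM]] [[B' hB'] [M' hM']]; split.
  exists (B + B') => N; apply: (@le_trans _ _ (\sum_(k < N) (`|iota (pcoef f k)| * s ^+ k + `|iota (pcoef g k)| * s ^+ k))).
    apply: ler_sum => k _; rewrite -mulrDl /= rmorphD; apply: ler_wpM2r; last exact: ler_normD.
    by rewrite exprn_ge0 // ltW.
  by rewrite big_split; apply: lerD.
exists (M + M') => N; rewrite psumD mulrDl (_ : _ - _ = (l - psum (cf f) z N) + (l' - psum (cf g) z N)); last by ring.
by apply: le_trans (ler_normD _ _) _; apply: lerD.
Qed.

Lemma conv_sum (G : nat -> nat -> C) N :
  \sum_(k < N) \sum_(i < k.+1) G i (k - i)%N = \sum_(i < N) \sum_(j < N | (i + j < N)%N) G i j.
Proof.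
transitivity (\sum_(i < N) \sum_(j < N - i) G i j).
  elim: N => [|N IH]; first by rewrite !big_ord0.
  rewrite big_ord_recr /= IH [in RHS]big_ord_recr /= subSnn big_ord1.
  under [X in _ = X + _]eq_bigr => i _ do rewrite subSn ?(ltnW (ltn_ord i)) // big_ord_recr.
  rewrite big_split /= -addrA; congr (_ + _).
  by rewrite big_ord_recr /= subnn.
apply: eq_bigr => i _; rewrite (big_ord_widen N (fun j => G i j)) ?leq_subr //.
by apply: eq_bigl => j; rewrite ltn_subRL.
Qed.

(* The discrepancy between the product of two partial sums and the partial sum of the
   Cauchy product only involves monomials of degree at least N. *)
Lemma cauchy_gap (a b : nat -> C) x y N : 0 < x -> `|y| <= x ->
  `|psum a y N * psum b y N - psum (fun k => \sum_(i < k.+1) a i * b (k - i)%N) y N| <=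
  (\sum_(k < N) `|a k| * x ^+ k) * (\sum_(k < N) `|b k| * x ^+ k) * (`|y| / x) ^+ N.
Proof.
move=> x0 yx; pose pr (i j : 'I_N) := (i + j < N)%N.
have E : psum (fun k => \sum_(i < k.+1) a i * b (k - i)%N) y N =
    \sum_(i < N) \sum_(j < N | pr i j) a i * y ^+ i * (b j * y ^+ j).
  rewrite -(conv_sum (fun i j => a i * y ^+ i * (b j * y ^+ j))); apply: eq_bigr => k _.
  rewrite mulr_suml; apply: eq_bigr => i _; rewrite mulrACA -exprD subnKC //.
  by rewrite -ltnS.
rewrite E /psum big_distrlr /= -sumrB.
apply: le_trans (ler_norm_sum _ _ _) _; rewrite big_distrlr /= mulr_suml; apply: ler_sum => i _.
rewrite [X in X - _](bigID (pr i)) /= addrAC subrr add0r mulr_suml; apply: le_trans (ler_norm_sum _ _ _) _.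
rewrite big_mkcond; apply: ler_sum => j _; have yx0 : 0 <= `|y| / x by rewrite divr_ge0 // ltW.
have nn : 0 <= `|a i| * x ^+ i * (`|b j| * x ^+ j).
  by rewrite !mulr_ge0 ?exprn_ge0 // ltW.
rewrite /pr -leqNgt; case: ifP => [h|_]; last by rewrite mulr_ge0 // exprn_ge0.
rewrite (_ : `|a i * y ^+ i * (b j * y ^+ j)| = `|a i| * x ^+ i * (`|b j| * x ^+ j) * (`|y| / x) ^+ (i + j)).
  by apply: ler_wpM2l => //; apply: ler_wiXn2l => //; rewrite ler_pdivrMr ?mul1r.
have xn k : x ^+ k * (`|y| / x) ^+ k = `|y| ^+ k by rewrite -exprMn mulrC divfK // lt0r_neq0.
by rewrite !normrM !normrX exprD -!xn; ring.
Qed.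

Lemma evalsM f g l l' : evals f l -> evals g l' -> evals (f * g) (l * l').
Proof.
move=> [[B hB] [M hM]] [[B' hB'] [M' hM']].
have cE k : iota (pcoef (f * g) k) = \sum_(i < k.+1) iota (pcoef f i) * iota (pcoef g (k - i)%N).
  by rewrite /= rmorph_sum; apply: eq_bigr => i _; rewrite rmorphM.
have B0 := bsum_ge0 hB; have B0' := bsum_ge0 hB'.
have M0 : 0 <= M by have := hM 0%N; rewrite expr0 mulr1; apply: le_trans.
have M0' : 0 <= M' by have := hM' 0%N; rewrite expr0 mulr1; apply: le_trans.
split.
  exists (B * B') => N; apply: (@le_trans _ _ ((\sum_(k < N) `|cf f k| * s ^+ k) * (\sum_(k < N) `|cf g k| * s ^+ k))).
    apply: (@le_trans _ _ (\sum_(k < N) \sum_(i < k.+1) `|cf f i| * s ^+ i * (`|cf g (k - i)%N| * s ^+ (k - i)))).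
      apply: ler_sum => k _; rewrite cE; apply: (@le_trans _ _ ((\sum_(i < k.+1) `|cf f i * cf g (k - i)%N|) * s ^+ k)).
        by apply: ler_wpM2r; [rewrite exprn_ge0 // ltW|exact: ler_norm_sum].
      rewrite mulr_suml le_eqVlt; apply/orP; left; apply/eqP; apply: eq_bigr => i _.
      by rewrite normrM mulrACA -exprD subnKC // -ltnS.
    rewrite (conv_sum (fun i j => `|cf f i| * s ^+ i * (`|cf g j| * s ^+ j))) big_distrlr /=.
    apply: ler_sum => i _; rewrite [leRHS](bigID (fun j : 'I_N => (i + j < N)%N)) /= lerDl.
    by apply: sumr_ge0 => j _; rewrite !mulr_ge0 ?exprn_ge0 // ltW.
  by apply: ler_pM => //; apply: sumr_ge0 => k _; rewrite mulr_ge0 // exprn_ge0 // ltW.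
exists (M * `|l'| + (`|l| + M) * M' + B * B') => N.
set Sa := psum (cf f) z N; set Sb := psum (cf g) z N.
have tN0 : 0 <= t ^+ N by exact: exprn_ge0.
have Sab : `|Sa| <= `|l| + M.
  rewrite (_ : Sa = l - (l - Sa)); last by ring.
  apply: le_trans (ler_normB _ _) _; rewrite lerD2l; apply: le_trans (hM N) _.
  by rewrite ler_piMr // exprn_ile1 // ltW.
have gap := cauchy_gap (cf f) (cf g) N s0 (ltW zs).
have cpE : psum (cf (f * g)) z N = psum (fun k => \sum_(i < k.+1) cf f i * cf g (k - i)%N) z N.
  by apply: eq_bigr => k _; rewrite cE.
rewrite cpE (_ : l * l' - _ = (l - Sa) * l' + Sa * (l' - Sb) + (Sa * Sb - psum (fun k => \sum_(i < k.+1) cf f i * cf g (k - i)%N) z N)); last by ring.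
apply: le_trans (ler_normD _ _) _; rewrite [leRHS]mulrDl; apply: lerD; last first.
  apply: le_trans gap _; apply: ler_wpM2r => //; apply: ler_pM => //;
  by apply: sumr_ge0 => k _; rewrite mulr_ge0 // exprn_ge0 // ltW.
apply: le_trans (ler_normD _ _) _; rewrite [leRHS]mulrDl !normrM; apply: lerD.
  by rewrite [leRHS]mulrAC; apply: ler_wpM2r => //; exact: hM.
by rewrite -[leRHS]mulrA; apply: ler_pM => //; exact: hM'.
Qed.

Lemma evals_psc c : evals (psc K c) (iota c).
Proof. by have := evals_poly c%:P; rewrite map_polyC hornerC. Qed.

Lemma evals_mmap n (S : 'I_n -> powser K) (l : 'I_n -> C) (Q : mpoly n K) :
  (forall v, evals (S v) (l v)) -> evals (mmap (@psc K) S Q) (mmap iota l Q).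
Proof.
move=> h; have e1 : evals 1 1 by have := evals_psc 1; rewrite !rmorph1.
have e0 : evals 0 0 by have := evals_psc 0; rewrite !rmorph0.
rewrite /mmap; elim: (msupp Q : seq _) => [|m ms IH]; first by rewrite !big_nil.
rewrite !big_cons; apply: evalsD => //; apply: evalsM; first exact: evals_psc.
rewrite /mmap1; elim: (index_enum _) => [|v vs IHv]; first by rewrite !big_nil.
rewrite !big_cons; apply: evalsM => //.
by elim: (m v) => [|k IHk]; rewrite ?expr0 // !exprS; exact: evalsM.
Qed.

Lemma evals_ex f B : bsum s (cf f) B -> exists l, evals f l.
Proof.
move=> hB; have [l hl] := psum_limit s0 hB zs; exists l; split; [by exists B|by exists B].
Qed.

End Evaluation.

(** Below N there are (N + q - 1) div q multiples of q. [G] is the identity for values and the norm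
    for absolute sums. *)
Lemma psum_subst (K : fieldType) (iota : {rmorphism K -> C}) (f : powser K) q z (G : C -> C) N :
  (0 < q)%N -> G 0 = 0 ->
  \sum_(k < N) G (iota (pcoef (ps_subst q f) k)) * z ^+ k =
  \sum_(j < (N + q.-1) %/ q) G (iota (pcoef f j)) * (z ^+ q) ^+ j.
Proof.
move=> q0 G0; elim: N => [|N IH].
  by rewrite big_ord0 add0n divn_small ?big_ord0 // prednK.
rewrite big_ord_recr /= IH; case: ifP => [/dvdnP[j Nj]|nd].
  have e1 : ((N + q.-1) %/ q = j)%N by rewrite Nj divnMDl // divn_small ?addn0 // prednK.
  have e2 : ((N.+1 + q.-1) %/ q = j.+1)%N by rewrite Nj addSnnS prednK // -mulSnr mulnK.
  by rewrite e1 e2 Nj mulnK // big_ord_recr /= -exprM mulnC.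
suff -> : ((N.+1 + q.-1) %/ q = (N + q.-1) %/ q)%N by rewrite rmorph0 G0 mul0r addr0.
rewrite addSnnS prednK // divnDr ?dvdnn // divnn q0.
rewrite [in RHS](divn_eq N q) -addnA divnMDl //; congr (_ + _)%N.
have r0 : (0 < N %% q)%N by rewrite lt0n; move: nd; rewrite /dvdn => ->.
have rq : (N %% q < q)%N by rewrite ltn_mod.
apply/eqP; rewrite eqn_leq; apply/andP; split.
  by rewrite divn_gt0 //; lia.
by rewrite -ltnS ltn_divLR //; lia.
Qed.

Lemma evals_subst (K : fieldType) (iota : {rmorphism K -> C}) s z (f : powser K) q l :
  0 < s -> s <= 1 -> `|z| < s -> (0 < q)%N -> evals iota s (z ^+ q) f l -> evals iota s z (ps_subst q f) l.
Proof.
move=> s0 s1 zs q0 [[B hB] [M hM]].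
split.
  exists B => N; rewrite (@psum_subst K iota f q s (fun x => `|x|) N q0 (normr0 _)).
  apply: le_trans (hB ((N + q.-1) %/ q)%N); apply: ler_sum => j _; apply: ler_wpM2l => //.
  apply: lerXn2r; rewrite ?nnegrE ?exprn_ge0 ?(ltW s0) //.
  by rewrite -[leRHS]expr1; apply: ler_wiXn2l => //; exact: ltW.
exists M => N; have := hM ((N + q.-1) %/ q)%N.
rewrite /psum -(@psum_subst K iota f q z id N q0 erefl) => /le_trans; apply.
have M0 : 0 <= M by have := hM 0%N; rewrite expr0 mulr1; apply: le_trans.
apply: ler_wpM2l => //; have t0 : 0 <= `|z| / s by rewrite divr_ge0 // ltW.
have t1 : `|z| / s <= 1 by rewrite ler_pdivrMr // mul1r ltW.
apply: (@le_trans _ _ (((`|z| / s) ^+ q) ^+ ((N + q.-1) %/ q))).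
  apply: lerXn2r; rewrite ?nnegrE ?exprn_ge0 ?divr_ge0 ?(ltW s0) //.
  rewrite normrX expr_div_n; apply: ler_wpM2l; first exact: exprn_ge0.
  rewrite lef_pV2 ?posrE ?exprn_gt0 // -[leRHS]expr1; apply: ler_wiXn2l => //; exact: ltW.
rewrite -exprM; apply: ler_wiXn2l => //.
have := ltn_ceil (N + q.-1) q0; rewrite mulSn (mulnC _ q); lia.
Qed.

(** * Taylor expansion *)

Section Taylor.
Variables (K : fieldType) (iota : {rmorphism K -> C}).
Local Notation cf f := (fun k => iota (pcoef f k)).

(** The i-th derivative divided by i!, which keeps factorials out of Taylor's formula and its
    bounds. *)
Definition hasse i (f : powser K) := PowSer (fun k => pcoef f (i + k)%N *+ 'C(i + k, i)).
Definition hcoef i a := fun k => a (i + k)%N *+ 'C(i + k, i) : C.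

Lemma hasseE i f : cf (hasse i f) = hcoef i (cf f).
Proof. by apply/funext => k; rewrite /= rmorphMn. Qed.

Lemma hasse0 f : hasse 0 f = f.
Proof. by apply: powserP => k; rewrite /= bin0. Qed.

Lemma hasse_psum a i z N :
  psum (hcoef i a) z N = \sum_(n < i + N) (a n *+ 'C(n, i)) * z ^+ (n - i).
Proof.
rewrite big_split_ord /= big1 ?add0r => [|k _]; last by rewrite bin_small ?mulr0n ?mul0r.
by apply: eq_bigr => k _; rewrite addKn.
Qed.

Lemma exprDn_wide (x y : C) n m :
  (x + y) ^+ n = \sum_(i < m + n.+1) (x ^+ (n - i) * y ^+ i) *+ 'C(n, i).
Proof.
rewrite exprDn (big_ord_widen (m + n.+1) (fun i => (x ^+ (n - i) * y ^+ i) *+ 'C(n, i))) ?leq_addl //.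
rewrite big_mkcond; apply: eq_bigr => i _; rewrite ltnS; case: leqP => // h.
by rewrite bin_small ?mulr0n.
Qed.

Lemma bin_term_le (x y : C) n i : 0 <= x -> 0 <= y -> (x ^+ (n - i) * y ^+ i) *+ 'C(n, i) <= (x + y) ^+ n.
Proof.
move=> x0 y0; have hi : (i < i.+1 + n.+1)%N by rewrite addSn ltnS leq_addr.
rewrite (exprDn_wide x y n i.+1) (bigD1 (Ordinal hi)) //= lerDl.
by apply: sumr_ge0 => k _; rewrite mulrn_wge0 // mulr_ge0 // exprn_ge0.
Qed.

(** The number C(i+k, i) s'^k d^i is one term of the expansion of (s' + d)^(i+k), which is at most
    s^(i+k). *)
Lemma hasse_bsum a s s' d B i : 0 <= s' -> 0 < d -> s' + d <= s -> bsum s a B ->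
  bsum s' (hcoef i a) (B / d ^+ i).
Proof.
move=> s0 d0 sd hB N; rewrite ler_pdivlMr ?exprn_gt0 // mulr_suml.
apply: le_trans (hB (i + N)%N); rewrite big_split_ord /=; apply: ler_wpDl.
  by apply: sumr_ge0 => k _; rewrite mulr_ge0 // exprn_ge0 // (le_trans _ sd) // addr_ge0 // ltW.
apply: ler_sum => k _; rewrite /hcoef normrMn -mulrA mulrnAl -mulrnAr; apply: ler_wpM2l => //.
apply: (@le_trans _ _ ((s' + d) ^+ (i + k))).
  by have := bin_term_le (i + k) i s0 (ltW d0); rewrite addKn.
by apply: lerXn2r; rewrite ?nnegrE // ?addr_ge0 ?(ltW d0) // (le_trans _ sd) // addr_ge0 // ltW.
Qed.

(** The terms of (z + h)^n beyond h^mu are majorised by the same terms of (s' + d)^n, and the factor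
    (|h| / d)^(mu+1) is gained. *)
Lemma taylor_remainder a s s' d B z h mu N : 0 <= s' -> 0 < d -> s' + d <= s -> bsum s a B ->
  `|z| <= s' -> `|h| <= d ->
  `|psum a (z + h) (mu.+1 + N) -
     \sum_(i < mu.+1) psum (hcoef i a) z (mu.+1 + N - i) * h ^+ i| <= B * (`|h| / d) ^+ mu.+1.
Proof.
move=> s0 d0 sd hB zs hd.
have -> : \sum_(i < mu.+1) psum (hcoef i a) z (mu.+1 + N - i) * h ^+ i =
    \sum_(n < mu.+1 + N) a n * \sum_(i < mu.+1) (z ^+ (n - i) * h ^+ i) *+ 'C(n, i).
  under eq_bigr => i _.
    rewrite hasse_psum subnKC; last by rewrite (leq_trans (ltnW (ltn_ord i))) ?leq_addr.
    rewrite mulr_suml; over.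
  rewrite exchange_big; apply: eq_bigr => n _; rewrite mulr_sumr; apply: eq_bigr => i _.
  by rewrite mulrnAl mulrnAr mulrnAl mulrA.
rewrite /psum -sumrB; apply: le_trans (ler_norm_sum _ _ _) _.
apply: (@le_trans _ _ (\sum_(n < mu.+1 + N) `|a n| * s ^+ n * (`|h| / d) ^+ mu.+1)); last first.
  by rewrite -mulr_suml; apply: ler_wpM2r; [rewrite exprn_ge0 // divr_ge0 // ltW|exact: hB].
apply: ler_sum => n _; rewrite -mulrBr normrM -mulrA; apply: ler_wpM2l => //.
rewrite (exprDn_wide z h n mu.+1) big_split_ord /= addrAC subrr add0r.
apply: le_trans (ler_norm_sum _ _ _) _.
apply: (@le_trans _ _ ((s' + d) ^+ n * (`|h| / d) ^+ mu.+1)); last first.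
  apply: ler_wpM2r; first by rewrite exprn_ge0 // divr_ge0 // ltW.
  by apply: lerXn2r; rewrite ?nnegrE // ?addr_ge0 ?(ltW d0) // (le_trans _ sd) // addr_ge0 // ltW.
apply: (@le_trans _ _ ((\sum_(j < n.+1) (s' ^+ (n - (mu.+1 + j)) * d ^+ (mu.+1 + j)) *+ 'C(n, mu.+1 + j)) * (`|h| / d) ^+ mu.+1)); last first.
  apply: ler_wpM2r; first by rewrite exprn_ge0 // divr_ge0 // ltW.
  rewrite (exprDn_wide s' d n mu.+1) big_split_ord /= lerDr.
  by apply: sumr_ge0 => k _; rewrite mulrn_wge0 // mulr_ge0 // exprn_ge0 // ltW.
rewrite mulr_suml; apply: ler_sum => j _; rewrite normrMn mulrnAl; apply: ler_wMn2r.
rewrite normrM !normrX -mulrA; apply: ler_pM; rewrite ?exprn_ge0 //.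
  by apply: lerXn2r; rewrite ?nnegrE.
have -> : d ^+ (mu.+1 + j) * (`|h| / d) ^+ mu.+1 = `|h| ^+ mu.+1 * d ^+ j.
  by rewrite expr_div_n exprD; field; rewrite expf_neq0 // lt0r_neq0.
rewrite exprD; apply: ler_wpM2l; rewrite ?exprn_ge0 //.
by apply: lerXn2r; rewrite ?nnegrE // ltW.
Qed.

Lemma taylor (f : powser K) s s' d B z mu (D : 'I_mu.+1 -> C) : 0 < s' -> 0 < d -> s' + d <= s ->
  bsum s (cf f) B -> `|z| < s' -> (forall i : 'I_mu.+1, evals iota s' z (hasse i f) (D i)) ->
  forall h l, `|h| <= d -> `|z + h| < s' -> evals iota s' (z + h) f l ->
  `|l - \sum_i D i * h ^+ i| <= B * (`|h| / d) ^+ mu.+1.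
Proof.
move=> s0 d0 sd hB zs hD h l hd zhs [_ [M0 hM0]].
have /choice[M hM] : forall i, exists B', forall N, `|D i - psum (cf (hasse i f)) z N| <= B' * (`|z| / s') ^+ N.
  by move=> i; case: (hD i).
(* t = 1 - (1 - t1)(1 - t2) is a common ratio below 1 that dominates both t1 and t2. *)
pose t1 := `|z| / s'; pose t2 := `|z + h| / s'; pose t := t1 + t2 - t1 * t2.
have t10 : 0 <= t1 by rewrite divr_ge0 // ltW.
have t20 : 0 <= t2 by rewrite divr_ge0 // ltW.
have t11 : t1 < 1 by rewrite ltr_pdivrMr ?mul1r.
have t21 : t2 < 1 by rewrite ltr_pdivrMr ?mul1r.
have tt1 : t1 <= t.
  by rewrite /t -addrA lerDl -{1}[t2]mul1r -mulrBl mulr_ge0 // subr_ge0 ltW.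
have tt2 : t2 <= t.
  by rewrite /t addrAC lerDr -{1}[t1]mulr1 -mulrBr mulr_ge0 // subr_ge0 ltW.
have t1' : t < 1.
  rewrite -subr_gt0 (_ : 1 - t = (1 - t1) * (1 - t2)); last by rewrite /t; ring.
  by rewrite mulr_gt0 // subr_gt0.
have M0p : 0 <= M0 by have := hM0 0%N; rewrite expr0 mulr1; apply: le_trans.
have Mp i : 0 <= M i by have := hM i 0%N; rewrite expr0 mulr1; apply: le_trans.
apply: (@geom_le _ _ (M0 + \sum_i M i * `|h| ^+ i) t) => //.
- exact: le_trans tt1.
- by apply: ger0_real; rewrite mulr_ge0 ?(bsum_ge0 hB) // exprn_ge0 // divr_ge0 // ltW.
- by apply: addr_ge0 => //; apply: sumr_ge0 => i _; rewrite mulr_ge0 // exprn_ge0.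
move=> N; pose N' := (mu.+1 + N)%N.
have tr := taylor_remainder mu N (ltW s0) d0 sd hB (ltW zs) hd.
have E : l - \sum_i D i * h ^+ i =
   (psum (cf f) (z + h) N' - \sum_(i < mu.+1) psum (hcoef i (cf f)) z (N' - i) * h ^+ i) +
   ((l - psum (cf f) (z + h) N') - \sum_i (D i - psum (hcoef i (cf f)) z (N' - i)) * h ^+ i).
  under [X in _ = _ + (_ - X)]eq_bigr => i _ do rewrite mulrBl.
  rewrite sumrB; move: (\sum_i D i * _) (\sum_(i < _) psum _ _ _ * _) => x y; ring.
rewrite E; apply: le_trans (ler_normD _ _) _; apply: lerD => //.
apply: le_trans (ler_normB _ _) _; rewrite mulrDl; apply: lerD.
  apply: le_trans (hM0 N') _; apply: ler_wpM2l => //.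
  apply: (@le_trans _ _ (t2 ^+ N)); first by apply: ler_wiXn2l; rewrite ?(ltW t21) // leq_addl.
  by apply: lerXn2r; rewrite ?nnegrE // (le_trans t20).
apply: le_trans (ler_norm_sum _ _ _) _; rewrite mulr_suml; apply: ler_sum => i _.
rewrite normrM normrX mulrAC; apply: ler_wpM2r; first exact: exprn_ge0.
rewrite -hasseE; apply: le_trans (hM i _) _; apply: ler_wpM2l => //.
apply: (@le_trans _ _ (t1 ^+ N)).
  apply: ler_wiXn2l; rewrite ?(ltW t11) //.
  by rewrite /N' addnC -addnBA ?leq_addr // ltnW.
by apply: lerXn2r; rewrite ?nnegrE // (le_trans t10).
Qed.

Lemma hasse_evals_ex (f : powser K) s s' d B z i : 0 < s' -> 0 < d -> s' + d <= s ->
  bsum s (cf f) B -> `|z| < s' -> exists l, evals iota s' z (hasse i f) l.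
Proof.
move=> s0 d0 sd hB zs; have hb := hasse_bsum i (ltW s0) d0 sd hB.
by apply: (@evals_ex K iota s' z s0 zs _ (B / d ^+ i)); rewrite hasseE.
Qed.

Lemma evals_cdiff (f : powser K) s s' d B (G : C -> C) z : 0 < s' -> 0 < d -> s' + d <= s ->
  bsum s (cf f) B -> `|z| < s' -> (forall w, `|w| < s' -> evals iota s' w f (G w)) -> cdiff G z.
Proof.
move=> s0 d0 sd hB zs hG.
have /choice[D hD] : forall i : 'I_2, exists l, evals iota s' z (hasse i f) l.
  by move=> i; exact: (hasse_evals_ex i s0 d0 sd hB zs).
have D0 : D ord0 = G z.
  by apply: (evals_unique s0 zs (hD ord0)); rewrite hasse0; exact: hG.
exists (D (lift ord0 ord0)) => e e0.
have B0 := bsum_ge0 hB; have B1 : 0 < B + 1 by rewrite ltr_wpDl.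
have zs' : 0 < s' - `|z| by rewrite subr_gt0.
have ed : 0 < e * d ^+ 2 / (B + 1) by rewrite divr_gt0 // mulr_gt0 // exprn_gt0.
have [d1 d10 [d1d d1z]] := cmin d0 zs'; have [d2 d20 [d21 d2e]] := cmin d10 ed.
exists d2 => // w hw; have wz : z + (w - z) = w by rewrite addrC subrK.
have hwd : `|w - z| <= d by apply: ltW; apply: lt_le_trans hw _; exact: le_trans d1d.
have hws : `|z + (w - z)| < s'.
  apply: le_lt_trans (ler_normD _ _) _; rewrite addrC -ltrBrDr.
  by apply: lt_le_trans hw _; exact: le_trans d1z.
have := taylor s0 d0 sd hB zs hD hwd hws; rewrite wz in hws *; move=> /(_ (G w) (hG w hws)).
rewrite !big_ord_recl big_ord0 D0 /= expr0 mulr1 addr0 opprD addrA expr1 => /le_trans; apply.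
have Bx : B * `|w - z| <= e * d ^+ 2.
  apply: (@le_trans _ _ (`|w - z| * (B + 1))); first by rewrite mulrC ler_wpM2l // lerDl.
  by rewrite -ler_pdivlMr // ltW // (lt_le_trans hw).
rewrite expr_div_n mulrA ler_pdivrMr ?exprn_gt0 // expr2 mulrA (mulrAC e).
by apply: ler_wpM2r.
Qed.

End Taylor.

End PowerSums.

(** * Mahler systems *)

Section Formal.
Variable K : fieldType.
Implicit Types (f g : powser K) (p : {poly K}).

Lemma ps_subst_comp a b f : (0 < a)%N -> (0 < b)%N -> ps_subst a (ps_subst b f) = ps_subst (a * b) f.
Proof.
move=> a0 b0; apply: powserP => n /=; have [/dvdnP[k ->]|na] := boolP (a %| n)%N.
  by rewrite mulnK // (mulnC k a) dvdn_pmul2l // divnMl.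
by case: ifP => // /(dvdn_trans (dvdn_mulr b (dvdnn a))) h; rewrite h in na.
Qed.

Lemma ps_subst_sum a (I : Type) (s : seq I) (F : I -> powser K) :
  ps_subst a (\sum_(i <- s) F i) = \sum_(i <- s) ps_subst a (F i).
Proof.
elim: s => [|i s IH]; last by rewrite !big_cons ps_substD IH.
by rewrite !big_nil; apply: powserP => n /=; rewrite !coef0; case: ifP.
Qed.

Definition ps_deriv f := PowSer (fun n => pcoef f n.+1 *+ n.+1).

Lemma ps_derivD f g : ps_deriv (f + g) = ps_deriv f + ps_deriv g.
Proof. by apply: powserP => n /=; rewrite mulrnDl. Qed.

Lemma ps_deriv_sum (I : Type) (s : seq I) (F : I -> powser K) :
  ps_deriv (\sum_(i <- s) F i) = \sum_(i <- s) ps_deriv (F i).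
Proof.
elim: s => [|i s IH]; last by rewrite !big_cons ps_derivD IH.
by rewrite !big_nil; apply: powserP => n /=; rewrite !coef0 mul0rn.
Qed.

Lemma ps_derivM f g : ps_deriv (f * g) = ps_deriv f * g + f * ps_deriv g.
Proof.
apply: powserP => n; rewrite pcoefD /= -sumrMnl.
have E (i : 'I_n.+2) : pcoef f i * pcoef g (n.+1 - i) *+ n.+1 =
    pcoef f i *+ i * pcoef g (n.+1 - i) + pcoef f i * (pcoef g (n.+1 - i) *+ (n.+1 - i)).
  by rewrite mulrnAl mulrnAr -mulrnDr subnKC // -ltnS.
rewrite (eq_bigr _ (fun i _ => E i)) big_split /=; congr (_ + _).
  rewrite big_ord_recl mulr0n mul0r add0r; apply: eq_bigr => i _.
  by rewrite /= /bump /= add1n subSS.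
rewrite big_ord_recr /= subnn mulr0n mulr0 addr0; apply: eq_bigr => i _.
by rewrite subSn // -ltnS.
Qed.

Lemma ps_deriv_poly p : ps_deriv (ps_of_poly p) = ps_of_poly p^`().
Proof. by apply: powserP => n /=; rewrite coef_deriv. Qed.

Lemma ps_deriv_subst q f : (0 < q)%N ->
  ps_deriv (ps_subst q f) = ps_of_poly (q%:R *: 'X^(q.-1)) * ps_subst q (ps_deriv f).
Proof.
move=> q0; apply: powserP => n; rewrite pcoefM /=.
have [/dvdnP[k nk]|nd] := boolP (q %| n.+1)%N.
  have k0 : (0 < k)%N by case: k nk.
  have h : (q.-1 < n.+1)%N by rewrite nk prednK // leq_pmull.
  rewrite (bigD1 (Ordinal h)) //= big1 ?addr0 => [|i]; last first.
    by rewrite -val_eqE /= coefZ coefXn => /negPf ->; rewrite mulr0 mul0r.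
  have -> : (n - q.-1 = k.-1 * q)%N.
    by rewrite -subSS nk prednK // -{2}(mul1n q) -mulnBl subn1.
  rewrite coefZ coefXn eqxx mulr1 dvdn_mull // mulnK // prednK // nk mulnK //.
  by rewrite mulr_natl -mulrnA.
rewrite mul0rn big1 // => i _; rewrite coefZ coefXn; case: eqP => [iq|_]; last by rewrite mulr0 mul0r.
case: ifP; last by rewrite mulr0.
move=> /dvdnP[k nk]; case/negP: nd; apply/dvdnP; exists k.+1.
by move: (ltn_ord i); rewrite mulSn -nk iq; lia.
Qed.

(** Denominators are cleared, so that the system can be evaluated at points; it is invertible where
    e and det A do not vanish. *)
Definition mahler_sys q m (e : {poly K}) (A : 'M[{poly K}]_m) (g : 'I_m -> powser K) :=
  [/\ e != 0, \det A != 0 &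
  forall i, ps_of_poly e * g i = \sum_j ps_of_poly (A i j) * ps_subst q (g j)].

(** The polynomial P is the product of the e(z^(q^j)) with j < l. It does not depend on i. *)
Lemma mahler_iterate q m e A (g : 'I_m -> powser K) l : (0 < q)%N -> mahler_sys q e A g ->
  exists2 P : {poly K}, P != 0 & forall i, exists c : 'I_m -> {poly K},
    ps_of_poly P * g i = \sum_j ps_of_poly (c j) * ps_subst (q ^ l) (g j).
Proof.
move=> q0 [e0 _ sys]; elim: l => [|l [P P0 IH]].
  exists 1; first exact: oner_neq0.
  move=> i; exists (fun j => (i == j)%:R); rewrite (bigD1 i) //= big1 ?addr0 => [|j ji].
    by rewrite eqxx; congr (_ * _); apply: powserP => n /=; rewrite expn0 dvd1n divn1.
  by rewrite eq_sym (negPf ji) rmorph0 mul0r.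
have ql : (0 < q ^ l)%N by rewrite expn_gt0 q0.
exists (P * (e \Po 'X^(q ^ l))).
  rewrite mulf_neq0 // comp_poly_eq0 ?size_polyXn //.
move=> i; have [c hc] := IH i.
exists (fun k => \sum_j c j * (A j k \Po 'X^(q ^ l))).
rewrite rmorphM mulrAC hc mulr_suml.
transitivity (\sum_j \sum_k ps_of_poly (c j * (A j k \Po 'X^(q ^ l))) * ps_subst (q ^ l.+1) (g k)).
  apply: eq_bigr => j _.
  transitivity (ps_of_poly (c j) * ps_subst (q ^ l) (ps_of_poly e * g j)).
    by rewrite ps_substM // ps_subst_poly // -mulrA; congr (_ * _); rewrite mulrC.
  rewrite sys ps_subst_sum mulr_sumr; apply: eq_bigr => k _.
  by rewrite ps_substM // ps_subst_comp // ps_subst_poly // rmorphM mulrA -expnSr.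
by rewrite exchange_big; apply: eq_bigr => k _; rewrite rmorph_sum mulr_suml.
Qed.

Definition double m (g : 'I_m -> powser K) (v : 'I_(m + m)) :=
  match fintype.split v with inl i => g i | inr i => ps_deriv (g i) end.

Lemma doubleL m (g : 'I_m -> powser K) i : double g (lshift m i) = g i.
Proof. by rewrite /double (unsplitK (inl i)). Qed.

Lemma doubleR m (g : 'I_m -> powser K) i : double g (rshift m i) = ps_deriv (g i).
Proof. by rewrite /double (unsplitK (inr i)). Qed.

(** Differentiating the system and multiplying by e gives e^2 g' = (e A' - e' A) g(z^q) + q z^(q-1)
    e A g'(z^q), because e e' g = e' A g(z^q). The enlarged matrix is block triangular; its
    determinant vanishes only at 0 and at zeros of e and det A, so regular points stay regular. *)
Lemma mahler_double q m e A (g : 'I_m -> powser K) : (0 < q)%N -> (q%:R != 0 :> K) ->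
  mahler_sys q e A g -> exists e' A', mahler_sys q e' A' (double g) /\
    forall x, x != 0 -> e.[x] != 0 -> (\det A).[x] != 0 -> e'.[x] != 0 /\ (\det A').[x] != 0.
Proof.
move=> q0 qK [e0 A0 sys].
pose Q : {poly K} := q%:R *: 'X^(q.-1).
have Q0 : Q != 0 by rewrite scaler_eq0 negb_or qK -size_poly_eq0 size_polyXn.
pose D := map_mx (@deriv K) A.
exists (e ^+ 2), (block_mx (e *: A) 0 (e *: D - e^`() *: A) ((Q * e) *: A)); split; last first.
  move=> x x0 ex Ax; rewrite horner_exp expf_neq0 // det_lblock !detZ !(hornerM, horner_exp).
  rewrite /Q hornerZ hornerXn; split=> //.
  by rewrite !(mulf_neq0, expf_neq0).
split.
- by rewrite expf_neq0.
- by rewrite det_lblock !detZ !mulf_neq0 // expf_neq0 ?mulf_neq0.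
move=> v; rewrite big_split_ord /=.
case: (split_ordP v) => i ->.
  under eq_bigr => j _ do rewrite block_mxEul mxE doubleL rmorphM -mulrA.
  rewrite -mulr_sumr -sys [X in _ + X]big1 ?addr0 => [|j _].
    by rewrite doubleL expr2 rmorphM mulrA.
  by rewrite block_mxEur mxE rmorph0 mul0r.
under eq_bigr => j _ do rewrite block_mxEdl !mxE doubleL rmorphB mulrBl !rmorphM -!mulrA.
under [X in _ + X]eq_bigr => j _ do rewrite block_mxEdr !mxE doubleR !rmorphM -!mulrA.
rewrite sumrB -!mulr_sumr -sys doubleR.
have := congr1 ps_deriv (sys i); rewrite ps_derivM ps_deriv_sum ps_deriv_poly.
under eq_bigr => j _ do rewrite ps_derivM ps_deriv_poly ps_deriv_subst // mulrCA.
rewrite big_split /= => E.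
rewrite expr2 rmorphM -mulrA.
have -> : ps_of_poly e * ps_deriv (g i) = \sum_j ps_of_poly (A i j)^`() * ps_subst q (g j) +
   \sum_j ps_of_poly Q * (ps_of_poly (A i j) * ps_subst q (ps_deriv (g j))) -
   ps_of_poly e^`() * g i by rewrite -E addrAC subrr add0r.
rewrite -mulr_sumr; move: (\sum_j _) (\sum_j _) => x y; ring.
Qed.

Lemma mahler_derivatives q m e A (g : 'I_m -> powser K) mu : (0 < q)%N -> (q%:R != 0 :> K) ->
  mahler_sys q e A g -> exists M (e' : {poly K}) (A' : 'M[{poly K}]_M) (G : 'I_M -> powser K),
  [/\ mahler_sys q e' A' G,
      (forall x, x != 0 -> e.[x] != 0 -> (\det A).[x] != 0 -> e'.[x] != 0 /\ (\det A').[x] != 0),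
      (forall j k, (k <= mu)%N -> exists v, G v = iter k ps_deriv (g j)) &
      (forall v, exists j k, G v = iter k ps_deriv (g j))].
Proof.
move=> q0 qK sys; elim: mu => [|mu [M [e' [A' [G [sysG hx h1 h2]]]]]].
  exists m, e, A, g; split=> //; last by move=> v; exists v, 0%N.
  by move=> j k; rewrite leqn0 => /eqP ->; exists j.
have [e2 [A2 [sys2 hx2]]] := mahler_double q0 qK sysG.
exists (M + M)%N, e2, A2, (double G); split=> //.
  by move=> x x0 ex Ax; have [h3 h4] := hx x x0 ex Ax; exact: hx2.
  move=> j k; rewrite leq_eqVlt => /orP[/eqP ->|].
    by have [v hv] := h1 j mu (leqnn mu); exists (rshift M v); rewrite doubleR hv.
  by rewrite ltnS => /(h1 j)[v hv]; exists (lshift M v); rewrite doubleL.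
move=> v; case: (split_ordP v) => i ->; have [j [k hk]] := h2 i.
  by exists j, k; rewrite doubleL.
by exists j, k.+1; rewrite doubleR hk.
Qed.

End Formal.

Section Descent.
Variables (L : fieldType) (B : set L) (q m : nat) (e : {poly L}) (A : 'M[{poly L}]_m).
Variable g : 'I_m -> powser L.
Hypothesis q2 : (1 < q)%N.
Hypothesis sys : mahler_sys q e A g.
Hypothesis eB : forall k, fgen B e`_k.
Hypothesis AB : forall i j k, fgen B (A i j)`_k.
Hypothesis gB : forall i k, (k <= size e)%N -> fgen B (pcoef (g i) k).

(* The coefficients of large index are determined by those of smaller index: compare
   the coefficients of z^(n+v) on both sides, where v is the valuation of e. *)
Lemma mahler_coefs i k : fgen B (pcoef (g i) k).
Proof.
have [e0 _ eqn] := sys.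
have ex : exists v, e`_v != 0 by exists (size e).-1; rewrite -lead_coefE lead_coef_eq0.
pose v := ex_minn ex.
have [ev vmin] : e`_v != 0 /\ forall w, (w < v)%N -> e`_w = 0.
  rewrite /v; case: ex_minnP => w hw hmin; split=> // u uw.
  by apply/eqP; apply: contraTT uw => /hmin; rewrite -leqNgt.
have vs : (v < size e)%N by rewrite ltnNge; apply: contra ev => h; rewrite nth_default.
elim/ltn_ind: k i => k IH i; have [|ks] := leqP k (size e); first exact: gB.
have := congr1 (fun f => pcoef f (v + k)%N) (eqn i); rewrite pcoefM.
have hv : (v < (v + k).+1)%N by rewrite ltnS leq_addr.
rewrite (bigD1 (Ordinal hv)) //= addKn => E.
suff : fgen B (e`_v * pcoef (g i) k).
  by move=> /fgen_div/(_ (eB v)); rewrite mulrC mulKf.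
have -> : e`_v * pcoef (g i) k = pcoef (\sum_j ps_of_poly (A i j) * ps_subst q (g j)) (v + k) -
   \sum_(i0 < (v + k).+1 | i0 != Ordinal hv) e`_i0 * pcoef (g i) (v + k - i0) by rewrite -E addrK.
apply: fgen_sub; last first.
  apply: fgen_sum => w; rewrite -val_eqE /= neq_ltn => /orP[wv|vw].
    by rewrite vmin // mul0r; exact: fgen0.
  by apply: fgenM => //; apply: IH; have := ltn_ord w; lia.
have pcoef_sum (I : Type) (s : seq I) (F : I -> powser L) n :
    pcoef (\sum_(x <- s) F x) n = \sum_(x <- s) pcoef (F x) n.
  elim: s => [|x s IHs]; first by rewrite !big_nil pcoef0.
  by rewrite !big_cons pcoefD IHs.
rewrite pcoef_sum; apply: fgen_sum => j _; rewrite pcoefM; apply: fgen_sum => w _.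
apply: fgenM; first exact: AB.
rewrite /=; case: ifP => _; last exact: fgen0.
(* The index is at most (v + k) / q, which is below k as v < size e < k and q >= 2. *)
by apply: IH; rewrite ltn_divLR; nia.
Qed.

End Descent.

Section Orbit.
Variables (C : numClosedFieldType) (q m : nat) (e : {poly C}) (A : 'M[{poly C}]_m) (beta : C).
Local Notation x k := (beta ^+ (q ^ k)).

Definition mx_at k := map_mx (fun p : {poly C} => p.[x k]) A.
Fixpoint orbit_det k := if k is k'.+1 then \det (mx_at k') * orbit_det k' else 1.
(** Adjugates replace inverses, the determinants being collected in [orbit_det]. The entries are
    then polynomial in the values of e and A, which keeps their heights under control. *)
Fixpoint orbit_mx k : 'M[C]_m :=
  if k is k'.+1 then (e.[x k'] *: \adj (mx_at k')) *m orbit_mx k' else 1%:M.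

Hypothesis e0 : forall k, e.[x k] != 0.
Hypothesis A0 : forall k, (\det A).[x k] != 0.

Lemma det_mx_at k : \det (mx_at k) = (\det A).[x k].
Proof.
rewrite -[(\det A).[_]]/(horner_eval (x k) (\det A)) -det_map_mx.
by congr (\det _); apply/matrixP => i j; rewrite !mxE.
Qed.

Lemma orbit_det_neq0 k : orbit_det k != 0.
Proof. by elim: k => [|k IH] /=; rewrite ?oner_eq0 // mulf_neq0 // det_mx_at. Qed.

Lemma orbit_mx_unit k : orbit_mx k \in unitmx.
Proof.
elim: k => [|k IH] /=; first exact: unitmx1.
rewrite unitmx_mul IH andbT unitmxE detZ unitfE mulf_neq0 ?expf_neq0 //.
have := congr1 (fun M => \det M) (mul_mx_adj (mx_at k)); rewrite det_mulmx det_scalar => h.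
have : \det (mx_at k) * \det (\adj (mx_at k)) != 0 by rewrite h expf_neq0 // det_mx_at.
by rewrite mulf_eq0 negb_or => /andP[].
Qed.

Variable v : nat -> 'cV[C]_m.
Hypothesis step : forall k, e.[x k] *: v k = mx_at k *m v k.+1.

Lemma orbit_relation k : orbit_det k *: v k = orbit_mx k *m v 0.
Proof.
elim: k => [|k IH] /=; first by rewrite scale1r mul1mx.
rewrite -mulmxA -IH -scalemxAl -scalemxAr (mulrC (\det _)) -scalerA.
have -> : \det (mx_at k) *: v k.+1 = \adj (mx_at k) *m (e.[x k] *: v k).
  by rewrite step mulmxA mul_adj_mx mul_scalar_mx.
by rewrite -scalemxAr !scalerA mulrC.
Qed.

End Orbit.

(** * Values by analytic continuation *)

Section Asymptotics.
Variable C : numClosedFieldType.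
Implicit Types (f g : C -> C) (p : {poly C}).

Lemma cdiff_comp f g z : cdiff f z -> cdiff g (f z) -> cdiff (g \o f) z.
Proof.
move=> fz [D gD]; have [M [d1 [M0 d10 lip]]] := cdiff_lip fz; case: fz => E fE.
exists (D * E) => e e0; have e20 : 0 < e / 2%:R by rewrite divr_gt0 ?ltr0n.
have a0 : 0 < e / 2%:R / M by rewrite divr_gt0.
have D1 : 0 < `|D| + 1 by rewrite ltr_wpDl.
have b0 : 0 < e / 2%:R / (`|D| + 1) by rewrite divr_gt0.
have [d2 d20 h2] := gD _ a0; have [d3 d30 h3] := fE _ b0.
have d2M : 0 < d2 / M by rewrite divr_gt0.
have [x x0 [x1 x3]] := cmin d10 d30; have [y y0 [yx yM]] := cmin x0 d2M.
exists y => // w wy; have w1 : `|w - z| < d1 by apply: lt_le_trans wy (le_trans yx x1).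
have w3 : `|w - z| < d3 by apply: lt_le_trans wy (le_trans yx x3).
have fw : `|f w - f z| < d2.
  by apply: le_lt_trans (lip _ w1) _; rewrite mulrC -ltr_pdivlMr // (lt_le_trans wy).
rewrite /comp (_ : _ - _ - _ = (g (f w) - g (f z) - D * (f w - f z)) + D * (f w - f z - E * (w - z))); last by ring.
apply: le_trans (ler_normD _ _) _; rewrite (_ : e * _ = e / 2%:R * `|w - z| + e / 2%:R * `|w - z|); last by field.
apply: lerD.
  apply: le_trans (h2 _ fw) _; apply: (@le_trans _ _ (e / 2%:R / M * (M * `|w - z|))).
    by apply: ler_wpM2l; [exact: ltW|exact: lip].
  by rewrite mulrA divfK // lt0r_neq0.
rewrite normrM; apply: (@le_trans _ _ ((`|D| + 1) * (e / 2%:R / (`|D| + 1) * `|w - z|))).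
  by apply: ler_pM => //; [rewrite lerDl|exact: h3].
by rewrite mulrA mulrC mulrA mulrAC -mulrA divfK // ?lt0r_neq0 // mulrC.
Qed.

Definition bigO k f := exists M d, [/\ 0 <= M, 0 < d & forall h, h != 0 -> `|h| < d -> `|f h| <= M * `|h| ^+ k].

Lemma bigOD k f g : bigO k f -> bigO k g -> bigO k (fun h => f h + g h).
Proof.
move=> [M [d [M0 d0 hf]]] [M' [d' [M0' d0' hg]]].
have [x x0 [xd xd']] := cmin d0 d0'; exists (M + M'), x; split=> //; first exact: addr_ge0.
move=> h hn hx; rewrite mulrDl; apply: le_trans (ler_normD _ _) _.
by apply: lerD; [apply: hf|apply: hg] => //; exact: lt_le_trans hx _.
Qed.

Lemma bigO_sum k (I : Type) (s : seq I) (F : I -> C -> C) :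
  (forall i, bigO k (F i)) -> bigO k (fun h => \sum_(i <- s) F i h).
Proof.
move=> hF; elim: s => [|i s IH].
  by exists 0, 1; split=> // h _ _; rewrite big_nil normr0 mul0r.
have [M [d [M0 d0 h]]] := bigOD (hF i) IH; exists M, d; split=> // x xn xd.
by rewrite big_cons; exact: h.
Qed.

Lemma bigOM k f g : bigO 0 f -> bigO k g -> bigO k (fun h => f h * g h).
Proof.
move=> [M [d [M0 d0 hf]]] [M' [d' [M0' d0' hg]]].
have [x x0 [xd xd']] := cmin d0 d0'; exists (M * M'), x; split=> //; first exact: mulr_ge0.
move=> h hn hx; rewrite normrM -mulrA; apply: ler_pM => //.
  by rewrite -[leRHS]mulr1 -(expr0 `|h|); apply: hf => //; exact: lt_le_trans hx _.
by apply: hg => //; exact: lt_le_trans hx _.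
Qed.

Lemma bigO_horner p : bigO 0 (horner p).
Proof.
have [M [d [M0 d0 lip]]] := cdiff_lip (cdiff_horner p 0).
have [x x0 [xd x1]] := cmin d0 (@ltr01 C).
exists (`|p.[0]| + M), x; split=> //; first by rewrite addr_ge0 // ltW.
move=> h _ hx; rewrite expr0 mulr1 (_ : p.[h] = p.[0] + (p.[h] - p.[0])); last by ring.
apply: le_trans (ler_normD _ _) _; rewrite lerD2l.
have := lip h; rewrite subr0 => /(_ (lt_le_trans hx xd)) /le_trans; apply.
by rewrite ler_piMr ?(ltW M0) // ltW // (lt_le_trans hx).
Qed.

Definition tends f v := forall e, 0 < e -> exists2 d, 0 < d & forall h, h != 0 -> `|h| < d -> `|f h - v| <= e.

Lemma jet_value0 p f v : bigO 1 (fun h => f h - p.[h]) -> tends f v -> v = p`_0.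
Proof.
move=> [M [d [M0 d0 hM]]] hf; apply/eqP; rewrite -horner_coef0 -subr_eq0; apply/negPn/negP => ne.
have x0 : 0 < `|v - p.[0]| by rewrite normr_gt0.
set x := `|_| in x0; have x40 : 0 < x / 4%:R by rewrite divr_gt0 ?ltr0n.
have [M1 [d1 [M10 d10 lip]]] := cdiff_lip (cdiff_horner p 0).
have [d2 d20 h2] := hf _ x40.
have Mp : 0 < M + M1 by rewrite ltr_wpDl.
have d30 : 0 < x / 4%:R / (M + M1) by rewrite divr_gt0.
have [a a0 [ad a1]] := cmin d0 d10; have [b b0 [ba b2]] := cmin a0 d20.
have [y y0 [yb y3]] := cmin b0 d30; have y2 : 0 < y / 2%:R by rewrite divr_gt0 ?ltr0n.
have yn : `|y / 2%:R| < y by rewrite gtr0_norm // ltr_pdivrMr ?ltr0n // ltr_pMr // ltr1n.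
have yd : y <= d by exact: le_trans yb (le_trans ba ad).
have yd1 : y <= d1 by exact: le_trans yb (le_trans ba a1).
have yd2 : y <= d2 by exact: le_trans yb b2.
have := hM _ (lt0r_neq0 y2) (lt_le_trans yn yd); have := h2 _ (lt0r_neq0 y2) (lt_le_trans yn yd2).
have := lip (y / 2%:R); rewrite subr0 => /(_ (lt_le_trans yn yd1)).
rewrite expr1; set h := y / 2%:R in yn *; move=> i1 i2 i3.
have : x <= x / 4%:R + x / 4%:R.
  rewrite {1}/x (_ : v - p.[0] = - (f h - v) + ((f h - p.[h]) + (p.[h] - p.[0]))); last by ring.
  apply: le_trans (ler_normD _ _) _; rewrite normrN; apply: lerD => //.
  apply: le_trans (ler_normD _ _) _; apply: le_trans (lerD i3 i1) _.
  rewrite -mulrDl mulrC -ler_pdivlMr //; apply: le_trans y3; exact: ltW.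
have -> : x / 4%:R + x / 4%:R = x / 2%:R by field.
by rewrite ler_pdivlMr ?ltr0n // mulr_natr mulr2n gerDl => /(lt_le_trans x0); rewrite ltxx.
Qed.

(** The value of f at 0 is read off a Taylor polynomial of h^k f(h). One factor h is removed at a
    time; p(0) = 0 is forced because h^(k+1) f(h) tends to 0. *)
Lemma jet_value p k f v : bigO k.+1 (fun h => h ^+ k * f h - p.[h]) -> tends f v -> v = p`_k.
Proof.
elim: k p => [|k IH] p hO hf.
  apply: jet_value0 hf; have [M [d [M0 d0 hM]]] := hO; exists M, d; split=> // h hn hd.
  by have := hM h hn hd; rewrite expr0 mul1r.
have p0 : p`_0 = 0.
  apply/esym; apply: (@jet_value0 _ (fun h => h ^+ k.+1 * f h)).
    have [M [d [M0 d0 hM]]] := hO; have [x x0 [xd x1]] := cmin d0 (@ltr01 C).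
    exists M, x; split=> // h hn hx; apply: le_trans (hM h hn (lt_le_trans hx xd)) _.
    by apply: ler_wpM2l => //; apply: ler_wiXn2l => //; rewrite ltW // (lt_le_trans hx).
  move=> e e0; have [d1 d10 h1] := hf 1 ltr01.
  have v1 : 0 < `|v| + 1 by rewrite ltr_wpDl.
  have e1 : 0 < e / (`|v| + 1) by rewrite divr_gt0.
  have [a a0 [ad a1]] := cmin d10 (@ltr01 C); have [b b0 [ba b2]] := cmin a0 e1.
  exists b => // h hn hb; rewrite subr0 normrM normrX.
  apply: (@le_trans _ _ (e / (`|v| + 1) * (`|v| + 1))); last by rewrite divfK // lt0r_neq0.
  apply: ler_pM; rewrite ?exprn_ge0 //.
    apply: (@le_trans _ _ (`|h| ^+ 1)); last by rewrite expr1 ltW // (lt_le_trans hb).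
    by apply: ler_wiXn2l => //; rewrite ltW // (lt_le_trans hb) // (le_trans ba).
  rewrite -lerBlDl; apply: le_trans (lerB_dist _ _) _.
  by apply: h1 => //; apply: lt_le_trans hb (le_trans ba ad).
have /factor_theorem[p' pE] : root p 0 by rewrite /root horner_coef0 p0.
rewrite subr0 in pE; rewrite pE coefMX /=; apply: IH => //.
have [M [d [M0 d0 hM]]] := hO.
exists M, d; split=> // h hn hd; have := hM h hn hd.
rewrite pE hornerMX exprS (mulrC p'.[h]) -mulrA -mulrBr normrM [_ ^+ k.+2]exprS mulrCA.
by rewrite ler_pM2l ?normr_gt0.
Qed.

Lemma bigO_ext k f g : bigO k f -> (exists2 d, 0 < d & forall h, h != 0 -> `|h| < d -> g h = f h) ->
  bigO k g.
Proof.
move=> [M [d [M0 d0 hM]]] [d' d0' e]; have [x x0 [xd xd']] := cmin d0 d0'.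
by exists M, x; split=> // h hn hx; rewrite e ?hM // (lt_le_trans hx).
Qed.

Lemma cdiff_tends f z : cdiff f z -> tends (fun h => f (z + h)) (f z).
Proof.
move=> /cdiff_lip[M [d [M0 d0 lip]]] e e0; have e1 : 0 < e / M by rewrite divr_gt0.
have [x x0 [xd xe]] := cmin d0 e1; exists x => // h _ hx.
have := lip (z + h); rewrite addrAC subrr add0r => /(_ (lt_le_trans hx xd)) /le_trans; apply.
by rewrite mulrC -ler_pdivlMr // ltW // (lt_le_trans hx).
Qed.

End Asymptotics.

Section Spreading.
Variable C : numClosedFieldType.
Hypothesis arch : forall x : C, exists k : nat, `|x| <= k%:R.
Hypothesis complete : forall (u : nat -> C) (b t : C), 0 <= t -> t < 1 ->
  (forall m n, (m <= n)%N -> `|u n - u m| <= b * t ^+ m) ->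
  exists l, forall m, `|l - u m| <= b * t ^+ m.
Variables (F H : C -> C) (P : {poly C}).

(** The centre is left out because the value of F at a pole is arbitrary. *)
Definition agree c := exists2 d, 0 < d & forall w, w != c -> `|w - c| < d -> P.[w] * F w = H w.

Lemma corner_dist (w s z : C) : 0 < s -> insq (corner w s) s z -> `|z - w| <= 2%:R * s.
Proof.
move=> s0 hz; apply: insq_dist hz _.
have h : ((0 : C) <= 2%:R^-1) && ((2%:R^-1 : C) <= 1).
    by rewrite invr_ge0 ler0n /= invf_le1 ?ltr0n // ler1n.
have := insqP (corner w s) (ltW s0) h h; congr insq.
by rewrite /corner; field.
Qed.

(** Multiplication by (w - c)^k turns P F - H into a function Psi that is differentiable around c.
    If Psi vanishes on a disc near a, [vanishing_spreads] carries this to all points near c. *)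
Lemma agree_local c k G (rho : C) : 0 < rho -> (forall w, `|w - c| < rho -> cdiff G w) ->
  (forall w, w != c -> `|w - c| < rho -> (w - c) ^+ k * F w = G w) ->
  (forall w, `|w - c| < rho -> cdiff H w) ->
  exists2 sg, 0 < sg & forall a b, `|a - c| < sg -> `|b - c| < sg -> agree a -> agree b.
Proof.
(* Psi will vanish around a0, at distance below 3 sg from w, so [vanishing_spreads] needs a square
   of side s = 18 sg. Its points are within 36 sg + sg of c, less than rho = 40 sg. *)
move=> rho0 hG FG hH; pose sg := rho / 40%:R.
have sg0 : 0 < sg by rewrite divr_gt0 ?ltr0n.
have rhoE : rho = 40%:R * sg by rewrite /sg; field.
exists sg => // a b ac bc [d d0 hd].
pose Psi w := P.[w] * G w - (w - c) ^+ k * H w.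
have PsiE w : w != c -> `|w - c| < rho -> Psi w = (w - c) ^+ k * (P.[w] * F w - H w).
  by move=> wc wr; rewrite /Psi -FG //; ring.
have [e e0 [ed es]] := cmin d0 sg0.
(* At a itself the equality is not given, and at c the values of F and G are unrelated; a0 avoids
   both, with a whole disc around it. *)
have [a0 [a0a a0e a0c]] : exists a0, [/\ a0 != a, `|a0 - a| < e & a0 != c].
  have e2 : 0 < e / 2%:R by rewrite divr_gt0 ?ltr0n.
  have e3 : 0 < e / 3%:R by rewrite divr_gt0 ?ltr0n.
  have ee : e / 2%:R != e / 3%:R.
    rewrite -subr_eq0 (_ : _ - _ = e / 6%:R); last by field.
    by rewrite lt0r_neq0 // divr_gt0 ?ltr0n.
  have [ac2|ac2] := eqVneq (a + e / 2%:R) c.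
    exists (a + e / 3%:R); rewrite addrAC subrr add0r gtr0_norm //; split.
    - by rewrite -subr_eq0 addrAC subrr add0r lt0r_neq0.
    - by rewrite ltr_pdivrMr ?ltr0n // ltr_pMr // ltr1n.
    - by rewrite -ac2 (inj_eq (addrI a)) eq_sym.
  exists (a + e / 2%:R); rewrite addrAC subrr add0r gtr0_norm //; split=> //.
  - by rewrite -subr_eq0 addrAC subrr add0r lt0r_neq0.
  - by rewrite ltr_pdivrMr ?ltr0n // ltr_pMr // ltr1n.
have n1 : 0 < `|a0 - a| by rewrite normr_gt0 subr_eq0.
have n2 : 0 < `|a0 - c| by rewrite normr_gt0 subr_eq0.
have n3 : 0 < e - `|a0 - a| by rewrite subr_gt0.
have [x x0 [x1 x2]] := cmin n1 n2; have [r r0 [rx r3]] := cmin x0 n3.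
have Psi0 z : `|z - a0| < r -> Psi z = 0.
  move=> zr; have za : `|z - a| < e.
    rewrite (_ : z - a = (z - a0) + (a0 - a)); last by ring.
    by apply: le_lt_trans (ler_normD _ _) _; rewrite -ltrBrDr; exact: lt_le_trans zr r3.
  have zc : z != c.
    apply/eqP => zc; move: zr; rewrite zc distrC; apply/negP; rewrite -real_leNgt ?realE ?(ltW r0) ?normr_ge0 //.
    exact: le_trans rx x2.
  have zna : z != a.
    apply/eqP => zc'; move: zr; rewrite zc' distrC; apply/negP; rewrite -real_leNgt ?realE ?(ltW r0) ?normr_ge0 //.
    exact: le_trans rx x1.
  have zrho : `|z - c| < rho.
    rewrite (_ : z - c = (z - a) + (a - c)); last by ring.
    apply: le_lt_trans (ler_normD _ _) _; apply: (@lt_trans _ _ (sg + sg)).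
      by apply: ltrD => //; exact: lt_le_trans za es.
    have -> : sg + sg = 2%:R * sg by ring.
    by rewrite rhoE ltr_pM2r // ltr_nat.
  by rewrite PsiE // hd ?subrr ?mulr0 // (lt_le_trans za).
have Psi_sg w : `|w - c| < sg -> Psi w = 0.
  move=> wc; pose s := 18%:R * sg; have s0 : 0 < s by rewrite mulr_gt0 ?ltr0n.
  apply: (vanishing_spreads arch complete s0 r0 _ Psi0).
    move=> z /(corner_dist s0) zw.
    have zr : `|z - c| < rho.
      rewrite (_ : z - c = (z - w) + (w - c)); last by ring.
      apply: le_lt_trans (ler_normD _ _) _; apply: (@lt_trans _ _ (2%:R * s + sg)).
        by apply: ler_ltD.
      rewrite rhoE /s mulrA -natrM -[X in _ + X]mul1r -mulrDl ltr_pM2r // -[1]/(1%:R) -natrD ltr_nat.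
      by [].
    apply: (@cdiff_ext C (fun w => P.[w] * G w + (-1) * ((w - c) ^+ k * H w))).
      apply: (@cdiffD C (fun w => P.[w] * G w)).
        by apply: (@cdiffM C (horner P)); [exact: cdiff_horner|exact: hG].
      apply: (@cdiffM C (fun=> -1)); first exact: cdiff_cst.
      apply: (@cdiffM C (fun w => (w - c) ^+ k)); last exact: hH.
      apply: (@cdiffX C (fun w => w - c)).
      by apply: (@cdiffD C id (fun=> - c)); [exact: cdiff_id|exact: cdiff_cst].
    by exists 1; rewrite ?ltr01 // => y _; rewrite /Psi mulN1r.
  have -> : s / 6%:R = 3%:R * sg by rewrite /s; field.
  rewrite (_ : w - a0 = (w - c) + ((c - a) + (a - a0))); last by ring.
  apply: le_trans (ler_normD _ _) _; rewrite (_ : 3%:R * sg = sg + (sg + sg)); last by ring.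
  apply: lerD; first exact: ltW.
  apply: le_trans (ler_normD _ _) _; apply: lerD; rewrite distrC; apply: ltW => //.
  exact: lt_le_trans a0e es.
have main w : w != c -> `|w - c| < sg -> P.[w] * F w = H w.
  move=> wc ws; have wr : `|w - c| < rho.
    by apply: lt_trans ws _; rewrite rhoE -{1}[sg]mul1r ltr_pM2r // ltr1n.
  have /eqP := Psi_sg w ws; rewrite PsiE // mulf_eq0 expf_eq0 subr_eq0 (negPf wc) andbF /= subr_eq0.
  by move/eqP.
have [bE|bc'] := eqVneq b c; first by exists sg => // w; rewrite bE; exact: main.
have m1 : 0 < `|b - c| by rewrite normr_gt0 subr_eq0.
have m2 : 0 < sg - `|b - c| by rewrite subr_gt0.
have [y y0 [y1 y2]] := cmin m1 m2; exists y => // w wb wy; apply: main.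
  apply/eqP => wc; move: wy; rewrite wc distrC; apply/negP.
  by rewrite -real_leNgt ?realE ?(ltW y0) ?normr_ge0.
rewrite (_ : w - c = (w - b) + (b - c)); last by ring.
by apply: le_lt_trans (ler_normD _ _) _; rewrite -ltrBrDr; exact: lt_le_trans wy y2.
Qed.

Variable alpha : C.
Hypothesis local : forall t, `|t| <= 1 ->
  exists2 sg, 0 < sg & forall a b, `|a - t * alpha| < sg -> `|b - t * alpha| < sg -> agree a -> agree b.

(** Bisection of the segment from 0 to alpha keeps agreement at the left end and its failure at the
    right end; around the limit point this contradicts [local]. *)
Lemma agree_spreads : agree 0 -> agree alpha.
Proof.
move=> a0; apply: contrapT => na.
pose h n : C := 2%:R^-1 ^+ n.
have hS n : h n = h n.+1 + h n.+1 by rewrite /h exprS; field.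
have h0 n : 0 < h n by rewrite exprn_gt0 // invr_gt0 ltr0n.
pose step n (x : C) := if `[< agree ((x + h n.+1) * alpha) >] then x + h n.+1 else x.
pose u := fix u n := if n is n'.+1 then step n' (u n') else 0.
have inv n : [/\ agree (u n * alpha), ~ agree ((u n + h n) * alpha), 0 <= u n & u n + h n <= 1].
  elim: n => [|n [i1 i2 i3 i4]]; first by rewrite /= mul0r /h expr0 add0r mul1r.
  rewrite /= /step; case: asboolP => hb; split=> //.
  - by rewrite -addrA -hS.
  - by rewrite addr_ge0 // ltW.
  - by rewrite -addrA -hS.
  - by apply: le_trans i4; rewrite lerD2l (hS n) lerDl ltW.
have uS n : u n <= u n.+1 /\ u n.+1 + h n.+1 <= u n + h n.
  rewrite /= /step; case: asboolP => _.
    by rewrite lerDl (ltW (h0 _)) -addrA -hS.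
  by split=> //; rewrite lerD2l (hS n) lerDl ltW.
have umn m n : (m <= n)%N -> u m <= u n /\ u n + h n <= u m + h m.
  elim: n => [|n IH]; first by rewrite leqn0 => /eqP ->.
  rewrite leq_eqVlt => /orP[/eqP -> //|]; rewrite ltnS => /IH[j1 j2]; have [k1 k2] := uS n.
  by split; [exact: le_trans k1|exact: le_trans j2].
have h20 : 0 <= 2%:R^-1 :> C by rewrite invr_ge0 ler0n.
have h21 : 2%:R^-1 < 1 :> C by rewrite invf_lt1 ?ltr0n // ltr1n.
have [l hl] : exists l, forall m, `|l - u m| <= 1 * 2%:R^-1 ^+ m.
  apply: complete => // m n mn; have [j1 j2] := umn m n mn.
  rewrite ger0_norm ?subr_ge0 // mul1r lerBlDl; apply: le_trans j2.
  by rewrite lerDl ltW.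
have l1 : `|l| <= 1.
  apply: (@geom_le C arch _ _ 1 2%:R^-1) => //; rewrite ?normr_real ?real1 // => m.
  rewrite (_ : l = (l - u m) + u m); last by ring.
  apply: le_trans (ler_normD _ _) _; rewrite addrC; apply: lerD; last exact: hl.
  by have [_ _ j3 j4] := inv m; rewrite ger0_norm // (le_trans _ j4) // lerDl ltW.
have [sg sg0 hsg] := local l1.
have al1 : 0 < 2%:R * (`|alpha| + 1) by rewrite mulr_gt0 ?ltr0n // ltr_wpDl.
have e0 : 0 < sg / (2%:R * (`|alpha| + 1)) by rewrite divr_gt0.
have [m hm] := pow_small arch h20 h21 e0.
have hb : h m * `|alpha| + h m * `|alpha| < sg.
  have : h m * (2%:R * (`|alpha| + 1)) <= sg by rewrite -ler_pdivlMr.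
  apply: lt_le_trans; rewrite mulrCA -[X in X < _]mulr1 (_ : _ * 1 = 2%:R * (h m * `|alpha|)); last by ring.
  by rewrite ltr_pM2l ?ltr0n // ltr_pM2l // ltrDl.
have [j1 j2 _ _] := inv m; apply: j2; apply: (hsg _ _ _ _ j1).
  rewrite -mulrBl normrM distrC; apply: le_lt_trans hb.
  apply: (@le_trans _ _ (h m * `|alpha|)); last by rewrite lerDl mulr_ge0 // ltW.
  by apply: ler_wpM2r => //; have := hl m; rewrite mul1r.
rewrite -mulrBl normrM; apply: le_lt_trans hb; rewrite -mulrDl; apply: ler_wpM2r => //.
rewrite (_ : _ - l = h m - (l - u m)); last by ring.
apply: le_trans (ler_normB _ _) _; rewrite gtr0_norm // lerD2l.
by have := hl m; rewrite mul1r.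
Qed.

End Spreading.

Lemma evals_radius (C : numClosedFieldType) (K : fieldType) (iota : {rmorphism K -> C}) (s s' z : C) f l :
  0 < s' -> s' <= s -> evals iota s z f l -> evals iota s' z f l.
Proof.
move=> s0 ss [[B hB] [M hM]]; split.
  by exists B; apply: bsum_mono hB => //; exact: ltW.
have s00 := lt_le_trans s0 ss.
have M0 : 0 <= M by have := hM 0%N; rewrite expr0 mulr1; apply: le_trans.
exists M => N; apply: le_trans (hM N) _; apply: ler_wpM2l => //.
apply: lerXn2r; rewrite ?nnegrE ?divr_ge0 ?(ltW s0) ?(ltW s00) //.
by apply: ler_wpM2l => //; rewrite lef_pV2.
Qed.

Lemma polyOver_XsubC_div (L : fieldType) (A : set L) a (q : {poly L}) : fgen A a ->
  q * ('X - a%:P) \is a polyOver (fgenb A) -> q \is a polyOver (fgenb A).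
Proof.
move=> Aa /polyOverP h.
have rec i : q`_i = (q * ('X - a%:P))`_i.+1 + a * q`_i.+1.
  by rewrite mulrBr coefB coefMX coefMC /=; ring.
have key n i : (size q <= i + n)%N -> q`_i \in fgenb A.
  elim: n i => [|n IH] i hi; first by rewrite nth_default ?rpred0 //; rewrite addn0 in hi.
  rewrite rec rpredD // rpredM //; first by apply/fgenbP.
  by apply: IH; rewrite addSnnS.
by apply/polyOverP => i; apply: (key (size q)); rewrite leq_addl.
Qed.

Section Value.
Variable C : numClosedFieldType.
Hypothesis arch : forall x : C, exists k : nat, `|x| <= k%:R.
Hypothesis complete : forall (u : nat -> C) (b t : C), 0 <= t -> t < 1 ->
  (forall m n, (m <= n)%N -> `|u n - u m| <= b * t ^+ m) ->
  exists l, forall m, `|l - u m| <= b * t ^+ m.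
Variables (K : fieldType) (iota : {rmorphism K -> C}) (m : nat).
Variables (P : {poly K}) (c : 'I_m -> {poly K}) (g : 'I_m -> powser K) (f : powser K) (Q : nat).
Variables (s s' d B alpha : C) (F : C -> C).
Local Notation "p ^i" := (map_poly iota p) (at level 2, format "p ^i").
Hypothesis P0 : P != 0.
Hypothesis rel : ps_of_poly P * f = \sum_j ps_of_poly (c j) * ps_subst Q (g j).
Hypotheses (Q0 : (0 < Q)%N) (s0 : 0 < s') (d0 : 0 < d) (sd : s' + d <= s) (s1 : s' <= 1).
Hypothesis hB : forall j, bsum s (fun k => iota (pcoef (g j) k)) B.
Hypotheses (a1 : `|alpha| < 1) (aQ : `|alpha| ^+ Q < s').
Hypothesis mero : forall z, `|z| < 1 -> exists k G rho, [/\ 0 < rho,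
  forall w, `|w - z| < rho -> cdiff G w &
  forall w, w != z -> `|w - z| < rho -> (w - z) ^+ k * F w = G w].
Hypothesis F0 : exists rho s0, [/\ 0 < rho, rho <= s0 & forall z, `|z| < rho -> evals iota s0 z f (F z)].
Hypothesis Fa : cdiff F alpha.

Lemma values_ex : exists V : 'I_m -> C -> C, forall j w, `|w| < s' -> evals iota s' w (g j) (V j w).
Proof.
have /choice[V hV] : forall jw : 'I_m * C, exists l, `|jw.2| < s' -> evals iota s' jw.2 (g jw.1) l.
  move=> [j w] /=; have [h|] := boolP (`|w| < s'); last by exists 0.
  have hb : bsum s' (fun k => iota (pcoef (g j) k)) B.
    by apply: bsum_mono (hB j); rewrite ?(ltW s0) // (le_trans _ sd) // lerDl ltW.
  by have [l hl] := evals_ex complete s0 h hb; exists l.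
by exists (fun j w => V (j, w)) => j w /= h; exact: (hV (j, w)).
Qed.

Variable V : 'I_m -> C -> C.
Hypothesis hV : forall j w, `|w| < s' -> evals iota s' w (g j) (V j w).
Let H z := \sum_j (c j)^i.[z] * V j (z ^+ Q).

Let cdiff_H z : `|z| ^+ Q < s' -> cdiff H z.
Proof.
move=> zQ; apply: (@cdiff_sum C _ _ (fun j z => (c j)^i.[z] * V j (z ^+ Q))) => j.
apply: (@cdiffM C (horner (c j)^i)); first exact: cdiff_horner.
apply: (@cdiff_comp C (fun z => z ^+ Q)).
  by apply: (@cdiffX C id); exact: cdiff_id.
by apply: (evals_cdiff arch complete s0 d0 sd (hB j)); [rewrite normrX|exact: hV].
Qed.

Let pow_near (z : C) : `|z| ^+ Q < s' -> exists2 e, 0 < e & forall w : C, `|w - z| < e -> `|w| ^+ Q < s'.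
Proof.
move=> zQ; have [M [e [M0 e0 lip]]] := cdiff_lip (@cdiffX C id z Q (cdiff_id z)).
have e1 : 0 < (s' - `|z| ^+ Q) / M by rewrite divr_gt0 // subr_gt0.
have [x x0 [xe x1]] := cmin e0 e1; exists x => // w wx.
rewrite -normrX (_ : w ^+ Q = z ^+ Q + (w ^+ Q - z ^+ Q)); last by ring.
apply: le_lt_trans (ler_normD _ _) _; rewrite normrX addrC -ltrBrDr.
apply: le_lt_trans (lip w (lt_le_trans wx xe)) _.
by rewrite mulrC -ltr_pdivlMr // (lt_le_trans wx).
Qed.

(** Near 0 both sides are sums of the same series. The function H is defined wherever |z|^Q < s', in
    particular along the segment from 0 to alpha, so the identity extends although the series of f
    need not converge there. *)
Lemma value_agree : agree F H P^i alpha.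
Proof.
apply: (agree_spreads arch complete) => [t t1|]; last first.
  have [rho [s2 [r0 rs hF]]] := F0.
  have [x x0 [x2 x1]] := cmin (lt_le_trans r0 rs) s0.
  have [y y0 [yr yx]] := cmin r0 x0.
  exists y => // z _; rewrite subr0 => zy.
  have zx : `|z| < x by exact: lt_le_trans zy yx.
  have z1 : `|z| <= 1 by apply: ltW; apply: lt_le_trans zx (le_trans x1 s1).
  have zQ : `|z ^+ Q| < x.
    by rewrite normrX; apply: le_lt_trans zx; rewrite -[leRHS]expr1; apply: ler_wiXn2l.
  have e1 : evals iota x z (ps_of_poly P * f) (P^i.[z] * F z).
    apply: (evalsM x0 zx); first exact: evals_poly.
    by apply: evals_radius (hF z _) => //; exact: lt_le_trans zy yr.
  apply: (evals_unique arch x0 zx e1); rewrite rel /H.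
  elim: (index_enum _) => [|j js IH].
    by rewrite !big_nil; have := evals_poly iota x0 zx 0; rewrite !rmorph0 horner0.
  rewrite !big_cons; apply: evalsD => //; apply: (evalsM x0 zx); first exact: evals_poly.
  apply: evals_subst => //; first exact: le_trans x1 s1.
  by apply: evals_radius (hV j _) => //; exact: lt_le_trans zQ x1.
have ta : `|t * alpha| <= `|alpha| by rewrite normrM ler_piMl.
have [k [G [rho [r0 hG FG]]]] := mero (le_lt_trans ta a1).
have taQ : `|t * alpha| ^+ Q < s'.
  by apply: le_lt_trans aQ; apply: lerXn2r; rewrite ?nnegrE.
have [e e0 he] := pow_near taQ; have [x x0 [xr xe]] := cmin r0 e0.
have h1 w : `|w - t * alpha| < x -> cdiff G w by move=> wx; apply: hG; exact: lt_le_trans wx xr.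
have h2 w : w != t * alpha -> `|w - t * alpha| < x -> (w - t * alpha) ^+ k * F w = G w.
  by move=> wn wx; apply: FG => //; exact: lt_le_trans wx xr.
have h3 w : `|w - t * alpha| < x -> cdiff H w.
  by move=> wx; apply: cdiff_H; apply: he; exact: lt_le_trans wx xe.
have [sg sg0 hsg] := agree_local arch complete P^i x0 h1 h2 h3.
by exists sg => // a b; exact: hsg.
Qed.

(** P may vanish at alpha, to order mu say. In the expansion of P F = sum c_j g_j(z^Q) around alpha,
    the coefficient of h^mu is F(alpha) times a nonzero element on the left, and on the right it
    involves the Taylor coefficients of the g_j at alpha^Q up to order mu. This is why derivatives
    have to be included in the systems. *)
Theorem value_fgen : exists mu, forall A : set C, fgen A alpha -> (forall x, fgen A (iota x)) ->
  (forall j i, (i <= mu)%N -> exists2 D, evals iota s' (alpha ^+ Q) (hasse i (g j)) D & fgen A D) ->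
  fgen A (F alpha).
Proof.
have [mu [q0 qa0 PE]] := multiplicity_XsubC P^i alpha.
have Pi0 : P^i != 0 by rewrite map_poly_eq0.
rewrite Pi0 /= in qa0; exists mu => A Aa Ai hD.
have qA : q0 \is a polyOver (fgenb A).
  have PA : P^i \is a polyOver (fgenb A).
    by apply/polyOverP => k; rewrite coef_map; apply/fgenbP; exact: Ai.
  move: PA; rewrite PE {qa0 PE Pi0}; elim: (mu) q0 => [|k IH] q0; first by rewrite mulr1.
  rewrite exprSr mulrA => /(polyOver_XsubC_div Aa); exact: IH.
pose u := ('X + alpha%:P) ^+ Q - (alpha ^+ Q)%:P : {poly C}.
have uE h : u.[h] = (alpha + h) ^+ Q - alpha ^+ Q.
  by rewrite /u hornerD hornerN hornerC horner_exp hornerD hornerX hornerC (addrC h).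
have /choice[D hDD] : forall ji : 'I_m * 'I_mu.+1, exists D,
    evals iota s' (alpha ^+ Q) (hasse ji.2 (g ji.1)) D /\ fgen A D.
  by move=> [j i]; have [D h1 h2] := hD j i (ltn_ord i : (i <= mu)%N); exists D.
have AX : 'X + alpha%:P \is a polyOver (fgenb A).
  by rewrite rpredD ?polyOverX // polyOverC; apply/fgenbP.
have Au : u \is a polyOver (fgenb A).
  by rewrite rpredB ?rpredX // polyOverC rpredX //; apply/fgenbP.
(* The Taylor polynomial of the right-hand side, where u = (alpha + h)^Q - alpha^Q is itself a
   polynomial in h. *)
pose T := \sum_j ((c j)^i \Po ('X + alpha%:P)) * \sum_(i < mu.+1) (D (j, i))%:P * u ^+ i.
have TA : T \is a polyOver (fgenb A).
  apply: rpred_sum => j _; apply: rpredM.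
    by apply: polyOver_comp => //; apply/polyOverP => k; rewrite coef_map; apply/fgenbP; exact: Ai.
  apply: rpred_sum => i _; apply: rpredM; last exact: rpredX.
  by rewrite polyOverC; apply/fgenbP; case: (hDD (j, i)).
have compE (p : {poly C}) h : (p \Po ('X + alpha%:P)).[h] = p.[alpha + h].
  by rewrite horner_comp hornerD hornerX hornerC addrC.
have O : bigO mu.+1 (fun h => h ^+ mu * (q0.[alpha + h] * F (alpha + h)) - T.[h]).
  pose fj j h := ((c j)^i \Po ('X + alpha%:P)).[h] *
     (V j ((alpha + h) ^+ Q) - \sum_(i < mu.+1) D (j, i) * u.[h] ^+ i).
  apply: (@bigO_ext C _ (fun h => \sum_j fj j h)).
    apply: bigO_sum => j; apply: bigOM; first exact: bigO_horner.
    have [M [e [M0 e0 lip]]] := cdiff_lip (@cdiffX C id alpha Q (cdiff_id alpha)).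
    have [e1 e10 he1] := pow_near aQ.
    have dM : 0 < d / M by rewrite divr_gt0.
    have [x x0 [xe x1]] := cmin e0 e10; have [y y0 [yx yd]] := cmin x0 dM.
    exists (B * (M / d) ^+ mu.+1), y; split=> //.
      by rewrite mulr_ge0 ?(bsum_ge0 (hB j)) // exprn_ge0 // divr_ge0 // ltW.
    move=> h _ hy; have aah : `|alpha + h - alpha| = `|h| by rewrite addrAC subrr add0r.
    have uh : `|u.[h]| <= M * `|h|.
      by rewrite uE -aah; apply: lip; rewrite aah; apply: lt_le_trans hy (le_trans yx xe).
    have uz : alpha ^+ Q + u.[h] = (alpha + h) ^+ Q by rewrite uE; ring.
    have sh : `|alpha ^+ Q + u.[h]| < s'.
      by rewrite uz normrX; apply: he1; rewrite aah; apply: lt_le_trans hy (le_trans yx x1).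
    have ud : `|u.[h]| <= d.
      apply: le_trans uh _; rewrite mulrC -ler_pdivlMr //; apply: le_trans yd; exact: ltW.
    have az : `|alpha ^+ Q| < s' by rewrite normrX.
    have ev : evals iota s' (alpha ^+ Q + u.[h]) (g j) (V j ((alpha + h) ^+ Q)).
      by rewrite uz; apply: hV; rewrite -uz.
    have hDj (i : 'I_mu.+1) : evals iota s' (alpha ^+ Q) (hasse i (g j)) (D (j, i)) by case: (hDD (j, i)).
    apply: le_trans (taylor arch s0 d0 sd (hB j) az hDj ud sh ev) _.
    rewrite -mulrA -exprMn; apply: ler_wpM2l; first exact: bsum_ge0 (hB j).
    apply: lerXn2r; rewrite ?nnegrE ?mulr_ge0 ?invr_ge0 ?(ltW d0) ?(ltW M0) //.
    by rewrite mulrAC; apply: ler_wpM2r; rewrite ?invr_ge0 ?(ltW d0).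
  have [e e0 he] := value_agree; exists e => // h hn hd.
  have aah : alpha + h - alpha = h by rewrite addrAC subrr add0r.
  have := he (alpha + h); rewrite -subr_eq0 aah => /(_ hn hd).
  rewrite PE hornerM horner_exp hornerXsubC aah => E.
  rewrite mulrA (mulrC (h ^+ _)) E /T horner_sum -sumrB; apply: eq_bigr => j _.
  rewrite /fj hornerM compE mulrBr; congr (_ - _ * _).
  by rewrite horner_sum; apply: eq_bigr => i _; rewrite hornerM hornerC horner_exp.
have tn : tends (fun h => q0.[alpha + h] * F (alpha + h)) (q0.[alpha] * F alpha).
  by apply: (@cdiff_tends C (fun w => q0.[w] * F w)); apply: (@cdiffM C (horner q0)) => //; exact: cdiff_horner.
have E := jet_value O tn.
have -> : F alpha = T`_mu / q0.[alpha].
  by rewrite -E mulrC mulKf //; move: qa0; rewrite /root.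
by apply: fgen_div; apply/fgenbP; [move/polyOverP: TA|apply: rpred_horner => //; apply/fgenbP].
Qed.

End Value.

(** * Analytic properties of the complex numbers *)

Section ComplexNumbers.
Variable R : realType.
Local Notation C := (CC R).

HB.instance Definition _ := GRing.isZmodMorphism.Build (Qbar R) C (@QbarC R)
  (rmorphB (val : Qbar R -> C)).
HB.instance Definition _ := GRing.isMonoidMorphism.Build (Qbar R) C (@QbarC R)
  (conj (rmorph1 (val : Qbar R -> C)) (rmorphM (val : Qbar R -> C))).

Lemma CC_arch (x : C) : exists k : nat, `|x| <= k%:R.
Proof.
have [r r0 ->] : exists2 r : R, 0 <= r & `|x| = (r%:C)%C :> complex R.
  by case: x => a b; exists (Num.sqrt (a ^+ 2 + b ^+ 2)); rewrite ?sqrtr_ge0.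
exists (Num.bound r); rewrite -(rmorph_nat (real_complex R)) lecR ltW //.
exact: archi_boundP.
Qed.

Lemma normc_le_Re (x y : complex R) : (`|complex.Re x - complex.Re y|%:C)%C <= `|x - y|.
Proof.
case: x y => a b [c d]; rewrite normc_def /= lecR -sqrtr_sqr; apply: ler_wsqrtr.
by rewrite lerDl sqr_ge0.
Qed.

Lemma normc_le_Im (x y : complex R) : (`|complex.Im x - complex.Im y|%:C)%C <= `|x - y|.
Proof.
case: x y => a b [c d]; rewrite normc_def /= lecR -sqrtr_sqr; apply: ler_wsqrtr.
by rewrite lerDr sqr_ge0.
Qed.

Lemma real_seq_lim (v : nat -> R) :
  (forall e : R, 0 < e -> exists N, forall n, (N <= n)%N -> `|v N - v n| < e) ->
  exists l : R, forall e, 0 < e -> exists N, forall n, (N <= n)%N -> `|l - v n| < e.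
Proof.
move=> h; have cv : cvg (v @ \oo).
  apply/cauchy_cvgP; apply: cauchy_exP => e e0; have [N hN] := h e e0.
  by exists (v N); exists N => // n /= Nn; rewrite -ball_normE /=; exact: hN.
exists (lim (v @ \oo)) => e e0.
have /cvgrPdist_lt/(_ e e0)[N _ hN] := cv.
by exists N => n Nn; apply: hN.
Qed.

(** Real and imaginary parts are Cauchy sequences of reals. The geometric rate for the limit is
    recovered from that of u n - u m by letting n grow. *)
Lemma CC_complete (u : nat -> C) (b t : C) : 0 <= t -> t < 1 ->
  (forall m n, (m <= n)%N -> `|u n - u m| <= b * t ^+ m) ->
  exists l, forall m, `|l - u m| <= b * t ^+ m.
Proof.
move=> t0 t1 hu; have b0 : 0 <= b.
  by have := hu 0%N 0%N (leqnn _); rewrite expr0 mulr1; apply: le_trans.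
have small (e : R) : 0 < e -> exists N, b * t ^+ N < (e%:C)%C :> complex R.
  move=> e0; have b1 : 0 < b + 1 by rewrite ltr_wpDl.
  have ec : 0 < (e%:C)%C :> C by rewrite (ltcR 0).
  have e1 : 0 < ((e%:C)%C : C) / 2%:R / (b + 1) by rewrite !divr_gt0.
  have [k hk] := pow_small CC_arch t0 t1 e1; exists k.
  apply: (@le_lt_trans _ _ (((e%:C)%C : C) / 2%:R)).
    apply: (@le_trans _ _ ((b + 1) * (((e%:C)%C : C) / 2%:R / (b + 1)))).
      by apply: ler_pM; rewrite ?exprn_ge0 // lerDl.
    by rewrite mulrC divfK // lt0r_neq0.
  by rewrite ltr_pdivrMr ?ltr0n // ltr_pMr // ltr1n.
have [lr hlr] : exists l : R, forall e, 0 < e -> exists N, forall n, (N <= n)%N -> `|l - complex.Re (u n)| < e.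
  apply: real_seq_lim => e /small[N hN]; exists N => n Nn.
  rewrite -ltcR; apply: le_lt_trans hN; apply: le_trans (hu N n Nn); rewrite distrC.
  exact: normc_le_Re.
have [li hli] : exists l : R, forall e, 0 < e -> exists N, forall n, (N <= n)%N -> `|l - complex.Im (u n)| < e.
  apply: real_seq_lim => e /small[N hN]; exists N => n Nn.
  rewrite -ltcR; apply: le_lt_trans hN; apply: le_trans (hu N n Nn); rewrite distrC.
  exact: normc_le_Im.
pose l : C := (lr +i* li)%C; exists l => m.
have h20 : (0 : C) <= 2%:R^-1 by rewrite invr_ge0 ler0n.
have h21 : (2%:R^-1 : C) < 1 by rewrite invf_lt1 ?ltr0n // ltr1n.
apply: (@geom_le C CC_arch _ _ 2%:R 2%:R^-1) => //; rewrite ?normr_real ?ger0_real ?mulr_ge0 ?exprn_ge0 ?ler0n //.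
move=> N; have e0 : 0 < 2%:R^-1 ^+ N :> R by rewrite exprn_gt0 // invr_gt0 ltr0n.
have [N1 h1] := hlr _ e0; have [N2 h2] := hli _ e0.
pose n := maxn m (maxn N1 N2).
have n1 : (N1 <= n)%N by rewrite /n; lia.
have n2 : (N2 <= n)%N by rewrite /n; lia.
have mn : (m <= n)%N by rewrite /n; lia.
rewrite (_ : l - u m = (l - u n) + (u n - u m)); last by ring.
apply: le_trans (ler_normD _ _) _; rewrite addrC; apply: lerD; first exact: hu.
have -> : l - u n = ((lr - complex.Re (u n))%:C)%C + 'i%C * ((li - complex.Im (u n))%:C)%C :> complex R.
  by rewrite /l; case: (u n) => x y; apply/eqP; rewrite eq_complex /=; apply/andP; split; apply/eqP; ring.
apply: le_trans (ler_normD _ _) _; rewrite mulr2n mulrDl mul1r.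
have E : (2%:R^-1 ^+ N : C) = ((2%:R^-1 ^+ N)%:C)%C :> complex R.
  by rewrite rmorphXn fmorphV rmorph_nat.
rewrite E normrM; apply: lerD.
  by rewrite normc_def /= expr0n addr0 sqrtr_sqr lecR ltW // h1.
have -> : `|'i%C : complex R| = 1 by rewrite normc_def /= expr0n expr1n add0r sqrtr1.
by rewrite mul1r normc_def /= expr0n addr0 sqrtr_sqr lecR ltW // h2.
Qed.

Lemma near_ball (P : set C) (z : C) : (\forall w \near z, P w) ->
  exists2 d : C, 0 < d & forall w, `|w - z| < d -> P w.
Proof.
move=> /nbhs_ballP[d d0 h]; exists d => // w wz; apply: h.
by rewrite -ball_normE /= distrC.
Qed.

Lemma near_punctured (P : set C) (z : C) : (\forall w \near z^', P w) ->
  exists2 d : C, 0 < d & forall w, w != z -> `|w - z| < d -> P w.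
Proof. by move=> /near_ball[d d0 h]; exists d => // w wn wz; apply: h. Qed.

Lemma derivable_cdiff (F : C -> C) (w : C) : derivable F w 1 -> cdiff F w.
Proof.
move=> /cvg_ex[D /cvgrPdist_lt hD]; exists D => e e0.
have [d d0 h] := near_punctured (hD e e0); exists d => // z zw.
have [->|zn] := eqVneq z w; first by rewrite !subrr mulr0 subr0 normr0 mulr0.
have z0 : z - w != 0 by rewrite subr_eq0.
have := h (z - w) z0; rewrite subr0 => /(_ zw) /=.
rewrite /GRing.scale /= mulr1 subrK => /ltW hq.
have -> : F z - F w - (D : C) * (z - w) = - (((D : C) - (z - w)^-1 * (F z - F w)) * (z - w)).
  by rewrite mulrBl mulrAC mulVf // mul1r opprB.
by rewrite normrN normrM; apply: ler_wpM2r.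
Qed.

Lemma holomorphic_cdiff (F : C -> C) (z : C) : holomorphic_at F z ->
  exists2 d : C, 0 < d & forall w, `|w - z| < d -> cdiff F w.
Proof.
by move=> /near_ball[d d0 h]; exists d => // w /h; exact: derivable_cdiff.
Qed.

Local Notation cf f := (fun k => QbarC (pcoef f k)).

(** Convergence at one positive z bounds the terms by some M; at z / 2 they are dominated by a
    geometric series with sum at most 2 M. *)
Lemma convergent_bsum (f : powser (Qbar R)) : convergent f -> exists s B : C, 0 < s /\ bsum s (cf f) B.
Proof.
move=> /near_ball[d d0 h]; have d2 : 0 < d / 2%:R by rewrite divr_gt0 ?ltr0n.
have [|l hl] := h (d / 2%:R).
  by rewrite subr0 gtr0_norm // ltr_pdivrMr ?ltr0n // ltr_pMr // ltr1n.
set z := d / 2%:R in d2 hl.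
have [M M0 hM] : exists2 M : C, 0 <= M & forall n, `|QbarC (pcoef f n)| * z ^+ n <= M.
  have cv : cvg (series (fun n => QbarC (pcoef f n) * z ^+ n) @ \oo) by apply/cvg_ex; exists l.
  have /cvgrPdist_lt/(_ 1 ltr01)[N _ hN] := cvg_series_cvg_0 cv.
  exists (1 + \sum_(n < N) `|QbarC (pcoef f n)| * z ^+ n).
    by rewrite addr_ge0 // sumr_ge0 // => n _; rewrite mulr_ge0 // exprn_ge0 // ltW.
  move=> n; have [Nn|nN] := leqP N n.
    have := hN n Nn; rewrite sub0r normrN normrM normrX (gtr0_norm d2) => /ltW/le_trans; apply.
    by rewrite lerDl sumr_ge0 // => k _; rewrite mulr_ge0 // exprn_ge0 // ltW.
  rewrite (bigD1 (Ordinal nN)) //= addrCA lerDl addr_ge0 // sumr_ge0 // => k _.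
  by rewrite mulr_ge0 // exprn_ge0 // ltW.
exists (z / 2%:R), (M * 2%:R); split; first by rewrite divr_gt0 ?ltr0n.
move=> N; apply: (@le_trans _ _ (\sum_(k < N) M * 2%:R^-1 ^+ k)).
  apply: ler_sum => k _; rewrite exprMn mulrA; apply: ler_wpM2r; last exact: hM.
  by rewrite exprn_ge0 // invr_ge0 ler0n.
rewrite -mulr_sumr; apply: ler_wpM2l => //.
have -> : \sum_(k < N) (2%:R^-1 : C) ^+ k = 2%:R - 2%:R * 2%:R^-1 ^+ N.
  elim: N => [|N IH]; first by rewrite big_ord0 expr0 mulr1 subrr.
  by rewrite big_ord_recr /= IH exprS; field.
by rewrite gerBl mulr_ge0 ?exprn_ge0 ?invr_ge0 ?ler0n.
Qed.

Lemma ps_sum_evals (f : powser (Qbar R)) (s B z l : C) : 0 < s -> bsum s (cf f) B -> `|z| < s ->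
  ps_sum f z l -> evals (@QbarC R) s z f l.
Proof.
move=> s0 hB zs hl; have [l' hl'] := evals_ex CC_complete s0 zs hB.
suff -> : l = l' by [].
have [_ [M hM]] := hl'; apply/eqP; rewrite -subr_eq0; apply/negPn/negP => ne.
have e0 : 0 < `|l - l'| / 2%:R by rewrite divr_gt0 ?ltr0n // normr_gt0.
have /cvgrPdist_lt/(_ _ e0)[N _ hN] := hl.
have t0 : 0 <= `|z| / s by rewrite divr_ge0 // ltW.
have t1 : `|z| / s < 1 by rewrite ltr_pdivrMr ?mul1r.
have M0 : 0 <= M by have := hM 0%N; rewrite expr0 mulr1; apply: le_trans.
have M1 : 0 < M + 1 by rewrite ltr_wpDl.
have e1 : 0 < `|l - l'| / 2%:R / (M + 1) by rewrite divr_gt0.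
have [k hk] := pow_small CC_arch t0 t1 e1; pose n := (N + k)%N.
have h1 := hN n (leq_addr _ _); rewrite /series /= big_mkord in h1.
have h2 : `|l' - psum (cf f) z n| <= `|l - l'| / 2%:R.
  apply: le_trans (hM n) _; apply: (@le_trans _ _ ((M + 1) * (`|l - l'| / 2%:R / (M + 1)))).
    apply: ler_pM; rewrite ?exprn_ge0 ?lerDl //; apply: le_trans hk.
    by apply: ler_wiXn2l; rewrite ?(ltW t1) // leq_addl.
  by rewrite mulrC divfK // lt0r_neq0.
have : `|l - l'| < `|l - l'|; last by rewrite ltxx.
rewrite {1}(_ : l - l' = (l - psum (cf f) z n) - (l' - psum (cf f) z n)); last by ring.
apply: le_lt_trans (ler_normB _ _) _.
rewrite [ltRHS](_ : _ = `|l - l'| / 2%:R + `|l - l'| / 2%:R); last by field.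
exact: ltr_leD.
Qed.

End ComplexNumbers.

Section Fractions.

Lemma common_denominator (A : idomainType) (I : finType) (x : I -> {fraction A}) :
  exists (e : A) (N : I -> A), e != 0 /\ forall i, x i = (N i)%:F / e%:F.
Proof.
have d0 i : denom (x i) != 0 by exact: denom_ratioP.
exists (\prod_i denom (x i)), (fun i => numer (x i) * \prod_(j | j != i) denom (x j)); split.
  by apply/prodf_neq0 => i _.
move=> i; transitivity ((numer (x i))%:F / (denom (x i))%:F); first exact: frac_repr.
pose pr := \prod_(j | j != i) denom (x j).
have FM (a b : A) : (a * b)%:F = a%:F * b%:F :> {fraction A} by exact: tofracM.
have -> : \prod_i denom (x i) = denom (x i) * pr by rewrite (bigD1 i).
have p0 : pr%:F != 0 :> {fraction A} by rewrite tofrac_eq0; apply/prodf_neq0 => j _.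
by rewrite !FM -mulf_div divff // mulr1.
Qed.

Lemma mahler_sys_of_solution (R : realType) q m (A : 'M[{fraction {poly (Qbar R)}}]_m)
    (g : 'cV[powser (Qbar R)]_m) : A \in unitmx -> mahler_solution q A g ->
  exists e N, mahler_sys q e N (fun i => g i 0).
Proof.
move=> Au sol; have [e [N [e0 hN]]] := common_denominator (fun ij : 'I_m * 'I_m => A ij.1 ij.2).
pose M := \matrix_(i, j) N (i, j); exists e, M.
have eF : e%:F != 0 :> {fraction {poly (Qbar R)}} by rewrite tofrac_eq0.
have psM : {morph @ps_of_poly (Qbar R) : x y / x * y} by move=> x y; rewrite rmorphM.
have inj x : ps_of_poly x = 0 -> x = 0 :> {poly (Qbar R)} by exact: ps_of_poly_eq0.
split=> // [|i].
  have AE : A = (e%:F)^-1 *: map_mx (@FracField.tofrac _) M.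
    by apply/matrixP => i j; rewrite !mxE (hN (i, j)) mulrC.
  move: Au; rewrite unitmxE unitfE AE detZ mulf_eq0 negb_or => /andP[_].
  by rewrite det_map_mx tofrac_eq0.
have := congr1 (fun B : 'cV_m => B i 0) sol; rewrite !mxE => E.
have eP : (ps_of_poly e)%:F != 0 :> {fraction (powser (Qbar R))}.
  by rewrite tofrac_eq0; apply: contra_neq e0; exact: inj.
apply/eqP; rewrite -tofrac_eq tofracM E mulr_sumr rmorph_sum; apply/eqP; apply: eq_bigr => j _.
rewrite !mxE (hN (i, j)) (frac_mapE _ psM (rmorph0 _) inj e0) rmorphM /=.
by rewrite mulrA mulrCA divff // mulr1.
Qed.

End Fractions.

Section MapSeries.
Variables (K L : fieldType) (iota : {rmorphism K -> L}).

Definition ps_map (f : powser K) : powser L := PowSer (fun n => iota (pcoef f n)).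

Lemma ps_mapM f g : ps_map (f * g) = ps_map f * ps_map g.
Proof.
by apply: powserP => n /=; rewrite rmorph_sum; apply: eq_bigr => i _; rewrite rmorphM.
Qed.

Lemma ps_map_sum (I : Type) (s : seq I) (F : I -> powser K) :
  ps_map (\sum_(i <- s) F i) = \sum_(i <- s) ps_map (F i).
Proof.
elim: s => [|i s IH].
  by rewrite !big_nil; apply: powserP => n /=; rewrite !coef0 rmorph0.
by rewrite !big_cons -IH; apply: powserP => n /=; rewrite rmorphD.
Qed.

Lemma ps_map_poly p : ps_map (ps_of_poly p) = ps_of_poly (map_poly iota p).
Proof. by apply: powserP => n /=; rewrite coef_map. Qed.

Lemma ps_map_subst q f : ps_map (ps_subst q f) = ps_subst q (ps_map f).
Proof. by apply: powserP => n /=; case: ifP => //; rewrite rmorph0. Qed.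

Lemma mahler_sys_map q m e (A : 'M[{poly K}]_m) (g : 'I_m -> powser K) : mahler_sys q e A g ->
  mahler_sys q (map_poly iota e) (map_mx (map_poly iota) A) (fun i => ps_map (g i)).
Proof.
move=> [e0 A0 sys]; split.
- by rewrite map_poly_eq0.
- by rewrite det_map_mx map_poly_eq0.
move=> i; rewrite -ps_map_poly -ps_mapM sys ps_map_sum; apply: eq_bigr => j _.
by rewrite ps_mapM ps_map_poly ps_map_subst mxE.
Qed.

End MapSeries.

(** * Algebraic relations between series *)

Section IndependenceComplements.
Variable L : fieldType.
Implicit Types (A B : set L).

Lemma aindep_sub A B (s : seq L) : A `<=` B -> aindep B s -> aindep A s.
Proof.
elim: s A B => //= x s IH A B AB [xB h]; split; first by move=> xA; apply: xB; exact: acl_mono xA.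
by apply: IH h; apply: setSU.
Qed.

Lemma aindep_notin A (s : seq L) x : aindep A s -> A x -> x \notin s.
Proof.
elim: s A => //= y s IH A [yA h] Ax; rewrite in_cons negb_or; apply/andP; split.
  by apply/eqP => xy; apply: yA; rewrite -xy; exact: acl_in.
by apply: IH h _; left.
Qed.

Lemma aindep_uniq A (s : seq L) : aindep A s -> uniq s.
Proof.
elim: s A => //= x s IH A [xA h]; apply/andP; split; last exact: IH h.
by apply: aindep_notin h _; right.
Qed.

End IndependenceComplements.

Lemma fgen_image (K L : fieldType) (phi : {rmorphism K -> L}) (A : set K) x :
  fgen A x -> fgen (phi @` A) (phi x).
Proof.
elim=> [{}x Ax||{}x y _ hx _ hy|{}x y _ hx _ hy].
- by apply: fgen_in; exists x.
- by rewrite rmorph1; exact: fgen_1.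
- by rewrite rmorphB; exact: fgen_sub.
- by rewrite fmorph_div; exact: fgen_div.
Qed.

Lemma acl_image (K L : fieldType) (phi : {rmorphism K -> L}) (A : set K) x :
  acl A x -> acl (phi @` A) (phi x).
Proof.
move=> [p p0 rp]; apply: (@acl_root _ _ (map_poly phi (map_poly val p))).
- by rewrite !map_poly_eq0.
- by move=> i; rewrite !coef_map; apply: acl_fgen; apply: fgen_image; exact: fgenP.
- by rewrite fmorph_root.
Qed.

Lemma mmap_comp (K A B : comNzRingType) (f : K -> A) (psi : {rmorphism A -> B}) n (h : 'I_n -> A)
    (P : mpoly n K) : psi (mmap f h P) = mmap (psi \o f) (psi \o h) P.
Proof.
rewrite /mmap rmorph_sum; apply: eq_bigr => m _; rewrite rmorphM; congr (_ * _).
by rewrite /mmap1 rmorph_prod; apply: eq_bigr => i _; rewrite rmorphXn.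
Qed.

Section Relations.
Variables (K L : fieldType) (iota : {rmorphism K -> L}).

Lemma acl_relation n (S : 'I_n -> L) y : acl (range iota `|` [set` codom S]) y ->
  exists P : {poly mpoly n K}, map_poly (mmap iota S) P != 0 /\ root (map_poly (mmap iota S) P) y.
Proof.
move=> [p p0 rp].
have /choice[PQ hPQ] : forall k, exists PQ : mpoly n K * mpoly n K, mmap iota S PQ.2 != 0 /\
    val p`_k = mmap iota S PQ.1 / mmap iota S PQ.2.
  by move=> k; have [a [b h]] := fgen_mmap (fgenP p`_k); exists (a, b).
pose den (k : 'I_(size p)) := (PQ k).2; pose D := \prod_k den k.
pose P := \poly_(k < size p) ((PQ k).1 * \prod_(l < size p | val l != k) den l).
have D0 : mmap iota S D != 0.
  by rewrite rmorph_prod; apply/prodf_neq0 => k _; case: (hPQ k).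
have E : map_poly (mmap iota S) P = mmap iota S D *: map_poly val p.
  apply/polyP => k; rewrite coefZ !coef_map /= coef_poly; case: ltnP => h; last first.
    by rewrite rmorph0 nth_default ?rmorph0 ?mulr0.
  have MM a b : mmap iota S (a * b) = mmap iota S a * mmap iota S b by exact: rmorphM.
  have DE : D = (PQ k).2 * \prod_(l < size p | val l != k) den l by rewrite /D (bigD1 (Ordinal h)).
  have [h1 ->] := hPQ k; rewrite DE !MM.
  by move: (mmap _ _ (\prod_(_ < _ | _) _)) => w /=; field.
exists P; rewrite E; split.
  by rewrite scaler_eq0 negb_or D0 map_poly_eq0.
by rewrite /root hornerZ mulf_eq0; move: rp; rewrite /root => ->; rewrite orbT.
Qed.

(** A formal relation stays nontrivial at a point if its leading coefficient survives there. With
    [acl_relation] this transfers dependence from series to values. *)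
Lemma relation_acl n (S : 'I_n -> L) y (P : {poly mpoly n K}) :
  mmap iota S (lead_coef P) != 0 -> root (map_poly (mmap iota S) P) y ->
  acl (range iota `|` [set` codom S]) y.
Proof.
move=> l0 r; apply: acl_root r; last by move=> i; rewrite coef_map; exact: acl_mmap.
by apply/eqP => /(congr1 (fun p : {poly L} => p`_(size P).-1)); rewrite coef_map coef0 -lead_coefE; exact/eqP.
Qed.

End Relations.

Section Renaming.
Variables (K : fieldType) (n N : nat) (emb : 'I_n -> 'I_N).
Hypothesis emb_inj : injective emb.

(** Moves a polynomial in one block of variables to the full set of variables; [unren] goes back by
    sending the other variables to 0. *)
Definition ren : {rmorphism mpoly n K -> mpoly N K} :=
  mmap (@mpolyC N K) (fun u => 'X_[mnm1 (emb u)]).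
Definition unren : {rmorphism mpoly N K -> mpoly n K} :=
  mmap (@mpolyC n K) (fun v => if [pick u | emb u == v] is Some u then 'X_[mnm1 u] else 0).

Lemma mmap_id (Q : mpoly n K) : mmap (@mpolyC n K) (fun u => 'X_[mnm1 u]) Q = Q.
Proof.
rewrite [RHS](@mpolyE n K Q) /mmap; apply: eq_bigr => m _.
by rewrite mul_mpolyC; congr (_ *: _); rewrite [RHS]mpolyXE_id /mmap1.
Qed.

Lemma renK : cancel ren unren.
Proof.
move=> Q; rewrite -[RHS]mmap_id /ren /= mmap_comp; apply: eq_bigr => m _; congr (_ * _).
  by rewrite /= /unren /= mmapC.
apply: eq_bigr => u _; congr (_ ^+ _); rewrite /= /unren /= mmapX mmap1U.
by case: pickP => [u' /eqP/emb_inj -> //|/(_ u)]; rewrite eqxx.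
Qed.

Lemma ren_eq0 Q : ren Q = 0 -> Q = 0.
Proof. by move=> h; rewrite -[Q]renK h rmorph0. Qed.

Lemma mmap_ren (A : comNzRingType) (f : {rmorphism K -> A}) (x : 'I_N -> A) Q :
  mmap f x (ren Q) = mmap f (x \o emb) Q.
Proof.
rewrite /ren /= mmap_comp; apply: eq_bigr => m _; congr (_ * _); first by rewrite /= mmapC.
by apply: eq_bigr => u _; congr (_ ^+ _); rewrite /= mmapX mmap1U.
Qed.

Lemma ren_unren Q : (forall m, m \in msupp Q -> forall v, v \notin codom emb -> m v = 0%N) ->
  ren (unren Q) = Q.
Proof.
move=> h; rewrite /unren /= mmap_comp [RHS](@mpolyE N K Q) /mmap.
rewrite big_seq [RHS]big_seq; apply: eq_bigr => m hm; rewrite /= /ren /= mmapC mul_mpolyC; congr (_ *: _).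
rewrite [RHS]mpolyXE_id /mmap1; apply: eq_bigr => v _ /=.
case: pickP => [u /eqP <-|hn] /=; first by rewrite mmapX mmap1U.
by rewrite h ?expr0 //; apply/codomP => -[u e]; have := hn u; rewrite e eqxx.
Qed.

End Renaming.

Section FormalRelations.
Variable K : fieldType.

Lemma pcoef_sum (I : Type) (s : seq I) (F : I -> powser K) n :
  pcoef (\sum_(i <- s) F i) n = \sum_(i <- s) pcoef (F i) n.
Proof. by elim: s => [|i s IH]; rewrite ?big_nil ?pcoef0 // !big_cons pcoefD IH. Qed.

Lemma poly_var_free n (v : 'I_n) (Q : mpoly n K) (S : 'I_n -> powser K) : S v = ps_of_poly 'X ->
  (forall m, m \in msupp Q -> forall u, u != v -> m u = 0%N) -> mmap (@psc K) S Q = 0 -> Q = 0.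
Proof.
move=> Sv h Q0; apply/mpolyP => m0; rewrite mcoeff0; apply/eqP; rewrite mcoeff_eq0; apply/negP => hm.
have E : pcoef (mmap (@psc K) S Q) (m0 v) = \sum_(m <- msupp Q) Q@_m * (m v == m0 v)%:R.
  rewrite /mmap pcoef_sum big_seq [RHS]big_seq; apply: eq_bigr => m hm'.
  have -> : mmap1 S m = S v ^+ m v.
    by rewrite /mmap1 (bigD1 v) //= big1 ?mulr1 // => u uv; rewrite h // expr0.
  by rewrite pcoef_psc Sv -rmorphXn /= coefXn eq_sym.
move: E; rewrite Q0 pcoef0 (bigD1_seq m0) ?msupp_uniq //= eqxx mulr1 big_seq_cond big1 ?addr0.
  by move=> /esym/eqP; rewrite mcoeff_eq0 hm.
move=> m /andP[hm' mm]; case: eqP => [e|]; last by rewrite mulr0.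
case/eqP: mm; apply/mnmP => u; have [->//|uv] := eqVneq u v.
by rewrite !h.
Qed.

(** Dependence of series is studied in the field of fractions of K[[z]], because [acl] lives in a
    field. *)
Definition kfrac : {rmorphism K -> {fraction (powser K)}} := (@FracField.tofrac (powser K) \o @psc K).

Lemma mmap_kfrac n (S : 'I_n -> powser K) (Q : mpoly n K) :
  mmap kfrac (fun v => (S v)%:F) Q = (mmap (@psc K) S Q)%:F.
Proof. by rewrite (mmap_comp _ (@FracField.tofrac (powser K))). Qed.

Lemma root_kfrac n (S : 'I_n -> powser K) (P : {poly mpoly n K}) g :
  root (map_poly (mmap kfrac (fun v => (S v)%:F)) P) g%:F -> (map_poly (mmap (@psc K) S) P).[g] = 0.
Proof.
rewrite /root => /eqP h; apply/eqP; rewrite -(tofrac_eq0 (_.[g])).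
rewrite -[_%:F]/(@FracField.tofrac (powser K) _) -horner_map /=; apply/eqP; rewrite -[RHS]h; congr (_.[_]).
by apply/polyP => k; rewrite !coef_map /= -mmap_kfrac.
Qed.

Lemma X_free : ~ acl (range kfrac) (ps_of_poly 'X)%:F.
Proof.
have : aindep (range kfrac) (codom (fun _ : 'I_1 => (ps_of_poly 'X : powser K)%:F)).
  apply: mmap_aindep => P; rewrite (mmap_kfrac (fun=> ps_of_poly 'X)) => /eqP.
  rewrite tofrac_eq0 => /eqP; apply: (poly_var_free (v := ord0)) => // m _ u.
  by rewrite ord1.
by rewrite /codom /image_mem enum_ordSl /= => -[].
Qed.

Variables (C : numClosedFieldType) (iota : {rmorphism K -> C}) (s z : C).
Hypothesis arch : forall x : C, exists k : nat, `|x| <= k%:R.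
Hypotheses (s0 : 0 < s) (zs : `|z| < s).

Lemma evals_root n (S : 'I_n -> powser K) (l : 'I_n -> C) (P : {poly mpoly n K}) g y :
  (forall v, evals iota s z (S v) (l v)) -> evals iota s z g y ->
  evals iota s z (map_poly (mmap (@psc K) S) P).[g] (map_poly (mmap iota l) P).[y].
Proof.
move=> hS hg; have e1 : evals iota s z 1 1 by have := evals_psc iota s0 zs 1; rewrite !rmorph1.
have e0 : evals iota s z 0 0 by have := evals_psc iota s0 zs 0; rewrite !rmorph0.
rewrite (@horner_coef_wide _ (size P)) ?size_poly // (@horner_coef_wide _ (size P) (map_poly _ _)) ?size_poly //.
elim: (index_enum _) => [|k ks IH]; first by rewrite !big_nil.
rewrite !big_cons; apply: evalsD => //; apply: (evalsM s0 zs).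
  by rewrite !coef_map; apply: evals_mmap.
by elim: (k : nat) => [|j IHj]; rewrite ?expr0 // !exprS; exact: evalsM.
Qed.

Hypothesis complete : forall (u : nat -> C) (b t : C), 0 <= t -> t < 1 ->
  (forall m n, (m <= n)%N -> `|u n - u m| <= b * t ^+ m) ->
  exists l, forall m, `|l - u m| <= b * t ^+ m.

Lemma evals_bound (f : powser K) B l N : bsum s (fun k => iota (pcoef f k)) B -> evals iota s z f l ->
  `|l - psum (fun k => iota (pcoef f k)) z N| <= B * (`|z| / s) ^+ N.
Proof.
move=> hB hl; have [l' hl'] := psum_limit complete s0 hB zs.
have -> // : l = l'; apply: (evals_unique arch s0 zs hl); split; first by exists B.
by exists B.
Qed.

End FormalRelations.

(** Write p = p1 X^v with p1(0) != 0; the points a^(q^j) are nonzero and tend to 0. *)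
Lemma eventually_nonzero (C : numClosedFieldType) (arch : forall x : C, exists k : nat, `|x| <= k%:R)
    (p : {poly C}) (a : C) q : p != 0 -> a != 0 -> `|a| < 1 -> (1 < q)%N ->
  exists l, forall j, (l <= j)%N -> p.[a ^+ (q ^ j)] != 0.
Proof.
move=> p0 a0 a1 q1; have [v [p1 r1 pE]] := multiplicity_XsubC p 0; rewrite p0 /= in r1.
have [M [d [M0 d0 lip]]] := cdiff_lip (cdiff_horner p1 0).
have e0 : 0 < `|p1.[0]| / M by rewrite divr_gt0 // normr_gt0; move: r1; rewrite /root.
have [x x0 [xd xe]] := cmin d0 e0; have x2 : 0 < x / 2%:R by rewrite divr_gt0 ?ltr0n.
have [l hl] := pow_small arch (normr_ge0 a) a1 x2; exists l => j lj.
have ax : `|a ^+ (q ^ j)| < x.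
  rewrite normrX; apply: (@le_lt_trans _ _ (x / 2%:R)); last by rewrite ltr_pdivrMr ?ltr0n // ltr_pMr // ltr1n.
  apply: le_trans hl; apply: ler_wiXn2l; rewrite ?(ltW a1) //.
  by apply: leq_trans lj _; apply: ltnW; exact: ltn_expl.
rewrite pE hornerM horner_exp hornerXsubC subr0 mulf_neq0 ?expf_neq0 //.
apply/eqP => h; have := lip (a ^+ (q ^ j)); rewrite h sub0r normrN subr0.
move=> /(_ (lt_le_trans ax xd)); rewrite mulrC -ler_pdivrMr // => /le_lt_trans/(_ ax)/lt_le_trans/(_ xe).
by rewrite ltxx.
Qed.

(** * Growth of heights along an orbit *)

Section Tame.
Variables (C : numClosedFieldType) (d : nat) (e : 'I_d -> C) (c : 'I_d -> 'I_d -> 'I_d -> int).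
Hypothesis emul : forall i j, e i * e j = \sum_k (c i j k)%:~R * e k.
Variable c0 : nat.
Hypotheses (c02 : (2 <= c0)%N) (c0k : (kap c <= c0)%N).

(** One base c0 >= [kap] measures denominators and coordinates. In a product the exponent N + N' + 1
    gives the height two more powers of c0: one absorbs [kap], the other the scaling of the
    denominator. *)
Definition tame N x := hgt e (c0 ^ N) (c0 ^ (2 * N)) x.

Let pow0 n : (0 < c0 ^ n)%N. Proof. by rewrite expn_gt0 (leq_trans _ c02). Qed.

Lemma tame_mono N N' x : (N <= N')%N -> tame N x -> tame N' x.
Proof.
move=> h /(hgt_scale (c0 ^ (N' - N))); rewrite -!expnD subnKC //; apply: hgt_mono.
by rewrite leq_pexp2l //; lia.
Qed.

Lemma tame0 N : tame N 0. Proof. exact: hgt0. Qed.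

Lemma tameM N N' x y : tame N x -> tame N' y -> tame (N + N').+1 (x * y).
Proof.
move=> hx hy; have := hgt_scale c0 (hgtM emul hx hy).
rewrite -!expnD -!expnSr /tame; apply: hgt_mono.
have -> : (c0 ^ (2 * (N + N').+1) = c0 ^ (2 * N + 2 * N') * c0 * c0)%N.
  by rewrite -!expnSr; congr (_ ^ _)%N; lia.
by rewrite leq_mul2r [X in (X <= _)%N]mulnC leq_mul2l c0k !orbT.
Qed.

Lemma tame_sum N (I : finType) (F : I -> C) : (#|I| <= c0)%N -> (forall i, tame N (F i)) ->
  tame N.+1 (\sum_i F i).
Proof.
move=> h hF; have := hgt_sum (index_enum I) (P := xpredT) (fun i _ => hF i) => /(hgt_scale c0).
rewrite -expnSr; apply: hgt_mono; rewrite -mulnA -expnSr (_ : 2 * N.+1 = (2 * N).+1.+1)%N; last by lia.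
by rewrite (expnS _ (2 * N).+1) leq_mul // (leq_trans _ h) // cardT enumT.
Qed.

Lemma tameD N x y : tame N x -> tame N y -> tame N.+1 (x + y).
Proof.
move=> hx hy; have -> : x + y = \sum_(i < 2) (if val i == 0%N then x else y).
  by rewrite !big_ord_recl big_ord0 addr0.
by apply: tame_sum; rewrite ?card_ord // => i; case: ifP.
Qed.

Lemma growth_tame n (X : nat -> 'I_n -> C) kp : (forall k i, tame (kp * 2 ^ k) (X k i)) -> growth e X.
Proof.
move=> h; exists (c0 ^ (2 * kp))%N; split=> // k i; exists (c0 ^ (kp * 2 ^ k))%N.
rewrite -expnM; split=> //; first by rewrite leq_pexp2l ?(leq_trans _ c02) //; lia.
by have := h k i; rewrite /tame mulnA.
Qed.

Variable q : nat.
Hypothesis q2 : (2 <= q)%N.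
Let q1 k : (1 <= q ^ k)%N. Proof. by rewrite expn_gt0 (leq_trans _ q2). Qed.

Definition tseq (x : nat -> C) := exists kp, forall k, tame (kp * q ^ k) (x k).

Lemma tseq_ext x y : x =1 y -> tseq x -> tseq y.
Proof. by move=> xy [kp h]; exists kp => k; rewrite -xy. Qed.

Lemma tseqD x y : tseq x -> tseq y -> tseq (fun k => x k + y k).
Proof.
move=> [a ha] [b hb]; exists (a + b).+1 => k; apply: (@tame_mono ((a + b) * q ^ k).+1).
  by rewrite mulSn -add1n leq_add2r.
by apply: tameD; [apply: tame_mono (ha k)|apply: tame_mono (hb k)]; rewrite mulnDl ?leq_addr ?leq_addl.
Qed.

Lemma tseqM x y : tseq x -> tseq y -> tseq (fun k => x k * y k).
Proof.
move=> [a ha] [b hb]; exists (a + b).+1 => k; apply: tame_mono (tameM (ha k) (hb k)).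
by rewrite mulSn -mulnDl -add1n leq_add2r.
Qed.

Lemma tseq_cst x : tame 1 x -> tseq (fun _ => x).
Proof. by move=> h; exists 1%N => k; apply: tame_mono h; rewrite mul1n. Qed.

Lemma tame_exp x n : tame 1 1 -> tame 1 x -> tame (2 * n + 1) (x ^+ n).
Proof.
move=> h1 hx; elim: n => [|n IH]; first by rewrite expr0.
by rewrite exprS; apply: tame_mono (tameM hx IH); lia.
Qed.

Lemma tseq_pow x : tame 1 1 -> tame 1 x -> tseq (fun k => x ^+ (q ^ k)).
Proof.
move=> h1 hx; exists 3%N => k; apply: tame_mono (tame_exp (q ^ k) h1 hx).
by have := q1 k; lia.
Qed.

Lemma tseq_horner (p : {poly C}) x : tame 1 1 -> tame 1 x -> (forall i, tame 1 p`_i) ->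
  tseq (fun k => p.[x ^+ (q ^ k)]).
Proof.
move=> h1 hx hp; have hpow := tseq_pow h1 hx.
apply: (tseq_ext (x := fun k => \sum_(i < size p) p`_i * (x ^+ (q ^ k)) ^+ i)).
  by move=> k; rewrite horner_coef.
elim: (index_enum _) => [|i s IH].
  by apply: (tseq_ext (x := fun=> 0)) => [k|]; [rewrite big_nil|apply: tseq_cst; exact: tame0].
apply: (tseq_ext (x := fun k => p`_i * (x ^+ (q ^ k)) ^+ i + \sum_(i <- s) p`_i * (x ^+ (q ^ k)) ^+ i)).
  by move=> k; rewrite big_cons.
apply: tseqD => //; apply: tseqM; first exact: tseq_cst.
elim: (i : nat) => [|j IHj].
  by apply: (tseq_ext (x := fun=> 1)) => [k|]; [rewrite expr0|exact: tseq_cst].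
apply: (tseq_ext (x := fun k => x ^+ (q ^ k) * (x ^+ (q ^ k)) ^+ j)); last exact: tseqM.
by move=> k; rewrite exprS.
Qed.

Variables (m : nat) (E : {poly C}) (A : 'M[{poly C}]_m) (beta : C).
Hypotheses (mc : (m <= c0)%N) (t1 : tame 1 1) (tb : tame 1 beta).
Hypothesis tdet : forall k, tame 1 (\det A)`_k.
Hypothesis tadj : forall i j k, tame 1 (E * (\adj A) i j)`_k.

Lemma orbit_det_tame : tseq (orbit_det q A beta).
Proof.
have [kp h] := tseq_horner t1 tb tdet; exists (kp + 2)%N; elim=> [|k IH] /=.
  by apply: tame_mono t1; rewrite muln1 addn2.
rewrite det_mx_at; apply: tame_mono (tameM (h k) IH).
by have := q1 k; rewrite expnS; nia.
Qed.

(** Each step adds K q^k to the exponent. Since q >= 2, the total stays below (K + 2) q^(k+1): all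
    earlier factors together weigh about as much as the last one. *)
Lemma orbit_mx_tame i j : tseq (fun k => orbit_mx q E A beta k i j).
Proof.
have /choice[kp h] : forall ij : 'I_m * 'I_m, exists kp, forall k,
    tame (kp * q ^ k) (E * (\adj A) ij.1 ij.2).[beta ^+ (q ^ k)].
  by move=> [a b]; exact: (tseq_horner t1 tb (tadj a b)).
pose K := \max_ij kp ij; exists (K + 2)%N => k; move: i j; elim: k => [|k IH] i j /=.
  by rewrite mxE; case: eqP => _; [apply: tame_mono t1; rewrite muln1 addn2|exact: tame0].
rewrite mxE; apply: (@tame_mono (K * q ^ k + (K + 2) * q ^ k).+1.+1).
  by have := q1 k; rewrite expnS; nia.
apply: tame_sum; first by rewrite card_ord.
move=> l; apply: tameM; last exact: IH.
apply: (@tame_mono (kp (i, l) * q ^ k)); first by rewrite leq_mul2r (leq_bigmax (i, l)) orbT.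
have -> : (E.[beta ^+ (q ^ k)] *: \adj (mx_at q A beta k)) i l = (E * (\adj A) i l).[beta ^+ (q ^ k)].
  rewrite mxE hornerM; congr (_ * _).
  rewrite -[_.[_]]/(horner_eval (beta ^+ (q ^ k)) ((\adj A) i l)).
  by have := map_mx_adj (horner_eval (beta ^+ (q ^ k))) A => /(congr1 (fun M : 'M[C]_m => M i l)); rewrite mxE => ->.
exact: (h (i, l) k).
Qed.

End Tame.

Lemma tame_ex (C : numClosedFieldType) (d : nat) (e : 'I_d -> C) (c : 'I_d -> 'I_d -> 'I_d -> int)
    (B : set C) b (s : seq C) :
  (forall x, fgen B x -> exists (D : nat) (a : 'I_d -> int), (0 < D)%N /\ x * D%:R = \sum_k (a k)%:~R * e k) ->
  (forall x, x \in s -> fgen B x) ->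
  exists c0, [/\ (2 <= c0)%N, (kap c <= c0)%N, (b <= c0)%N & forall x, x \in s -> tame e c0 1 x].
Proof.
move=> span hs; have [D [H [D0 H0 h]]] := hgt_ex_seq span hs.
pose E := (2 * kap c * H * b.+1)%N; exists (D * E)%N.
have k0 : (0 < kap c)%N by [].
split; rewrite /E; try nia.
move=> x xs; rewrite /tame expn1; apply: hgt_mono (hgt_scale E (h x xs)).
by rewrite muln1 expnMn /E; nia.
Qed.

(** * Transcendence degree of the values *)

Section LinearSystems.
Variables (L : fieldType) (S : set L).

Lemma acl_det n (G : 'M[L]_n) : (forall i j, acl S (G i j)) -> acl S (\det G).
Proof.
move=> h; apply: acl_sum => p _; apply: aclM; last by apply: acl_prod.
by apply: aclX; rewrite -sub0r; apply: aclB; [exact: acl0|exact: acl1].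
Qed.

Lemma acl_solve n (G : 'M[L]_n) (a b : 'cV[L]_n) : G \in unitmx -> (forall i j, acl S (G i j)) ->
  (forall i, acl S (b i 0)) -> G *m a = b -> forall i, acl S (a i 0).
Proof.
move=> Gu hG hb E i; have -> : a = invmx G *m b by rewrite -E mulKmx.
rewrite mxE; apply: acl_sum => j _; apply: aclM => //.
rewrite /invmx Gu mxE; apply: aclM; first by apply: aclV; exact: acl_det.
rewrite mxE /cofactor; apply: aclM; last by apply: acl_det => k l; rewrite !mxE.
by apply: aclX; rewrite -sub0r; apply: aclB; [exact: acl0|exact: acl1].
Qed.

Lemma fgen_horner (p : {poly L}) x : (forall i, fgen S p`_i) -> fgen S x -> fgen S p.[x].
Proof.
by move=> hp hx; rewrite horner_coef; apply: fgen_sum => i _; apply: fgenM => //; exact: fgenX.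
Qed.

End LinearSystems.

Lemma orbit_fgen (C : numClosedFieldType) (B : set C) q m (E : {poly C}) (A : 'M[{poly C}]_m) (b : C) :
  fgen B b -> (forall k, fgen B (\det A)`_k) -> (forall i j k, fgen B (E * (\adj A) i j)`_k) ->
  forall k, fgen B (orbit_det q A b k) /\ forall i j, fgen B (orbit_mx q E A b k i j).
Proof.
move=> hb hd ha; elim=> [|k [IH1 IH2]] /=.
  split; first exact: fgen_1.
  by move=> i j; rewrite mxE; case: eqP => _; [exact: fgen_1|exact: fgen0].
split.
  by rewrite det_mx_at; apply: fgenM => //; apply: fgen_horner => //; exact: fgenX.
move=> i j; rewrite mxE; apply: fgen_sum => l _; apply: fgenM => //.
have -> : (E.[b ^+ (q ^ k)] *: \adj (mx_at q A b k)) i l = (E * (\adj A) i l).[b ^+ (q ^ k)].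
  rewrite mxE hornerM; congr (_ * _).
  rewrite -[_.[_]]/(horner_eval (b ^+ (q ^ k)) ((\adj A) i l)).
  by have := map_mx_adj (horner_eval (b ^+ (q ^ k))) A => /(congr1 (fun M : 'M[C]_m => M i l)); rewrite mxE => ->.
by apply: fgen_horner => //; exact: fgenX.
Qed.

Lemma filter_all (U : set_system nat) (UU : UltraFilter U) (I : Type) (s : seq I) (P : I -> nat -> Prop) :
  (forall i, U [set n | P i n]) -> U [set n | List.Forall (fun i => P i n) s].
Proof.
move=> h; have UP : ProperFilter U := @ultra_proper _ _ UU.
elim: s => [|i s IH]; first by apply: (filterS (P := setT)); [move=> n _; constructor|exact: filterT].
apply: (filterS (P := [set n | P i n] `&` [set n | List.Forall (fun i => P i n) s])).
  by move=> n [h1 h2]; constructor.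
exact: filterI.
Qed.

Section Core.
Variable C : numClosedFieldType.
Hypothesis arch : forall x : C, exists k : nat, `|x| <= k%:R.
Hypothesis complete : forall (u : nat -> C) (b t : C), 0 <= t -> t < 1 ->
  (forall m n, (m <= n)%N -> `|u n - u m| <= b * t ^+ m) ->
  exists l, forall m, `|l - u m| <= b * t ^+ m.
Variables (r : nat) (q : nat -> nat) (L : nat) (beta : nat -> C).
Hypothesis r0 : (0 < r)%N.
Hypothesis q2 : forall i, (2 <= q i)%N.
Hypothesis qL : forall i, (q i <= 2 ^ L)%N.
Hypothesis beta0 : forall i, beta i != 0.
Hypothesis beta1 : forall i, `|beta i| < 1.
Variables (M : nat -> nat) (E : nat -> {poly C}) (A : forall i, 'M[{poly C}]_(M i)).
Variable g : forall i, 'I_(M i) -> powser C.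
Variables (B : set C) (nB : nat).
Hypothesis Bfin : fdim set0 B nB.
Hypothesis betaB : forall i, fgen B (beta i).
Hypothesis detB : forall i k, fgen B (\det (A i))`_k.
Hypothesis adjB : forall i a b k, fgen B (E i * (\adj (A i)) a b)`_k.
Hypothesis gB : forall i j k, fgen B (pcoef (@g i j) k).
Hypothesis Ereg : forall i k, (E i).[beta i ^+ (q i ^ k)] != 0.
Hypothesis Areg : forall i k, (\det (A i)).[beta i ^+ (q i ^ k)] != 0.
Variables (s : nat -> C) (v : forall i, 'I_(M i) -> C -> C).
Hypothesis s0 : forall i, 0 < s i.
Hypothesis bs : forall i, `|beta i| < s i.
Hypothesis hv : forall i j z, `|z| < s i -> evals idfun (s i) z (@g i j) (@v i j z).
Definition vv i k : 'cV[C]_(M i) := \col_j @v i j (beta i ^+ (q i ^ k)).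
Hypothesis step : forall i k, (E i).[beta i ^+ (q i ^ k)] *: vv i k = mx_at (q i) (A i) (beta i) k *m vv i k.+1.
Variables (U : set_system nat) (UU : UltraFilter U).
Hypothesis Uoo : forall N, U [set n | (N <= n)%N].
Local Notation zz := (zseq q L beta).
Hypothesis zfree : forall P : mpoly r C, mmap (udiag UU \o idfun) (fun i : 'I_r => upi UU (zz i)) P = 0 -> P = 0.

Local Notation K := (FG B).
Local Notation KB := (range (@fgval C B)).
Let UP : ProperFilter U := @ultra_proper _ _ UU.
Let Om := ultraprod C UU.
Let io : {rmorphism K -> Om} := (udiag UU \o (@fgval C B)).

Lemma zzE i n : zz i n = beta i ^+ (q i ^ expo q L i n). Proof. by []. Qed.

Lemma KBfgen x : fgen B x -> KB x. Proof. by move=> h; exists (fgin h). Qed.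

Lemma zzs i n : `|zz i n| < s i.
Proof.
apply: le_lt_trans (bs i); rewrite normrX -[leRHS]expr1; apply: ler_wiXn2l => //.
  exact: ltW.
by rewrite expn_gt0 (leq_trans _ (q2 i)).
Qed.

Lemma orbit_eq i j n : orbit_det (q i) (A i) (beta i) (expo q L i n) * @v i j (zz i n) =
  \sum_l orbit_mx (q i) (E i) (A i) (beta i) (expo q L i n) j l * @v i l (beta i).
Proof.
have := orbit_relation (v := vv i) (step i) (expo q L i n).
move=> /(congr1 (fun w : 'cV[C]_(M i) => w j 0)); rewrite !mxE => ->.
by apply: eq_bigr => l _; rewrite mxE expn0 expr1.
Qed.

(** [None] stands for the determinant and [Some] of a pair for an entry of the transition matrix of
    the system i. *)
Definition entI : finType := {i : 'I_r & option ('I_(M i) * 'I_(M i))}.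
Definition ent (u : entI) n : C :=
  match tagged u with
  | None => orbit_det (q (tag u)) (A (tag u)) (beta (tag u)) (expo q L (tag u) n)
  | Some ab => orbit_mx (q (tag u)) (E (tag u)) (A (tag u)) (beta (tag u)) (expo q L (tag u) n) ab.1 ab.2
  end.
Definition zst : seq Om := codom (fun i : 'I_r => upi UU (zz i)).
Definition ye (u : entI) : Om := upi UU (ent u).

Lemma zst_indep : aindep (range io) zst.
Proof.
apply: (@aindep_sub _ _ (range (udiag UU \o idfun))).
  by move=> _ [k _ <-]; exists (fgval k).
by rewrite /zst; apply: mmap_aindep => P h; exact: zfree.
Qed.

Lemma ys_ex : exists ys : seq entI, aindep (range io `|` [set` zst]) (map ye ys) /\
  forall u, acl ((range io `|` [set` zst]) `|` [set` map ye ys]) (ye u).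
Proof.
have [ys [_ h1 h2]] := abasis ye (range io `|` [set` zst]) (enum entI).
by exists ys; split=> // u; apply: h2; rewrite mem_enum.
Qed.

(** Only a transcendence basis of the entries over K(z) becomes part of the sampled point, so that
    the point is generic; the other entries are algebraic over it. *)
Definition ys := projT1 (cid ys_ex).
Let ysP := projT2 (cid ys_ex).
Definition yn (k : 'I_(size ys)) : entI := tnth (in_tuple ys) k.
Local Notation t := (size ys).
Local Notation rho := (r + t)%N.

Definition X n (w : 'I_rho) : C :=
  match fintype.split w with inl i => zz i n | inr k => ent (yn k) n end.

Lemma XL n i : X n (lshift t i) = zz i n.
Proof. by rewrite /X (unsplitK (inl i)). Qed.

Lemma XR n k : X n (rshift r k) = ent (yn k) n.
Proof. by rewrite /X (unsplitK (inr k)). Qed.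

Lemma codom_split (T : Type) m n (f : 'I_(m + n) -> T) :
  codom f = codom (f \o lshift n) ++ codom (f \o @rshift m n).
Proof.
rewrite /codom /image_mem.
have -> : enum 'I_(m + n) = map (lshift n) (enum 'I_m) ++ map (@rshift m n) (enum 'I_n).
  apply: (@inj_map _ _ (@nat_of_ord (m + n)) (@ord_inj _)).
  have -> : map (@nat_of_ord (m + n)) (enum 'I_(m + n)) = iota 0 (m + n) by exact: val_enum_ord.
  rewrite map_cat -(map_comp _ (lshift n)) -(map_comp _ (@rshift m n)) iotaD; congr (_ ++ _).
    by rewrite -(val_enum_ord m); exact: eq_map.
  by rewrite add0n -[in LHS](addn0 m) iotaDl -(val_enum_ord n) -(map_comp (addn m)); exact: eq_map.
by rewrite map_cat -!map_comp.
Qed.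

Lemma codom_yn (T : Type) (f : entI -> T) : codom (f \o yn) = map f ys.
Proof. by rewrite /codom /image_mem map_comp /yn map_tnth_enum. Qed.

Lemma X_indep : aindep (range io) (codom (fun w => upi UU (fun n => X n w))).
Proof.
rewrite codom_split; apply/aindep_cat.
have -> : codom ((fun w => upi UU (fun n => X n w)) \o lshift t) = zst.
  by apply: eq_codom => i; congr upi; apply/funext => n; rewrite XL.
split; first exact: zst_indep.
rewrite (eq_codom (g := ye \o yn)) ?codom_yn; first by case: ysP.
by move=> k; congr upi; apply/funext => n; rewrite XR.
Qed.

Lemma ultra_neq (f : nat -> C) : upi UU f != 0 -> U [set n | f n != 0].
Proof.
move=> h; have [h1|h1] := in_ultra_setVsetC [set n | f n = 0] UU.
  by case/eqP: h; apply/upi_eq0.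
by apply: filterS h1 => n /= fn; apply/eqP.
Qed.

Lemma Unv (P : mpoly rho K) : P != 0 -> U [set n | mmap (@fgval C B) (X n) P != 0].
Proof.
move=> P0; apply: ultra_neq; rewrite -(upi_mmap _ _ _ (fun w n => X n w)).
by apply: contra_neq P0 => /(aindep_mmap X_indep).
Qed.

Definition gK i j : powser K := PowSer (fun k => fgin (@gB i j k)).
Local Notation XF := (ps_of_poly 'X : powser K)%:F.

Lemma W_ex i : exists W : seq 'I_(M i),
  aindep (range (kfrac K) `|` [set XF]) (map (fun j => (@gK i j)%:F) W) /\
  forall j, acl ((range (kfrac K) `|` [set XF]) `|` [set` map (fun j => (@gK i j)%:F) W]) (@gK i j)%:F.
Proof.
have [W [_ h1 h2]] := abasis (fun j => (@gK i j)%:F) (range (kfrac K) `|` [set XF]) (enum 'I_(M i)).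
by exists W; split=> // j; apply: h2; rewrite mem_enum.
Qed.

Definition W i := projT1 (cid (W_ex i)).
Let WP i := projT2 (cid (W_ex i)).

Definition gI : finType := {i : 'I_r & 'I_(M i)}.
Definition PW : pred gI := fun u => tagged u \in W (tag u).
Local Notation T := #|PW|.
Definition Wu (k : 'I_T) : gI := enum_val k.
Definition blk (k : 'I_T) : 'I_rho := lshift t (tag (Wu k)).
Definition Fs (k : 'I_T) : powser K := gK (tagged (Wu k)).
Definition wv n (k : 'I_T) : C := v (tagged (Wu k)) (zz (tag (Wu k)) n).

Lemma W_uniq i : uniq (W i).
Proof. by case: (WP i) => /aindep_uniq/map_uniq. Qed.

Lemma card_T : T = (\sum_(i < r) size (W i))%N.
Proof.
rewrite -sum1_card; rewrite (eq_bigl (fun u : gI => xpredT (tag u) && (tagged u \in W (tag u)))) //.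
rewrite -(@sig_big_dep _ _ _ _ (fun i : 'I_r => 'I_(M i)) xpredT (fun i j => j \in W i) (fun _ _ => 1%N)) /=.
by apply: eq_bigr => i _; rewrite sum1_card; apply/card_uniqP; exact: W_uniq.
Qed.

Section Embedding.
Variable i : 'I_r.
Local Notation n := (size (W i)).+1.

Definition We (k : 'I_(size (W i))) : gI := Tagged (fun i : 'I_r => 'I_(M i)) (tnth (in_tuple (W i)) k).

Lemma We_in k : We k \in PW.
Proof. by rewrite unfold_in /PW /= mem_tnth. Qed.

(** Locates z_i and the basis series of system i among all variables of the point. *)
Definition emb (u : 'I_n) : 'I_(rho + T) :=
  match unlift ord0 u with
  | None => lshift T (lshift t i)
  | Some k => rshift rho (enum_rank_in (We_in k) (We k))
  end.

Lemma emb0 : emb ord0 = lshift T (lshift t i).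
Proof. by rewrite /emb unlift_none. Qed.

Lemma embS k : emb (lift ord0 k) = rshift rho (enum_rank_in (We_in k) (We k)).
Proof. by rewrite /emb liftK. Qed.

Lemma Wu_emb k : Wu (enum_rank_in (We_in k) (We k)) = We k.
Proof. by rewrite /Wu enum_rankK_in // We_in. Qed.

Lemma emb_inj : injective emb.
Proof.
move=> u u'; case: (unliftP ord0 u) => [k ->|->]; case: (unliftP ord0 u') => [k' ->|->] //.
- rewrite !embS => /rshift_inj/(congr1 Wu); rewrite !Wu_emb /We => /eqP.
  rewrite -tag_eqE /tag_eq /= eqxx /= tagged_asE => /eqP h.
  have /tuple_uniqP inj : uniq (in_tuple (W i)) by exact: W_uniq.
  by congr lift; exact: inj.
- by rewrite emb0 embS => /eqP; rewrite eq_rlshift.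
- by rewrite emb0 embS => /eqP; rewrite eq_lrshift.
Qed.

Lemma emb_codom w : bl blk w = lshift t i -> w \in codom emb.
Proof.
rewrite /bl; case: (split_ordP w) => [a ->|k ->]; rewrite ?(unsplitK (inl a)) ?(unsplitK (inr k)).
  by move=> ->; apply/codomP; exists ord0; rewrite emb0.
move=> /lshift_inj tk; apply/codomP.
have : Wu k \in PW by exact: enum_valP.
case E1 : (Wu k) => [i' j] /=; rewrite E1 /= in tk; subst i'.
rewrite unfold_in /PW /= => jW.
have hj : (index j (W i) < size (W i))%N by rewrite index_mem.
exists (lift ord0 (Ordinal hj)); rewrite embS; congr rshift; apply: enum_val_inj.
rewrite -[LHS]/(Wu k) E1 -[RHS]/(Wu _) Wu_emb /We; congr (Tagged _ _).
by rewrite (tnth_nth j) /= nth_index.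
Qed.

Definition S (u : 'I_n) : powser K := bser Fs (emb u).

Lemma S0 : S ord0 = ps_of_poly 'X.
Proof. by rewrite /S emb0 /bser (unsplitK (inl _)). Qed.

Lemma SS k : S (lift ord0 k) = gK (tnth (in_tuple (W i)) k).
Proof. by rewrite /S embS /bser (unsplitK (inr _)) /Fs Wu_emb. Qed.

Lemma codom_S : codom (fun u => (S u)%:F) = XF :: map (fun j => (@gK i j)%:F) (W i).
Proof.
rewrite /codom /image_mem enum_ordSl /= S0 -map_comp; congr (_ :: _).
transitivity [seq (@gK i j)%:F | j <- [seq tnth (in_tuple (W i)) k | k <- enum 'I_(size (W i))]].
  by rewrite -map_comp; apply: eq_map => k /=; rewrite SS.
by rewrite map_tnth_enum.
Qed.

Lemma S_free (P : mpoly n K) : mmap (@psc K) S P = 0 -> P = 0.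
Proof.
move=> h; have ai : aindep (range (kfrac K)) (codom (fun u => (S u)%:F)).
  by rewrite codom_S /=; split; [exact: X_free|case: (WP i)].
by apply: (aindep_mmap ai); rewrite mmap_kfrac h rmorph0.
Qed.

End Embedding.

(** For the block of z_i this is the independence of [W] over K(z). The block of a coordinate y
    consists of its own variable alone. *)
Lemma blockfree (w : 'I_rho) (Q : mpoly (rho + T) K) :
  (forall m, m \in msupp Q -> forall u, bl blk u != w -> m u = 0%N) ->
  mmap (@psc K) (bser Fs) Q = 0 -> Q = 0.
Proof.
case: (split_ordP w) => [i ->|k ->] h hQ.
  have RU : ren K (@emb i) (unren K (@emb i) Q) = Q.
    by apply: ren_unren => m hm u hu; apply: (h m hm); apply: contra hu => /eqP/emb_codom.
  rewrite -RU (@S_free i (unren K (@emb i) Q)) ?rmorph0 //.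
  by have := mmap_ren (@emb i) (@psc K) (bser Fs) (unren K (@emb i) Q); rewrite RU hQ => /esym.
apply: (@poly_var_free K _ (lshift T (rshift r k)) Q (bser Fs)) hQ.
  by rewrite /bser (unsplitK (inl _)).
move=> m hm u uv; apply: (h) => //; move: uv; case: (split_ordP u) => [a ->|b ->].
  by rewrite /bl (unsplitK (inl _)); apply: contra => /eqP ->.
by rewrite /bl (unsplitK (inr _)) /blk eq_lrshift.
Qed.

Lemma theta_ex : exists th : C, 0 < th < 1 /\ forall i : 'I_r, `|beta i| <= th.
Proof.
have : exists th : C, 0 < th < 1 /\ forall i, i \in enum 'I_r -> `|beta i| <= th.
  elim: (enum _) => [|i l [th [/andP[t0 t1] h]]].
    by exists 2%:R^-1; rewrite invr_gt0 ltr0n invf_lt1 ?ltr0n // ltr1n.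
  have [h1|h1] := real_leP (normr_real (beta i)) (gtr0_real t0).
    by exists th; rewrite t0 t1; split=> // j; rewrite in_cons => /orP[/eqP ->|/h].
  exists `|beta i|; rewrite beta1 normr_gt0 beta0; split=> // j.
  by rewrite in_cons => /orP[/eqP ->|/h/le_trans] //; apply; exact: ltW.
by move=> [th [h1 h2]]; exists th; split=> // i; apply: h2; rewrite mem_enum.
Qed.

(** One integral basis and one c0 serve for the finitely many coefficients of all systems. As the
    sampled exponents are at most 2^(n + L), growth in powers of q_i turns into growth in 2^n. *)
Lemma growth_X : exists d (e : 'I_d -> C) (c : 'I_d -> 'I_d -> 'I_d -> int),
  [/\ forall a : 'I_d -> int, \sum_i (a i)%:~R * e i = 0 -> forall i, a i = 0,
      forall i j, e i * e j = \sum_k (c i j k)%:~R * e k,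
      forall x, fgen B x -> exists (D : nat) (a : 'I_d -> int), (0 < D)%N /\ x * D%:R = \sum_k (a k)%:~R * e k &
      growth e X].
Proof.
have [d [e [c [efree emul span]]]] := integral_basis Bfin; exists d, e, c; split=> //.
pose l (i : 'I_r) : seq C := [:: 1, beta i & (\det (A i) : seq C) ++
  flatten [seq (E i * (\adj (A i)) ab.1 ab.2 : seq C) | ab <- enum {: 'I_(M i) * 'I_(M i)}]].
have nthB (p : {poly C}) x : (forall k, fgen B p`_k) -> x \in (p : seq C) -> fgen B x.
  by move=> h /(nthP 0)[k _ <-].
have lB x : x \in flatten [seq l i | i <- enum 'I_r] -> fgen B x.
  move=> /flatten_mapP[i _]; rewrite /l !in_cons mem_cat.
  move=> /or3P[/eqP ->|/eqP ->|/orP[h|/flatten_mapP[ab _ h]]]; first exact: fgen_1.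
  - exact: betaB.
  - exact: nthB h.
  - exact: nthB h.
have [c0 [c02 c0k c0M hs]] := @tame_ex C d e c B (\max_(i < r) M i) _ span lB.
have in_l i x : x \in l i -> tame e c0 1 x.
  by move=> h; apply: hs; apply/flatten_mapP; exists i; rewrite ?mem_enum.
have tp i (p : {poly C}) : (forall x, x \in (p : seq C) -> x \in l i) -> forall k, tame e c0 1 p`_k.
  move=> h k; have [pk|pk] := leqP (size p) k; first by rewrite nth_default //; exact: tame0.
  by apply: (in_l i); apply: h; exact: mem_nth.
have i0 : 'I_r := Ordinal r0.
have t1 : tame e c0 1 1 by apply: (in_l i0); rewrite /l in_cons eqxx.
have tb (i : 'I_r) : tame e c0 1 (beta i) by apply: (in_l i); rewrite /l !in_cons eqxx orbT.
have tdet (i : 'I_r) : forall k, tame e c0 1 (\det (A i))`_k.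
  by apply: (tp i) => x h; rewrite /l !in_cons mem_cat h !orbT.
have tadj (i : 'I_r) a b : forall k, tame e c0 1 (E i * (\adj (A i)) a b)`_k.
  apply: (tp i) => x h; rewrite /l !in_cons mem_cat; apply/or3P; constructor 3; apply/orP; right.
  by apply/flatten_mapP; exists (a, b); rewrite ?mem_enum.
have key (i : 'I_r) (x : nat -> C) : tseq e c0 (q i) x ->
    exists kp, forall n, tame e c0 (kp * 2 ^ n) (x (expo q L i n)).
  move=> [kp h]; exists (kp * 2 ^ L)%N => n; apply: (tame_mono c02 c0k) (h _).
  rewrite -mulnA leq_mul2l -expnD addnC; apply/orP; right.
  exact: bigexp_leq.
have Mc (i : 'I_r) : (M i <= c0)%N by apply: leq_trans c0M; exact: (leq_bigmax i).
have /choice[kp hkp] : forall w : 'I_rho, exists kp, forall n, tame e c0 (kp * 2 ^ n) (X n w).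
  move=> w; case: (split_ordP w) => [i ->|k ->].
    have [kp h] := key i _ (tseq_pow emul c02 c0k (q2 i) t1 (tb i)).
    by exists kp => n; rewrite XL.
  have [kp h] : exists kp, forall n, tame e c0 (kp * 2 ^ n) (ent (yn k) n).
    case: (yn k) => i ab; rewrite /ent /=; case: ab => [[a b]|].
      exact: (key i _ (orbit_mx_tame emul c02 c0k (q2 i) (Mc i) t1 (tb i) (@tadj i) a b)).
    exact: (key i _ (orbit_det_tame emul c02 c0k (q2 i) (Mc i) t1 (tb i) (tdet i))).
  by exists kp => n; rewrite XR.
apply: (growth_tame c02 c0k (kp := \max_w kp w)) => k w.
by apply: (tame_mono c02 c0k) (hkp w k); rewrite leq_mul2r (leq_bigmax w) orbT.
Qed.

Definition Zp : pred 'I_rho := fun w => if fintype.split w is inl _ then true else false.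

Local Notation pt := (point X wv).

Lemma ptL n w : pt n (lshift T w) = X n w.
Proof. by rewrite /point (unsplitK (inl w)). Qed.

Lemma ptR n k : pt n (rshift rho k) = wv n k.
Proof. by rewrite /point (unsplitK (inr k)). Qed.

Lemma zz_theta th i n : 0 < th < 1 -> `|beta i| <= th -> `|zz i n| <= th ^+ (2 ^ n).
Proof.
move=> /andP[t0 t1] h; rewrite normrX; apply: (@le_trans _ _ (th ^+ (bigexp q L i n))).
  by apply: lerXn2r; rewrite ?nnegrE // ltW.
by apply: ler_wiXn2l; rewrite ?(ltW t0) ?(ltW t1) //; exact: bigexp_geq.
Qed.

Lemma truncation th : 0 < th < 1 -> (forall i : 'I_r, `|beta i| <= th) -> forall N,
  exists2 c : C, 0 <= c & forall k j,
  `|wv k j - (map_poly (@fgval C B) (\poly_(l < N) pcoef (Fs j) l)).[X k (blk j)]| <= c * th ^+ (N * 2 ^ k).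
Proof.
move=> th01 hth N; have /andP[th0 th1] := th01.
have /choice[Bj hB] : forall j : 'I_T, exists b, bsum (s (tag (Wu j))) (fun k => idfun (pcoef (@g _ (tagged (Wu j))) k)) b.
  by move=> j; case: (hv (tagged (Wu j)) (zzs (tag (Wu j)) 0)).
have cp j : 0 <= Bj j / s (tag (Wu j)) ^+ N.
  by rewrite divr_ge0 ?(bsum_ge0 (hB j)) // exprn_ge0 // ltW.
exists (\sum_j Bj j / s (tag (Wu j)) ^+ N); first exact: sumr_ge0.
move=> k j; have hz := zzs (tag (Wu j)) k.
have := evals_bound arch (s0 _) hz complete N (hB j) (hv (tagged (Wu j)) hz).
rewrite /blk XL; have -> : (map_poly (@fgval C B) (\poly_(l < N) pcoef (Fs j) l)).[zz (tag (Wu j)) k] =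
    psum (fun l => idfun (pcoef (@g _ (tagged (Wu j))) l)) (zz (tag (Wu j)) k) N.
  rewrite (@horner_coef_wide _ N) ?(leq_trans (size_poly _ _)) ?size_map_poly ?size_poly //.
  by apply: eq_bigr => l _; rewrite coef_map coef_poly ltn_ord.
move=> /le_trans; apply; apply: (@le_trans _ _ (Bj j / s (tag (Wu j)) ^+ N * th ^+ (N * 2 ^ k))).
  rewrite expr_div_n mulrA mulrAC; apply: ler_wpM2l; first exact: cp.
  rewrite mulnC exprM; apply: lerXn2r; rewrite ?nnegrE ?exprn_ge0 ?(ltW th0) //.
  exact: zz_theta.
by apply: ler_wpM2r; [rewrite exprn_ge0 // ltW|rewrite (bigD1 j) //= lerDl sumr_ge0].
Qed.

(** The small variables are the z_i, which carry all the series; the y enter through the growth of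
    their heights. *)
Lemma point_generic (FF : mpoly (rho + T) K) : FF != 0 ->
  U [set k | mmap (@fgval C B) (pt k) FF != 0].
Proof.
have [d [e [c [efree emul span gX]]]] := growth_X.
have [th [th01 hth]] := theta_ex.
apply: (@algebraic_independence_lift C B rho T blk Fs Zp (lshift t (Ordinal r0)) X wv th) => //.
- exact: liouville_mpoly gX.
- exact: growth_norm gX.
- by rewrite /Zp (unsplitK (inl _)).
- move=> k w; rewrite /Zp; case: (split_ordP w) => [i ->|j ->]; rewrite ?(unsplitK (inl _)) ?(unsplitK (inr _)) // => _.
  by rewrite XL; exact: zz_theta.
- by move=> j; rewrite /Zp /blk (unsplitK (inl _)).
- exact: truncation.
- exact: blockfree.
- exact: Unv.
Qed.

Lemma pt_indep : aindep (range io) (codom (fun w => upi UU (fun n => pt n w))).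
Proof.
apply: mmap_aindep => P; rewrite (upi_mmap _ _ _ (fun w n => pt n w)) => /upi_eq0 h.
apply/eqP; apply/negPn/negP => /point_generic h2.
by have [n [/= h3 /eqP]] := filter_ex (filterI h h2).
Qed.

Definition wlist i n : seq C := map (fun j => @v i j (zz i n)) (W i).

Lemma emb_evals (i : 'I_r) n w : evals (@fgval C B) (s i) (zz i n) (@S i w) (pt n (@emb i w)).
Proof.
case: (unliftP ord0 w) => [k ->|->].
  rewrite SS embS ptR /wv Wu_emb; exact: (hv _ (zzs i n)).
rewrite S0 emb0 ptL XL; have := evals_poly (@fgval C B) (s0 i) (zzs i n) 'X.
by rewrite map_polyX hornerX.
Qed.

(** A formal relation of a series over the basis [W] gives a relation of values wherever its leading
    coefficient does not vanish, that is, for U-almost all n. The series are finitely many, so one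
    n0 serves for all. *)
Lemma generic_index : exists n0, forall (i : 'I_r) j, acl (KB `|` [set` wlist i n0]) (@v i j (zz i n0)).
Proof.
pose good (u : gI) n := acl (KB `|` [set` wlist (tag u) n]) (v (tagged u) (zz (tag u) n)).
have hU u : U [set n | good u n].
  case: u => i j; have [_ /(_ j)] := WP i; rewrite -setU_cons -codom_S.
  move=> /acl_relation[P [P0 rP]]; have D0 : lead_coef P != 0.
    by rewrite lead_coef_eq0; apply: contra_neq P0 => ->; rewrite rmorph0.
  have rD : ren K (@emb i) (lead_coef P) != 0.
    by apply: contra_neq D0 => /(ren_eq0 (@emb_inj i)).
  apply: filterS (point_generic rD) => n /=; rewrite mmap_ren => hn.
  apply: (@acl_le _ (KB `|` [set` codom (pt n \o @emb i)])).
    move=> x [h|/= /codomP[w ->]]; first by apply: acl_in; left.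
    case: (unliftP ord0 w) => [k ->|->]; apply: acl_in => /=.
      right; rewrite /wlist; apply/mapP; exists (tnth (in_tuple (W i)) k); first exact: mem_tnth.
      by rewrite embS ptR /wv Wu_emb.
    by left; rewrite emb0 ptL XL; apply: KBfgen; rewrite zzE; exact: fgenX.
  apply: (relation_acl hn); apply/eqP.
  have ev := evals_root (s0 i) (zzs i n) P (@emb_evals i n) (hv j (zzs i n) : evals (@fgval C B) _ _ (gK j) _).
  apply: (evals_unique arch (s0 i) (zzs i n) ev).
  rewrite (root_kfrac rP); have := evals_psc (@fgval C B) (s0 i) (zzs i n) 0.
  by rewrite !rmorph0.
have [n hn] := filter_ex (filter_all UU (enum gI) hU).
exists n => i j; have : Tagged (fun i : 'I_r => 'I_(M i)) j \in enum gI by rewrite mem_enum.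
elim: (enum gI) hn => //= u l IH h; inversion h; subst.
by rewrite in_cons => /orP[/eqP e|]; [move: H1; rewrite -e|exact: IH].
Qed.

(** The transition matrix has entries in K and is invertible, so the values at beta_i are
    combinations of those at time n. Hence their transcendence degree over K is at most the length
    of [W]. *)
Lemma value_acl n (i : 'I_r) : (forall j, acl (KB `|` [set` wlist i n]) (@v i j (zz i n))) ->
  forall j, acl (KB `|` [set` wlist i n]) (@v i j (beta i)).
Proof.
move=> h j; have [oB mB] := orbit_fgen (q i) (betaB i) (detB i) (@adjB i) (expo q L i n).
have fB x : fgen B x -> acl (KB `|` [set` wlist i n]) x.
  by move=> hx; apply: acl_in; left; exact: KBfgen.
have := @acl_solve C (KB `|` [set` wlist i n]) _ (orbit_mx (q i) (E i) (A i) (beta i) (expo q L i n))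
  (\col_j @v i j (beta i)) (orbit_det (q i) (A i) (beta i) (expo q L i n) *: \col_j @v i j (zz i n)).
move=> /(_ _ _ _ _ j); rewrite mxE; apply.
- exact: orbit_mx_unit.
- by move=> a b; exact: fB.
- by move=> a; rewrite !mxE; apply: aclM; [exact: fB|exact: h].
- by apply/colP => a; rewrite !mxE orbit_eq; apply: eq_bigr => l _; rewrite mxE.
Qed.

(* If the x i were dependent over KB, all the v i j (beta i) would be algebraic over a set with
   fewer than T elements; together with zst and ys it would bound the size of pt_indep. *)
Theorem values_independent (x : 'I_r -> C) :
  (forall i : 'I_r, acl (KB `|` [set` codom (fun j => @v i j (beta i))]) (x i)) ->
  (forall i, ~ acl KB (x i)) -> aindep KB (codom x).
Proof.
move=> xv xt; have [n0 hn0] := generic_index.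
have vW i := value_acl (hn0 i).
(* Since x i is algebraic over the values of the basis series but not over K, it can be exchanged
   for one of them; [t'] is what remains. *)
have /choice[t' ht'] : forall i : 'I_r, exists t', (size t').+1 = size (W i) /\
    [set` wlist i n0] `<=` acl ((KB `|` [set x i]) `|` [set` t']).
  move=> i; have [|t' [h1 _ h2]] := acl_exchange_seq _ (xt i) (t := wlist i n0).
    apply: acl_le (xv i) => y [hy|/= /codomP[j ->]]; last exact: vW.
    by apply: acl_in; left.
  by exists t'; rewrite h1 size_map.
apply: aindep_nth => k; rewrite size_codom card_ord => kr xk.
pose i0 := Ordinal kr; pose xs := [seq x i | i <- enum 'I_r & i != i0].
pose Sx := xs ++ flatten [seq t' i | i <- enum 'I_r].
have xi0 : acl (KB `|` [set` xs]) (x i0).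
  have -> : x i0 = nth 0 (codom x) k.
    by rewrite /codom /image_mem (nth_map i0) ?size_enum_ord // -[k]/(val i0) nth_ord_enum.
  apply: acl_mono xk => y [h|/= /(nthP 0)[l]]; first by left.
  rewrite size_take size_codom card_ord kr => lk yE; right; rewrite -yE nth_take //.
  have lr : (l < r)%N by exact: ltn_trans lk kr.
  have -> : nth 0 (codom x) l = x (Ordinal lr).
    by rewrite /codom /image_mem (nth_map i0) ?size_enum_ord // -[l]/(val (Ordinal lr)) nth_ord_enum.
  apply/mapP; exists (Ordinal lr) => //; rewrite mem_filter mem_enum andbT -val_eqE /=.
  by rewrite neq_ltn lk.
have sub1 : KB `|` [set` xs] `<=` KB `|` [set` Sx].
  by move=> y [h|h]; [left|right; rewrite /= mem_cat h].
have xS i : acl (KB `|` [set` Sx]) (x i).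
  have [->|ii] := eqVneq i i0; first exact: acl_mono xi0.
  apply: acl_in; apply: sub1; right; apply/mapP; exists i => //.
  by rewrite mem_filter ii mem_enum.
have vS (i : 'I_r) j : acl (KB `|` [set` Sx]) (@v i j (beta i)).
  apply: acl_le (vW i j) => y [h|h]; first by apply: acl_in; left.
  have [_ /(_ y h)] := ht' i; apply: acl_le => z [[hz|->]|hz]; first by apply: acl_in; left.
    exact: xS.
  apply: acl_in; right; rewrite /= mem_cat; apply/orP; right.
  by apply/flatten_mapP; exists i; rewrite ?mem_enum.
have szS : (size Sx < T)%N.
  rewrite size_cat size_flatten /shape -map_comp sumnE big_map big_enum /= card_T.
  have -> : (\sum_(i < r) size (W i) = \sum_(i < r) size (t' i) + r)%N.
    transitivity (\sum_(i < r) size (t' i) + \sum_(i < r) 1)%N; last by rewrite sum1_card card_ord.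
    rewrite -big_split /=; apply: eq_bigr => i _.
    by case: (ht' i) => <- _; rewrite addn1.
  rewrite addnC ltn_add2l size_map size_filter.
  have := count_predC (pred1 i0) (enum 'I_r); rewrite size_enum_ord => hc.
  have pos : (0 < count_mem i0 (enum 'I_r))%N by rewrite -has_count has_pred1 mem_enum.
  rewrite (eq_count (a2 := predC (pred1 i0))) //; move: hc pos.
  by move: (count_mem i0 (enum 'I_r)) (count (predC (pred1 i0)) (enum 'I_r)) => a b; clear; lia.
have st : (size (codom (fun w => upi UU (fun n => pt n w))) <= size (zst ++ map ye ys ++ map (udiag UU) Sx))%N.
  apply: (steinitz pt_indep) => _ /= /codomP[w ->].
  set Z := range io `|` _.
  have ZY : (range io `|` [set` zst]) `|` [set` map ye ys] `<=` Z.
    by move=> y [[h|h]|h]; [left|right; rewrite /= mem_cat h|right; rewrite /= !mem_cat h orbT].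
  have yZ u : acl Z (ye u) by case: ysP => _ /(_ u); exact: acl_mono.
  have dZ y : acl (KB `|` [set` Sx]) y -> acl Z (udiag UU y).
    move=> /(acl_image (udiag UU)); apply: acl_mono => _ [a [[b _ <-]|h] <-].
      by left; exists b.
    by right; rewrite /= !mem_cat (map_f (udiag UU) h) !orbT.
  case: (split_ordP w) => [w' ->|j ->].
    have -> : (fun n => pt n (lshift T w')) = (fun n => X n w') by apply/funext => n; rewrite ptL.
    case: (split_ordP w') => [i ->|k' ->].
      have -> : (fun n => X n (lshift t i)) = zz i by apply/funext => n; rewrite XL.
      by apply: acl_in; apply: ZY; left; right; exact: codom_f.
    have -> : (fun n => X n (rshift r k')) = ent (yn k') by apply/funext => n; rewrite XR.
    exact: yZ.
  have -> : (fun n => pt n (rshift rho j)) = (fun n => wv n j) by apply/funext => n; rewrite ptR.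
  rewrite /wv; case: (Wu j) => i a /=.
  pose u0 : entI := Tagged (fun i : 'I_r => option ('I_(M i) * 'I_(M i))) (None : option ('I_(M i) * 'I_(M i))).
  pose u1 l : entI := Tagged (fun i : 'I_r => option ('I_(M i) * 'I_(M i))) (Some (a, l) : option ('I_(M i) * 'I_(M i))).
  have e0 : ye u0 != 0.
    apply/eqP => /upi_eq0 h; have [n /eqP] := filter_ex h.
    by apply/negP; exact: orbit_det_neq0.
  (* The orbit relation solved for the value at time n. Its coefficients are entries, algebraic over
     z and y, and the values at beta_i are constants. *)
  have -> : upi UU (fun n => @v i a (zz i n)) = (\sum_l ye (u1 l) * udiag UU (@v i l (beta i))) / ye u0.
    apply: (canRL (mulfK e0)); rewrite /ye /udiag mulrC -upiM.
    under eq_bigr => l _ do rewrite -upiM.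
    rewrite -upi_sum; congr upi; apply/funext => n; exact: orbit_eq.
  apply: acl_div => //; apply: acl_sum => l _; apply: aclM => //.
  by apply: dZ; exact: vS.
have szz : size zst = r by rewrite /zst size_codom card_ord.
move: st; rewrite size_codom card_ord !size_cat szz !size_map.
by rewrite leqNgt addnA ltn_add2l szS.
Qed.

End Core.

(** * Independence of the values *)

Lemma primitive_roots (C : numClosedFieldType) l : (0 < l)%N -> exists zeta : C, l.-primitive_root zeta.
Proof.
move=> l0; have [rs Drs] := closed_field_poly_normal ('X^l - 1 : {poly C}).
have lc : lead_coef ('X^l - 1 : {poly C}) = 1 by exact/monicP/monicXnsubC.
rewrite lc scale1r in Drs.
have sz : size rs = l.
  by apply: succn_inj; rewrite -(size_prod_XsubC rs id) -Drs size_XnsubC.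
have un : uniq rs.
  rewrite -separable_prod_XsubC -Drs; apply: separable_Xn_sub_1.
  by rewrite pnatr_eq0 -lt0n.
have ar : all l.-unity_root rs.
  by apply/allP => z; rewrite -root_prod_XsubC -Drs.
have /hasP[z _ hz] : has l.-primitive_root rs by apply: has_prim_root; rewrite ?sz.
by exists z.
Qed.

Section AlgebraicNumbers.
Variable R : realType.
Local Notation C := (CC R).

Lemma algebraic_acl0 (x : C) : algebraic x <-> acl set0 x.
Proof.
split=> [[p p0 rp]|[p p0 rp]].
  apply: acl_root rp; first by rewrite map_poly_eq0.
  move=> i; rewrite coef_map /=; apply: acl_fgen; rewrite /ratr.
  by apply: fgen_div; exact: fgen_int.
have /choice[a ha] : forall i, exists a : rat, val p`_i = ratr a :> C.
  move=> i; have [D [b [D0 h]]] := fgen_rat (fgenP p`_i).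
  exists (b%:~R / D%:R); rewrite fmorph_div rmorph_int rmorph_nat -h mulfK // pnatr_eq0 -lt0n.
  by [].
pose p' := \poly_(i < size p) a i.
have pE : map_poly ratr p' = map_poly val p :> {poly C}.
  apply/polyP => i; rewrite !coef_map coef_poly /=; case: ltnP => h; first by rewrite ha.
  by rewrite nth_default // !rmorph0.
exists p'; last by rewrite pE.
by rewrite -(map_poly_eq0 (ratr : {rmorphism rat -> C})) pE map_poly_eq0.
Qed.

Lemma Qbar_acl0 (x : Qbar R) : acl set0 (QbarC x).
Proof. by apply/algebraic_acl0; have /asboolP := QbarP x. Qed.

Lemma Qbar_fdim (l : seq (Qbar R)) : exists n, fdim set0 (set0 `|` [set` map (@QbarC R) l]) n.
Proof.
have /choice[d hd] : forall x : Qbar R, exists d, (0 < d)%N /\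
    forall B, fgen set0 `<=` fgen B -> fdim B (B `|` [set QbarC x]) d.
  by move=> x; exact: acl_fdim (Qbar_acl0 x).
exists (\prod_(x <- l) d x)%N; apply: fdim_seq => x B _ _.
by case: (hd x) => _; apply; apply: fgen_mono => y.
Qed.

Lemma independent_transcendental r (x : 'I_r -> C) : algebraically_independent x ->
  forall i, transcendental (x i).
Proof.
move=> h i ai; have xq : x i \in @algebraicb R by apply/asboolP.
pose P : mpoly r (Qbar R) := 'X_[mnm1 i] - mpolyC r (MkQbar xq).
have P0 : P = 0.
  by apply: h; rewrite rmorphB /= mmapX mmap1U mmapC /= subrr.
have := congr1 (mcoeff (mnm1 i)) P0; rewrite mcoeffB mcoeffX eqxx mcoeffC mcoeff0.
rewrite (_ : (mnm1 i == mnm0 :> (multinom r)) = false) ?mulr0 ?subr0; first by move/eqP; rewrite oner_eq0.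
by apply/eqP => /(congr1 (fun m : (multinom r) => m i)); rewrite mnm1E eqxx mnm0E.
Qed.

(** The number field consists of algebraic numbers and algebraic numbers are algebraic over the
    prime field, so both base fields have the same algebraic closure. *)
Lemma independent_of_aindep r (x : 'I_r -> C) (B : set C) : (forall y, fgen B y -> acl set0 y) ->
  aindep (range (@fgval C B)) (codom x) -> algebraically_independent x.
Proof.
move=> hB h P hP; apply: (@aindep_mmap (Qbar R) C (@QbarC R) r x) => //.
apply: aindep_eq h => y [a _ <-].
  by apply: acl_mono (hB _ (fgenP a)) => z.
by apply: acl_mono (Qbar_acl0 a) => z.
Qed.

End AlgebraicNumbers.

Lemma iter_deriv (K : fieldType) k (f : powser K) : iter k (@ps_deriv K) f = psc K k`!%:R * hasse k f.
Proof.
have E n : pcoef (iter k (@ps_deriv K) f) n = pcoef f (k + n)%N *+ ((k + n) ^_ k).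
  elim: k n => [|k IH] n; first by rewrite ffactn0 mulr1n.
  rewrite /= IH -mulrnA addSnnS; congr (_ *+ _).
  by rewrite ffactnSr addKn.
apply: powserP => n; rewrite E pcoef_psc /= -bin_ffact mulnC mulrnA mulr_natl.
by rewrite -mulrnA mulnC mulrnA.
Qed.

Lemma hasse_fgen (K : fieldType) (C : numClosedFieldType) (iota : {rmorphism K -> C}) (A : set C) s z k (f : powser K) D D' : 
  (forall x : C, exists k : nat, `|x| <= k%:R) -> 0 < s -> `|z| < s ->
  evals iota s z (hasse k f) D -> evals iota s z (iter k (@ps_deriv K) f) D' -> fgen A D' -> fgen A D.
Proof.
move=> arch s0 zs hD hD' AD'.
have kF : (k`!%:R : C) != 0 by rewrite pnatr_eq0 -lt0n fact_gt0.
have -> : D = D' / k`!%:R.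
  apply: (canRL (mulfK kF)); apply: (evals_unique arch s0 zs) hD'; rewrite iter_deriv mulrC.
  by rewrite -(rmorph_nat iota); apply: evalsM => //; exact: evals_psc.
by apply: fgen_div => //; rewrite -[_%:R]/((k`!)%:Z%:~R); exact: fgen_int.
Qed.

(** What is kept of one function: the exponent l of the base point alpha^(q^l), the system enlarged
    by derivatives, and a radius. The size of the matrix is part of the data, so that it can be
    chosen for each index. *)
Record mahler_data (R : realType) := MahlerData {
  md_l : nat;
  md_M : nat;
  md_e : {poly (Qbar R)};
  md_A : 'M[{poly (Qbar R)}]_md_M;
  md_G : 'I_md_M -> powser (Qbar R);
  md_s : CC R
}.

(** * The system and the base point of a single function *)

Section OneFunction.
Variable R : realType.
Local Notation C := (CC R).
Local Notation iota := (@QbarC R).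
Local Notation cf f := (fun k => QbarC (pcoef f k)).

(** The second clause is regularity along the orbit from the base point on. F occurs in the last
    clause only: F(alpha) lies in every subfield containing the algebraic numbers and the values of
    the enlarged system at the base point. *)
Definition data_for (q : nat) (alpha : Qbar R) (F : C -> C) (D : mahler_data R) :=
  [/\ mahler_sys q (md_e D) (md_A D) (@md_G R D),
      forall k, (md_e D).[alpha ^+ (q ^ (md_l D + k))] != 0 /\ (\det (md_A D)).[alpha ^+ (q ^ (md_l D + k))] != 0,
      0 < md_s D <= 1 /\ `|QbarC alpha| ^+ (q ^ md_l D) < md_s D,
      forall j z, `|z| < md_s D -> exists y, evals iota (md_s D) z (@md_G R D j) y &
      forall A : set C, (forall x : Qbar R, fgen A (QbarC x)) ->
        (forall j, exists2 y, evals iota (md_s D) (QbarC alpha ^+ (q ^ md_l D)) (@md_G R D j) y & fgen A y) ->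
        fgen A (F (QbarC alpha))].

Lemma common_bsum (I : finType) (g : I -> powser (Qbar R)) : (forall i, convergent (g i)) ->
  exists s B : C, 0 < s /\ forall i, bsum s (cf (g i)) B.
Proof.
move=> h; have [s [B [s0 hB]]] : exists s B : C, 0 < s /\ forall i, i \in enum I -> bsum s (cf (g i)) B.
  elim: (enum I) => [|i l [s [B [s0 hB]]]]; first by exists 1, 0; rewrite ltr01.
  have [s' [B' [s0' hB']]] := convergent_bsum (h i).
  have [x x0 [xs xs']] := cmin s0 s0'; exists x, (`|B| + `|B'|); split=> // j.
  rewrite in_cons => /orP[/eqP ->|/hB hj] N.
    have := bsum_mono (ltW x0) xs' hB' N => /le_trans; apply.
    by rewrite (ger0_norm (bsum_ge0 hB')) lerDr.
  have := bsum_mono (ltW x0) xs hj N => /le_trans; apply.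
  by rewrite (ger0_norm (bsum_ge0 hj)) lerDl.
by exists s, B; split=> // i; apply: hB; rewrite mem_enum.
Qed.

(** The exponent l adds up three bounds: from l1 and l2 on, e and det do not vanish along the orbit;
    from l3 on, the base point lies within the radius. The order mu of the derivatives depends on l,
    and including them afterwards keeps all nonzero regular points regular. *)
Lemma data_ex (q : nat) (f : powser (Qbar R)) (alpha : Qbar R) (F : C -> C) : (2 <= q)%N ->
  regular_singular q f -> 0 < `|QbarC alpha| < 1 -> meromorphic_extension f F ->
  holomorphic_at F (QbarC alpha) -> exists D, data_for q alpha F D.
Proof.
move=> q2 [_ [m [A [g [i [Au _ gconv sol gif]]]]]] /andP[a0 a1] [mero0 F00] hol.
have q0 : (0 < q)%N by exact: leq_trans q2.
have [e [N sys]] := mahler_sys_of_solution Au sol; set g' := fun j => g j 0 in sys.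
have [s [B [s0 hB]]] := common_bsum gconv.
have [s1 s10 [s1s s11]] := cmin s0 (@ltr01 C).
(* Half of the radius is reserved for the displacement d in Taylor's formula. *)
pose s' := s1 / 2%:R; have s'0 : 0 < s' by rewrite divr_gt0 ?ltr0n.
have sd : s' + s' <= s by rewrite (_ : s' + s' = s1) // /s'; field.
have s'1 : s' <= 1 by apply: le_trans s11; rewrite ler_pdivrMr ?ltr0n // ler_peMr ?(ltW s10) // ler1n.
have an0 : QbarC alpha != 0 by rewrite -normr_gt0.
have [e0 N0 _] := sys.
have mp0 (p : {poly (Qbar R)}) : p != 0 -> map_poly iota p != 0 by rewrite map_poly_eq0.
have [l1 h1] := eventually_nonzero (@CC_arch R) (mp0 _ e0) an0 a1 q2.
have [l2 h2] := eventually_nonzero (@CC_arch R) (mp0 _ N0) an0 a1 q2.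
have s2 : 0 < s' / 2%:R by rewrite divr_gt0 ?ltr0n.
have [l3 h3] := pow_small (@CC_arch R) (normr_ge0 (QbarC alpha)) a1 s2.
pose l := (l1 + l2 + l3)%N.
have aQ : `|QbarC alpha| ^+ (q ^ l) < s'.
  apply: (@le_lt_trans _ _ (s' / 2%:R)); last by rewrite ltr_pdivrMr ?ltr0n // ltr_pMr // ltr1n.
  apply: le_trans h3; apply: ler_wiXn2l => //; first exact: ltW.
  by apply: leq_trans (ltnW (ltn_expl l q2)); rewrite /l leq_addl.
have ev0 (p : {poly (Qbar R)}) n : (map_poly iota p).[QbarC alpha ^+ n] != 0 -> p.[alpha ^+ n] != 0.
  by rewrite -[QbarC alpha ^+ n](rmorphXn iota) horner_map fmorph_eq0.
have er k : e.[alpha ^+ (q ^ (l + k))] != 0.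
  by apply: ev0; apply: h1; rewrite /l -!addnA leq_addr.
have Nr k : (\det N).[alpha ^+ (q ^ (l + k))] != 0.
  by apply: ev0; apply: h2; apply: leq_trans (leq_addr _ _); rewrite /l -addnA addnCA leq_addr.
have [P P0 hP] := mahler_iterate l q0 sys; have [c rel] := hP i.
have ql0 : (0 < q ^ l)%N by rewrite expn_gt0 q0.
have [V hV] := values_ex (@CC_complete R) (iota := iota) s'0 s'0 sd (hB : forall j, bsum s (cf (g' j)) B).
have mero z : `|z| < 1 -> exists k (G : C -> C) (rho : C), [/\ 0 < rho,
    forall w, `|w - z| < rho -> cdiff G w &
    forall w, w != z -> `|w - z| < rho -> (w - z) ^+ k * F w = G w].
  move=> /mero0[k [G [/holomorphic_cdiff[d d0 hd] /near_punctured[d' d0' hd']]]].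
  have [x x0 [xd xd']] := cmin d0 d0'; exists k, G, x; split=> // [w wx|w wn wx].
    by apply: hd; exact: lt_le_trans wx xd.
  by apply: hd' => //; exact: lt_le_trans wx xd'.
have F0 : exists rho s0 : C, [/\ 0 < rho, rho <= s0 & forall z, `|z| < rho -> evals iota s0 z (g' i) (F z)].
  have [d d0 hd] := near_ball F00; have [x x0 [xd xs]] := cmin d0 s0.
  exists x, s; split=> // z zx; apply: (ps_sum_evals s0 (hB i) (lt_le_trans zx xs)).
  by rewrite gif; apply: hd; rewrite subr0; exact: lt_le_trans zx xd.
have Fa : cdiff F (QbarC alpha).
  by have [d d0 hd] := holomorphic_cdiff hol; apply: hd; rewrite subrr normr0.
have [mu hmu] := value_fgen (@CC_arch R) (@CC_complete R) P0 rel ql0 s'0 s'0 sd s'1 hB a1 aQ mero F0 Fa hV.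
have qK : (q%:R != 0 :> Qbar R).
  by rewrite -(fmorph_eq0 iota) rmorph_nat pnatr_eq0 -lt0n.
have [M [e' [A' [G [sysG reg all1 all2]]]]] := mahler_derivatives mu q0 qK sys.
exists (MahlerData l e' A' G s'); split=> //=.
- by move=> k; apply: reg => //; rewrite expf_neq0 // -(fmorph_eq0 iota).
- by rewrite s'0 s'1.
- move=> j z zs; have [j' [k ->]] := all2 j; rewrite iter_deriv.
  have [y hy] := hasse_evals_ex (@CC_complete R) k s'0 s'0 sd (hB j' : bsum s (cf (g' j')) B) zs.
  by exists (QbarC k`!%:R * y); apply: evalsM => //; exact: (evals_psc iota).
move=> S Sq hS; apply: hmu => // j k kmu.
have [v hv] := all1 j k kmu; have [y hy Sy] := hS v; rewrite hv in hy.
have az : `|QbarC alpha ^+ (q ^ l)| < s' by rewrite normrX.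
have [D hD] := hasse_evals_ex (@CC_complete R) k s'0 s'0 sd (hB j : bsum s (cf (g' j)) B) az.
by exists D => //; exact: (hasse_fgen (@CC_arch R) s'0 az hD hy).
Qed.

End OneFunction.

Lemma sys_values (C : numClosedFieldType) (arch : forall x : C, exists k : nat, `|x| <= k%:R)
    (K : fieldType) (iota : {rmorphism K -> C}) q m e (A : 'M[{poly K}]_m) (g : 'I_m -> powser K) s z
    (v v' : 'I_m -> C) : mahler_sys q e A g -> (0 < q)%N -> 0 < s -> s <= 1 -> `|z| < s ->
  (forall j, evals iota s z (g j) (v j)) -> (forall j, evals iota s (z ^+ q) (g j) (v' j)) ->
  forall i, (map_poly iota e).[z] * v i = \sum_j (map_poly iota (A i j)).[z] * v' j.
Proof.
move=> [_ _ sys] q0 s0 s1 zs hv hv' i.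
have h1 : evals iota s z (ps_of_poly e * g i) ((map_poly iota e).[z] * v i).
  by apply: evalsM => //; exact: evals_poly.
apply: (evals_unique arch s0 zs h1); rewrite sys.
elim: (index_enum _) => [|j l IH].
  by rewrite !big_nil; have := evals_psc iota s0 zs 0; rewrite !rmorph0.
rewrite !big_cons; apply: evalsD => //; apply: evalsM => //; first exact: evals_poly.
exact: evals_subst.
Qed.

Lemma polyOver_det (L : fieldType) (B : set L) m (A : 'M[{poly L}]_m) :
  (forall i j k, fgen B (A i j)`_k) -> (forall k, fgen B (\det A)`_k) /\
  forall i j k, fgen B ((\adj A) i j)`_k.
Proof.
move=> h; have hd n (D : 'M[{poly L}]_n) : (forall i j k, fgen B (D i j)`_k) -> \det D \is a polyOver (fgenb B).
  move=> hD; apply: rpred_sum => p _; rewrite rpredM ?rpred_prod // => [|i _].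
    by rewrite rpredX // rpredN rpred1.
  by apply/polyOverP => k; apply/fgenbP.
split=> [k|i j k]; first by apply/fgenbP; move/polyOverP: (hd _ _ h).
rewrite mxE; apply/fgenbP; apply/polyOverP; rewrite /cofactor rpredM //.
  by rewrite rpredX // rpredN rpred1.
by apply: hd => a b c; rewrite !mxE.
Qed.

(** * All functions together *)

Section Assembly.
Variables (R : realType) (r : nat).
Hypothesis r0 : (0 < r)%N.
Variables (q : 'I_r -> nat) (alpha : 'I_r -> Qbar R) (F : 'I_r -> CC R -> CC R) (D : 'I_r -> mahler_data R).
Hypothesis q2 : forall i, (2 <= q i)%N.
Hypothesis alpha01 : forall i, 0 < `|QbarC (alpha i)| < 1.
Hypothesis hD : forall i, data_for (q i) (alpha i) (F i) (D i).
Local Notation C := (CC R).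
Local Notation iota := (@QbarC R).

(* values_independent is indexed by nat; indices beyond r repeat the first function. *)
Definition ix (k : nat) : 'I_r := insubd (Ordinal r0) k.

Lemma ixE (i : 'I_r) : ix i = i. Proof. exact: valKd. Qed.

Definition pw i := (q i ^ md_l (D i))%N.
Definition qn k := q (ix k).
Definition bn k : C := QbarC (alpha (ix k)) ^+ pw (ix k).
Definition Ln := (\sum_i q i)%N.

Lemma qn2 k : (2 <= qn k)%N. Proof. exact: q2. Qed.

Lemma qnL k : (qn k <= 2 ^ Ln)%N.
Proof.
apply: leq_trans (ltnW (ltn_expl _ (ltnSn 1))); rewrite /qn /Ln (bigD1 (ix k)) //=.
exact: leq_addr.
Qed.

Lemma pw_gt0 i : (0 < pw i)%N. Proof. by rewrite expn_gt0 (leq_trans _ (q2 i)). Qed.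

Lemma alpha_neq0 i : QbarC (alpha i) != 0.
Proof. by rewrite -normr_gt0; case/andP: (alpha01 i). Qed.

Lemma bn0 k : bn k != 0. Proof. by rewrite expf_neq0 // alpha_neq0. Qed.

Lemma bn1 k : `|bn k| < 1.
Proof. by rewrite normrX exprn_ilt1 ?(lt0n_neq0 (pw_gt0 _)) //; case/andP: (alpha01 (ix k)). Qed.

Lemma bn_inj k a b : bn k ^+ a = bn k ^+ b -> a = b.
Proof.
move: (bn0 k) (bn1 k); move: (bn k) => x x0 x1 /(congr1 Num.norm); rewrite !normrX; apply: ieexprIn.
  by rewrite normr_gt0.
by rewrite lt_eqF.
Qed.

(** The integer exponents pw i (a i - b i) turn a relation between the base points into one between
    the alpha_i. *)
Lemma base_relation : multiplicatively_independent (fun i => QbarC (alpha i)) ->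
  forall a b : nat -> nat, \prod_(i < r) bn i ^+ a i = \prod_(i < r) bn i ^+ b i ->
  forall i, (i < r)%N -> a i = b i.
Proof.
move=> h a b E i ir; have := h (fun i => ((pw i * a i)%N%:Z - (pw i * b i)%N%:Z)%R).
have P0 : \prod_(i < r) bn i ^+ b i != 0 by apply/prodf_neq0 => j _; rewrite expf_neq0 // bn0.
have -> : \prod_(i < r) QbarC (alpha i) ^ ((pw i * a i)%N%:Z - (pw i * b i)%N%:Z) = 1.
  transitivity ((\prod_(i < r) bn i ^+ a i) / \prod_(i < r) bn i ^+ b i); last by rewrite E divff.
  rewrite -prodf_div; apply: eq_bigr => j _.
  by rewrite expfzDr ?alpha_neq0 // -invr_expz /bn ixE -!exprM.
move=> /(_ erefl (Ordinal ir)) /= /eqP; rewrite subr_eq0 eqz_nat eqn_pmul2l ?pw_gt0 //.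
by move/eqP.
Qed.

Lemma exponent_relation : (forall i j, i != j -> multiplicatively_independent
    (fun k : 'I_2 => (tnth [tuple q i; q j] k)%:R : C)) ->
  forall i j a b, (i < r)%N -> (j < r)%N -> i != j -> (qn i ^ a)%N = (qn j ^ b)%N -> a = 0%N.
Proof.
move=> h i j a b ir jr ij E.
have ij' : ix i != ix j.
  by have := ixE (Ordinal ir); have := ixE (Ordinal jr) => /= -> ->; rewrite -val_eqE.
have := h _ _ ij' (fun k => if val k == 0%N then a%:Z else - (b%:Z)).
rewrite !big_ord_recl big_ord0 /= mulr1 !(tnth_nth 0%N) /= -invr_expz => /(_ _ ord0) /= h1.
have {}h1 : a%:Z = 0.
  apply: h1; rewrite -[_ ^ a%:Z]/(_ ^+ a) -[_ ^ b%:Z]/(_ ^+ b) -!natrX -/(qn i) -/(qn j) E divff //.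
  by rewrite pnatr_eq0 expn_eq0 negb_and -lt0n (leq_trans _ (qn2 j)).
by case: h1.
Qed.

Definition Mn k := md_M (D (ix k)).
Definition En k : {poly C} := map_poly iota (md_e (D (ix k))).
Definition An k : 'M[{poly C}]_(Mn k) := map_mx (map_poly iota) (md_A (D (ix k))).
Definition Gn k (j : 'I_(Mn k)) : powser C := ps_map iota (@md_G R (D (ix k)) j).
Arguments Gn : clear implicits.
Definition sn k : C := md_s (D (ix k)).

(** Generators of a number field containing all data. Of each series the coefficients with index at
    most size e suffice, as [mahler_coefs] derives the others from the system. *)
Definition finite_part (i : 'I_r) : seq (Qbar R) :=
  alpha i :: (md_e (D i) : seq (Qbar R)) ++
  flatten [seq (md_A (D i) ab.1 ab.2 : seq (Qbar R)) | ab <- enum {: 'I_(md_M (D i)) * 'I_(md_M (D i))}] ++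
  [seq pcoef (@md_G R (D i) j) k | j <- enum 'I_(md_M (D i)), k <- seq.iota 0 (size (md_e (D i))).+1].
Definition Bn : set C := set0 `|` [set` map iota (flatten [seq finite_part i | i <- enum 'I_r])].

Lemma Bn_in k x : x \in finite_part (ix k) -> fgen Bn (QbarC x).
Proof.
move=> h; apply: fgen_in; right; apply: map_f; apply/flatten_mapP.
by exists (ix k); rewrite ?mem_enum.
Qed.

Lemma Bn_coef k (p : {poly (Qbar R)}) : {subset (p : seq (Qbar R)) <= finite_part (ix k)} ->
  forall i, fgen Bn (map_poly iota p)`_i.
Proof.
move=> h i; rewrite coef_map; have [pi|pi] := leqP (size p) i.
  by rewrite nth_default ?rmorph0 //; exact: fgen0.
by apply: Bn_in (h _ (mem_nth 0 pi)).
Qed.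

Lemma Bn_alpha k : fgen Bn (bn k).
Proof. by apply: fgenX; apply: (@Bn_in k); rewrite in_cons eqxx. Qed.

Lemma Bn_e k i : fgen Bn (En k)`_i.
Proof. by apply: (@Bn_coef k) => x h; rewrite in_cons mem_cat h orbT. Qed.

Lemma Bn_A k a b i : fgen Bn (An k a b)`_i.
Proof.
rewrite mxE; apply: (@Bn_coef k) => x h; rewrite in_cons !mem_cat; apply/orP; right; apply/orP; right.
by apply/orP; left; apply/flatten_mapP; exists (a, b); rewrite ?mem_enum.
Qed.

Lemma sys_n k : mahler_sys (qn k) (En k) (An k) (Gn k).
Proof. by case: (hD (ix k)) => /(mahler_sys_map iota). Qed.

Lemma Bn_G k j i : fgen Bn (pcoef (Gn k j) i).
Proof.
apply: (mahler_coefs (qn2 k) (sys_n k) (@Bn_e k) (@Bn_A k)) => {}j {}i hi.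
apply: (@Bn_in k); rewrite in_cons !mem_cat; apply/orP; right; apply/orP; right; apply/orP; right.
apply: (allpairs_f (fun j k => pcoef (@md_G R (D _) j) k)); rewrite ?mem_enum // mem_iota /= add0n ltnS.
by move: hi; rewrite size_map_poly.
Qed.

Lemma regular_n k n : (En k).[bn k ^+ (qn k ^ n)] != 0 /\ (\det (An k)).[bn k ^+ (qn k ^ n)] != 0.
Proof.
have [_ /(_ n)[h1 h2] _ _ _] := hD (ix k).
have -> : bn k ^+ (qn k ^ n) = QbarC (alpha (ix k) ^+ (q (ix k) ^ (md_l (D (ix k)) + n))).
  by rewrite rmorphXn /bn /pw -exprM -expnD.
by rewrite /An det_map_mx !horner_map !fmorph_eq0.
Qed.

Lemma sn0 k : 0 < sn k. Proof. by case: (hD (ix k)) => _ _ [/andP[]]. Qed.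
Lemma sn1 k : sn k <= 1. Proof. by case: (hD (ix k)) => _ _ [/andP[]]. Qed.
Lemma bs_n k : `|bn k| < sn k. Proof. by rewrite normrX; case: (hD (ix k)) => _ _ []. Qed.

Lemma vn_ex k (jz : 'I_(Mn k) * C) : exists y, `|jz.2| < sn k -> evals idfun (sn k) jz.2 (Gn k jz.1) y.
Proof.
have [h|h] := boolP (`|jz.2| < sn k); last by exists 0.
by case: (hD (ix k)) => _ _ _ /(_ jz.1 _ h)[y hy] _; exists y.
Qed.

Definition vn k (j : 'I_(Mn k)) z : C := projT1 (cid (vn_ex (j, z))).

Lemma vnP k j z : `|z| < sn k -> evals idfun (sn k) z (Gn k j) (@vn k j z).
Proof. exact: (projT2 (cid (vn_ex (j, z)))). Qed.

Lemma step_n k n : (En k).[bn k ^+ (qn k ^ n)] *: vv qn bn vn k n =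
  mx_at (qn k) (An k) (bn k) n *m vv qn bn vn k n.+1.
Proof.
have small m : `|bn k ^+ (qn k ^ m)| < sn k.
  rewrite normrX; apply: le_lt_trans (bs_n k); rewrite -[leRHS]expr1; apply: ler_wiXn2l => //.
    exact: ltW (bn1 k).
  by rewrite expn_gt0 (leq_trans _ (qn2 k)).
have E1 : (bn k ^+ (qn k ^ n)) ^+ qn k = bn k ^+ (qn k ^ n.+1) by rewrite -exprM -expnSr.
have h := sys_values (@CC_arch R) (iota := idfun) (sys_n k) (ltnW (qn2 k)) (sn0 k) (sn1 k) (small n)
  (fun j => vnP j (small n)).
apply/colP => j; rewrite !mxE.
have := h (fun j => vn j (bn k ^+ (qn k ^ n.+1))) _ j; rewrite E1 => /(_ (fun j => vnP j (small n.+1))).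
rewrite !map_poly_id // => ->; apply: eq_bigr => l _; rewrite !mxE; congr (_.[_] * _).
by rewrite map_poly_id.
Qed.

Hypothesis norel : forall U (UU : UltraFilter U) c, (c < r)%N ->
  (forall N, U [set n | (N <= n)%N]) ->
  (forall (m m' : multinom c) e,
    U [set n | \prod_(i < c) zseq qn Ln bn i n ^+ m i = e * \prod_(i < c) zseq qn Ln bn i n ^+ m' i] -> m = m') ->
  forall S : seq (multinom c.+1), ~ (forall t, exists m m' e, [/\ m \in S, m' \in S, m != m' &
    U [set n | \prod_(i < c.+1) zseq qn Ln bn i (n + t)%N ^+ m i =
               e * \prod_(i < c.+1) zseq qn Ln bn i (n + t)%N ^+ m' i]]).

Theorem transcendental_independent : (forall i, transcendental (F i (QbarC (alpha i)))) ->
  algebraically_independent (fun i => F i (QbarC (alpha i))).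
Proof.
move=> tr.
(* Coefficients are taken in the whole of C: all roots of unity are then available, and a constant e
   is itself a coefficient. *)
have nv := nonvanishing (iota := idfun) (@primitive_roots C) (zseq_neq0 qn Ln bn0) (zseq_shift bn qn2 qnL)
  (fun e => ex_intro _ e erefl) norel (leqnn r).
have [U [UU [Uoo zfree]]] := exists_ultra nv.
have [nB Bfin] := Qbar_fdim (flatten [seq finite_part i | i <- enum 'I_r]).
have AB k := polyOver_det (@Bn_A k).
have Bacl y : fgen Bn y -> acl set0 y.
  by apply: acl_gen => z [//|/mapP[x _ ->]]; exact: Qbar_acl0.
apply: (@independent_of_aindep R r _ Bn Bacl).
apply: (@values_independent C (@CC_arch R) (@CC_complete R) r qn Ln bn r0 qn2 qnL bn0 bn1
  Mn En An Gn Bn nB Bfin Bn_alpha _ _ Bn_G _ _ sn vn sn0 bs_n _ step_n U UU Uoo).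
- by move=> k; case: (AB k).
- move=> k a b i; have [_ hadj] := AB k; rewrite coefM; apply: fgen_sum => l _.
  by apply: fgenM; [exact: Bn_e|exact: hadj].
- by move=> k n; case: (regular_n k n).
- by move=> k n; case: (regular_n k n).
- by move=> k j z; exact: vnP.
- move=> P hP; apply: zfree; rewrite -[RHS]hP; congr mmap.
  by apply/funext => i; congr upi; apply/funext => n; rewrite addn0.
- move=> i; set S := range _ `|` _.
  (* [ix i] and i are equal but not convertible, and the types of the data depend on the index;
     hence the detour through k. *)
  have : forall k, ix i = k -> acl S (F k (QbarC (alpha k))).
    move=> k <-; have [_ _ _ _ h] := hD (ix i).
    have := h (acl S) => /(_ _ _) h2; apply: (acl_gen (A := acl S)) => //; apply: h2.
      move=> y; apply: fgen_in; apply: acl_mono (Qbar_acl0 y) => z //.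
    move=> j; exists (vn j (bn i)); first exact: (vnP j (bs_n i)).
    by apply: fgen_in; apply: acl_in; right; apply: (codom_f (fun j => vn j (bn i))).
  by move/(_ i); apply; exact: ixE.
- move=> i hi; apply: (tr i); apply/algebraic_acl0; apply: acl_le hi => z [a _ <-].
  exact: Bacl (fgenP a).
Qed.

End Assembly.

Theorem theorem1p7 (R : realType) (r : nat) (hr : (2 <= r)%N)
  (q : 'I_r -> nat) (hq : forall i, (2 <= q i)%N)
  (f : 'I_r -> powser (Qbar R))
  (hconv : forall i, convergent (f i))
  (hf : forall i, regular_singular (q i) (f i))
  (alpha : 'I_r -> Qbar R)
  (halpha : forall i, 0 < `|QbarC (alpha i)| < 1)
  (F : 'I_r -> CC R -> CC R)
  (hF : forall i, meromorphic_extension (f i) (F i))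
  (hdef : forall i, holomorphic_at (F i) (QbarC (alpha i))) :
  (multiplicatively_independent (fun i => QbarC (alpha i)) ->
     (algebraically_independent (fun i => F i (QbarC (alpha i))) <->
      forall i, transcendental (F i (QbarC (alpha i))))) /\
  ((forall i j, i != j ->
      multiplicatively_independent
        (fun k : 'I_2 => (tnth [tuple q i; q j] k)%:R : CC R)) ->
     (algebraically_independent (fun i => F i (QbarC (alpha i))) <->
      forall i, transcendental (F i (QbarC (alpha i))))).
Proof.
have r0 : (0 < r)%N by exact: leq_trans hr.
have /choice[D hD] : forall i, exists D, data_for (q i) (alpha i) (F i) D.
  by move=> i; exact: (data_ex (hq i) (hf i) (halpha i) (hF i) (hdef i)).
have key := @transcendental_independent R r r0 q alpha F D hq halpha hD.
split=> hind; split; try exact: independent_transcendental.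
  move=> tr; refine (key _ tr) => U UU c cr Uoo rigid S hS.
  (* When the alpha_i are independent, the relation at the single shift 0 already gives a
     contradiction. *)
  have [m [m' [e [_ _ mm rel]]]] := hS 0%N.
  apply: (no_relation_base (qn2 r0 hq) (qnL r0 q) UU cr Uoo mm rel).
  exact: base_relation.
move=> tr; refine (key _ tr) => U UU c cr Uoo rigid S.
exact: (@no_relations_exponents _ _ _ _ (qn2 r0 hq) (qnL r0 q) (bn0 r0 q D halpha)
  (fun i a b h => bn_inj hq halpha h) r U UU c cr Uoo rigid S (@exponent_relation R r r0 q hq hind)).
Qed.
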